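(* Let $0<\beta<1$ and let $\Omega\subset\mathbb{C}$ be a bounded doubly-connected domain with $C^{3,\alpha}$ outermost boundary component. If $\Omega$ is biholomorphic to $B_1-\overline{B}_\beta=\{z:\beta<|z|<1\}$ and $$\lambda(\Omega,v)=\frac{2\pi^2}{3}\Bigl[\Bigl(\frac{\pi}{\ln\beta}\Bigr)^2+1\Bigr],$$ then $\Omega$ can be obtained from $B_1-\overline{B}_\beta$ by a composition of translations and homotheties.
   Context: For a bounded domain $\Omega\subset\mathbb{C}$, let $u$ be the solution of $\Delta u=e^{2u}$ in $\Omega$ with $u\to+\infty$ at $\partial\Omega$ (the conformal factor of the complete hyperbolic metric $e^{2u}g_E$), and set $v=e^{-u}$, so $v\Delta v=|\nabla v|^2-1$ in $\Omega$, $v=0$ on $\partial\Omega$. Near the $C^{3,\alpha}$ outermost boundary component $\mathcal{C}$, $v(z)=d(z)-\tfrac12\kappa(y)d(z)^2+c_3(y)d(z)^3+O(d(z)^{3+\alpha})$, where $d(z)$ is the Euclidean distance to $\partial\Omega$, $y\in\partial\Omega$ is the point with $d(z)=|z-y|$, and $\kappa(y)$ is the boundary curvature at $y$; this defines $c_3$ on $\mathcal{C}$. Then $\lambda(\Omega,v)=-\int_{\mathcal{C}}dl\cdot\int_{\mathcal{C}}c_3\,dl$, with Euclidean arc length. *)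

(* Defs.v *)
From Stdlib Require Import Reals.
From Coquelicot Require Import Coquelicot.
Open Scope R_scope.

Definition closureC (S : C -> Prop) (z : C) : Prop :=
  forall eps : R, 0 < eps -> exists w, S w /\ Cmod (w - z) < eps.
Definition interiorC (S : C -> Prop) (z : C) : Prop :=
  exists eps : R, 0 < eps /\ forall w, Cmod (w - z) < eps -> S w.
Definition boundaryC (S : C -> Prop) (z : C) : Prop :=
  closureC S z /\ ~ interiorC S z.

Definition boundedC (S : C -> Prop) : Prop :=
  exists M : R, forall z, S z -> Cmod z <= M.

Definition connectedC (S : C -> Prop) : Prop :=
  forall U V : C -> Prop, open U -> open V ->
    (forall z, S z -> U z \/ V z) ->
    (forall z, ~ (S z /\ U z /\ V z)) ->
    (forall z, S z -> U z) \/ (forall z, S z -> V z).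

Definition componentC (S K : C -> Prop) : Prop :=
  (exists z, K z) /\ (forall z, K z -> S z) /\ connectedC K /\
  (forall K' : C -> Prop, connectedC K' -> (forall z, K z -> K' z) ->
     (forall z, K' z -> S z) -> forall z, K' z -> K z).

Definition domainC (O : C -> Prop) : Prop :=
  (exists z, O z) /\ open O /\ connectedC O.

Definition doubly_connected (O : C -> Prop) : Prop :=
  domainC O /\
  exists K1 K2 : C -> Prop,
    componentC (fun z => ~ O z) K1 /\ componentC (fun z => ~ O z) K2 /\
    (exists z, K1 z /\ ~ K2 z) /\
    forall K, componentC (fun z => ~ O z) K ->
      (forall z, K z <-> K1 z) \/ (forall z, K z <-> K2 z).

Definition holomorphic_on (O : C -> Prop) (f : C -> C) : Prop :=
  forall z, O z -> ex_derive (K := C_AbsRing) (V := C_NormedModule) f z.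

Definition biholomorphic (O1 O2 : C -> Prop) : Prop :=
  exists f g : C -> C,
    holomorphic_on O1 f /\ holomorphic_on O2 g /\
    (forall z, O1 z -> O2 (f z)) /\ (forall w, O2 w -> O1 (g w)) /\
    (forall z, O1 z -> g (f z) = z) /\ (forall w, O2 w -> f (g w) = w).

Definition annulus (beta : R) (z : C) : Prop := beta < Cmod z < 1.

Definition Dx (f : C -> R) (z : C) : R := Derive (fun x => f (x, snd z)) (fst z).
Definition Dy (f : C -> R) (z : C) : R := Derive (fun y => f (fst z, y)) (snd z).

Definition C2_on (O : C -> Prop) (f : C -> R) : Prop :=
  forall z, O z ->
    (forall g, g = f \/ g = Dx f \/ g = Dy f ->
       ex_derive (fun x => g (x, snd z)) (fst z) /\
       ex_derive (fun y => g (fst z, y)) (snd z)) /\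
    (forall g, g = f \/ g = Dx f \/ g = Dy f \/ g = Dx (Dx f) \/
               g = Dx (Dy f) \/ g = Dy (Dx f) \/ g = Dy (Dy f) ->
       continuous g z).

Definition Lap (f : C -> R) (z : C) : R := Dx (Dx f) z + Dy (Dy f) z.

(** [u] is the conformal factor of the complete hyperbolic metric on [O]:
    a classical solution of  Delta u = e^{2u}  in [O] with u -> +oo at the
    boundary of [O]. *)
Definition hyperbolic_factor (O : C -> Prop) (u : C -> R) : Prop :=
  C2_on O u /\
  (forall z, O z -> Lap u z = exp (2 * u z)) /\
  (forall M : R, exists delta : R, 0 < delta /\
     forall z, O z -> (exists y, boundaryC O y /\ Cmod (z - y) < delta) ->
       M < u z).

Definition gx (gam : R -> C) (t : R) : R := fst (gam t).
Definition gy (gam : R -> C) (t : R) : R := snd (gam t).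

Definition C3alpha_closed_curve (alpha T : R) (gam : R -> C) : Prop :=
  0 < T /\
  (forall t, gam (t + T) = gam t) /\
  (forall s t, 0 <= s < T -> 0 <= t < T -> gam s = gam t -> s = t) /\
  (forall t k, (k <= 3)%nat ->
     ex_derive_n (gx gam) k t /\ ex_derive_n (gy gam) k t) /\
  (forall t, continuous (Derive_n (gx gam) 3) t /\
             continuous (Derive_n (gy gam) 3) t) /\
  (exists H : R, forall s t, s <> t ->
     Rabs (Derive_n (gx gam) 3 s - Derive_n (gx gam) 3 t)
       <= H * Rpower (Rabs (s - t)) alpha /\
     Rabs (Derive_n (gy gam) 3 s - Derive_n (gy gam) 3 t)
       <= H * Rpower (Rabs (s - t)) alpha) /\
  (forall t, (Derive (gx gam) t, Derive (gy gam) t) <> (0, 0)).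

Definition speed (gam : R -> C) (t : R) : R :=
  sqrt (Derive (gx gam) t ^ 2 + Derive (gy gam) t ^ 2).

(** Signed curvature of [gam] at parameter [t]
    (equal to 1/R on a counterclockwise circle of radius R). *)
Definition curvature (gam : R -> C) (t : R) : R :=
  (Derive (gx gam) t * Derive_n (gy gam) 2 t -
   Derive (gy gam) t * Derive_n (gx gam) 2 t) / (speed gam t ^ 3).

Definition outermost_boundary (O : C -> Prop) (T : R) (gam : R -> C) : Prop :=
  exists K : C -> Prop,
    componentC (fun z => ~ O z) K /\ ~ boundedC K /\
    forall y, boundaryC K y <-> exists t, 0 <= t < T /\ y = gam t.

(** Orientation: the left normal i*gam'(t) points into [O], i.e. [gam] is
    positively oriented (so that [curvature] is taken w.r.t. the inward
    normal, with the convention of the expansion). *)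
Definition inward_left_normal (O : C -> Prop) (gam : R -> C) : Prop :=
  forall t, exists s0, 0 < s0 /\ forall s, 0 < s < s0 ->
    O (Cplus (gam t) (Cmult (RtoC s) (Ropp (Derive (gy gam) t), Derive (gx gam) t))).

(** [c3] is the third-order coefficient in the boundary expansion of
    [v = exp (-u)] near the curve:
    v(z) = d - kappa(y) d^2/2 + c3(y) d^3 + O(d^{3+alpha}),
    where d = d(z) = dist(z, boundary O) = |z - y|, y on the curve. *)
Definition third_coefficient (O : C -> Prop) (alpha : R) (gam : R -> C)
    (u : C -> R) (c3 : C -> R) : Prop :=
  exists eps Cst : R, 0 < eps /\
    forall z t, O z ->
      let y := gam t in
      let d := Cmod (z - y) in
      (forall w, boundaryC O w -> d <= Cmod (z - w)) ->
      d < eps ->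
      Rabs (exp (- u z) - (d - / 2 * curvature gam t * d ^ 2 + c3 y * d ^ 3))
        <= Cst * Rpower d (3 + alpha).

Definition lambda_inv (T : R) (gam : R -> C) (c3 : C -> R) : R :=
  - (RInt (speed gam) 0 T * RInt (fun t => c3 (gam t) * speed gam t) 0 T).

(* Main.v *)
(* Put [v = exp (- u)], [l = f' / f], [sg = - ln |f|] and [k = - PI / ln beta], where [f] maps the domain onto the annulus.
   The factor [u] is the pull-back of the complete hyperbolic metric of the annulus, that is [v = sin (k sg) / (k |l|)]; this uniqueness
   rests on a subsolution, built from a square root on the complement of the inner component, which forces [u] to blow up there like
   a multiple [th < 1] of [- ln d] and, by iteration, like every such multiple. A quantitative Schwarz lemma in discs touching the outer
   curve controls [f] up to that curve. Let [rho+], [rho-] be the two Riccati functions [(- l' / l +- i k l) / 2] and [n] the normal.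
   Comparing the expansion of [v] with its mean over the parallel curves gives
     [int kap^2 / 2 + 3 int c3 + int (Im n rho+)^2 + int (Im n rho-)^2 = 0]
   in the limit, while the winding of [l] determines [int Im (n rho+-)]. Cauchy-Schwarz and Fenchel's inequality [int |kap| >= 2 PI]
   then bound [lambda] below by the given value. In the case of equality [kap] is constant, so the outer curve is a circle with some
   centre [c], and [(z - c) l] tends to [+-1] in mean square on concentric circles. A Hardy type argument gives [(z - c) l = +-1]
   identically, hence [f] is a constant multiple of [(z - c)^(+-1)]. *)
Require Import Defs.
From Stdlib Require Import Reals ZArith Lra Lia Psatz Classical ClassicalEpsilon.
From Corelib Require Import ssreflect.
From Coquelicot Require Import Coquelicot.
Open Scope R_scope.
Unset SsrRewrite. Unset SsrIdents. Close Scope boolean_if_scope. Open Scope general_if_scope.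

(** The map [f] has no given regularity at the outer curve, and the expansion of [v] is a sup-norm
    statement that cannot be differentiated. Comparison with the hyperbolic densities of osculating
    discs repairs this: at depth [s] the error is [O(s^2)] relative to [v], and stability of the
    Schwarz lemma turns it into an [O(s)] estimate of [l' / l + k cot (k sg) l] and a bound for the
    Schwarzian derivative of the developing map [f ^ (- i k)]. Uniqueness is not a plain maximum
    principle either: two solutions that are infinite on the boundary can be compared only once
    their rates are known, and at the inner component, about whose shape nothing is given, [u] is
    only known to tend to infinity. The constant is a sum of Cauchy-Schwarz bounds over a curve of
    length [L]: [int kap^2 >= (2 PI)^2 / L] and, in the limit, [int (Im n rho+-)^2 >= (PI k)^2 / L],
    whence [- 3 L int c3 >= 2 PI^2 + 2 PI^2 k^2]. Equality is asymptotic: it says something only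
    about circles shrinking to the curve, and has to be carried inside by reflection. *)

Ltac add_fact p := let P := type of p in lazymatch goal with _ : P |- _ => fail | _ => pose proof p end.

Ltac add_bounds :=
  repeat match goal with
  | x := Rmin ?a ?b |- _ => add_fact (Rmin_l a b : x <= a); add_fact (Rmin_r a b : x <= b)
  | |- context [Rmin ?a ?b] => add_fact (Rmin_l a b); add_fact (Rmin_r a b)
  | _ : context [Rmin ?a ?b] |- _ => add_fact (Rmin_l a b); add_fact (Rmin_r a b)
  | |- context [Rabs ?a] => add_fact (Rabs_pos a); pose proof (Rle_abs a)
  | _ : context [Rabs ?a] |- _ => add_fact (Rabs_pos a); pose proof (Rle_abs a)
  | |- context [Cmod ?a] => add_fact (Cmod_ge_0 a)
  | _ : context [Cmod ?a] |- _ => add_fact (Cmod_ge_0 a)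
  | |- context [PI] => add_fact PI_RGT_0
  | _ : context [PI] |- _ => add_fact PI_RGT_0
  end.

(* From here on [lra] also uses the bounds of [add_bounds] and the monotonicity of products. *)
Ltac lra := first
  [ Lra.lra
  | lazymatch goal with
    | |- 0 < Rmin _ _ => apply Rmin_pos; lra
    | |- 0 < _ * _ => apply Rmult_lt_0_compat; lra
    | |- 0 <= _ * _ => apply Rmult_le_pos; lra
    | |- 0 < _ / _ => apply Rdiv_lt_0_compat; lra
    | |- 0 < / _ => apply Rinv_0_lt_compat; lra
    | x := Rmin _ _ |- 0 < ?x => apply Rmin_pos; lra
    | |- _ /\ _ => split; lra
    | |- ?a * _ <= ?a * _ => apply Rmult_le_compat_l; lra
    | |- _ * ?a <= _ * ?a => apply Rmult_le_compat_r; lra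
    | |- _ * _ <= _ * _ => apply Rmult_le_compat; lra
    | |- ?a * _ < ?a * _ => apply Rmult_lt_compat_l; lra
    | |- _ * ?a < _ * ?a => apply Rmult_lt_compat_r; lra
    | |- Rabs _ <= _ => apply Rabs_le; lra
    | |- Rabs _ < _ => apply Rabs_def1; lra
    | |- RtoC _ <> RtoC _ => intros ?%RtoC_inj; lra
    | |- Cmult _ _ <> _ => apply Cmult_neq_0; lra
    | |- 0 < exp _ => apply exp_pos
    end
  | progress add_bounds; Lra.lra ].

Ltac bring := cbv beta; ring.

(** * Complex differentiation *)
(** Continuity and complex derivative by epsilon and delta in [Cmod], as a neutral ground between
    the several uniform and normed structures carried by [C]. *)
Definition ccont (f : C -> C) (z : C) : Prop :=
  forall eps : R, 0 < eps -> exists del : R, 0 < del /\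
    forall w, Cmod (w - z) < del -> Cmod (f w - f z) < eps.

Definition cder (f : C -> C) (z l : C) : Prop :=
  forall eps : R, 0 < eps -> exists del : R, 0 < del /\
    forall w, Cmod (w - z) < del ->
      Cmod (f w - f z - l * (w - z)) <= eps * Cmod (w - z).

Lemma Cmod_minus_sym a b : Cmod (a - b) = Cmod (b - a).
Proof. rewrite <- Cmod_opp. f_equal. ring. Qed.

Lemma Cmod_tri a b c : Cmod (a - c) <= Cmod (a - b) + Cmod (b - c).
Proof. replace (a - c)%C with ((a - b) + (b - c))%C by ring. apply Cmod_triangle. Qed.

Lemma Cmod_rev_tri a b : Cmod a - Cmod b <= Cmod (a - b).
Proof. have H := Cmod_triangle (a - b) b. replace (a - b + b)%C with a in H by ring. lra. Qed.

Lemma Cmod_le_plus a b : Cmod a <= Cmod (a - b) + Cmod b.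
Proof. have H := Cmod_rev_tri a b. lra. Qed.

Lemma Cmod_pos {z : C} : z <> 0 -> 0 < Cmod z.
Proof. apply Cmod_gt_0. Qed.

Lemma Cmod_sub_0 {a b} : Cmod (a - b) <= 0 -> a = b.
Proof.
intros H. have H0 : (a - b = 0)%C.
{ apply Cmod_eq_0. lra. }
replace a with (a - b + b)%C by ring. rewrite H0. ring.
Qed.

Lemma im_le_Cmod c : Rabs (Im c) <= Cmod c.
Proof. have H := Rmax_Cmod c. have K := Rmax_r (Rabs (fst c)) (Rabs (snd c)). unfold Im. lra. Qed.

Lemma Cmod_diag z : Cmod (z - z) = 0.
Proof. replace (z - z)%C with (RtoC 0) by ring. apply Cmod_0. Qed.

Lemma Cmod_le_Re_Im c : Cmod c <= Rabs (Re c) + Rabs (Im c).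
Proof.
unfold Cmod, Re, Im. destruct c as [x y]; simpl fst; simpl snd. rewrite <- sqrt_Rsqr.
- apply sqrt_le_1_alt. unfold Rsqr. rewrite <- pow2_abs, <- (pow2_abs y). have H1 := Rabs_pos x. have H2 := Rabs_pos y. nra.
- lra.
Qed.

Lemma Cmod_sqr z : Cmod z * Cmod z = Re z * Re z + Im z * Im z.
Proof. have H := Cmod2_alt z. nra. Qed.

Lemma Re_minus a b : Re (a - b) = Re a - Re b.
Proof. auto. Qed.

Lemma Im_minus a b : Im (a - b) = Im a - Im b.
Proof. auto. Qed.

Lemma Ceq {a b} : Re a = Re b -> Im a = Im b -> a = b.
Proof. destruct a, b; simpl; congruence. Qed.

Lemma CiCi : (Ci * Ci)%C = (- (1))%C.
Proof. apply Ceq; simpl; ring. Qed.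

Lemma Ceta z : (Re z, Im z) = z.
Proof. destruct z; reflexivity. Qed.

Lemma RtoC_neq x : x <> 0 -> RtoC x <> RtoC 0.
Proof. intros H K. now apply RtoC_inj in K. Qed.

Lemma ccont_ext f g z : (exists r, 0 < r /\ forall w, Cmod (w - z) < r -> f w = g w) -> ccont f z -> ccont g z.
Proof.
intros [r [Hr E]] H eps He. have [d [Hd K]] := H eps He. exists (Rmin r d). split; [lra|]. intros w Hw. rewrite <- !E.
- apply K. lra.
- rewrite Cmod_diag; lra.
- lra.
Qed.

Notation CU := (AbsRing_UniformSpace C_AbsRing).

Notation CN := (AbsRing_NormedModule C_AbsRing).

Lemma ccont_continuous {f z} : ccont f z <-> continuous (T := CU) (U := CU) f z.
Proof.
split.
- intros H. apply filterlim_locally. intros eps. have [d [Hd K]] := H eps (cond_pos eps). exists (mkposreal d Hd). exact K.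
- intros H eps He. have [d Hd] := proj1 (filterlim_locally (U := CU) f (f z)) H (mkposreal eps He). exists d. split; [apply cond_pos|auto].
Qed.

Lemma ccont_const c z : ccont (fun _ => c) z.
Proof. apply ccont_continuous, (@continuous_const CU CU). Qed.

Lemma ccont_id z : ccont (fun w => w) z.
Proof. intros eps He; exists eps; split; auto. Qed.

Lemma ccont_plus {f g z} : ccont f z -> ccont g z -> ccont (fun w => f w + g w)%C z.
Proof. rewrite !ccont_continuous. apply (@continuous_plus CU _ CN). Qed.

Lemma ccont_mult {f g z} : ccont f z -> ccont g z -> ccont (fun w => f w * g w)%C z.
Proof. rewrite !ccont_continuous. apply (@continuous_mult CU C_AbsRing). Qed.

Lemma ccont_opp {f z} : ccont f z -> ccont (fun w => - f w)%C z.
Proof. rewrite !ccont_continuous. apply (@continuous_opp CU _ CN). Qed.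

Lemma ccont_minus {f g z} : ccont f z -> ccont g z -> ccont (fun w => f w - g w)%C z.
Proof. intros; apply ccont_plus; auto. now apply ccont_opp. Qed.

Lemma ccont_inv {f : C -> C} {z} : f z <> 0 -> ccont f z -> ccont (fun w => / f w)%C z.
Proof.
intros H0 Hf eps He. have P := Cmod_pos H0. set (e := Rmin (Cmod (f z) / 2) (eps * Cmod (f z) * Cmod (f z) / 4)). have He1 : 0 < e by lra.
have [d [Hd K]] := Hf e He1. exists d; split; auto. intros w Hw. specialize (K w Hw). have E1 : e <= Cmod (f z) / 2 by lra.
have E2 : e <= eps * Cmod (f z) * Cmod (f z) / 4 by apply Rmin_r. have Q : Cmod (f z) / 2 <= Cmod (f w).
{ have X := Cmod_rev_tri (f z) (f w). rewrite Cmod_minus_sym in X. lra. }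
have Hw0 : f w <> 0 by (apply Cmod_gt_0; lra). replace (/ f w - / f z)%C with ((f z - f w) / (f w * f z))%C by (field; auto).
rewrite Cmod_div, Cmod_mult by (apply Cmult_neq_0; auto). rewrite Cmod_minus_sym. apply Rlt_div_l.
- nra.
- nra.
Qed.

Lemma ccont_comp {f g z} : ccont g z -> ccont f (g z) -> ccont (fun w => f (g w)) z.
Proof. intros Hg Hf eps He. have [d [Hd K]] := Hf eps He. have [d' [Hd' K']] := Hg d Hd. exists d'; split; auto. Qed.

Lemma ccont_Re {f z} : ccont f z -> ccont (fun w => RtoC (Re (f w))) z.
Proof.
intros H eps He. have [d [Hd K]] := H eps He. exists d; split; auto. intros w Hw. rewrite <- RtoC_minus, Cmod_R, <- Re_minus.
eapply Rle_lt_trans; [apply re_le_Cmod|auto].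
Qed.

Lemma ccont_Im {f z} : ccont f z -> ccont (fun w => RtoC (Im (f w))) z.
Proof.
intros H eps He. have [d [Hd K]] := H eps He. exists d; split; auto. intros w Hw. rewrite <- RtoC_minus, Cmod_R, <- Im_minus.
eapply Rle_lt_trans; [apply im_le_Cmod|auto].
Qed.

Lemma ccont_conj {f z} : ccont f z -> ccont (fun w => Cconj (f w)) z.
Proof. intros H eps He. have [d [Hd K]] := H eps He. exists d; split; auto. intros w Hw. rewrite <- Cminus_conj, Cmod_conj. auto. Qed.

Lemma ccont_Cmod {f z} : ccont f z -> ccont (fun w => RtoC (Cmod (f w))) z.
Proof.
intros H eps He. have [d [Hd K]] := H eps He. exists d; split; auto. intros w Hw. rewrite <- RtoC_minus, Cmod_R. eapply Rle_lt_trans; [|apply (K w Hw)].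
have A := Cmod_rev_tri (f w) (f z). have B := Cmod_rev_tri (f z) (f w). rewrite Cmod_minus_sym in B. lra.
Qed.

Lemma continuous_eps {g : R -> R} {x : R} : continuous g x <-> forall eps, 0 < eps -> exists del, 0 < del /\ forall y, Rabs (y - x) < del -> Rabs (g y - g x) < eps.
Proof.
split.
- intros H eps He. have [d Hd] := proj1 (filterlim_locally g (g x)) H (mkposreal eps He). exists d; split; [apply cond_pos|]. intros y Hy. apply (Hd y Hy).
- intros H. apply filterlim_locally. intros eps. have [d [Hd K]] := H eps (cond_pos eps). exists (mkposreal d Hd). intros y Hy. apply (K y Hy).
Qed.

Lemma ccont_R {g : R -> R} {h z} : ccont (fun w => RtoC (h w)) z -> continuous g (h z) -> ccont (fun w => RtoC (g (h w))) z.
Proof.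
intros Hh Hg eps He. have [d [Hd K]] := proj1 continuous_eps Hg eps He. have [d' [Hd' K']] := Hh d Hd. exists d'; split; auto. intros w Hw. specialize (K' w Hw).
rewrite <- RtoC_minus, Cmod_R in *. auto.
Qed.

Lemma ccont_pair {a b z} : ccont (fun w => RtoC (a w)) z -> ccont (fun w => RtoC (b w)) z -> ccont (fun w => (a w, b w)) z.
Proof.
intros Ha Hb. apply ccont_ext with (fun w => RtoC (a w) + Ci * RtoC (b w))%C.
{ exists 1; split; [lra|]. intros w _. apply Ceq; simpl; ring. }
apply ccont_plus; auto. apply ccont_mult; auto. apply ccont_const.
Qed.

Lemma cder_ccont {f z l} : cder f z l -> ccont f z.
Proof.
intros H eps He. have [d [Hd K]] := H 1 Rlt_0_1. have P := Cmod_ge_0 l. exists (Rmin d (eps / (2 + Cmod l))). split.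
{ lra. }
intros w Hw. have W1 : Cmod (w - z) < d by lra. have W2 : Cmod (w - z) < eps / (2 + Cmod l) by lra. specialize (K w W1).
replace (f w - f z)%C with ((f w - f z - l * (w - z)) + l * (w - z))%C by ring. eapply Rle_lt_trans; [apply Cmod_triangle|]. rewrite Cmod_mult.
apply (Rmult_lt_compat_r (2 + Cmod l)) in W2; [|lra]. replace (eps / (2 + Cmod l) * (2 + Cmod l)) with eps in W2 by (field; lra). nra.
Qed.

Lemma Cball_norm_lt {z w eps} : Cmod (w - z) < eps -> ball z eps w.
Proof. apply C_NormedModule_mixin_compat1. Qed.

Ltac cder_iff := split;
  [ intros H; split; [apply is_linear_scal_l|]; intros x Hx eps; assert (E := is_filter_lim_locally_unique (V := CN) _ x Hx); subst x;
    destruct (H eps (cond_pos eps)) as [d [Hd K]]; exists (mkposreal d Hd); intros w Hw; specialize (K w Hw); rewrite Cmult_comm in K; exact K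
  | intros [_ H] eps He; destruct (H _ (fun P HP => HP) (mkposreal eps He)) as [d Hd]; exists d; split; [apply cond_pos|];
    intros w Hw; specialize (Hd w Hw); rewrite Cmult_comm; exact Hd ].

Lemma cder_derive {f z l} : cder f z l <-> is_derive (K := C_AbsRing) (V := C_NormedModule) f z l.
Proof. cder_iff. Qed.

(* The two modules differ in their uniform structure, hence are not convertible. *)
Lemma cder_deriveN {f z l} : cder f z l <-> is_derive (K := C_AbsRing) (V := CN) f z l.
Proof. cder_iff. Qed.

Lemma cder_ext f g z l : (exists r, 0 < r /\ forall w, Cmod (w - z) < r -> f w = g w) -> cder f z l -> cder g z l.
Proof.
intros [r [Hr E]] H eps He. have [d [Hd K]] := H eps He. exists (Rmin r d). split; [lra|]. intros w Hw. rewrite <- !E.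
- apply K. lra.
- rewrite Cmod_diag; lra.
- lra.
Qed.

Lemma cder_eq {f z l l'} : cder f z l -> l = l' -> cder f z l'.
Proof. intros H <-. exact H. Qed.

Lemma cder_const c z : cder (fun _ => c) z 0.
Proof. apply cder_deriveN, (is_derive_const (V := CN)). Qed.

Lemma cder_id z : cder (fun w => w) z 1.
Proof. apply cder_deriveN, (is_derive_id (K := C_AbsRing)). Qed.

Lemma cder_plus {f g z l m} : cder f z l -> cder g z m -> cder (fun w => f w + g w)%C z (l + m).
Proof. rewrite !cder_deriveN. apply (is_derive_plus (V := CN)). Qed.

Lemma cder_mult {f g z l m} : cder f z l -> cder g z m -> cder (fun w => f w * g w)%C z (l * g z + f z * m).
Proof. rewrite !cder_deriveN. intros A B. apply (is_derive_mult (K := C_AbsRing)); auto. apply Cmult_comm. Qed.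

Lemma cder_scal c {f z l} : cder f z l -> cder (fun w => c * f w)%C z (c * l).
Proof. intros H. eapply cder_eq. apply (cder_mult (cder_const c z) H). ring. Qed.

Lemma cder_opp {f z l} : cder f z l -> cder (fun w => - f w)%C z (- l).
Proof. rewrite !cder_deriveN. apply (is_derive_opp (V := CN)). Qed.

Lemma cder_minus {f g z l m} : cder f z l -> cder g z m -> cder (fun w => f w - g w)%C z (l - m).
Proof. intros; apply cder_plus; auto. now apply cder_opp. Qed.

Lemma cder_comp {f g z l m} : cder g z m -> cder f (g z) l -> cder (fun w => f (g w)) z (l * m).
Proof. rewrite !cder_deriveN, Cmult_comm. intros A B. apply (is_derive_comp (V := CN) f g); auto. Qed.

Lemma cder_inv_id {z : C} : z <> 0 -> cder (fun w => / w)%C z (- / (z * z)).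
Proof.
intros H0 eps He. have P := Cmod_pos H0. set (m := Cmod z) in *. set (d := Rmin (m / 2) (eps * m * m * m / 2)). have Hd : 0 < d by lra. exists d; split; auto.
intros w Hw. have D1 : d <= m / 2 by lra. have D2 : d <= eps * m * m * m / 2 by apply Rmin_r. have Q : m / 2 <= Cmod w.
{ have X := Cmod_rev_tri z w. rewrite Cmod_minus_sym in X. unfold m in *. lra. }
have Hw0 : w <> 0 by (apply Cmod_gt_0; lra). replace (/ w - / z - - / (z * z) * (w - z))%C with ((w - z) * ((w - z) / (w * z * z)))%C by (field; auto).
rewrite Cmod_mult, Cmod_div, !Cmod_mult by (repeat apply Cmult_neq_0; auto). rewrite Rmult_comm. apply Rmult_le_compat_r; [lra|]. fold m. apply Rle_div_l.
- apply Rlt_gt. lra.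
- nra.
Qed.

Lemma cder_inv {f : C -> C} {z l} : f z <> 0 -> cder f z l -> cder (fun w => / f w)%C z (- l / (f z * f z)).
Proof.
intros H0 H. eapply cder_eq.
- apply (cder_comp H (cder_inv_id H0)).
- field; auto.
Qed.

Lemma cder_div {f g : C -> C} {z l m} : g z <> 0 -> cder f z l -> cder g z m -> cder (fun w => f w / g w)%C z ((l * g z - f z * m) / (g z * g z)).
Proof.
intros H0 Hf Hg. eapply cder_eq.
- apply (@cder_mult f (fun w => / g w)%C); [exact Hf|apply @cder_inv; [auto|exact Hg]].
- field; auto.
Qed.

Lemma cder_unique {f z l m} : cder f z l -> cder f z m -> l = m.
Proof. rewrite !cder_derive. intros A%is_C_derive_unique B%is_C_derive_unique. congruence. Qed.

Notation hol := holomorphic_on.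

Lemma hol_cder {O f z} : hol O f -> O z -> cder f z (C_derive f z).
Proof. intros H Hz. apply cder_derive, C_derive_correct; [auto|]. auto. Qed.

Lemma cder_C_derive {f z l} : cder f z l -> C_derive f z = l.
Proof. intros H. apply is_C_derive_unique. now apply cder_derive. Qed.

Lemma hol_intro {O f f'} : (forall z, O z -> cder f z (f' z)) -> hol O f.
Proof. intros H z Hz. exists (f' z). now apply cder_derive, H. Qed.

Definition opn (O : C -> Prop) : Prop :=
  forall z, O z -> exists r, 0 < r /\ forall w, Cmod (w - z) < r -> O w.

Lemma open_opn {O : C -> Prop} : open O -> opn O.
Proof. intros H z Hz. have [d Hd] := H z Hz. exists d; split; [apply cond_pos|]. intros w Hw. apply Hd. now apply Cball_norm_lt. Qed.

Lemma opn_open {O} : opn O -> open O.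
Proof.
intros H z Hz. have [d [Hd K]] := H z Hz. have Hd2 : 0 < d / 2 by lra. exists (mkposreal _ Hd2). intros w [Hw1 Hw2]. apply K.
eapply Rle_lt_trans; [apply Cmod_le_Re_Im|]. simpl. unfold ball in Hw1, Hw2; simpl in Hw1, Hw2.
unfold AbsRing_ball, abs, minus, plus, opp in Hw1, Hw2; simpl in Hw1, Hw2. lra.
Qed.

(** * Paths in the plane and their integrals *)
Definition pcont (c : R -> C) (t : R) : Prop :=
  continuous (fun s => Re (c s)) t /\ continuous (fun s => Im (c s)) t.

Definition pder (c : R -> C) (t : R) (d : C) : Prop :=
  is_derive (fun s => Re (c s)) t (Re d) /\ is_derive (fun s => Im (c s)) t (Im d).

Lemma is_derive_eps {g : R -> R} {x l : R} : is_derive g x l <-> forall eps, 0 < eps -> exists del, 0 < del /\ forall y, Rabs (y - x) < del ->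
 Rabs (g y - g x - l * (y - x)) <= eps * Rabs (y - x).
Proof.
split.
- intros [_ H] eps He. have [d Hd] := H x (fun P HP => HP) (mkposreal eps He). exists d; split; [apply cond_pos|]. intros y Hy. specialize (Hd y Hy).
 change (Rabs (g y - g x - (y - x) * l) <= eps * Rabs (y - x)) in Hd. rewrite Rmult_comm. lra.
- intros H. split; [apply is_linear_scal_l|]. intros x' Hx eps. have E : x = x' by apply (is_filter_lim_locally_unique x x' Hx). subst x'.
 have [d [Hd K]] := H eps (cond_pos eps). exists (mkposreal d Hd). intros y Hy. specialize (K y Hy). change (Rabs (g y - g x - (y - x) * l) <= eps * Rabs (y - x)).
 rewrite Rmult_comm. lra.
Qed.

Lemma pder_eps {c t d} : pder c t d <-> forall eps, 0 < eps -> exists del, 0 < del /\ forall s, Rabs (s - t) < del ->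
 Cmod (c s - c t - d * RtoC (s - t)) <= eps * Rabs (s - t).
Proof.
split.
- intros [H1 H2] eps He. destruct (proj1 is_derive_eps H1 (eps/2)) as [d1 [Hd1 K1]]; [lra|]. destruct (proj1 is_derive_eps H2 (eps/2)) as [d2 [Hd2 K2]]; [lra|].
 exists (Rmin d1 d2); split; [lra|]. intros s Hs. specialize (K1 s ltac:(lra)). specialize (K2 s ltac:(lra)). eapply Rle_trans; [apply Cmod_le_Re_Im|].
 replace (Re (c s - c t - d * RtoC (s - t))) with (Re (c s) - Re (c t) - Re d * (s - t)) by (unfold Re; simpl; ring).
 replace (Im (c s - c t - d * RtoC (s - t))) with (Im (c s) - Im (c t) - Im d * (s - t)) by (unfold Im; simpl; ring). lra.
- intros H.
 split; apply is_derive_eps; intros eps He; have [d1 [Hd1 K1]] := H eps He; exists d1; split; auto; intros s Hs; specialize (K1 s Hs); eapply Rle_trans; try exact K1.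
 + eapply Rle_trans; [|apply re_le_Cmod]. right; f_equal. unfold Re; simpl; ring.
 + eapply Rle_trans; [|apply im_le_Cmod]. right; f_equal. unfold Im; simpl; ring.
Qed.

Lemma pcont_eps {c t} : pcont c t <-> forall eps, 0 < eps -> exists del, 0 < del /\ forall s, Rabs (s - t) < del -> Cmod (c s - c t) < eps.
Proof.
split.
- intros [H1 H2] eps He. destruct (proj1 continuous_eps H1 (eps/2)) as [d1 [Hd1 K1]]; [lra|]. destruct (proj1 continuous_eps H2 (eps/2)) as [d2 [Hd2 K2]]; [lra|].
 exists (Rmin d1 d2); split; [lra|]. intros s Hs. specialize (K1 s ltac:(lra)). specialize (K2 s ltac:(lra)). eapply Rle_lt_trans; [apply Cmod_le_Re_Im|].
 rewrite Re_minus, Im_minus. lra.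
- intros H.
 split; apply continuous_eps; intros eps He; have [d1 [Hd1 K1]] := H eps He; exists d1; split; auto; intros s Hs; specialize (K1 s Hs); eapply Rle_lt_trans; try exact K1.
 + rewrite <- Re_minus. apply re_le_Cmod.
 + rewrite <- Im_minus. apply im_le_Cmod.
Qed.

Lemma pder_pcont {c t d} : pder c t d -> pcont c t.
Proof. intros [H1 H2]; split; apply (ex_derive_continuous (V := R_NormedModule)); eexists; eauto. Qed.

Lemma pcont_comp {f c t} : pcont c t -> ccont f (c t) -> pcont (fun s => f (c s)) t.
Proof. rewrite !pcont_eps. intros Hc Hf eps He. have [d [Hd K]] := Hf eps He. have [d' [Hd' K']] := Hc d Hd. exists d'; split; auto. Qed.

Lemma pcont_ext {c e t} : (forall s, c s = e s) -> pcont c t -> pcont e t.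
Proof. rewrite !pcont_eps. intros E H eps He. have [d [Hd K]] := H eps He. exists d; split; auto. intros s Hs. rewrite <- !E. auto. Qed.

Lemma pcont_const c t : pcont (fun _ => c) t.
Proof. split; apply continuous_const. Qed.

Lemma pcont_RtoC {g : R -> R} {t : R} : continuous g t -> pcont (fun s => RtoC (g s)) t.
Proof. intros H; split; [exact H|simpl; apply continuous_const]. Qed.

Lemma pcont_plus {c e t} : pcont c t -> pcont e t -> pcont (fun s => c s + e s)%C t.
Proof.
intros [A B] [A' B']; split.
- apply (continuous_plus (V := R_NormedModule)); auto.
- apply (continuous_plus (V := R_NormedModule)); auto.
Qed.

Lemma pcont_mult {c e t} : pcont c t -> pcont e t -> pcont (fun s => c s * e s)%C t.
Proof.
intros [A B] [A' B']; split.
- apply (continuous_minus (V := R_NormedModule)); apply (continuous_mult (K := R_AbsRing)); auto.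
- apply (continuous_plus (V := R_NormedModule)); apply (continuous_mult (K := R_AbsRing)); auto.
Qed.

Lemma pcont_opp {c t} : pcont c t -> pcont (fun s => - c s)%C t.
Proof. intros [A B]; split; apply (continuous_opp (V := R_NormedModule)); auto. Qed.

Lemma pcont_minus {c e t} : pcont c t -> pcont e t -> pcont (fun s => c s - e s)%C t.
Proof. intros; apply pcont_plus; auto. now apply pcont_opp. Qed.

Lemma pcont_inv {c : R -> C} {t} : c t <> 0 -> pcont c t -> pcont (fun s => / c s)%C t.
Proof. intros H Hc. apply (pcont_comp Hc). apply ccont_inv; auto. apply ccont_id. Qed.

Lemma pcont_conj {c t} : pcont c t -> pcont (fun s => Cconj (c s)) t.
Proof. intros H. apply (pcont_comp H). apply ccont_conj, ccont_id. Qed.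

Lemma pder_eq {c t d d'} : pder c t d -> d = d' -> pder c t d'.
Proof. intros H <-; exact H. Qed.

Lemma is_derive_Rconst (c x : R) : is_derive (fun _ : R => c) x 0.
Proof. apply (is_derive_const (V := R_NormedModule)). Qed.

Lemma pder_const c t : pder (fun _ => c) t 0.
Proof. split; apply is_derive_Rconst. Qed.

Lemma pder_RtoC {g : R -> R} {t l : R} : is_derive g t l -> pder (fun s => RtoC (g s)) t l.
Proof. intros H; split; [exact H|simpl; apply is_derive_Rconst]. Qed.

Lemma pder_pair {f g : R -> R} {t l m : R} : is_derive f t l -> is_derive g t m -> pder (fun s => (f s, g s)) t (l, m).
Proof. intros; split; auto. Qed.

Lemma pder_plus {c e t d d'} : pder c t d -> pder e t d' -> pder (fun s => c s + e s)%C t (d + d').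
Proof. intros [A B] [A' B']; split; apply (is_derive_plus (V := R_NormedModule)); auto. Qed.

Lemma pder_opp {c t d} : pder c t d -> pder (fun s => - c s)%C t (- d).
Proof. intros [A B]; split; apply (is_derive_opp (V := R_NormedModule)); auto. Qed.

Lemma pder_minus {c e t d d'} : pder c t d -> pder e t d' -> pder (fun s => c s - e s)%C t (d - d').
Proof. intros; apply pder_plus; auto. now apply pder_opp. Qed.

Lemma is_derive_Rmult {f g : R -> R} {x l m : R} : is_derive f x l -> is_derive g x m -> is_derive (fun t => f t * g t) x (l * g x + f x * m).
Proof. intros. apply (is_derive_mult (K := R_AbsRing)); auto. intros; apply Rmult_comm. Qed.

Lemma is_derive_eq {f : R -> R} {x l m : R} : is_derive f x l -> l = m -> is_derive f x m.
Proof. intros H <-; exact H. Qed.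

Lemma is_derive_Rminus {f g : R -> R} {x l m : R} : is_derive f x l -> is_derive g x m -> is_derive (fun t => f t - g t) x (l - m).
Proof. intros. apply (is_derive_minus (V := R_NormedModule)); auto. Qed.

Lemma is_derive_Rplus {f g : R -> R} {x l m : R} : is_derive f x l -> is_derive g x m -> is_derive (fun t => f t + g t) x (l + m).
Proof. intros. apply (is_derive_plus (V := R_NormedModule)); auto. Qed.

Lemma is_derive_Rcomp {f g : R -> R} {x l m : R} : is_derive f (g x) l -> is_derive g x m -> is_derive (fun t => f (g t)) x (l * m).
Proof. intros H1 H2. eapply is_derive_eq. apply (is_derive_comp f g x l m H1 H2). change (m * l = l * m). ring. Qed.

Lemma pder_mult {c e t d d'} : pder c t d -> pder e t d' -> pder (fun s => c s * e s)%C t (d * e t + c t * d').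
Proof.
intros [A B] [A' B']; split.
- eapply is_derive_eq.
 + apply @is_derive_Rminus; apply @is_derive_Rmult; [exact A|exact A'|exact B|exact B'].
 + unfold Re, Im; simpl; ring.
- eapply is_derive_eq.
 + apply @is_derive_Rplus; apply @is_derive_Rmult; [exact A|exact B'|exact B|exact A'].
 + unfold Re, Im; simpl; ring.
Qed.

Lemma pder_scal a {c t d} : pder c t d -> pder (fun s => a * c s)%C t (a * d).
Proof. intros H. eapply pder_eq; [apply (@pder_mult (fun _ => a) c); [apply pder_const|exact H]|ring]. Qed.

Lemma pder_conj {c t d} : pder c t d -> pder (fun s => Cconj (c s)) t (Cconj d).
Proof. intros [A B]; split; [exact A|apply (is_derive_opp (V := R_NormedModule)); exact B]. Qed.

Lemma pder_comp {f c t l d} : pder c t d -> cder f (c t) l -> pder (fun s => f (c s)) t (l * d).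
Proof.
intros Hc Hf. apply pder_eps. intros eps He. have Hc' := proj1 pder_eps Hc. have P1 := Cmod_ge_0 l. set (e1 := Rmin 1 (eps / (2 * (1 + Cmod l)))).
have He1 : 0 < e1 by lra. have E1 : e1 <= 1 by lra. have E1' : e1 * (1 + Cmod l) <= eps / 2.
{ have X : e1 <= eps / (2 * (1 + Cmod l)) by apply Rmin_r. apply (Rmult_le_compat_r (1 + Cmod l)) in X; [|lra]. eapply Rle_trans; [exact X|right; field; lra]. }
set (e2 := eps / (2 * (1 + Cmod d))). have He2 : 0 < e2 by (apply Rdiv_lt_0_compat; lra). have E2 : e2 * (1 + Cmod d) = eps / 2 by (unfold e2; field; lra).
have [d1 [Hd1 K1]] := Hc' e1 He1. have [d2 [Hd2 K2]] := Hf e2 He2. have [d3 [Hd3 K3]] := proj1 pcont_eps (pder_pcont Hc) d2 Hd2. exists (Rmin d1 d3); split; [lra|].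
intros s Hs. specialize (K1 s ltac:(lra)). specialize (K3 s ltac:(lra)). specialize (K2 (c s) K3).
replace (f (c s) - f (c t) - l * d * RtoC (s - t))%C with ((f (c s) - f (c t) - l * (c s - c t)) + l * (c s - c t - d * RtoC (s - t)))%C by ring.
eapply Rle_trans; [apply Cmod_triangle|]. rewrite Cmod_mult. have Q := Rabs_pos (s - t). have G : Cmod (c s - c t) <= (1 + Cmod d) * Rabs (s - t).
{ have X := Cmod_le_plus (c s - c t) (d * RtoC (s - t)). rewrite Cmod_mult, Cmod_R in X. nra. }
set (q := Rabs (s - t)) in *. have T1 : Cmod (f (c s) - f (c t) - l * (c s - c t)) <= eps / 2 * q.
{ eapply Rle_trans; [exact K2|]. rewrite <- E2. rewrite Rmult_assoc. lra. }
have T2 : Cmod l * Cmod (c s - c t - d * RtoC (s - t)) <= eps / 2 * q by nra. lra.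
Qed.

Lemma pder_inv {c : R -> C} {t d} : c t <> 0 -> pder c t d -> pder (fun s => / c s)%C t (- d / (c t * c t)).
Proof.
intros H0 H. eapply pder_eq.
- apply (pder_comp H (cder_inv_id H0)).
- field; auto.
Qed.

Lemma is_derive_Cmod_ln {c : R -> C} {t d} : c t <> 0 -> pder c t d -> is_derive (fun s => ln (Cmod (c s))) t (Re (d / c t)).
Proof.
intros H0 [A B]. have P := Cmod_pos H0. have Q : 0 < Re (c t) * Re (c t) + Im (c t) * Im (c t).
{ rewrite <- Cmod_sqr. nra. }
apply is_derive_ext with (fun s => ln (sqrt (Re (c s) * Re (c s) + Im (c s) * Im (c s)))).
{ intros s. unfold Cmod. do 2 f_equal. unfold Re, Im. ring. }
eapply is_derive_eq.
- apply @is_derive_Rcomp.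
 + apply is_derive_ln. now apply sqrt_lt_R0.
 + apply @is_derive_Rcomp.
  * apply is_derive_Reals, derivable_pt_lim_sqrt, Q.
  * apply @is_derive_Rplus; apply @is_derive_Rmult; eassumption.
- have S : sqrt (Re (c t) * Re (c t) + Im (c t) * Im (c t)) <> 0.
 { assert (0 < sqrt (Re (c t) * Re (c t) + Im (c t) * Im (c t))) by now apply sqrt_lt_R0. lra. }
 replace (Re (d / c t)) with ((Re d * Re (c t) + Im d * Im (c t)) / (Re (c t) * Re (c t) + Im (c t) * Im (c t))).
 + have QQ := sqrt_sqrt (Re (c t) * Re (c t) + Im (c t) * Im (c t)) ltac:(lra). set (q := sqrt (Re (c t) * Re (c t) + Im (c t) * Im (c t))) in *. rewrite <- QQ.
  field. lra.
 + unfold Re, Im in *. simpl in *. field. lra.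
Qed.

(* Project onto the direction of [c b - c a]. *)
Lemma pder_lip {c d a b M} : a <= b -> (forall t, a <= t <= b -> pder c t (d t)) -> (forall t, a <= t <= b -> Cmod (d t) <= M) ->
 Cmod (c b - c a) <= M * (b - a).
Proof.
intros Hab H HM. set (u := (c b - c a)%C). have [E|E] := Req_dec (Cmod u) 0.
{ rewrite E. assert (0 <= M).
 { specialize (HM a ltac:(lra)). lra. }
 lra. }
have P : 0 < Cmod u by lra. set (phi := fun t => Re u * Re (c t) + Im u * Im (c t)). set (dphi := fun t => Re u * Re (d t) + Im u * Im (d t)).
have D : forall t, a <= t <= b -> is_derive phi t (dphi t).
{ intros t Ht. have [A B] := H t Ht. unfold dphi. eapply is_derive_eq.
 - apply @is_derive_Rplus; apply @is_derive_Rmult; [apply is_derive_Rconst|exact A|apply is_derive_Rconst|exact B].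
 - bring. }
destruct (MVT_gen phi a b dphi) as [xi [Hxi E2]].
- intros t Ht. rewrite Rmin_left, Rmax_right in Ht by lra. apply D; lra.
- intros t Ht. rewrite Rmin_left, Rmax_right in Ht by lra. apply continuity_pt_filterlim. apply (ex_derive_continuous (V := R_NormedModule)). eexists; apply D; lra.
- rewrite Rmin_left, Rmax_right in Hxi by lra. have E3 : phi b - phi a = Cmod u * Cmod u.
 { rewrite Cmod_sqr. unfold phi, u. rewrite !Re_minus, !Im_minus. ring. }
 have E4 : dphi xi <= Cmod u * M.
 { have X : dphi xi = Re (Cconj u * d xi) by (unfold dphi, Re, Im; simpl; ring). rewrite X. eapply Rle_trans; [apply Rle_abs|].
  eapply Rle_trans; [apply re_le_Cmod|]. rewrite Cmod_mult, Cmod_conj. apply Rmult_le_compat_l; [lra|auto]. }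
 assert (dphi xi * (b - a) <= Cmod u * M * (b - a)) by lra. apply Rmult_le_reg_l with (Cmod u); auto. lra.
Qed.

Lemma pder_zero_const {c a b} : (forall t, Rmin a b <= t <= Rmax a b -> pder c t 0) -> c a = c b.
Proof.
have G : forall a b, a <= b -> (forall t, a <= t <= b -> pder c t 0) -> c a = c b.
{ clear. intros a b Hab H. symmetry. apply Cmod_sub_0. eapply Rle_trans; [apply (@pder_lip c (fun _ => 0%C) a b 0 Hab H)|lra]. intros. rewrite Cmod_0; lra. }
intros H. have [h|h] := Rle_dec a b.
- apply G; auto. intros t Ht. apply H. rewrite Rmax_right; lra.
- symmetry; apply G; [lra|]. intros t Ht. apply H. rewrite Rmax_left; lra.
Qed.

(** The increment from [z] to [w] is taken along a horizontal and then a vertical segment; on each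
    of them [pder_lip] is applied to [F] minus its linear part at [z]. *)
Lemma cder_of_partials {F f : C -> C} {z} : (exists r, 0 < r /\ forall w, Cmod (w - z) < r ->
 pder (fun x => F (x, Im w)) (Re w) (f w) /\ pder (fun y => F (Re w, y)) (Im w) (Ci * f w)) -> ccont f z -> cder F z (f z).
Proof.
intros [r [Hr H]] Hf eps He. destruct (Hf (eps / 2)) as [d [Hd K]]; [lra|]. exists (Rmin r d / 2). split.
{ lra. }
intros w Hw. have M1 := Rmin_l r d. have M2 := Rmin_r r d. have Rw := re_le_Cmod (w - z). have Iw := im_le_Cmod (w - z). rewrite Re_minus in Rw.
rewrite Im_minus in Iw. have near : forall p, Rabs (Re p - Re z) <= Cmod (w - z) -> Rabs (Im p - Im z) <= Cmod (w - z) -> Cmod (p - z) < Rmin r d.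
{ intros p A B. eapply Rle_lt_trans; [apply Cmod_le_Re_Im|]. rewrite Re_minus, Im_minus. lra. }
have G : forall (c e : R -> C) (m : C) a b, (forall t, Rmin a b <= t <= Rmax a b -> pder c t (e t) /\ Cmod (e t - m) <= eps / 2) -> Cmod (c b - c a - m * RtoC (b - a)) <= eps / 2 * Rabs (b - a).
{ clear. intros c e m.
 have G : forall a b, a <= b -> (forall t, a <= t <= b -> pder c t (e t) /\ Cmod (e t - m) <= eps / 2) -> Cmod (c b - c a - m * RtoC (b - a)) <= eps / 2 * Rabs (b - a).
 { intros a b Hab H. rewrite Rabs_pos_eq by lra. replace (c b - c a - m * RtoC (b - a))%C with ((c b - m * b) - (c a - m * a))%C by (rewrite RtoC_minus; ring).
  apply (@pder_lip (fun t => c t - m * t)%C (fun t => e t - m)%C); auto.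
  - intros t Ht. apply pder_minus; [apply H; auto|]. eapply pder_eq; [apply pder_scal, @pder_RtoC, is_derive_id|]. unfold one; simpl; ring.
  - intros; apply H; auto. }
 intros a b H. have [h|h] := Rle_dec a b.
 - apply G; auto. intros t Ht. apply H. rewrite Rmax_right; lra.
 - replace (c b - c a - m * RtoC (b - a))%C with (- (c a - c b - m * RtoC (a - b)))%C by (rewrite !RtoC_minus; ring). rewrite Cmod_opp, Rabs_minus_sym.
  apply G; [lra|]. intros t Ht. apply H. rewrite Rmax_left; lra. }
have Ga : Cmod (F (Re w, Im z) - F (Re z, Im z) - f z * RtoC (Re w - Re z)) <= eps / 2 * Rabs (Re w - Re z).
{ apply (G (fun x => F (x, Im z)) (fun x => f (x, Im z))). intros x Hx. have N : Cmod ((x, Im z) - z) < Rmin r d.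
 { apply near; simpl.
  - unfold Rmin, Rmax in Hx. eapply Rle_trans; [|exact Rw]. apply Rabs_le. unfold Rabs. destruct (Rle_dec (Re z) (Re w)), Rcase_abs; lra.
  - lra. }
 split.
 - apply (H (x, Im z)). lra.
 - left. apply K. lra. }
have Gb : Cmod (F (Re w, Im w) - F (Re w, Im z) - Ci * f z * RtoC (Im w - Im z)) <= eps / 2 * Rabs (Im w - Im z).
{ apply (G (fun y => F (Re w, y)) (fun y => Ci * f (Re w, y))%C). intros y Hy. have N : Cmod ((Re w, y) - z) < Rmin r d.
 { apply near; simpl.
  - lra.
  - unfold Rmin, Rmax in Hy. eapply Rle_trans; [|exact Iw]. apply Rabs_le. unfold Rabs. destruct (Rle_dec (Im z) (Im w)), Rcase_abs; lra. }
 split.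
 - apply (H (Re w, y)). lra.
 - replace (Ci * f (Re w, y) - Ci * f z)%C with (Ci * (f (Re w, y) - f z))%C by ring. rewrite Cmod_mult, Cmod_Ci, Rmult_1_l. left; apply K. lra. }
rewrite !Ceta in *.
replace (F w - F z - f z * (w - z))%C with ((F (Re w, Im z) - F z - f z * RtoC (Re w - Re z)) + (F w - F (Re w, Im z) - Ci * f z * RtoC (Im w - Im z)))%C.
- eapply Rle_trans; [apply Cmod_triangle|]. nra.
- apply Ceq; unfold Re, Im; simpl; ring.
Qed.

(** * The complex exponential and polar form *)

Definition cis (t : R) : C := (cos t, sin t).

Definition Cexp (z : C) : C := (RtoC (exp (Re z)) * cis (Im z))%C.

Lemma Cmod_cis t : Cmod (cis t) = 1.
Proof. unfold Cmod; simpl. replace (cos t * (cos t * 1) + sin t * (sin t * 1)) with 1. apply sqrt_1. have H := sin2_cos2 t. unfold Rsqr in H. lra. Qed.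

Lemma cis_neq_0 t : cis t <> 0.
Proof. apply Cmod_gt_0. rewrite Cmod_cis; lra. Qed.

Lemma cis_plus a b : cis (a + b) = (cis a * cis b)%C.
Proof. apply Ceq; simpl; [rewrite cos_plus|rewrite sin_plus]; ring. Qed.

Lemma cis_opp a : cis (- a) = Cconj (cis a).
Proof. apply Ceq; [apply cos_neg|apply sin_neg]. Qed.

Lemma cis_0 : cis 0 = 1.
Proof. unfold cis. rewrite cos_0, sin_0. auto. Qed.

Lemma cis_2PI t : cis (t + 2 * PI) = cis t.
Proof. unfold cis. now rewrite cos_plus, sin_plus, cos_2PI, sin_2PI, !Rmult_1_r, !Rmult_0_r, Rminus_0_r, Rplus_0_r. Qed.

Lemma pder_cis t : pder cis t (Ci * cis t).
Proof.
split; simpl.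
- eapply is_derive_eq; [apply is_derive_cos|]. lra.
- eapply is_derive_eq; [apply is_derive_sin|]. lra.
Qed.

Lemma pder_cis_comp {g : R -> R} {t l : R} : is_derive g t l -> pder (fun s => cis (g s)) t (Ci * RtoC l * cis (g t)).
Proof.
intros H. split; simpl.
- eapply is_derive_eq; [apply @is_derive_Rcomp; [apply is_derive_cos|exact H]|]. lra.
- eapply is_derive_eq; [apply @is_derive_Rcomp; [apply is_derive_sin|exact H]|]. lra.
Qed.

Lemma pcont_cis t : pcont cis t.
Proof. eapply pder_pcont, pder_cis. Qed.

Lemma ccont_cis {h z} : ccont (fun w => RtoC (h w)) z -> ccont (fun w => cis (h w)) z.
Proof.
intros H. apply ccont_pair; apply ccont_R; auto.
- apply continuity_pt_filterlim, continuity_cos.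
- apply continuity_pt_filterlim, continuity_sin.
Qed.

Lemma ccont_RtoC_Re z : ccont (fun w => RtoC (Re w)) z.
Proof. apply ccont_Re, ccont_id. Qed.

Lemma ccont_RtoC_Im z : ccont (fun w => RtoC (Im w)) z.
Proof. apply ccont_Im, ccont_id. Qed.

Lemma Cexp_neq_0 z : Cexp z <> 0.
Proof. apply Cmult_neq_0; [|apply cis_neq_0]. have H := exp_pos (Re z). lra. Qed.

Lemma Cmod_Cexp z : Cmod (Cexp z) = exp (Re z).
Proof. unfold Cexp. rewrite Cmod_mult, Cmod_cis, Cmod_R, Rabs_pos_eq; [ring|]. left; apply exp_pos. Qed.

Lemma Cexp_plus a b : Cexp (a + b) = (Cexp a * Cexp b)%C.
Proof.
unfold Cexp. replace (Re (a + b)) with (Re a + Re b) by reflexivity. replace (Im (a + b)) with (Im a + Im b) by reflexivity. rewrite exp_plus, cis_plus, RtoC_mult.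
ring.
Qed.

Lemma ccont_exp_Re z : ccont Cexp z.
Proof.
apply ccont_mult.
- apply ccont_R; [apply ccont_RtoC_Re|]. apply (ex_derive_continuous (V := R_NormedModule)). eexists; apply is_derive_exp.
- apply ccont_cis, ccont_RtoC_Im.
Qed.

Lemma cder_Cexp z : cder Cexp z (Cexp z).
Proof.
apply cder_of_partials; [|apply ccont_exp_Re]. exists 1; split; [lra|]. intros w _. unfold Cexp; simpl; split.
- eapply pder_eq; [apply @pder_mult; [apply @pder_RtoC, is_derive_exp|apply pder_const]|]. bring.
- eapply pder_eq; [apply pder_scal, pder_cis|]. ring.
Qed.

Lemma sin_neq_1_cos {x} : cis x = 1 -> exists m : Z, x = 2 * PI * IZR m.
Proof.
intros H. have Hs : sin (x / 2) = 0.
{ have Hc : cos x = 1 by (apply (f_equal fst) in H; exact H). have E := cos_2a_sin (x / 2). replace (2 * (x / 2)) with x in E by field. nra. }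
have [m Hm] := sin_eq_0_0 _ Hs. exists m. lra.
Qed.

Lemma unit_circle_cis {w} : Cmod w = 1 -> exists t, w = cis t.
Proof.
intros H. have S := Cmod_sqr w. have B : -1 <= Re w <= 1 by (split; nra). have E : sin (acos (Re w)) = sqrt (1 - Rsqr (Re w)) by now apply sin_acos.
have [h|h] := Rle_dec 0 (Im w).
- exists (acos (Re w)). apply Ceq; unfold cis; [now rewrite cos_acos|]. rewrite E. symmetry. apply sqrt_lem_1; unfold Rsqr; nra.
- exists (- acos (Re w)). apply Ceq; simpl; [now rewrite cos_neg, cos_acos|]. rewrite sin_neg.
 have X : sqrt (1 - Rsqr (Re w)) = - Im w by (apply sqrt_lem_1; unfold Rsqr; nra). lra.
Qed.

Lemma Cexp_surj {w : C} : w <> 0 -> exists z, Cexp z = w /\ Re z = ln (Cmod w).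
Proof.
intros H. have P := Cmod_pos H. destruct (@unit_circle_cis (w / RtoC (Cmod w))) as [t Ht].
{ rewrite Cmod_div, Cmod_R, Rabs_pos_eq by (try lra; apply RtoC_neq). field; lra. }
exists (ln (Cmod w), t). split; auto. unfold Cexp; simpl. rewrite exp_ln by auto. rewrite <- Ht. field. lra.
Qed.

(** * Integrals of complex functions of a real variable *)

Definition CInt (f : R -> C) (a b : R) : C :=
  (RInt (fun t => Re (f t)) a b, RInt (fun t => Im (f t)) a b).

Definition cintg (f : R -> C) (a b : R) : Prop :=
  ex_RInt (fun t => Re (f t)) a b /\ ex_RInt (fun t => Im (f t)) a b.

Lemma cintg_pcont {f a b} : (forall t, Rmin a b <= t <= Rmax a b -> pcont f t) -> cintg f a b.
Proof. intros H; split; apply (ex_RInt_continuous (V := R_CompleteNormedModule)); intros t Ht; destruct (H t Ht); auto. Qed.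

Lemma ex_RInt_cont {f : R -> R} a b : (forall t, continuous f t) -> ex_RInt f a b.
Proof. intros H. apply (ex_RInt_continuous (V := R_CompleteNormedModule)); auto. Qed.

Lemma RInt_Rplus {f g : R -> R} {a b} : ex_RInt f a b -> ex_RInt g a b -> RInt (fun t => f t + g t) a b = RInt f a b + RInt g a b.
Proof. intros. apply (RInt_plus (V := R_CompleteNormedModule)); auto. Qed.

Lemma RInt_Rminus {f g : R -> R} {a b} : ex_RInt f a b -> ex_RInt g a b -> RInt (fun t => f t - g t) a b = RInt f a b - RInt g a b.
Proof. intros. apply (RInt_minus (V := R_CompleteNormedModule)); auto. Qed.

Lemma RInt_Rscal {f : R -> R} l {a b} : ex_RInt f a b -> RInt (fun t => l * f t) a b = l * RInt f a b.
Proof. intros. apply (RInt_scal (V := R_CompleteNormedModule)); auto. Qed.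

Lemma ex_RInt_Rplus {f g : R -> R} {a b} : ex_RInt f a b -> ex_RInt g a b -> ex_RInt (fun t => f t + g t) a b.
Proof. intros. apply (ex_RInt_plus (V := R_NormedModule)); auto. Qed.

Lemma ex_RInt_Rminus {f g : R -> R} {a b} : ex_RInt f a b -> ex_RInt g a b -> ex_RInt (fun t => f t - g t) a b.
Proof. intros. apply (ex_RInt_minus (V := R_NormedModule)); auto. Qed.

Lemma ex_RInt_Rscal {f : R -> R} l {a b} : ex_RInt f a b -> ex_RInt (fun t => l * f t) a b.
Proof. intros. apply (ex_RInt_scal (V := R_NormedModule)); auto. Qed.

Lemma RInt_Rconst (c a b : R) : RInt (fun _ => c) a b = (b - a) * c.
Proof. apply (RInt_const (V := R_CompleteNormedModule)). Qed.

Lemma ex_RInt_Rconst (c a b : R) : ex_RInt (fun _ => c) a b.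
Proof. apply ex_RInt_const. Qed.

Lemma CInt_ext {f g a b} : (forall t, Rmin a b < t < Rmax a b -> f t = g t) -> CInt f a b = CInt g a b.
Proof. intros H. unfold CInt. f_equal; apply RInt_ext; intros t Ht; now rewrite H. Qed.

Lemma CInt_plus {f g a b} : cintg f a b -> cintg g a b -> CInt (fun t => f t + g t)%C a b = (CInt f a b + CInt g a b)%C.
Proof. intros [A B] [A' B']. apply Ceq; apply RInt_Rplus; auto. Qed.

Lemma CInt_scal c {f a b} : cintg f a b -> CInt (fun t => c * f t)%C a b = (c * CInt f a b)%C.
Proof.
intros [A B]. apply Ceq; unfold Im in *; simpl.
- rewrite RInt_Rminus by (apply ex_RInt_Rscal; auto). now rewrite !RInt_Rscal.
- rewrite RInt_Rplus by (apply ex_RInt_Rscal; auto). now rewrite !RInt_Rscal.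
Qed.

Lemma cintg_scal c {f a b} : cintg f a b -> cintg (fun t => c * f t)%C a b.
Proof.
intros [A B]; split; unfold Re, Im in *; simpl.
- apply ex_RInt_Rminus; apply ex_RInt_Rscal; auto.
- apply ex_RInt_Rplus; apply ex_RInt_Rscal; auto.
Qed.

Lemma CInt_minus {f g a b} : cintg f a b -> cintg g a b -> CInt (fun t => f t - g t)%C a b = (CInt f a b - CInt g a b)%C.
Proof. intros [A B] [A' B']. apply Ceq; apply RInt_Rminus; auto. Qed.

Lemma CInt_const c a b : CInt (fun _ => c) a b = (RtoC (b - a) * c)%C.
Proof. unfold CInt. rewrite !RInt_Rconst. apply Ceq; unfold Re, Im; simpl; ring. Qed.

Lemma CInt_Chasles {f a b c} : cintg f a b -> cintg f b c -> (CInt f a b + CInt f b c)%C = CInt f a c.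
Proof. intros [A B] [A' B']. apply Ceq; unfold Im in *; apply (RInt_Chasles (V := R_CompleteNormedModule)); auto. Qed.

Lemma CInt_swap {f a b} : cintg f a b -> CInt f b a = (- CInt f a b)%C.
Proof. intros [A B]. apply Ceq; unfold Im in *; symmetry; apply (opp_RInt_swap (V := R_CompleteNormedModule)); auto; apply ex_RInt_swap. Qed.

(** The integrand is paired with the conjugate of the integral itself, which leaves an inequality
    between real integrals; the common factor [Cmod u] is then cancelled. *)
Lemma CInt_norm {f} {g : R -> R} {a b} : a <= b -> cintg f a b -> ex_RInt g a b -> (forall t, a <= t <= b -> Cmod (f t) <= g t) ->
 Cmod (CInt f a b) <= RInt g a b.
Proof.
intros Hab H Hg HM. set (u := CInt f a b). have G0 : 0 <= RInt g a b.
{ apply RInt_ge_0; auto. intros x Hx. specialize (HM x ltac:(lra)). lra. }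
have [E|E] := Req_dec (Cmod u) 0; [lra|]. have P : 0 < Cmod u by lra. have E1 : Cmod u * Cmod u = RInt (fun t => Re (Cconj u * f t)%C) a b.
{ change (RInt (fun t => Re (Cconj u * f t)%C) a b) with (Re (CInt (fun t => Cconj u * f t)%C a b)). rewrite CInt_scal by auto. rewrite Cmod_sqr. simpl. ring. }
have E2 : RInt (fun t => Re (Cconj u * f t)%C) a b <= RInt (fun t => Cmod u * g t) a b.
{ apply RInt_le; auto.
 - apply (cintg_scal (Cconj u) H).
 - now apply ex_RInt_Rscal.
 - intros x Hx. eapply Rle_trans; [apply Rle_abs|]. eapply Rle_trans; [apply re_le_Cmod|]. rewrite Cmod_mult, Cmod_conj. apply Rmult_le_compat_l; [lra|].
  apply HM; lra. }
rewrite RInt_Rscal in E2 by auto. apply Rmult_le_reg_l with (Cmod u); auto. lra.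
Qed.

Lemma CInt_bound {f M a b} : a <= b -> cintg f a b -> (forall t, a <= t <= b -> Cmod (f t) <= M) -> Cmod (CInt f a b) <= M * (b - a).
Proof.
intros Hab H HM. eapply Rle_trans; [apply (@CInt_norm f (fun _ => M)); auto|].
- apply ex_RInt_Rconst.
- rewrite RInt_Rconst; lra.
Qed.

Lemma CInt_FTC {c d a b} : (forall t, Rmin a b <= t <= Rmax a b -> pder c t (d t)) -> (forall t, Rmin a b <= t <= Rmax a b -> pcont d t) ->
 CInt d a b = (c b - c a)%C.
Proof.
intros H1 H2. apply Ceq.
- apply is_RInt_unique. apply (is_RInt_derive (fun t => Re (c t)) (fun t => Re (d t))).
 + intros t Ht; apply (proj1 (H1 t Ht)).
 + intros t Ht; apply (proj1 (H2 t Ht)).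
- apply is_RInt_unique. apply (is_RInt_derive (fun t => Im (c t)) (fun t => Im (d t))).
 + intros t Ht; apply (proj2 (H1 t Ht)).
 + intros t Ht; apply (proj2 (H2 t Ht)).
Qed.

Lemma RInt_FTC {c d : R -> R} {a b} : (forall t, Rmin a b <= t <= Rmax a b -> is_derive c t (d t)) -> (forall t, Rmin a b <= t <= Rmax a b -> continuous d t) ->
 RInt d a b = c b - c a.
Proof. intros H1 H2. apply is_RInt_unique. apply (is_RInt_derive c d); auto. Qed.

Lemma ccont_continuity_2d {f s t} : ccont (fun p => RtoC (f (Re p) (Im p))) (s, t) -> continuity_2d_pt f s t.
Proof.
intros H eps. have [d [Hd K]] := H eps (cond_pos eps). have Hd2 : 0 < d / 2 by lra. exists (mkposreal _ Hd2). simpl. intros u v Hu Hv. specialize (K (u, v)).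
rewrite <- RtoC_minus, Cmod_R in K. apply K. eapply Rle_lt_trans; [apply Cmod_le_Re_Im|]. rewrite Re_minus, Im_minus; simpl. lra.
Qed.

Lemma RInt_param {f f1 : R -> R -> R} {s0} a b : (exists r, 0 < r /\ forall s, Rabs (s - s0) < r ->
 forall t, is_derive (fun x => f x t) s (f1 s t) /\ continuous (f s) t) -> (forall t, ccont (fun p => RtoC (f1 (Re p) (Im p))) (s0, t)) ->
 is_derive (fun s => RInt (f s) a b) s0 (RInt (f1 s0) a b).
Proof.
intros [r [Hr H]] Hc. have L : forall P : R -> Prop, (forall s, Rabs (s - s0) < r -> P s) -> locally s0 P.
{ intros P HP. exists (mkposreal r Hr). intros s Hs. auto. }
rewrite (RInt_ext (f1 s0) (fun t => Derive (fun x => f x t) s0)).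
2:{ intros t _. symmetry. apply is_derive_unique. apply H. lra. }
apply is_derive_RInt_param.
- apply L. intros s Hs t _. eexists; apply H; auto.
- intros t _. apply continuity_2d_pt_ext_loc with f1.
 + exists (mkposreal r Hr). intros u v Hu Hv. symmetry. apply is_derive_unique. apply H; auto.
 + apply ccont_continuity_2d, Hc.
- apply L. intros s Hs. apply ex_RInt_cont. intros t. apply H; auto.
Qed.

Lemma CInt_param {f f1 s0} a b : (exists r, 0 < r /\ forall s, Rabs (s - s0) < r ->
 forall t, pder (fun x => f x t) s (f1 s t) /\ pcont (f s) t) -> (forall t, ccont (fun p => f1 (Re p) (Im p)) (s0, t)) ->
 pder (fun s => CInt (f s) a b) s0 (CInt (f1 s0) a b).
Proof.
intros [r [Hr H]] Hc. split.
- apply (@RInt_param (fun s t => Re (f s t)) (fun s t => Re (f1 s t))).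
 + exists r; split; auto. intros s Hs t. have [[A B] [A' B']] := H s Hs t; auto.
 + intros t. apply ccont_Re, Hc.
- apply (@RInt_param (fun s t => Im (f s t)) (fun s t => Im (f1 s t))).
 + exists r; split; auto. intros s Hs t. have [[A B] [A' B']] := H s Hs t; auto.
 + intros t. apply ccont_Im, Hc.
Qed.

Lemma continuous_Rplus {f g : R -> R} {t : R} : continuous f t -> continuous g t -> continuous (fun s => f s + g s) t.
Proof. apply (continuous_plus (V := R_NormedModule)). Qed.

Lemma continuous_Rminus {f g : R -> R} {t : R} : continuous f t -> continuous g t -> continuous (fun s => f s - g s) t.
Proof. apply (continuous_minus (V := R_NormedModule)). Qed.

Lemma continuous_Ropp {f : R -> R} {t : R} : continuous f t -> continuous (fun s => - f s) t.
Proof. apply (continuous_opp (V := R_NormedModule)). Qed.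

Lemma continuous_Rmult {f g : R -> R} {t : R} : continuous f t -> continuous g t -> continuous (fun s => f s * g s) t.
Proof. apply (continuous_mult (K := R_AbsRing)). Qed.

Lemma continuous_Cmod {c t} : pcont c t -> continuous (fun s => Cmod (c s)) t.
Proof. intros H. apply (@pcont_comp (fun w => RtoC (Cmod w)) c t H), ccont_Cmod, ccont_id. Qed.

Lemma is_derive_continuous {f : R -> R} {t l : R} : is_derive f t l -> continuous f t.
Proof. intros H. apply (ex_derive_continuous (V := R_NormedModule)). now exists l. Qed.

Lemma is_derive_Rid (x : R) : is_derive (fun t : R => t) x 1.
Proof. apply (is_derive_id (K := R_AbsRing)). Qed.

(** Syntax-directed closing tactic for continuity, integrability and derivatives. [cdiff], [pdiff]
    and [rdiff] compute a derivative in the form produced by the rules; [an] reconciles it with the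
    expected one by [ring], [field] or [lra]. *)
Ltac an := intros; first
  [ assumption
  | lazymatch goal with
    | |- ccont (fun _ => ?c) _ => apply ccont_const
    | |- ccont (fun w => w) _ => apply ccont_id
    | |- ccont (fun w => (@?f w + @?g w)%C) _ => apply (@ccont_plus f g); an
    | |- ccont (fun w => (@?f w - @?g w)%C) _ => apply (@ccont_minus f g); an
    | |- ccont (fun w => (@?f w * @?g w)%C) _ => apply (@ccont_mult f g); an
    | |- ccont (fun w => (@?f w / @?g w)%C) _ => apply (@ccont_mult f (fun w => / g w)%C); [|apply @ccont_inv]; an
    | |- ccont (fun w => (- @?f w)%C) _ => apply (@ccont_opp f); an
    | |- ccont (fun w => (/ @?f w)%C) _ => apply (@ccont_inv f); an
    | |- ccont (fun w => Cconj (@?f w)) _ => apply (@ccont_conj f); an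
    | |- ccont (fun w => RtoC (Cmod (@?f w))) _ => apply (@ccont_Cmod f); an
    | |- ccont (fun w => RtoC (Re (@?f w))) _ => apply (@ccont_Re f); an
    | |- ccont (fun w => RtoC (Im (@?f w))) _ => apply (@ccont_Im f); an
    | |- pcont (fun _ => ?c) _ => apply pcont_const
    | |- pcont cis _ => apply pcont_cis
    | |- pcont (fun w => (@?f w + @?g w)%C) _ => apply (@pcont_plus f g); an
    | |- pcont (fun w => (@?f w - @?g w)%C) _ => apply (@pcont_minus f g); an
    | |- pcont (fun w => (@?f w * @?g w)%C) _ => apply (@pcont_mult f g); an
    | |- pcont (fun w => (@?f w / @?g w)%C) _ => apply (@pcont_mult f (fun w => / g w)%C); [|apply @pcont_inv]; an
    | |- pcont (fun w => (- @?f w)%C) _ => apply (@pcont_opp f); an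
    | |- pcont (fun w => (/ @?f w)%C) _ => apply (@pcont_inv f); an
    | |- pcont (fun w => Cconj (@?f w)) _ => apply (@pcont_conj f); an
    | |- pcont (fun w => RtoC (@?f w)) _ => apply (@pcont_RtoC f); an
    | |- continuous (fun _ => ?c) _ => apply continuous_const
    | |- continuous (fun t => t) _ => apply continuous_id
    | |- continuous (fun t => @?f t + @?g t) _ => apply (@continuous_Rplus f g); an
    | |- continuous (fun t => @?f t - @?g t) _ => apply (@continuous_Rminus f g); an
    | |- continuous (fun t => - @?f t) _ => apply (@continuous_Ropp f); an
    | |- continuous (fun t => @?f t * @?g t) _ => apply (@continuous_Rmult f g); an
    | |- continuous (fun t => @?f t / ?c) _ => apply (@continuous_Rmult f (fun _ => / c)); an
    | |- continuous (fun t => Cmod (@?f t)) _ => apply (@continuous_Cmod f); an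
    | |- continuous (fun t => Rabs (@?f t)) _ => apply (continuous_comp f Rabs); [an|apply continuous_Rabs]
    | |- ex_RInt _ _ _ => apply @ex_RInt_cont; an
    | |- cintg _ _ _ => apply @cintg_pcont; an
    | |- cder _ _ _ => first [cdiff | eapply @cder_eq; [cdiff|cbv beta; solve [ring|field; auto]]]
    | |- pder _ _ _ => first [pdiff | eapply @pder_eq; [pdiff|cbv beta; solve [ring|field; auto]]]
    | |- is_derive _ _ _ => first [rdiff | eapply @is_derive_eq; [rdiff|cbv beta; solve [ring|field; auto|lra]]]
    end
  | solve [auto]
  | match goal with
    | |- continuous (fun t => Re (@?f t)) _ => let H := fresh in enough (H : pcont f _) by apply H; an
    | |- continuous (fun t => Im (@?f t)) _ => let H := fresh in enough (H : pcont f _) by apply H; an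
    | |- continuous _ _ => eapply @is_derive_continuous; solve [eauto]
    | |- pcont _ _ => eapply @pder_pcont; solve [eauto]
    | |- ccont _ _ => eapply @cder_ccont; solve [eauto]
    | H : hol ?O ?f |- ccont ?f _ => eapply @cder_ccont, (@hol_cder O f); solve [auto]
    end
  | lra ]
with cdiff := lazymatch goal with
  | |- cder (fun _ => ?c) _ _ => apply cder_const
  | |- cder (fun w => w) _ _ => apply cder_id
  | |- cder (fun w => (@?f w + @?g w)%C) _ _ => apply (@cder_plus f g); cdiff
  | |- cder (fun w => (@?f w - @?g w)%C) _ _ => apply (@cder_minus f g); cdiff
  | |- cder (fun w => (?c * @?g w)%C) _ _ => apply (@cder_scal c g); cdiff
  | |- cder (fun w => (@?f w * @?g w)%C) _ _ => apply (@cder_mult f g); cdiff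
  | |- cder (fun w => (@?f w / @?g w)%C) _ _ => apply (@cder_div f g); [auto|cdiff|cdiff]
  | |- cder (fun w => (- @?f w)%C) _ _ => apply (@cder_opp f); cdiff
  | |- cder (fun w => (/ @?f w)%C) _ _ => apply (@cder_inv f); [auto|cdiff]
  | |- cder ?f _ _ => first [solve [eauto] | match goal with H : hol ?O f |- _ => apply (@hol_cder O f); solve [auto] end
      | match f with fun w => ?g (@?h w) => apply (@cder_comp g h); cdiff end]
  end
with pdiff := lazymatch goal with
  | |- pder (fun _ => ?c) _ _ => apply pder_const
  | |- pder (fun w => (@?f w + @?g w)%C) _ _ => apply (@pder_plus f g); pdiff
  | |- pder (fun w => (@?f w - @?g w)%C) _ _ => apply (@pder_minus f g); pdiff
  | |- pder (fun w => (?c * @?g w)%C) _ _ => apply (@pder_scal c g); pdiff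
  | |- pder (fun w => (@?f w * @?g w)%C) _ _ => apply (@pder_mult f g); pdiff
  | |- pder (fun w => (- @?f w)%C) _ _ => apply (@pder_opp f); pdiff
  | |- pder (fun w => (/ @?f w)%C) _ _ => apply (@pder_inv f); [auto|pdiff]
  | |- pder (fun w => RtoC (@?f w)) _ _ => apply (@pder_RtoC f); rdiff
  | |- pder ?f _ _ => first [solve [eauto] | match f with fun w => ?g (@?h w) => apply (@pder_comp g h); [pdiff|cdiff] end]
  end
with rdiff := lazymatch goal with
  | |- is_derive (fun _ => ?c) _ _ => apply is_derive_Rconst
  | |- is_derive (fun t => t) _ _ => apply is_derive_Rid
  | |- is_derive (fun t => @?f t + @?g t) _ _ => apply (@is_derive_Rplus f g); rdiff
  | |- is_derive (fun t => @?f t - @?g t) _ _ => apply (@is_derive_Rminus f g); rdiff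
  | |- is_derive (fun t => @?f t * @?g t) _ _ => apply (@is_derive_Rmult f g); rdiff
  | |- is_derive exp _ _ => apply is_derive_exp
  | |- is_derive sin _ _ => apply is_derive_sin
  | |- is_derive cos _ _ => apply is_derive_cos
  | |- is_derive ?f _ _ => first [solve [eauto] | match f with fun w => ?g (@?h w) => apply (@is_derive_Rcomp g h); rdiff end]
  end.

(** * Goursat's lemma and Cauchy's formula *)
Definition hint (f : C -> C) (a b y : R) : C := CInt (fun x => f (x, y)) a b.

Definition vint (f : C -> C) (x c d : R) : C := CInt (fun y => f (x, y)) c d.

(** The contour integral round a rectangle, counterclockwise when [a <= b] and [c <= d]; [Ci] is the
    tangent of the vertical sides. *)
Definition rint (f : C -> C) (a b c d : R) : C :=
  (hint f a b c + Ci * vint f b c d - hint f a b d - Ci * vint f a c d)%C.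

Definition inrect (a b c d : R) (z : C) : Prop :=
  Rmin a b <= Re z <= Rmax a b /\ Rmin c d <= Im z <= Rmax c d.

Lemma pder_hline x y : pder (fun t => (t, y)) x 1.
Proof. split; simpl; an. Qed.

Lemma pder_vline x y : pder (fun t => (x, t)) y Ci.
Proof. split; simpl; an. Qed.

Lemma pcont_hline {f x y} : ccont f (x, y) -> pcont (fun t => f (t, y)) x.
Proof. intros H. apply pcont_comp; auto. eapply pder_pcont, pder_hline. Qed.

Lemma pcont_vline {f x y} : ccont f (x, y) -> pcont (fun t => f (x, t)) y.
Proof. intros H. apply pcont_comp; auto. eapply pder_pcont, pder_vline. Qed.

Lemma cintg_h {f a b y} : (forall x, Rmin a b <= x <= Rmax a b -> ccont f (x, y)) -> cintg (fun x => f (x, y)) a b.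
Proof. intros H. apply cintg_pcont. intros x Hx. apply pcont_hline; auto. Qed.

Lemma cintg_v {f x c d} : (forall y, Rmin c d <= y <= Rmax c d -> ccont f (x, y)) -> cintg (fun y => f (x, y)) c d.
Proof. intros H. apply cintg_pcont. intros y Hy. apply pcont_vline; auto. Qed.

Ltac mmx := repeat (rewrite ?Rmin_left, ?Rmax_right by lra); simpl; try Lra.lra.

Lemma rint_plus {f g a b c d} : a <= b -> c <= d -> (forall z, inrect a b c d z -> ccont f z) -> (forall z, inrect a b c d z -> ccont g z) ->
 rint (fun z => f z + g z)%C a b c d = (rint f a b c d + rint g a b c d)%C.
Proof.
intros Hab Hcd Hf Hg. unfold rint, hint, vint. have A : forall h y, (forall z, inrect a b c d z -> ccont h z) -> c <= y <= d -> cintg (fun x => h (x, y)) a b.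
{ intros h y Hh Hy. apply cintg_h. intros t Ht. apply Hh. split; auto. mmx. }
have B : forall h x, (forall z, inrect a b c d z -> ccont h z) -> a <= x <= b -> cintg (fun y => h (x, y)) c d.
{ intros h x Hh Hx. apply cintg_v. intros t Ht. apply Hh. split; auto. mmx. }
rewrite CInt_plus by (apply A; auto; lra). rewrite (@CInt_plus (fun x => f (x, d)) (fun x => g (x, d))) by (apply A; auto; lra).
rewrite CInt_plus by (apply B; auto; lra). rewrite CInt_plus by (apply B; auto; lra). ring.
Qed.

Lemma rint_ext {f g} a b c d : (forall z, f z = g z) -> rint f a b c d = rint g a b c d.
Proof.
intros H. unfold rint, hint, vint. rewrite (@CInt_ext (fun x => f (x, c)) (fun x => g (x, c))) by auto.
rewrite (@CInt_ext (fun x => f (x, d)) (fun x => g (x, d))) by auto. rewrite (@CInt_ext (fun y => f (a, y)) (fun y => g (a, y))) by auto.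
rewrite (@CInt_ext (fun y => f (b, y)) (fun y => g (b, y))) by auto. an.
Qed.

Lemma rint_primitive F g a b c d : (forall z, cder F z (g z)) -> (forall z, ccont g z) -> rint g a b c d = 0.
Proof.
intros H Hg. have E1 : forall y, hint g a b y = (F (b, y) - F (a, y))%C.
{ intros y. apply (@CInt_FTC (fun x => F (x, y))).
 - intros t _. eapply pder_eq; [apply (@pder_comp F (fun x => (x, y)) t (g (t, y)) 1 (pder_hline t y)), H|ring].
 - intros t _. apply pcont_hline; auto. }
have E2 : forall x, (Ci * vint g x c d)%C = (F (x, d) - F (x, c))%C.
{ intros x. unfold vint. rewrite <- CInt_scal by (apply cintg_v; auto). apply (@CInt_FTC (fun y => F (x, y))).
 - intros t _. eapply pder_eq; [apply (@pder_comp F (fun y => (x, y)) t (g (x, t)) Ci (pder_vline x t)), H|ring].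
 - intros t _. apply pcont_mult; [an|]. apply pcont_vline; auto. }
unfold rint. rewrite !E1, !E2. ring.
Qed.

Lemma rint_affine p l m a b c d : rint (fun z => p + l * (z - m))%C a b c d = 0.
Proof.
apply rint_primitive with (fun z => p * z + l * ((z - m) * (z - m)) * / 2)%C.
- intros z. eapply cder_eq.
 + apply @cder_plus; [apply cder_scal, cder_id|]. apply (@cder_mult (fun z => l * ((z - m) * (z - m)))%C (fun _ => / 2)%C); [|an]. apply cder_scal.
  apply (@cder_mult (fun z => z - m)%C (fun z => z - m)%C); (apply @cder_minus; an).
 + field.
- intros z. an.
Qed.

Lemma rint_bound {f a b c d M} : a <= b -> c <= d -> (forall z, inrect a b c d z -> ccont f z) -> (forall z, inrect a b c d z -> Cmod (f z) <= M) ->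
 Cmod (rint f a b c d) <= 2 * M * ((b - a) + (d - c)).
Proof.
intros Hab Hcd Hf HM. have B1 : forall y, c <= y <= d -> Cmod (hint f a b y) <= M * (b - a).
{ intros y Hy. apply CInt_bound; auto.
 - apply cintg_h. intros x Hx. apply Hf. split; auto. mmx.
 - intros x Hx. apply HM. split; mmx. }
have B2 : forall x, a <= x <= b -> Cmod (Ci * vint f x c d) <= M * (d - c).
{ intros x Hx. rewrite Cmod_mult, Cmod_Ci, Rmult_1_l. apply CInt_bound; auto.
 - apply cintg_v. intros y Hy. apply Hf. split; auto. mmx.
 - intros y Hy. apply HM. split; mmx. }
unfold rint, Cminus. repeat (eapply Rle_trans; [apply Cmod_triangle|]; rewrite ?Cmod_opp). have X1 := B1 c ltac:(lra). have X2 := B1 d ltac:(lra).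
have X3 := B2 a ltac:(lra). have X4 := B2 b ltac:(lra). have T := Cmod_triangle (hint f a b c + Ci * vint f b c d) (- hint f a b d).
have T' := Cmod_triangle (hint f a b c) (Ci * vint f b c d). rewrite Cmod_opp in T. lra.
Qed.

Lemma rint_split_h {f a m b c d} : a <= m <= b -> c <= d -> (forall z, inrect a b c d z -> ccont f z) ->
 rint f a b c d = (rint f a m c d + rint f m b c d)%C.
Proof.
intros Hm Hcd Hf. unfold rint, hint.
have X : forall y, c <= y <= d -> CInt (fun x => f (x, y)) a b = (CInt (fun x => f (x, y)) a m + CInt (fun x => f (x, y)) m b)%C.
{ intros y Hy. symmetry. apply CInt_Chasles; apply cintg_h; intros x Hx; apply Hf; rewrite Rmin_left, Rmax_right in Hx by lra; split; mmx. }
rewrite X, X by lra. ring.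
Qed.

Lemma rint_split_v {f a b c m d} : a <= b -> c <= m <= d -> (forall z, inrect a b c d z -> ccont f z) ->
 rint f a b c d = (rint f a b c m + rint f a b m d)%C.
Proof.
intros Hab Hm Hf. unfold rint, vint.
have X : forall x, a <= x <= b -> CInt (fun y => f (x, y)) c d = (CInt (fun y => f (x, y)) c m + CInt (fun y => f (x, y)) m d)%C.
{ intros x Hx. symmetry. apply CInt_Chasles; apply cintg_v; intros y Hy; apply Hf; rewrite Rmin_left, Rmax_right in Hy by lra; split; mmx. }
rewrite X, X by lra. ring.
Qed.

(** Selects a quarter whose integral has at least a fourth of the modulus of the whole. The last
    quarter is the default: by the triangle inequality it qualifies when the other three fail. *)
Definition quarter (f : C -> C) (r : (R * R) * (R * R)) : (R * R) * (R * R) :=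
  let '((a, b), (c, d)) := r in
  let m := (a + b) / 2 in let n := (c + d) / 2 in
  let J := Cmod (rint f a b c d) / 4 in
  if Rle_dec J (Cmod (rint f a m c n)) then ((a, m), (c, n)) else
  if Rle_dec J (Cmod (rint f m b c n)) then ((m, b), (c, n)) else
  if Rle_dec J (Cmod (rint f a m n d)) then ((a, m), (n, d)) else ((m, b), (n, d)).

Fixpoint qseq (f : C -> C) (r : (R * R) * (R * R)) (n : nat) : (R * R) * (R * R) :=
  match n with O => r | S n => quarter f (qseq f r n) end.

Lemma nested_point {a b} : (forall n, a n <= a (S n)) -> (forall n, b (S n) <= b n) -> (forall n, a n <= b n) -> exists x, forall n, a n <= x <= b n.
Proof.
intros Ha Hb Hab. have Ma : forall n k, a n <= a (n + k)%nat.
{ intros n k; induction k; [rewrite Nat.add_0_r; lra|]. rewrite Nat.add_succ_r. specialize (Ha (n + k)%nat). lra. }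
have Mb : forall n k, b (n + k)%nat <= b n.
{ intros n k; induction k; [rewrite Nat.add_0_r; lra|]. rewrite Nat.add_succ_r. specialize (Hb (n + k)%nat). lra. }
have Mab : forall n m, a n <= b m.
{ intros n m. have A := Ma n m. have B := Mb m n. rewrite Nat.add_comm in B. specialize (Hab (n + m)%nat). lra. }
destruct (completeness (fun x => exists n, x = a n)) as [x [H1 H2]].
- exists (b O). intros x [n ->]. an.
- exists (a O), O; auto.
- exists x. intros n. split.
 + apply H1. now exists n.
 + apply H2. intros y [m ->]. an.
Qed.

(** Goursat's bisection. Affine functions have primitives, so in the [n]-th rectangle only the
    remainder of the derivative at the common point counts; it is of the order of [eps] times the
    square of the size, against a lower bound decreasing like [4 ^ (- n)]. *)
Lemma goursat_le {f a b c d} : a <= b -> c <= d -> (forall z, inrect a b c d z -> exists l, cder f z l) -> rint f a b c d = 0.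
Proof.
intros Hab Hcd Hf. have Hc : forall z, inrect a b c d z -> ccont f z.
{ intros z Hz. have [l Hl] := Hf z Hz. an. }
set (r := qseq f ((a, b), (c, d))). set (an := fun n => fst (fst (r n))). set (bn := fun n => snd (fst (r n))). set (cn := fun n => fst (snd (r n))).
set (dn := fun n => snd (snd (r n))). have E : forall n, r n = ((an n, bn n), (cn n, dn n)).
{ intros n. unfold an, bn, cn, dn. destruct (r n) as [[? ?] [? ?]]; auto. }
have I : forall n, a <= an n <= bn n /\ bn n <= b /\ c <= cn n <= dn n /\ dn n <= d.
{ have X : forall n, let '((a', b'), (c', d')) := r n in a <= a' <= b' /\ b' <= b /\ c <= c' <= d' /\ d' <= d.
 { induction n; [simpl; lra|]. change (r (S n)) with (quarter f (r n)). destruct (r n) as [[a' b'] [c' d']]. unfold quarter. repeat destruct (Rle_dec _ _); lra. }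
 intros n. specialize (X n). rewrite E in X. lra. }
have St : forall n, an n <= an (S n) /\ bn (S n) <= bn n /\ cn n <= cn (S n) /\ dn (S n) <= dn n /\ bn (S n) - an (S n) = (bn n - an n) / 2 /\ dn (S n) - cn (S n) = (dn n - cn n) / 2 /\ Cmod (rint f (an n) (bn n) (cn n) (dn n)) / 4 <= Cmod (rint f (an (S n)) (bn (S n)) (cn (S n)) (dn (S n))).
{ intros n. have [I1 [I2 [I3 I4]]] := I n. have E' := E (S n). change (r (S n)) with (quarter f (r n)) in E'. rewrite E in E'. unfold quarter in E'.
 set (a' := an n) in *. set (b' := bn n) in *. set (c' := cn n) in *. set (d' := dn n) in *. have Hc' : forall z, inrect a' b' c' d' z -> ccont f z.
 { intros z [Z1 Z2]. apply Hc. rewrite Rmin_left, Rmax_right in Z1, Z2 by lra. split; mmx. }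
 repeat destruct (Rle_dec _ _) in E'; inversion E'; repeat split; try lra.
 have S1 : rint f a' b' c' d' = (rint f a' b' c' ((c' + d') / 2) + rint f a' b' ((c' + d') / 2) d')%C by (apply rint_split_v; auto; lra).
 have S2 : rint f a' b' c' ((c' + d') / 2) = (rint f a' ((a' + b') / 2) c' ((c' + d') / 2) + rint f ((a' + b') / 2) b' c' ((c' + d') / 2))%C.
 { apply rint_split_h; try lra. intros z [Z1 Z2]; apply Hc'. rewrite Rmin_left, Rmax_right in Z1, Z2 by lra. split; mmx. }
 have S3 : rint f a' b' ((c' + d') / 2) d' = (rint f a' ((a' + b') / 2) ((c' + d') / 2) d' + rint f ((a' + b') / 2) b' ((c' + d') / 2) d')%C.
 { apply rint_split_h; try lra. intros z [Z1 Z2]; apply Hc'. rewrite Rmin_left, Rmax_right in Z1, Z2 by lra. split; mmx. }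
 have T1 := Cmod_triangle (rint f a' b' c' ((c' + d') / 2)) (rint f a' b' ((c' + d') / 2) d'). rewrite <- S1 in T1.
 have T2 := Cmod_triangle (rint f a' ((a' + b') / 2) c' ((c' + d') / 2)) (rint f ((a' + b') / 2) b' c' ((c' + d') / 2)). rewrite <- S2 in T2.
 have T3 := Cmod_triangle (rint f a' ((a' + b') / 2) ((c' + d') / 2) d') (rint f ((a' + b') / 2) b' ((c' + d') / 2) d'). rewrite <- S3 in T3. lra. }
destruct (@nested_point an bn) as [x Hx]; try (intros n; apply St); [intros n; apply I|].
destruct (@nested_point cn dn) as [y Hy]; try (intros n; apply St); [intros n; apply I|]. have Hp : inrect a b c d (x, y).
{ specialize (Hx O). specialize (Hy O). destruct (I O). split; mmx. }
have [l Hl] := Hf _ Hp. set (J := Cmod (rint f a b c d)). have G : forall n, J / 4 ^ n <= Cmod (rint f (an n) (bn n) (cn n) (dn n)).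
{ induction n.
 - unfold J, an, bn, cn, dn; simpl; lra.
 - have [_ [_ [_ [_ [_ [_ X]]]]]] := St n. simpl. replace (J / (4 * 4 ^ n)) with (J / 4 ^ n / 4); [lra|]. field. apply pow_nonzero; lra. }
have Wd : forall n, bn n - an n = (b - a) / 2 ^ n /\ dn n - cn n = (d - c) / 2 ^ n.
{ induction n.
 - unfold an, bn, cn, dn; simpl. lra.
 - have [_ [_ [_ [_ [X1 [X2 _]]]]]] := St n. destruct IHn as [W1 W2]. rewrite X1, X2, W1, W2. simpl. split; field; apply pow_nonzero; lra. }
apply Cmod_eq_0. fold J. apply Rle_antisym; [|apply Cmod_ge_0]. apply Rnot_lt_le. intros HJ. set (W := (b - a) + (d - c)). have HW : 0 <= W by (unfold W; lra).
(* The final estimate will read [J <= 2 * eps * (W * W)], which this choice contradicts; [W] is half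
   of the perimeter. *)
set (eps := J / (4 * (W * W + 1))). have Heps : 0 < eps by (apply Rdiv_lt_0_compat; [lra|nra]). have [del [Hdel K]] := Hl eps Heps.
have N : exists n, W / 2 ^ n < del.
{ destruct (pow_lt_1_zero (/ 2)) with (y := del / (W + 1)) as [n Hn].
 - an.
 - lra.
 - exists n. specialize (Hn n (Nat.le_refl n)). rewrite Rabs_pos_eq in Hn by (apply pow_le; lra). rewrite pow_inv in Hn.
  apply (Rmult_lt_compat_r (W + 1)) in Hn; [|lra]. replace (del / (W + 1) * (W + 1)) with del in Hn by (field; lra). nra. }
destruct N as [n Hn]. specialize (G n). have [W1 W2] := Wd n. have [I1 [I2 [I3 I4]]] := I n. specialize (Hx n). specialize (Hy n). set (p := (x, y)) in *.
set (e := fun z => (f z - (f p + l * (z - p)))%C). have PW : (bn n - an n) + (dn n - cn n) = W / 2 ^ n.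
{ unfold W. an. }
have Hsub : forall z, inrect (an n) (bn n) (cn n) (dn n) z -> inrect a b c d z.
{ intros z [Z1 Z2]. rewrite Rmin_left, Rmax_right in Z1, Z2 by lra. split; mmx. }
have Haff : forall z, ccont (fun z => f p + l * (z - p))%C z by an. have He : forall z, inrect (an n) (bn n) (cn n) (dn n) z -> ccont e z.
{ intros z Hz. apply ccont_minus; auto. }
have B : Cmod (rint e (an n) (bn n) (cn n) (dn n)) <= 2 * (eps * (W / 2 ^ n)) * (W / 2 ^ n).
{ rewrite <- PW at 2. apply rint_bound; auto; try lra. intros z Hz. unfold e. have D : Cmod (z - p) <= W / 2 ^ n.
 { eapply Rle_trans; [apply Cmod_le_Re_Im|]. rewrite Re_minus, Im_minus. simpl. destruct Hz as [Z1 Z2]. rewrite Rmin_left, Rmax_right in Z1, Z2 by lra.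
  assert (Rabs (Re z - x) <= bn n - an n) by lra. assert (Rabs (Im z - y) <= dn n - cn n) by lra. lra. }
 replace (f z - (f p + l * (z - p)))%C with (f z - f p - l * (z - p))%C by ring. eapply Rle_trans; [apply K; lra|]. an. }
have E0 : rint f (an n) (bn n) (cn n) (dn n) = rint e (an n) (bn n) (cn n) (dn n).
{ transitivity (rint (fun z => e z + (f p + l * (z - p)))%C (an n) (bn n) (cn n) (dn n)).
 - apply rint_ext. intros z; unfold e; ring.
 - rewrite rint_plus; auto; try lra. rewrite rint_affine. ring. }
rewrite E0 in G. have P4 : 4 ^ n = 2 ^ n * 2 ^ n.
{ rewrite <- Rpow_mult_distr. f_equal. }
have P2 : 0 < 2 ^ n by (apply pow_lt; lra). have Q : J / 4 ^ n <= 2 * eps * (W * W) / 4 ^ n.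
{ eapply Rle_trans; [exact G|]. eapply Rle_trans; [exact B|]. right. rewrite P4. field. lra. }
apply (Rmult_le_compat_r (4 ^ n)) in Q; [|apply pow_le; lra]. replace (J / 4 ^ n * 4 ^ n) with J in Q by (field; apply pow_nonzero; lra).
replace (2 * eps * (W * W) / 4 ^ n * 4 ^ n) with (2 * eps * (W * W)) in Q by (field; apply pow_nonzero; lra).
assert (eps * (4 * (W * W + 1)) = J) by (unfold eps; field; nra). nra.
Qed.

Lemma rint_swap_h {f a b c d} : (forall z, inrect a b c d z -> ccont f z) -> rint f b a c d = (- rint f a b c d)%C.
Proof.
intros H. unfold rint, hint. rewrite !(@CInt_swap _ a b).
- ring.
- apply cintg_h. intros x Hx; apply H. split; auto. split; [apply Rmin_r|apply Rmax_r].
- apply cintg_h. intros x Hx; apply H. split; auto. split; [apply Rmin_l|apply Rmax_l].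
Qed.

Lemma rint_swap_v {f a b c d} : (forall z, inrect a b c d z -> ccont f z) -> rint f a b d c = (- rint f a b c d)%C.
Proof.
intros H. unfold rint, vint. rewrite !(@CInt_swap _ c d).
- ring.
- apply cintg_v. intros x Hx; apply H. split; auto. split; [apply Rmin_l|apply Rmax_l].
- apply cintg_v. intros x Hx; apply H. split; auto. split; [apply Rmin_r|apply Rmax_r].
Qed.

Lemma goursat {f a b c d} : (forall z, inrect a b c d z -> exists l, cder f z l) -> rint f a b c d = 0.
Proof.
have G : forall a b c d, a <= b -> (forall z, inrect a b c d z -> exists l, cder f z l) -> rint f a b c d = 0.
{ clear. intros a b c d Hab H. have [h|h] := Rle_dec c d.
 - apply goursat_le; auto.
 - have H' : forall z, inrect a b d c z -> exists l, cder f z l.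
  { intros z [Z1 Z2]; apply H; split; auto. now rewrite Rmin_comm, Rmax_comm. }
  rewrite rint_swap_v, goursat_le; auto; try lra. ring. intros z Hz. have [l Hl] := H' z Hz. an. }
intros H. have [h|h] := Rle_dec a b; auto. have H' : forall z, inrect b a c d z -> exists l, cder f z l.
{ intros z [Z1 Z2]; apply H; split; auto. now rewrite Rmin_comm, Rmax_comm. }
rewrite rint_swap_h, G; auto; try lra. ring. intros z Hz. have [l Hl] := H' z Hz. an.
Qed.

(** Open convex subsets of the line: one notion for the sides of rectangles and of strips. *)
Definition interval_like (X : R -> Prop) : Prop :=
  (forall x, X x -> exists r, 0 < r /\ forall y, Rabs (y - x) < r -> X y) /\
  (forall x y z, X x -> X y -> Rmin x y <= z <= Rmax x y -> X z).

Lemma interval_like_oo a b : interval_like (fun x => a < x < b).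
Proof.
split.
- intros x Hx. exists (Rmin (x - a) (b - x)). split; [an|]. intros y Hy. have A := Rmin_l (x - a) (b - x). have B := Rmin_r (x - a) (b - x). apply Rabs_def2 in Hy.
 lra.
- intros x y z Hx Hy. unfold Rmin, Rmax. destruct (Rle_dec x y); lra.
Qed.

Lemma interval_like_all : interval_like (fun _ => True).
Proof. split; auto. intros x _. exists 1; split; auto; lra. Qed.

Lemma pder_CInt {f a b} : (exists r, 0 < r /\ forall s, Rabs (s - b) < r -> cintg f a s) -> pcont f b -> pder (fun s => CInt f a s) b (f b).
Proof.
intros [r [Hr H]] [C1 C2]. split.
- apply (is_derive_RInt (fun t => Re (f t)) _ a b); auto. exists (mkposreal r Hr). intros s Hs. apply (RInt_correct (V := R_CompleteNormedModule)). apply H, Hs.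
- apply (is_derive_RInt (fun t => Im (f t)) _ a b); auto. exists (mkposreal r Hr). intros s Hs. apply (RInt_correct (V := R_CompleteNormedModule)). apply H, Hs.
Qed.

Lemma pder_ext_loc c e t d : (exists r, 0 < r /\ forall s, Rabs (s - t) < r -> c s = e s) -> pder c t d -> pder e t d.
Proof.
intros [r [Hr E]]. rewrite !pder_eps. intros H eps He. have [d' [Hd' K]] := H eps He. exists (Rmin r d'); split; [an|]. intros s Hs. rewrite <- !E.
- apply K. lra.
- an.
- lra.
Qed.

(** [F] integrates along a horizontal and then a vertical segment, [G] the other way round, and
    Goursat's lemma makes them equal. The vertical derivative is read off from [F], the horizontal
    one from [G]. *)
Lemma primitive_box {X Y f x0 y0} : interval_like X -> interval_like Y -> X x0 -> Y y0 -> (forall z, X (Re z) -> Y (Im z) ->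
 exists l, cder f z l) -> exists F : C -> C, F (x0, y0) = 0%C /\ forall z, X (Re z) -> Y (Im z) -> cder F z (f z).
Proof.
intros [OX CX] [OY CY] HX0 HY0 Hf. have Hc : forall z, X (Re z) -> Y (Im z) -> ccont f z.
{ intros z A B. have [l Hl] := Hf z A B. an. }
set (F := fun z : C => (hint f x0 (Re z) y0 + Ci * vint f (Re z) y0 (Im z))%C). set (G := fun z : C => (Ci * vint f x0 y0 (Im z) + hint f x0 (Re z) (Im z))%C).
have FG : forall z, X (Re z) -> Y (Im z) -> F z = G z.
{ intros z A B. have J := @goursat f x0 (Re z) y0 (Im z). unfold rint in J. unfold F, G.
 transitivity (hint f x0 (Re z) y0 + Ci * vint f (Re z) y0 (Im z) - 0)%C; [ring|]. rewrite <- J; [ring|]. intros w [W1 W2]. apply Hf.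
 - apply (CX x0 (Re z)); auto.
 - apply (CY y0 (Im z)); auto. }
exists F. split.
{ unfold F, hint, vint, CInt. rewrite !RInt_point. apply Ceq; unfold zero; simpl; ring. }
intros z A B. apply cder_of_partials; auto. have [r1 [Hr1 K1]] := OX _ A. have [r2 [Hr2 K2]] := OY _ B. exists (Rmin r1 r2); split; [an|]. intros w Hw.
have Aw : X (Re w).
{ apply K1. rewrite <- Re_minus. eapply Rle_lt_trans; [apply re_le_Cmod|]. lra. }
have Bw : Y (Im w).
{ apply K2. rewrite <- Im_minus. eapply Rle_lt_trans; [apply im_le_Cmod|]. lra. }
split.
- have [r [Hr K]] := OX _ Aw. apply pder_ext_loc with (fun x => G (x, Im w)).
 + exists r; split; auto. intros s Hs. symmetry. an.
 + unfold G; simpl. eapply pder_eq.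
  * apply @pder_plus; [an|]. apply pder_CInt.
   -- exists r; split; auto. intros s Hs. apply cintg_h. intros x Hx. apply Hc; auto. apply (CX x0 s); auto.
   -- apply pcont_hline. auto.
  * rewrite Ceta. ring.
- have [r [Hr K]] := OY _ Bw. unfold F; simpl. eapply pder_eq.
 + apply @pder_plus; [an|]. apply pder_scal. apply pder_CInt.
  * exists r; split; auto. intros s Hs. apply cintg_v. intros y Hy. apply Hc; auto. apply (CY y0 s); auto.
  * apply pcont_vline. auto.
 + rewrite Ceta. ring.
Qed.

(** * Mean values over circles and Cauchy's formulas at the centre *)

Definition circ (z0 : C) (r t : R) : C := (z0 + RtoC r * cis t)%C.

Lemma Cmod_circ z0 {r} t : 0 <= r -> Cmod (circ z0 r t - z0) = r.
Proof. intros H. unfold circ. replace (z0 + r * cis t - z0)%C with (r * cis t)%C by ring. rewrite Cmod_mult, Cmod_cis, Cmod_R, Rabs_pos_eq; lra. Qed.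

Lemma pder_circ z0 r t : pder (circ z0 r) t (Ci * (RtoC r * cis t)).
Proof.
eapply pder_eq.
- apply @pder_plus; [an|]. apply pder_scal, pder_cis.
- ring.
Qed.

Lemma pcont_circ z0 r t : pcont (circ z0 r) t.
Proof. eapply pder_pcont, pder_circ. Qed.

Lemma circ_2PI z0 r : circ z0 r (2 * PI) = circ z0 r 0.
Proof. unfold circ. rewrite <- (Rplus_0_l (2 * PI)), cis_2PI. an. Qed.

Lemma CInt_cis_0 : CInt cis 0 (2 * PI) = 0.
Proof.
rewrite (@CInt_FTC (fun t => - Ci * cis t)%C cis).
- rewrite <- (Rplus_0_l (2 * PI)), cis_2PI. ring.
- intros t _. eapply pder_eq; [apply pder_scal, pder_cis|]. apply Ceq; simpl; ring.
- intros t _. an.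
Qed.

Definition disc (z0 : C) (r : R) (z : C) : Prop := Cmod (z - z0) < r.

Lemma opn_disc z0 r : opn (disc z0 r).
Proof. intros z Hz. unfold disc in *. exists (r - Cmod (z - z0)). split; [lra|]. intros w Hw. have T := Cmod_tri w z z0. lra. Qed.

Lemma disc_center z0 r : 0 < r -> disc z0 r z0.
Proof. intros H. unfold disc. replace (z0 - z0)%C with (RtoC 0) by ring. now rewrite Cmod_0. Qed.

Lemma hol_ccont {O f z} : hol O f -> O z -> ccont f z.
Proof. intros. an. Qed.

Lemma hol_sub {O O' f} : (forall z, O' z -> O z) -> hol O f -> hol O' f.
Proof. intros H Hf z Hz. an. Qed.

Lemma pcont_pow {c} n {t} : pcont c t -> pcont (fun s => c s ^ n)%C t.
Proof. intros H. induction n; [apply pcont_const|]. now apply pcont_mult. Qed.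

Lemma pder_line z w t : pder (fun s => z + RtoC s * w)%C t w.
Proof.
eapply pder_eq.
- apply @pder_plus; [an|]. apply @pder_mult; [apply @pder_RtoC, is_derive_Rid|an].
- bring.
Qed.

(** The radial derivative of the mean is the integral of [F1 * cis], which is the angular derivative
    of [F / (Ci * r)] and vanishes over a period. Radius 0 is included because the integral of [cis]
    itself vanishes; this lets [circ_mean] shrink the circle to its centre. *)
Lemma circ_mean_pder {F F1 z0 r d} : 0 < d -> (forall q t, Rabs (q - r) < d ->
 cder F (circ z0 q t) (F1 (circ z0 q t)) /\ ccont F1 (circ z0 q t)) -> pder (fun r => CInt (fun t => F (circ z0 r t)) 0 (2 * PI)) r 0.
Proof.
intros Hd H. have Hr := fun t => H r t ltac:(lra). eapply pder_eq.
- apply (@CInt_param (fun r t => F (circ z0 r t)) (fun r t => F1 (circ z0 r t) * cis t)%C).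
 + exists d. split; auto. intros q Hq t. have [A B] := H q t Hq. split.
  * apply pder_comp; [apply pder_line|auto].
  * apply pcont_comp; [apply pcont_circ|]. an.
 + intros t. have X : ccont (fun p => cis (Im p)) (r, t) by apply ccont_cis, ccont_RtoC_Im. apply ccont_mult; auto. apply ccont_comp; [|apply Hr].
  apply ccont_plus; [an|]. an.
- have [->|N] := Req_dec r 0.
 + rewrite (@CInt_ext _ (fun t => F1 z0 * cis t)%C), CInt_scal, CInt_cis_0; [ring|an|]. intros t _. unfold circ. do 2 f_equal. ring.
 + apply RtoC_neq in N. rewrite (@CInt_FTC (fun t => F (circ z0 r t) * (/ (Ci * r)))%C).
  * rewrite circ_2PI. ring.
  * intros t _. eapply pder_eq; [apply @pder_mult; [|an]; apply (@pder_comp F); [apply pder_circ|apply Hr]|]. cbv beta. field. split; auto. intros E.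
   apply (f_equal Im) in E. simpl in E. lra.
  * intros t _. apply pcont_mult; [|an]. apply pcont_comp; [apply pcont_circ|apply Hr].
Qed.

Lemma circ_mean {F F1 z0 r Rr} : 0 < r < Rr -> (forall w, disc z0 Rr w -> cder F w (F1 w) /\ ccont F1 w) ->
 CInt (fun t => F (circ z0 r t)) 0 (2 * PI) = (RtoC (2 * PI) * F z0)%C.
Proof.
intros Hr H. transitivity (CInt (fun t => F (circ z0 0 t)) 0 (2 * PI)).
- apply (@pder_zero_const (fun r => CInt (fun t => F (circ z0 r t)) 0 (2 * PI))). intros s Hs. rewrite Rmin_right, Rmax_left in Hs by lra.
 apply (@circ_mean_pder F F1 z0 s (Rr - r)); [lra|]. intros q t Hq. apply H. unfold disc, circ. replace (z0 + q * cis t - z0)%C with (q * cis t)%C by ring.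
 rewrite Cmod_mult, Cmod_R, Cmod_cis. apply Rabs_def2 in Hq. assert (Rabs q < Rr) by lra. lra.
- rewrite (@CInt_ext _ (fun _ => F z0)), CInt_const, Rminus_0_r; auto. intros t _. unfold circ. f_equal. ring.
Qed.

Lemma circ_uniform {F z r e} : (forall t, ccont F (circ z r t)) -> 0 < e -> exists d, 0 < d /\ forall w t, Cmod (w - z) < d ->
 0 <= t <= 2 * PI -> Cmod (F (circ w r t) - F (circ z r t)) <= e.
Proof.
intros H He. have X : forall t, exists d : posreal, forall w t', Cmod (w - z) < d -> Rabs (t' - t) < d -> Cmod (F (circ w r t') - F (circ z r t)) < e / 2.
{ intros t. destruct (H t (e / 2)) as [n [Hn K]]; [lra|]. destruct (proj1 pcont_eps (pcont_circ z r t) (n / 2)) as [d [Hd K2]]; [lra|].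
 have P : 0 < Rmin d (n / 2) by lra. exists (mkposreal _ P). simpl. intros w t' Hw Ht. apply K. specialize (K2 t' ltac:(lra)).
 replace (circ w r t' - circ z r t)%C with ((w - z) + (circ z r t' - circ z r t))%C by (unfold circ; ring). eapply Rle_lt_trans; [apply Cmod_triangle|]. lra. }
have [del Hdel] := choice _ X. have [d Hd] := compactness_value_1d 0 (2 * PI) del. exists d. split; [apply cond_pos|]. intros w t Hw Ht. apply NNPP. intros N.
apply (Hd t Ht). intros [x [Hx [Hx1 Hx2]]]. have A := Hdel x w t ltac:(lra) Hx1. have B := Hdel x z t ltac:(rewrite Cmod_diag; apply cond_pos) Hx1.
have T := Cmod_tri (F (circ w r t)) (F (circ z r x)) (F (circ z r t)). rewrite (Cmod_minus_sym (F (circ z r x))) in T. lra.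
Qed.

(** Differentiation under the integral sign. Along the segment from [z] to [w] the remainder has a
    derivative of the form [(F1 - F1 at z) * h], which [circ_uniform] makes small for all angles at
    once. *)
Lemma cder_CInt {F F1 phi z r d} : 0 < d -> (forall t, pcont phi t) -> (forall w t, Cmod (w - z) < d ->
 cder F (circ w r t) (F1 (circ w r t)) /\ ccont F1 (circ w r t)) ->
 cder (fun z => CInt (fun t => F (circ z r t) * phi t)%C 0 (2 * PI)) z (CInt (fun t => F1 (circ z r t) * phi t)%C 0 (2 * PI)).
Proof.
intros Hd Hphi H eps He. have zz : Cmod (z - z) < d by (rewrite Cmod_diag; auto). set (M := RInt (fun t => Cmod (phi t)) 0 (2 * PI)).
have pc : forall t, continuous (fun t => Cmod (phi t)) t by an. have M0 : 0 <= M by (apply RInt_ge_0; an). set (e := eps / (M + 1)).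
have e0 : 0 < e by (apply Rdiv_lt_0_compat; lra). destruct (@circ_uniform F1 z r e) as [d2 [Hd2 U]]; auto; [intros t; apply (H z t zz)|]. exists (Rmin d d2).
split; [lra|]. intros w Hw. have I : forall w, Cmod (w - z) < d -> forall t, pcont (fun t => F (circ w r t) * phi t)%C t.
{ intros x Hx t. apply pcont_mult; auto. apply pcont_comp; [apply pcont_circ|]. eapply cder_ccont, H; auto. }
have I1 : forall t, pcont (fun t => F1 (circ z r t) * phi t)%C t by (intros t; apply pcont_mult; auto; apply pcont_comp; [apply pcont_circ|apply H; auto]).
have Iw := I w ltac:(lra). set (h := (w - z)%C) in *. have I2 : forall t, pcont (fun t => h * (F1 (circ z r t) * phi t))%C t by an.
have Iwz : forall t, pcont (fun t => F (circ w r t) * phi t - F (circ z r t) * phi t)%C t by an. rewrite Cmult_comm, <- CInt_scal by (apply cintg_pcont; auto).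
rewrite <- CInt_minus by (apply cintg_pcont; auto). rewrite <- CInt_minus by (apply cintg_pcont; auto).
apply Rle_trans with (RInt (fun t => e * Cmod h * Cmod (phi t)) 0 (2 * PI)).
- apply CInt_norm; [lra| |an|].
 + an.
 + intros t Ht.
  replace (F (circ w r t) * phi t - F (circ z r t) * phi t - h * (F1 (circ z r t) * phi t))%C with ((F (circ w r t) - F (circ z r t) - h * F1 (circ z r t)) * phi t)%C by ring.
  rewrite Cmod_mult. apply Rmult_le_compat_r; [an|]. set (c := fun s : R => (F (circ (z + s * h) r t) - s * (h * F1 (circ z r t)))%C).
  replace (F (circ w r t) - F (circ z r t) - h * F1 (circ z r t))%C with (c 1 - c 0)%C.
  2:{ unfold c. replace (z + RtoC 1 * h)%C with w by (unfold h; ring). replace (z + RtoC 0 * h)%C with z by ring. ring. }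
  rewrite <- Rmult_1_r. replace 1 with (1 - 0) at 2 by ring. have near : forall s, 0 <= s <= 1 -> Cmod (z + s * h - z) < Rmin d d2.
  { intros s Hs. replace (z + s * h - z)%C with (s * h)%C by ring. rewrite Cmod_mult, Cmod_R, Rabs_pos_eq by lra. have Q := Cmod_ge_0 h. nra. }
  apply (@pder_lip c (fun s => (F1 (circ (z + s * h) r t) - F1 (circ z r t)) * h)%C); [lra| |].
  * intros s Hs. specialize (near s Hs). eapply pder_eq.
   -- apply @pder_minus; [|apply @pder_mult; [apply @pder_RtoC, is_derive_Rid|an]]. apply (@pder_comp F (fun s => circ (z + RtoC s * h) r t)); [|apply H; lra].
    apply @pder_plus; [apply pder_line|an].
   -- bring.
  * intros s Hs. specialize (near s Hs). rewrite Cmod_mult. apply Rmult_le_compat_r; [an|]. apply U; auto. lra.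
- rewrite RInt_Rscal by now apply ex_RInt_cont. fold M. have E : eps = e * (M + 1) by (unfold e; field; lra). have Q := Cmod_ge_0 h. nra.
Qed.

(** Integration by parts over a closed circle: the angular derivative of [F] carries a factor
    [r * cis], which cancels one power of [/ cis]. *)
Lemma circ_ibp {F F1 z r} n : (forall t, cder F (circ z r t) (F1 (circ z r t)) /\ ccont F1 (circ z r t)) ->
 (RtoC (INR (S n)) * CInt (fun t => F (circ z r t) * (/ cis t) ^ (S n))%C 0 (2 * PI))%C = (RtoC r * CInt (fun t => F1 (circ z r t) * (/ cis t) ^ n)%C 0 (2 * PI))%C.
Proof.
intros H. set (i := fun t => (/ cis t)%C). have D : forall n t, pder (fun t => i t ^ n)%C t (- (Ci * RtoC (INR n)) * i t ^ n)%C.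
{ intros m t. induction m as [|m IH]; [eapply pder_eq; [apply (pder_const 1)|simpl; ring]|]. simpl Cpow. rewrite S_INR, RtoC_plus. eapply pder_eq.
 - apply @pder_mult; [apply @pder_inv; [apply cis_neq_0|apply pder_cis]|an].
 - unfold i. field. apply cis_neq_0. }
have pi : forall m t, pcont (fun t => i t ^ m)%C t by an.
have p0 : forall t, pcont (fun t => F (circ z r t)) t by (intros; apply pcont_comp; [apply pcont_circ|eapply cder_ccont, H]).
have p1 : forall t, pcont (fun t => F1 (circ z r t)) t by (intros; apply pcont_comp; [apply pcont_circ|apply H]). set (A := fun t => (F1 (circ z r t) * i t ^ n)%C).
set (B := fun t => (F (circ z r t) * i t ^ S n)%C). have pA : forall t, pcont A t by (intros; apply pcont_mult; auto).
have pB : forall t, pcont B t by (intros; apply pcont_mult; auto). have jA : cintg A 0 (2 * PI) by an. have jB : cintg B 0 (2 * PI) by an.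
have J : CInt (fun t => Ci * r * A t - Ci * RtoC (INR (S n)) * B t)%C 0 (2 * PI) = 0.
{ rewrite (@CInt_FTC B).
 - unfold B. rewrite circ_2PI. unfold i. rewrite <- (Rplus_0_l (2 * PI)), cis_2PI. ring.
 - intros t _. eapply pder_eq; [apply (@pder_mult (fun t => F (circ z r t)) (fun t => i t ^ S n)%C); [apply (@pder_comp F); [apply pder_circ|apply H]|an]|].
  unfold A, B, i. simpl Cpow. field. apply cis_neq_0.
 - intros t _. an. }
rewrite CInt_minus, !CInt_scal in J by (auto; apply cintg_scal; auto). set (X := CInt A 0 (2 * PI)) in *.
change ((RtoC (INR (S n)) * CInt B 0 (2 * PI))%C = (r * X)%C). set (Y := CInt B 0 (2 * PI)) in *. set (N := RtoC (INR (S n))) in *.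
transitivity (r * X + Ci * (Ci * r * X - Ci * N * Y))%C; [|rewrite J; ring]. transitivity (r * X + Ci * Ci * (r * X - N * Y))%C; [rewrite CiCi|]; ring.
Qed.

Lemma cder_eq_loc {f g z l m d} : 0 < d -> (forall w, Cmod (w - z) < d -> f w = g w) -> cder f z l -> cder g z m -> l = m.
Proof. intros Hd E A B. apply (@cder_unique g z); auto. apply cder_ext with f; auto. exists d; auto. Qed.

Lemma pcont_inv_cis n t : pcont (fun t => (/ cis t) ^ n)%C t.
Proof. apply pcont_pow, pcont_inv; [apply cis_neq_0|an]. Qed.

(* Applied to a primitive of [f], the mean value property and an integration by parts give the derivative of [f] as an integral of [f]. *)
Lemma derive_formula {O f z0} : opn O -> hol O f -> O z0 -> exists r, 0 < r /\ (forall w, Cmod (w - z0) < 3 * r ->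
 O w) /\ forall z, Cmod (z - z0) < r -> (RtoC (2 * PI) * RtoC r * C_derive f z)%C = CInt (fun t => f (circ z r t) * (/ cis t) ^ 1)%C 0 (2 * PI).
Proof.
intros HO Hf Hz0. have [Rr [HR HD]] := HO z0 Hz0.
destruct (@primitive_box (fun x => Re z0 - Rr / 2 < x < Re z0 + Rr / 2) (fun y => Im z0 - Rr / 2 < y < Im z0 + Rr / 2) f (Re z0) (Im z0)) as [P [_ HP]]; try apply interval_like_oo; try lra.
{ intros z A B. exists (C_derive f z). apply (@hol_cder O); auto. apply HD. eapply Rle_lt_trans; [apply Cmod_le_Re_Im|]. rewrite Re_minus, Im_minus.
 assert (Rabs (Re z - Re z0) < Rr / 2) by lra. assert (Rabs (Im z - Im z0) < Rr / 2) by lra. lra. }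
set (r := Rr / 8). have r0 : 0 < r by (unfold r; lra). exists r. split; [auto|split; [intros w Hw; apply HD; unfold r in Hw; lra|]].
have HP' : forall z w, Cmod (z - z0) < 2 * r -> disc z (2 * r) w -> cder P w (f w) /\ ccont f w.
{ intros z w Hz Hw. unfold disc in Hw. have T := Cmod_tri w z z0. assert (Cmod (w - z0) < Rr / 2) by (unfold r in *; lra). split.
 - have A := re_le_Cmod (w - z0). have B := im_le_Cmod (w - z0). rewrite Re_minus in A. rewrite Im_minus in B.
  have A' := Rabs_def2 (Re w - Re z0) (Rr / 2) ltac:(lra). have B' := Rabs_def2 (Im w - Im z0) (Rr / 2) ltac:(lra). apply HP; lra.
 - eapply cder_ccont, (@hol_cder O); auto. apply HD; lra. }
have HP1 : forall z w t, Cmod (z - z0) < 2 * r -> Cmod (w - z) < 2 * r - Cmod (z - z0) -> cder P (circ w r t) (f (circ w r t)) /\ ccont f (circ w r t).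
{ intros z w t Hz Hw. have T := Cmod_tri w z z0. apply (HP' w); [lra|]. unfold disc. rewrite Cmod_circ; lra. }
have D : forall phi z, (forall t, pcont phi t) -> Cmod (z - z0) < 2 * r -> cder (fun z => CInt (fun t => P (circ z r t) * phi t)%C 0 (2 * PI)) z (CInt (fun t => f (circ z r t) * phi t)%C 0 (2 * PI)).
{ intros phi z Hp Hz. apply (@cder_CInt P f phi z r (2 * r - Cmod (z - z0))); [lra|auto|]. intros w t Hw. apply (HP1 z); auto. }
have loc : forall z w, Cmod (z - z0) < 2 * r -> Cmod (w - z) < 2 * r - Cmod (z - z0) -> Cmod (w - z0) < 2 * r.
{ intros z w Hz Hw. have T := Cmod_tri w z z0. lra. }
have E2 : forall z, Cmod (z - z0) < 2 * r -> CInt (fun t => f (circ z r t) * (/ cis t) ^ 0)%C 0 (2 * PI) = (RtoC (2 * PI) * f z)%C.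
{ intros z Hz. eapply (@cder_eq_loc _ (fun z => RtoC (2 * PI) * P z)%C z _ _ (2 * r - Cmod (z - z0))); [lra| |apply D; auto; intros; apply pcont_const|].
 - intros w Hw. rewrite <- (@circ_mean P f w r (2 * r)); [|lra|intros; apply (HP' w); eauto]. apply CInt_ext. intros t _. ring.
 - apply cder_scal, (HP' z); auto. unfold disc. rewrite Cmod_diag. lra. }
intros z Hz. symmetry. eapply (@cder_eq_loc _ (fun z => RtoC (2 * PI) * r * f z)%C z _ _ (2 * r - Cmod (z - z0))); [lra| |apply D; [apply pcont_inv_cis|lra]|].
- intros w Hw. have w2 : Cmod (w - z0) < 2 * r by (apply (loc z w); lra). have I := @circ_ibp P f w r 0. rewrite E2 in I by auto. simpl INR in I.
 transitivity (r * (RtoC (2 * PI) * f w))%C; [|ring]. rewrite <- I; [ring|]. intros t. apply (HP' w); auto. unfold disc. rewrite Cmod_circ; lra.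
- apply cder_scal, (@hol_cder O); auto. apply HD. unfold r in *. lra.
Qed.

Lemma ccont_derive {O f z0} : opn O -> hol O f -> O z0 -> ccont (C_derive f) z0.
Proof.
intros HO Hf Hz. have [r [Hr [Or E]]] := derive_formula HO Hf Hz.
apply ccont_ext with (fun z => / (RtoC (2 * PI) * r) * CInt (fun t => f (circ z r t) * (/ cis t) ^ 1)%C 0 (2 * PI))%C.
{ exists r. split; auto. intros w Hw. rewrite <- E by auto. field. an. }
apply ccont_mult; [an|]. intros e He. have C1 : forall w t, Cmod (w - z0) < r -> ccont f (circ w r t).
{ intros w t Hw. eapply cder_ccont, (@hol_cder O); auto. apply Or. have T := Cmod_tri (circ w r t) w z0. rewrite Cmod_circ in T; lra. }
have zz : Cmod (z0 - z0) < r by (rewrite Cmod_diag; auto). destruct (@circ_uniform f z0 r (e / 10)) as [d [Hd U]]; [auto|lra|]. exists (Rmin d r). split; [lra|].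
intros w Hw. have J : forall w, Cmod (w - z0) < r -> forall t, pcont (fun t => f (circ w r t) * (/ cis t) ^ 1)%C t.
{ intros x Hx t. apply pcont_mult; [apply pcont_comp; [apply pcont_circ|auto]|apply pcont_inv_cis]. }
rewrite <- CInt_minus by (apply cintg_pcont; intros; apply J; lra). eapply Rle_lt_trans; [apply (@CInt_bound _ (e / 10)); [lra| |]|].
- apply cintg_pcont. intros. apply pcont_minus; apply J; lra.
- intros t Ht. replace (f (circ w r t) * (/ cis t) ^ 1 - f (circ z0 r t) * (/ cis t) ^ 1)%C with ((f (circ w r t) - f (circ z0 r t)) * / cis t)%C by ring.
 rewrite Cmod_mult, Cmod_inv, Cmod_cis, Rinv_1, Rmult_1_r by apply cis_neq_0. apply U; auto. lra.
- have X := PI_4. nra.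
Qed.

Theorem hol_derive {O f} : opn O -> hol O f -> hol O (C_derive f).
Proof.
intros HO Hf z0 Hz. have [r [Hr [Or E]]] := derive_formula HO Hf Hz. eexists. apply cder_derive.
apply cder_ext with (fun z => / (RtoC (2 * PI) * r) * CInt (fun t => f (circ z r t) * (/ cis t) ^ 1)%C 0 (2 * PI))%C.
{ exists r. split; auto. intros w Hw. rewrite <- E by auto. field. an. }
apply cder_scal, (@cder_CInt f (C_derive f) (fun t => (/ cis t) ^ 1)%C z0 r r); auto; [apply pcont_inv_cis|]. intros w t Hw.
have Ow : O (circ w r t) by (apply Or; have T := Cmod_tri (circ w r t) w z0; rewrite Cmod_circ in T; lra). split; [an|apply (@ccont_derive O)]; auto.
Qed.

(** [circ_ibp] lowers the power of [/ cis] at the price of a derivative until the plain mean value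
    property applies. *)
Theorem cauchy_center {f z0 r Rr} : 0 < r < Rr -> hol (disc z0 Rr) f ->
 let D := C_derive in CInt (fun t => f (circ z0 r t)) 0 (2 * PI) = (RtoC (2 * PI) * f z0)%C /\ CInt (fun t => f (circ z0 r t) * / cis t)%C 0 (2 * PI) = (RtoC (2 * PI) * RtoC r * D f z0)%C /\ CInt (fun t => f (circ z0 r t) * (/ cis t) ^ 2)%C 0 (2 * PI) = (RtoC PI * RtoC r ^ 2 * D (D f) z0)%C /\ CInt (fun t => f (circ z0 r t) * (/ cis t) ^ 3)%C 0 (2 * PI) = (RtoC (PI / 3) * RtoC r ^ 3 * D (D (D f)) z0)%C.
Proof.
intros Hr Hf D. have OD := opn_disc z0 Rr. have C1 : forall g, hol (disc z0 Rr) g -> forall w, disc z0 Rr w -> cder g w (D g w) /\ ccont (D g) w.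
{ intros g Hg w Hw. split; [an|eapply ccont_derive]; eauto. }
have M : forall g, hol (disc z0 Rr) g -> CInt (fun t => g (circ z0 r t)) 0 (2 * PI) = (RtoC (2 * PI) * g z0)%C by (intros g Hg; apply (@circ_mean g (D g) z0 r Rr); auto).
have S : forall g n, hol (disc z0 Rr) g -> CInt (fun t => g (circ z0 r t) * (/ cis t) ^ (S n))%C 0 (2 * PI) = (/ RtoC (INR (S n)) * (r * CInt (fun t => D g (circ z0 r t) * (/ cis t) ^ n)%C 0 (2 * PI)))%C.
{ intros g n Hg. rewrite <- (@circ_ibp g); [field; apply RtoC_neq, not_0_INR; lia|]. intros t. apply C1; auto. unfold disc. rewrite Cmod_circ; lra. }
have Z : forall g, hol (disc z0 Rr) g -> CInt (fun t => g (circ z0 r t) * (/ cis t) ^ 0)%C 0 (2 * PI) = (RtoC (2 * PI) * g z0)%C.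
{ intros g Hg. rewrite <- M by auto. apply CInt_ext. intros. ring. }
have H1 := hol_derive OD Hf. have H2 := hol_derive OD H1. have H3 := hol_derive OD H2. split; [auto|split; [|split]].
- rewrite (@CInt_ext _ (fun t => f (circ z0 r t) * (/ cis t) ^ 1)%C) by (intros; ring). rewrite S, Z by auto. simpl INR. field; apply RtoC_neq.
- rewrite !S, Z by auto. rewrite RtoC_mult. simpl INR. replace (1 + 1) with 2 by ring. field; repeat split; apply RtoC_neq.
- rewrite !S, Z by auto. rewrite RtoC_mult, RtoC_div by lra. simpl INR. replace (1 + 1) with 2 by ring. replace (2 + 1) with 3 by ring.
 field; repeat split; apply RtoC_neq.
Qed.

(** * Compactness and the maximum principle *)
Lemma choice_nat {A} P : (forall n, exists x, P n x) -> exists s : nat -> A, forall n, P n (s n).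
Proof. intros H. exists (fun n => proj1_sig (constructive_indefinite_description _ (H n))). intros n. apply proj2_sig. Qed.

Lemma cluster_R {u M} : (forall n, Rabs (u n) <= M) -> exists l, forall eps N, 0 < eps -> exists n, (N <= n)%nat /\ Rabs (u n - l) < eps.
Proof.
intros H. destruct (Bolzano_Weierstrass u (fun x => - M <= x <= M) (compact_P3 (- M) M)) as [l Hl].
{ intros n. specialize (H n). apply Rabs_le_between in H. lra. }
exists l. intros eps N He. destruct (Hl (Rtopology.disc l (mkposreal eps He)) N) as [n [Hn K]].
- exists (mkposreal eps He). intros x Hx. an.
- exists n; split; auto.
Qed.

Lemma cluster_C {z M} : (forall n, Cmod (z n) <= M) -> exists l, forall eps N, 0 < eps -> exists n, (N <= n)%nat /\ Cmod (z n - l) < eps.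
Proof.
intros H. destruct (@cluster_R (fun n => Re (z n)) M) as [x Hx].
{ intros n. eapply Rle_trans; [apply re_le_Cmod|auto]. }
destruct (choice_nat (fun k n => (k <= n)%nat /\ Rabs (Re (z n) - x) < / (INR k + 1))) as [s Hs].
{ intros k. apply Hx. have P := pos_INR k. lra. }
destruct (@cluster_R (fun k => Im (z (s k))) M) as [y Hy].
{ intros n. eapply Rle_trans; [apply im_le_Cmod|auto]. }
exists (x, y). intros eps N He. destruct (archimed_cor1 (eps / 2)) as [K [HK1 HK2]]; [lra|]. destruct (Hy (eps / 2) (N + K)%nat) as [k [Hk1 Hk2]]; [lra|].
have [Hs1 Hs2] := Hs k. exists (s k). split; [lia|]. eapply Rle_lt_trans; [apply Cmod_le_Re_Im|]. rewrite Re_minus, Im_minus. simpl.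
assert (/ (INR k + 1) < eps / 2).
{ eapply Rle_lt_trans; [|exact HK1]. apply Rinv_le_contravar.
 - apply lt_0_INR; lia.
 - apply Rle_trans with (INR k); [apply le_INR; lia|lra]. }
lra.
Qed.

(** The compactness behind every comparison below. At a limit point outside the region where [D] is
    continuous it is enough that [D <= c] nearby, with [c] below a value of [D]; thus [D] may tend
    to minus infinity at the boundary. Unboundedness of [D] from above is excluded by the same
    cluster point argument. *)
Lemma sup_attained {O D z1 c} : boundedC O -> O z1 -> c < D z1 -> (forall l, closureC O l ->
 (O l /\ ccont (fun z => RtoC (D z)) l) \/ (exists eps, 0 < eps /\ forall z, O z -> Cmod (z - l) < eps -> D z <= c)) ->
 exists z, O z /\ D z1 <= D z /\ forall w, O w -> D w <= D z.
Proof.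
intros [M HM] Hz1 Hc H.
have CL : forall s : nat -> C, (forall n, O (s n)) -> exists l, closureC O l /\ forall eps N, 0 < eps -> exists n, (N <= n)%nat /\ Cmod (s n - l) < eps.
{ intros s Hs. destruct (@cluster_C s M) as [l Hl]; auto. exists l; split; auto. intros eps He. have [n [_ Hn]] := Hl eps 0%nat He. eauto. }
have [[B HB]|NB] := classic (exists B, forall z, O z -> D z <= B).
- destruct (completeness (fun x => exists z, O z /\ x = D z)) as [s [S1 S2]].
 + exists B. intros x [z [Hz ->]]. auto.
 + exists (D z1), z1; auto.
 + have HS : forall n : nat, exists z, O z /\ s - / (INR n + 1) < D z.
  { intros n. apply NNPP. intros N. have X : s <= s - / (INR n + 1).
   { apply S2. intros x [z [Hz ->]]. apply Rnot_lt_le. intros L. apply N. now exists z. }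
   assert (0 < / (INR n + 1)) by (apply Rinv_0_lt_compat; have P := pos_INR n; lra). lra. }
  have [z Hz] := choice_nat _ HS. destruct (CL z) as [l [Hl1 Hl2]]; [intros; apply Hz|]. have s1 : D z1 <= s by (apply S1; now exists z1).
  have AR : forall e, 0 < e -> exists N, forall n, (N <= n)%nat -> / (INR n + 1) < e.
  { intros e He. have [K [HK1 HK2]] := archimed_cor1 e He. exists K. intros n Hn. eapply Rle_lt_trans; [|exact HK1]. apply Rinv_le_contravar; [apply lt_0_INR; lia|].
   apply Rle_trans with (INR n); [apply le_INR; lia|lra]. }
  have [[Ol Cl]|[eps [He K]]] := H l Hl1.
  * exists l. have E : s <= D l.
   { apply Rnot_lt_le. intros L. destruct (Cl ((s - D l) / 2)) as [d [Hd Kd]]; [lra|]. destruct (AR ((s - D l) / 2)) as [N HN]; [lra|].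
    have [n [Hn1 Hn2]] := Hl2 d N Hd. specialize (Kd _ Hn2). specialize (HN n Hn1). rewrite <- RtoC_minus, Cmod_R in Kd. have [_ Q] := Hz n. lra. }
   repeat split; auto; try lra. intros w Hw. apply Rle_trans with s; auto. apply S1. now exists w.
  * destruct (AR (D z1 - c)) as [N HN]; [lra|]. have [n [Hn1 Hn2]] := Hl2 eps N He. have [Q1 Q2] := Hz n. specialize (K _ Q1 Hn2). specialize (HN n Hn1). lra.
- have HS : forall n : nat, exists z, O z /\ INR n < D z.
 { intros n. apply NNPP. intros N. apply NB. exists (INR n). intros z Hz. apply Rnot_lt_le. intros L. apply N. now exists z. }
 have [z Hz] := choice_nat _ HS. destruct (CL z) as [l [Hl1 Hl2]]; [intros; apply Hz|]. have AR : forall B, exists N, forall n, (N <= n)%nat -> B < INR n.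
 { intros B. have [A _] := archimed B. exists (Z.to_nat (up B)). intros n Hn. apply Rlt_le_trans with (IZR (up B)); auto. rewrite INR_IZR_INZ. apply IZR_le. lia. }
 have [[Ol Cl]|[eps [He K]]] := H l Hl1.
 + have [d [Hd Kd]] := Cl 1 Rlt_0_1. have [N HN] := AR (D l + 1). have [n [Hn1 Hn2]] := Hl2 d N Hd. specialize (Kd _ Hn2). specialize (HN n Hn1).
  rewrite <- RtoC_minus, Cmod_R in Kd. have [_ Q] := Hz n. lra.
 + have [N HN] := AR c. have [n [Hn1 Hn2]] := Hl2 eps N He. have [Q1 Q2] := Hz n. specialize (K _ Q1 Hn2). specialize (HN n Hn1). lra.
Qed.

(** * Second derivative test, Laplacians and winding numbers *)

Lemma second_derivative_test {phi phi1 : R -> R} {x l : R} : (exists r, 0 < r /\ forall y, Rabs (y - x) < r -> is_derive phi y (phi1 y) /\ phi y <= phi x) ->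
 is_derive phi1 x l -> l <= 0.
Proof.
intros [r [Hr H]] Hl. have Hx : Rabs (x - x) < r by lra. have Z : phi1 x = 0.
{ have [Hd _] := H x Hx. have D := proj1 is_derive_eps Hd. apply NNPP. intros N. set (e := Rabs (phi1 x) / 2).
 have He : 0 < e by (unfold e; have X := Rabs_pos_lt _ N; lra). have [d [Hd' K]] := D e He. set (h := Rmin d r / 2).
 have Hh : 0 < h by (unfold h; assert (0 < Rmin d r) by (now apply Rmin_pos); lra). have h1 : h < d by (unfold h; have Y := Rmin_l d r; lra).
 have h2 : h < r by (unfold h; have Y := Rmin_r d r; lra). unfold e, Rabs in *. destruct (Rcase_abs (phi1 x)) as [s|s].
 - specialize (K (x - h)). replace (x - h - x) with (- h) in K by ring. destruct (H (x - h)) as [_ Q].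
  { apply Rabs_def1; lra. }
  destruct (Rcase_abs (- h)); [|lra]. destruct (Rcase_abs (phi (x - h) - phi x - phi1 x * - h)); nra.
 - specialize (K (x + h)). replace (x + h - x) with h in K by ring. destruct (H (x + h)) as [_ Q].
  { apply Rabs_def1; lra. }
  destruct (Rcase_abs h); [lra|]. destruct (Rcase_abs (phi (x + h) - phi x - phi1 x * h)); nra. }
apply Rnot_lt_le. intros Lp. destruct (proj1 is_derive_eps Hl (l / 2)) as [d [Hd K]]; [lra|]. set (h := Rmin d r / 2).
have Hh : 0 < h by (unfold h; assert (0 < Rmin d r) by (now apply Rmin_pos); lra). have h1 : h < d by (unfold h; have Y := Rmin_l d r; lra).
have h2 : h < r by (unfold h; have Y := Rmin_r d r; lra). destruct (MVT_gen phi x (x + h) phi1) as [xi [Hxi E]].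
- intros y Hy. rewrite Rmin_left, Rmax_right in Hy by lra. apply H. an.
- intros y Hy. rewrite Rmin_left, Rmax_right in Hy by lra. apply continuity_pt_filterlim, (ex_derive_continuous (V := R_NormedModule)). eexists. apply H. an.
- rewrite Rmin_left, Rmax_right in Hxi by lra. destruct (H (x + h)) as [_ Q].
 { an. }
 have [Lx|Ex] := Rle_lt_or_eq_dec _ _ (proj1 Hxi).
 + have Y := K xi ltac:(lra). rewrite (Rabs_pos_eq (xi - x)) in Y by lra. apply Rabs_le_between in Y. assert (0 < phi1 xi) by nra. nra.
 (* [MVT_gen] may return the end point [x], where [phi1] vanishes. Then the mean value theorem is
    used on both halves: on the right one [phi1] is positive, on the left one at least
    non-negative. *)
 + subst xi. destruct (MVT_gen phi (x + h / 2) (x + h) phi1) as [xi [Hx2 E2]].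
  * intros y Hy. rewrite Rmin_left, Rmax_right in Hy by lra. apply H. an.
  * intros y Hy. rewrite Rmin_left, Rmax_right in Hy by lra. apply continuity_pt_filterlim, (ex_derive_continuous (V := R_NormedModule)). eexists. apply H. an.
  * rewrite Rmin_left, Rmax_right in Hx2 by lra. destruct (H (x + h / 2)) as [_ Q2].
   { an. }
   have Y := K xi ltac:(lra). rewrite (Rabs_pos_eq (xi - x)) in Y by lra. apply Rabs_le_between in Y. destruct (MVT_gen phi x (x + h / 2) phi1) as [xi' [Hx3 E3]].
   -- intros y Hy. rewrite Rmin_left, Rmax_right in Hy by lra. apply H. an.
   -- intros y Hy. rewrite Rmin_left, Rmax_right in Hy by lra. apply continuity_pt_filterlim, (ex_derive_continuous (V := R_NormedModule)). eexists. apply H. an.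
   -- rewrite Rmin_left, Rmax_right in Hx3 by lra. have Y' := K xi' ltac:(lra). rewrite (Rabs_pos_eq (xi' - x)) in Y' by lra. apply Rabs_le_between in Y'.
    assert (0 < phi1 xi) by nra. nra.
Qed.

(** The partial derivatives are existentially quantified functions instead of values of [Derive], so
    that both [C2_on] and explicit formulas can supply them. *)
Definition has_lap (O : C -> Prop) (A L : C -> R) : Prop :=
  exists ax ay axx ayy : C -> R, forall z, O z ->
    is_derive (fun x => A (x, Im z)) (Re z) (ax z) /\
    is_derive (fun y => A (Re z, y)) (Im z) (ay z) /\
    is_derive (fun x => ax (x, Im z)) (Re z) (axx z) /\
    is_derive (fun y => ay (Re z, y)) (Im z) (ayy z) /\ L z = axx z + ayy z.

Lemma max_lap {O A B LA LB z} : opn O -> has_lap O A LA -> has_lap O B LB -> O z -> (forall w, O w -> A w - B w <= A z - B z) ->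
 LA z <= LB z.
Proof.
intros HO [ax [ay [axx [ayy HA]]]] [bx [by' [bxx [byy HB]]]] Hz Hm. have [r [Hr Kr]] := HO z Hz. have [_ [_ [A3 [A4 A5]]]] := HA z Hz.
have [_ [_ [B3 [B4 B5]]]] := HB z Hz. have X : axx z - bxx z <= 0.
{ apply (@second_derivative_test (fun x => A (x, Im z) - B (x, Im z)) (fun x => ax (x, Im z) - bx (x, Im z)) (Re z)).
 - exists r; split; auto. intros y Hy. have Oy : O (y, Im z).
  { apply Kr. replace ((y, Im z) - z)%C with (RtoC (y - Re z)) by (apply Ceq; unfold Re, Im; simpl; ring). now rewrite Cmod_R. }
  split.
  + apply is_derive_Rminus; [apply (HA _ Oy)|apply (HB _ Oy)].
  + rewrite Ceta. an.
 - an. }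
have Y : ayy z - byy z <= 0.
{ apply (@second_derivative_test (fun y => A (Re z, y) - B (Re z, y)) (fun y => ay (Re z, y) - by' (Re z, y)) (Im z)).
 - exists r; split; auto. intros y Hy. have Oy : O (Re z, y).
  { apply Kr. replace ((Re z, y) - z)%C with (Ci * RtoC (y - Im z))%C by (apply Ceq; unfold Re, Im; simpl; ring). now rewrite Cmod_mult, Cmod_Ci, Rmult_1_l, Cmod_R. }
  split.
  + apply is_derive_Rminus; [apply (HA _ Oy)|apply (HB _ Oy)].
  + rewrite Ceta. an.
 - an. }
lra.
Qed.

Ltac split5 := split; [|split; [|split; [|split]]].

Lemma has_lap_plus {O A B LA LB} : has_lap O A LA -> has_lap O B LB -> has_lap O (fun z => A z + B z) (fun z => LA z + LB z).
Proof.
intros [ax [ay [axx [ayy HA]]]] [bx [by' [bxx [byy HB]]]].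
exists (fun z => ax z + bx z), (fun z => ay z + by' z), (fun z => axx z + bxx z), (fun z => ayy z + byy z). intros z Hz. have [A1 [A2 [A3 [A4 A5]]]] := HA z Hz.
have [B1 [B2 [B3 [B4 B5]]]] := HB z Hz. split5; [an|an|an|an|]. lra.
Qed.

Lemma has_lap_affine {O A LA} c d : has_lap O A LA -> has_lap O (fun z => c * A z + d) (fun z => c * LA z).
Proof.
intros [ax [ay [axx [ayy HA]]]]. exists (fun z => c * ax z), (fun z => c * ay z), (fun z => c * axx z), (fun z => c * ayy z). intros z Hz.
have [A1 [A2 [A3 [A4 A5]]]] := HA z Hz. have X : forall (f : R -> R) (x l : R), is_derive f x l -> is_derive (fun t => c * f t) x (c * l) by an.
have X' : forall (f : R -> R) (x l : R), is_derive f x l -> is_derive (fun t => c * f t + d) x (c * l) by an. split5; auto. rewrite A5; ring.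
Qed.

Lemma has_lap_ext {O A LA LA'} : (forall z, O z -> LA z = LA' z) -> has_lap O A LA -> has_lap O A LA'.
Proof. intros E [ax [ay [axx [ayy HA]]]]. exists ax, ay, axx, ayy. intros z Hz. have [A1 [A2 [A3 [A4 A5]]]] := HA z Hz. now rewrite <- E. Qed.

Lemma has_lap_sub {O O' A LA} : (forall z, O' z -> O z) -> has_lap O A LA -> has_lap O' A LA.
Proof. intros E [ax [ay [axx [ayy HA]]]]. exists ax, ay, axx, ayy. intros z Hz. an. Qed.

Lemma hol_quot_der O b z : opn O -> hol O b -> O z -> b z <> 0 ->
 cder (fun w => C_derive b w / b w)%C z ((C_derive (C_derive b) z * b z - C_derive b z * C_derive b z) / (b z * b z))%C.
Proof. intros HO Hb Hz H0. apply cder_div; auto; eapply hol_cder; eauto. now apply hol_derive. Qed.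

(** With [l = b' / b], the gradient of [ln |b|] is [(Re l, - Im l)] and [ln |b|] is harmonic, so the
    Laplacian of [m (ln |b|)] is [m'' * |l|^2]. *)
Lemma has_lap_ln_comp {O b} {m m1 m2 : R -> R} : opn O -> hol O b -> (forall z, O z -> b z <> 0) -> (forall z, O z ->
 let x := ln (Cmod (b z)) in is_derive m x (m1 x) /\ is_derive m1 x (m2 x)) ->
 has_lap O (fun z => m (ln (Cmod (b z)))) (fun z => m2 (ln (Cmod (b z))) * (Cmod (C_derive b z / b z) * Cmod (C_derive b z / b z))).
Proof.
intros HO Hb H0 Hm. set (l := fun w => (C_derive b w / b w)%C). set (l' := fun z => ((C_derive (C_derive b) z * b z - C_derive b z * C_derive b z) / (b z * b z))%C).
set (x := fun z => ln (Cmod (b z))).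
exists (fun z => m1 (x z) * Re (l z)), (fun z => m1 (x z) * - Im (l z)), (fun z => m2 (x z) * Re (l z) * Re (l z) + m1 (x z) * Re (l' z)), (fun z => m2 (x z) * - Im (l z) * - Im (l z) + m1 (x z) * - Re (l' z)).
intros z Hz. specialize (H0 z Hz). have [M1 M2] := Hm z Hz. fold (x z) in M1, M2. have Db := hol_cder Hb Hz. have Dl := hol_quot_der O b z HO Hb Hz H0.
have Xx : is_derive (fun t => x (t, Im z)) (Re z) (Re (l z)).
{ eapply is_derive_eq.
 - apply (@is_derive_Cmod_ln (fun t => b (t, Im z)) (Re z) (C_derive b z * 1)%C).
  + now rewrite Ceta.
  + apply pder_comp; [apply pder_hline|now rewrite Ceta].
 - rewrite Ceta. now rewrite Cmult_1_r. }
have Xy : is_derive (fun t => x (Re z, t)) (Im z) (- Im (l z)).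
{ eapply is_derive_eq.
 - apply (@is_derive_Cmod_ln (fun t => b (Re z, t)) (Im z) (C_derive b z * Ci)%C).
  + now rewrite Ceta.
  + apply pder_comp; [apply pder_vline|now rewrite Ceta].
 - rewrite Ceta. simpl; ring. }
have Lx : pder (fun t => l (t, Im z)) (Re z) (l' z) by (eapply pder_eq; [apply (@pder_comp l (fun t => (t, Im z)) (Re z) (l' z) 1); [apply pder_hline|now rewrite Ceta]|ring]).
have Ly : pder (fun t => l (Re z, t)) (Im z) (l' z * Ci)%C by (apply pder_comp; [apply pder_vline|now rewrite Ceta]). split5.
- apply is_derive_Rcomp; [rewrite Ceta; exact M1|an].
- apply is_derive_Rcomp; [rewrite Ceta; exact M1|an].
- eapply is_derive_eq.
 + apply @is_derive_Rmult; [|apply (proj1 Lx)]. apply @is_derive_Rcomp; [rewrite Ceta; exact M2|an].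
 + cbv beta. rewrite Ceta. ring.
- eapply is_derive_eq.
 + apply @is_derive_Rmult; [apply @is_derive_Rcomp; [rewrite Ceta; exact M2|an]|]. apply (is_derive_opp (V := R_NormedModule)), (proj2 Ly).
 + cbv beta. rewrite Ceta. unfold opp; simpl. ring.
- fold (l z) (x z). rewrite Cmod_sqr. ring.
Qed.

Lemma has_lap_ln {O b} : opn O -> hol O b -> (forall z, O z -> b z <> 0) -> has_lap O (fun z => ln (Cmod (b z))) (fun _ => 0).
Proof.
intros HO Hb H0. eapply has_lap_ext; [|apply (@has_lap_ln_comp O b (fun x => x) (fun _ => 1) (fun _ => 0)); auto].
- intros z _; simpl; ring.
- intros z _ x. split; an.
Qed.

Lemma continuous_ccont {g : C -> R} {z : C} : continuous g z -> ccont (fun w => RtoC (g w)) z.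
Proof.
intros H eps He. have [d Hd] := proj1 (filterlim_locally g (g z)) H (mkposreal eps He). exists d; split; [apply cond_pos|]. intros w Hw.
rewrite <- RtoC_minus, Cmod_R. apply Hd. now apply Cball_norm_lt.
Qed.

Lemma has_lap_C2 {O u} : C2_on O u -> has_lap O u (Lap u).
Proof.
intros H. exists (Defs.Dx u), (Defs.Dy u), (Defs.Dx (Defs.Dx u)), (Defs.Dy (Defs.Dy u)). intros z Hz. have [H1 _] := H z Hz.
have [A1 A2] := H1 u (or_introl eq_refl). have [B1 _] := H1 (Defs.Dx u) (or_intror (or_introl eq_refl)).
have [_ C2] := H1 (Defs.Dy u) (or_intror (or_intror eq_refl)). split5; try (apply Derive_correct; auto; fail). an.
Qed.

(** With [L] a primitive of [d / c], the function [c * Cexp (- L)] is constant; as [c] returns to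
    its value, [Cexp (- L b) = 1]. *)
Lemma winding_int {c d a b} : (forall t, pder c t (d t) /\ pcont d t /\ c t <> 0) -> c b = c a ->
 exists m : Z, RInt (fun t => Im (d t / c t)%C) a b = 2 * PI * IZR m.
Proof.
intros H E. set (q := fun t => (d t / c t)%C). have Hq : forall t, pcont q t.
{ intros t. have [H1 [H2 H3]] := H t. apply pcont_mult; auto. an. }
set (L := fun t => CInt q a t). have HL : forall t, pder L t (q t).
{ intros t. apply pder_CInt; auto. exists 1; split; [lra|]. intros s _. an. }
set (e := fun t => (c t * Cexp (- L t))%C). have He : e a = e b.
{ apply pder_zero_const. intros t _. have [H1 [H2 H3]] := H t. eapply pder_eq.
 - apply @pder_mult; [an|]. apply @pder_comp; [an|apply cder_Cexp].
 - unfold q. field. auto. }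
unfold e in He. have La : L a = 0.
{ unfold L, CInt. rewrite !RInt_point. an. }
rewrite La, E in He. replace (- 0)%C with (RtoC 0) in He by ring. have Ex : Cexp (- L b) = Cexp 0.
{ have [_ [_ H3]] := H a. replace (Cexp (- L b)) with (c a * Cexp (- L b) / c a)%C by (field; auto). rewrite <- He. field; auto. }
have X0 : Cexp 0 = 1.
{ unfold Cexp; simpl. rewrite exp_0, cis_0. ring. }
rewrite X0 in Ex. have Hm := Cmod_Cexp (- L b). rewrite Ex, Cmod_1 in Hm. unfold Cexp in Ex. rewrite <- Hm in Ex.
replace (RtoC 1 * cis (Im (- L b)))%C with (cis (Im (- L b))) in Ex by ring. have [m Hm2] := sin_neq_1_cos Ex. exists (- m)%Z.
change (Im (L b) = 2 * PI * IZR (- m)). rewrite opp_IZR. replace (Im (- L b)) with (- Im (L b)) in Hm2 by reflexivity. lra.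
Qed.

Definition ann (z0 : C) (r1 r2 : R) (z : C) : Prop := r1 < Cmod (z - z0) < r2.

Lemma opn_ann z0 r1 r2 : opn (ann z0 r1 r2).
Proof.
intros z [H1 H2]. exists (Rmin (Cmod (z - z0) - r1) (r2 - Cmod (z - z0))). split; [an|]. intros w Hw. have A := Rmin_l (Cmod (z - z0) - r1) (r2 - Cmod (z - z0)).
have B := Rmin_r (Cmod (z - z0) - r1) (r2 - Cmod (z - z0)). have T1 := Cmod_tri w z z0. have T2 := Cmod_tri z w z0. rewrite (Cmod_minus_sym z w) in T2. split; lra.
Qed.

Lemma ann_circ z0 {r1 r2 r} t : 0 <= r1 -> r1 < r < r2 -> ann z0 r1 r2 (circ z0 r t).
Proof. intros H0 H. unfold ann. rewrite Cmod_circ; lra. Qed.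

Definition L2circ (h : C -> C) (z0 : C) (r : R) : R :=
  RInt (fun t => Cmod (h (circ z0 r t)) * Cmod (h (circ z0 r t))) 0 (2 * PI).

Lemma continuous_circ_mod {h z0 r} (t : R) : (forall s, ccont h (circ z0 r s)) -> continuous (fun t => Cmod (h (circ z0 r t))) t.
Proof.
intros H. destruct (@pcont_comp (fun w => RtoC (Cmod w)) (fun t => h (circ z0 r t)) t) as [A _]; auto.
- apply pcont_comp; [apply pcont_circ|auto].
- an.
Qed.

(** * Biholomorphic maps onto a round annulus *)
Definition biholo (O : C -> Prop) (beta : R) (f g : C -> C) : Prop :=
  hol O f /\ hol (annulus beta) g /\
  (forall z, O z -> annulus beta (f z)) /\ (forall w, annulus beta w -> O (g w)) /\
  (forall z, O z -> g (f z) = z) /\ (forall w, annulus beta w -> f (g w) = w).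

Definition ell (f : C -> C) (z : C) : C := (C_derive f z / f z)%C.

Definition sg (f : C -> C) (z : C) : R := - ln (Cmod (f z)).

Lemma opn_annulus beta : opn (annulus beta).
Proof.
intros z Hz. destruct (opn_ann 0 beta 1 z) as [r [Hr K]].
- unfold ann. replace (z - 0)%C with z by ring. an.
- exists r; split; auto. intros w Hw. specialize (K w Hw). unfold ann in K. replace (w - 0)%C with w in K by ring. exact K.
Qed.

Lemma biholo_derive_neq_0 {O beta f g z} : opn O -> biholo O beta f g -> O z -> C_derive f z <> 0.
Proof.
intros HO [Hf [Hg [Hfa [Hga [Hgf Hfg]]]]] Hz E. have D1 := hol_cder Hf Hz. have D2 := hol_cder Hg (Hfa z Hz). have D3 := cder_comp D1 D2.
have D4 : cder (fun w => g (f w)) z 1.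
{ apply cder_ext with (fun w => w); [|an]. have [r [Hr K]] := HO z Hz. exists r; split; auto. intros w Hw. symmetry; auto. }
have X := cder_unique D3 D4. rewrite E in X. apply (f_equal Re) in X. simpl in X. lra.
Qed.

Lemma annulus_neq_0 {beta w} : 0 < beta -> annulus beta w -> w <> 0.
Proof. intros Hb [H _]. apply Cmod_gt_0. lra. Qed.

Lemma hol_ell {O beta f g} : 0 < beta -> opn O -> biholo O beta f g -> hol O (ell f) /\ (forall z, O z -> ell f z <> 0).
Proof.
intros Hb HO B. have B' := B. destruct B as [Hf [Hg [Hfa _]]]. split.
- eapply hol_intro. intros z Hz. apply hol_quot_der with O; auto. apply (@annulus_neq_0 beta); auto.
- intros z Hz E. apply (biholo_derive_neq_0 HO B' Hz). have F0 := annulus_neq_0 Hb (Hfa z Hz).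
 replace (C_derive f z) with (ell f z * f z)%C by (unfold ell; field; auto). rewrite E. ring.
Qed.

Lemma sg_range {O beta f g z} : 0 < beta -> biholo O beta f g -> O z -> 0 < sg f z < - ln beta.
Proof.
intros Hb [_ [_ [Hfa _]]] Hz. have [H1 H2] := Hfa z Hz. unfold sg. have A := ln_increasing _ _ Hb H1. have B := ln_increasing (Cmod (f z)) 1 ltac:(lra) H2.
rewrite ln_1 in B. lra.
Qed.

Lemma ccont_ln_mod {h z} : ccont h z -> h z <> 0 -> ccont (fun w => RtoC (ln (Cmod (h w)))) z.
Proof. intros H H0. apply ccont_R; [an|]. apply (ex_derive_continuous (V := R_NormedModule)). eexists. apply is_derive_ln. now apply Cmod_pos. Qed.

Lemma ccont_sg {O beta f g z} : 0 < beta -> biholo O beta f g -> O z -> ccont (fun w => RtoC (sg f w)) z.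
Proof.
intros Hb [Hf [_ [Hfa _]]] Hz. unfold sg. apply ccont_ext with (fun w => - RtoC (ln (Cmod (f w))))%C.
- exists 1; split; [lra|]. intros; now rewrite RtoC_opp.
- apply ccont_opp, ccont_ln_mod; [an|apply (@annulus_neq_0 beta); auto].
Qed.

Lemma closureC_seq {S l} : closureC S l -> exists s : nat -> C, forall n, S (s n) /\ Cmod (s n - l) < / (INR n + 1).
Proof.
intros H. apply (choice_nat (fun n w => S w /\ Cmod (w - l) < / (INR n + 1))). intros n. destruct (H (/ (INR n + 1))) as [w [W1 W2]].
- have P := pos_INR n. lra.
- exists w; auto.
Qed.

Lemma inv_INR_small {e} : 0 < e -> exists N, forall n, (N <= n)%nat -> / (INR n + 1) < e.
Proof.
intros He. have [K [HK1 HK2]] := archimed_cor1 e He. exists K. intros n Hn. eapply Rle_lt_trans; [|exact HK1]. apply Rinv_le_contravar; [apply lt_0_INR; lia|].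
apply Rle_trans with (INR n); [apply le_INR; lia|lra].
Qed.

(** Properness of [f]: values in a compact subannulus cluster at some [w], and continuity of [g] at
    [w] identifies the limit point with [g w], a point of [O]. *)
Lemma biholo_closure {O beta a b f g l} : biholo O beta f g -> beta < a -> b < 1 ->
 closureC (fun z => O z /\ a <= Cmod (f z) <= b) l -> O l /\ a <= Cmod (f l) <= b.
Proof.
intros [Hf [Hg [Hfa [Hga [Hgf Hfg]]]]] Ha Hb Hl. have [z Hz] := closureC_seq Hl. destruct (@cluster_C (fun n => f (z n)) b) as [w Hw]; [intros n; apply Hz|].
have Bw : a <= Cmod w <= b.
{ split; apply Rnot_lt_le; intros L.
 - destruct (Hw (a - Cmod w) 0%nat) as [n [_ Hn]]; [lra|]. have T := Cmod_le_plus (f (z n)) w. have [[_ Q] _] := Hz n. lra.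
 - destruct (Hw (Cmod w - b) 0%nat) as [n [_ Hn]]; [lra|]. have T := Cmod_le_plus w (f (z n)). rewrite Cmod_minus_sym in T. have [[_ Q] _] := Hz n. lra. }
have Aw : annulus beta w by (unfold annulus; lra). have E : l = g w.
{ apply Cmod_sub_0. apply Rnot_lt_le. intros L. set (e := Cmod (l - g w)) in *. destruct (hol_ccont Hg Aw (e / 2)) as [d [Hd K]]; [lra|].
 destruct (@inv_INR_small (e / 2)) as [N HN]; [lra|]. have [n [Hn1 Hn2]] := Hw d N Hd. have [[Q1 _] Q2] := Hz n. specialize (K _ Hn2). rewrite Hgf in K by auto.
 specialize (HN n Hn1). have T := Cmod_tri l (z n) (g w). rewrite (Cmod_minus_sym l (z n)) in T. fold e in T. lra. }
subst l. rewrite Hfg; auto.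
Qed.

Lemma boundary_not_in {O y} : opn O -> boundaryC O y -> ~ O y.
Proof. intros HO [_ H] Hy. apply H. apply HO, Hy. Qed.

Lemma biholo_proper {O beta eta f g} : opn O -> boundedC O -> biholo O beta f g -> 0 < eta -> exists del, 0 < del /\ forall z y, O z ->
 boundaryC O y -> Cmod (z - y) < del -> Cmod (f z) < beta + eta \/ 1 - eta < Cmod (f z).
Proof.
intros HO [M HM] B He. apply NNPP. intros N.
have S : forall n : nat, exists p : C * C, O (fst p) /\ boundaryC O (snd p) /\ Cmod (fst p - snd p) < / (INR n + 1) /\ beta + eta <= Cmod (f (fst p)) <= 1 - eta.
{ intros n. apply NNPP. intros N'. apply N. exists (/ (INR n + 1)). split.
 - have P := pos_INR n. lra.
 - intros z y Hz Hy Hzy. apply NNPP. intros N''. apply N'. exists (z, y). repeat split; auto; try apply Hy; apply Rnot_lt_le; intros L; apply N''; auto. }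
have [p Hp] := choice_nat _ S. destruct (@cluster_C (fun n => fst (p n)) M) as [l Hl]; [intros n; apply HM, Hp|].
have Cl : closureC (fun z => O z /\ beta + eta <= Cmod (f z) <= 1 - eta) l.
{ intros e He'. have [n [_ Hn]] := Hl e 0%nat He'. exists (fst (p n)). have [Q1 [_ [_ Q2]]] := Hp n; auto. }
have [Ol _] := @biholo_closure O beta (beta + eta) (1 - eta) f g l B ltac:(lra) ltac:(lra) Cl. have [r [Hr K]] := HO l Ol.
destruct (@inv_INR_small (r / 2)) as [m Hm]; [lra|]. destruct (Hl (r / 2) m) as [n [Hn1 Hn2]]; [lra|]. have [Q1 [Q2 [Q3 _]]] := Hp n. apply (boundary_not_in HO Q2).
apply K. have T := Cmod_tri (snd (p n)) (fst (p n)) l. rewrite (Cmod_minus_sym (snd (p n)) (fst (p n))) in T. specialize (Hm n Hn1). lra.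
Qed.

(** The radius is the supremum of the radii of discs about [z] inside [O], and [y] is a cluster
    point of complementary points in slightly larger discs. *)
Lemma nearest_boundary {O z} : opn O -> boundedC O -> O z -> exists y, boundaryC O y /\ (forall w, Cmod (w - z) < Cmod (z - y) -> O w).
Proof.
intros HO [M HM] Hz. set (E := fun r => 0 <= r /\ forall w, Cmod (w - z) < r -> O w). destruct (completeness E) as [r [R1 R2]].
- exists (M + Cmod z + 1). intros r [_ Hr]. apply Rnot_lt_le. intros L. have P2 := HM z Hz. specialize (Hr (z + RtoC (M + Cmod z + 1))%C).
 replace (z + RtoC (M + Cmod z + 1) - z)%C with (RtoC (M + Cmod z + 1)) in Hr by ring. rewrite Cmod_R, Rabs_pos_eq in Hr by lra. specialize (Hr L). apply HM in Hr.
 have T := Cmod_le_plus (RtoC (M + Cmod z + 1)) (z + RtoC (M + Cmod z + 1)).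
 replace (RtoC (M + Cmod z + 1) - (z + RtoC (M + Cmod z + 1)))%C with (- z)%C in T by ring. rewrite Cmod_opp, Cmod_R in T by lra. lra.
- exists 0. split; [lra|]. intros w Hw. lra.
- have Hr : forall w, Cmod (w - z) < r -> O w.
 { intros w Hw. apply NNPP. intros N. have X : r <= Cmod (w - z); [|lra]. apply R2. intros x [_ Hx]. apply Rnot_lt_le. intros L. an. }
 have S : forall n : nat, exists w, ~ O w /\ Cmod (w - z) < r + / (INR n + 1).
 { intros n. apply NNPP. intros N. have Q : 0 < / (INR n + 1).
  { have P := pos_INR n. lra. }
  have X : r + / (INR n + 1) <= r; [|lra]. apply R1. split.
  - have X : 0 <= r; [|lra]. apply R1. split; [lra|]. intros w Hw. lra.
  - intros w Hw. apply NNPP. intros N'. apply N. now exists w. }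
 have [w Hw] := choice_nat _ S. destruct (@cluster_C w (r + 1 + Cmod z)) as [y Hy].
 { intros n. have [_ Q] := Hw n. have T := Cmod_le_plus (w n) z. assert (/ (INR n + 1) <= 1).
  { rewrite <- Rinv_1. apply Rinv_le_contravar; [lra|]. have P := pos_INR n. lra. }
  lra. }
 have NO : ~ O y.
 { intros Oy. have [e [He K]] := HO y Oy. have [n [_ Hn]] := Hy e 0%nat He. apply (proj1 (Hw n)), K, Hn. }
 have Ry : Cmod (z - y) = r.
 { rewrite Cmod_minus_sym. apply Rle_antisym; apply Rnot_lt_le; intros L.
  - set (e := (Cmod (y - z) - r) / 2). destruct (@inv_INR_small e) as [N HN]; [unfold e; lra|]. destruct (Hy e N) as [n [Hn1 Hn2]]; [unfold e; lra|].
   specialize (HN n Hn1). have [_ Q] := Hw n. have T := Cmod_tri y (w n) z. rewrite (Cmod_minus_sym y (w n)) in T. unfold e in *. lra.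
  - an. }
 exists y. rewrite Ry. split; auto. split.
 + intros e He. have [E0|E0] := Req_dec r 0.
  { assert (y = z) by (symmetry; apply Cmod_sub_0; lra). now subst. }
  have P := Cmod_ge_0 (z - y). set (t := Rmin (1 / 2) (e / (2 * r))). have t0 : 0 < t by lra. have t2 : t * r <= e / 2.
  { have X : t <= e / (2 * r) by lra. apply (Rmult_le_compat_r r) in X; [|lra]. eapply Rle_trans; [exact X|right; field; lra]. }
  exists (y + t * (z - y))%C. split.
  * apply Hr. replace (y + t * (z - y) - z)%C with (- (RtoC (1 - t) * (z - y)))%C by (rewrite RtoC_minus; ring).
   rewrite Cmod_opp, Cmod_mult, Cmod_R, Rabs_pos_eq by lra. nra.
  * replace (y + t * (z - y) - y)%C with (t * (z - y))%C by ring. rewrite Cmod_mult, Cmod_R, Rabs_pos_eq, Ry by lra. lra.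
 + intros [e [He K]]. apply NO, K. replace (y - y)%C with (RtoC 0) by ring. now rewrite Cmod_0.
Qed.

Lemma derive_bound_dist {O f z d} : 0 < d -> hol O f -> (forall w, Cmod (w - z) < d -> O w /\ Cmod (f w) <= 1) ->
 Cmod (C_derive f z) <= 2 / d.
Proof.
intros Hd Hf H. destruct (@cauchy_center f z (d / 2) d) as [_ [E _]]; [lra| |].
{ intros w Hw. apply Hf, H, Hw. }
have B : Cmod (CInt (fun t => f (circ z (d / 2) t) * / cis t)%C 0 (2 * PI)) <= 1 * (2 * PI - 0).
{ apply CInt_bound; [lra| |].
 - apply cintg_pcont. intros t _. apply pcont_mult.
  + apply pcont_comp; [apply pcont_circ|]. eapply hol_ccont; eauto. apply H. rewrite Cmod_circ; lra.
  + apply pcont_inv; [apply cis_neq_0|an].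
 - intros t _. rewrite Cmod_mult, Cmod_inv, Cmod_cis, Rinv_1, Rmult_1_r by apply cis_neq_0. apply H. rewrite Cmod_circ; lra. }
rewrite E, !Cmod_mult, !Cmod_R, !Rabs_pos_eq in B by lra. apply Rle_div_r; auto. apply Rmult_le_reg_l with PI; lra.
Qed.

(** * Uniqueness of the hyperbolic factor *)
Definition bw (beta eta : R) : R := PI / (- ln beta + 2 * eta).

(** The logarithm of the density, pulled back by [f], of the complete hyperbolic metric of the
    annulus [beta * exp (- eta) < |w| < exp eta]; taking logarithms turns that annulus into a strip
    of width [PI / bw beta eta]. Negative [eta] means a smaller annulus and a larger metric,
    positive [eta] a larger annulus, whose metric has no singularity on the original one. *)
Definition Ueta (f : C -> C) (beta eta : R) (z : C) : R :=
  ln (Cmod (ell f z)) - ln (sin (bw beta eta * (sg f z + eta)) / bw beta eta).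

Lemma bw_pos {beta eta} : 0 < - ln beta + 2 * eta -> 0 < bw beta eta.
Proof. intros H. apply Rdiv_lt_0_compat; auto. lra. Qed.

Lemma bw_range {beta eta x} : 0 < - ln beta + 2 * eta -> - eta < x < - ln beta + eta -> 0 < bw beta eta * (x + eta) < PI.
Proof. intros H Hx. have B := bw_pos H. have E : bw beta eta * (- ln beta + 2 * eta) = PI by (unfold bw; field; lra). nra. Qed.

Lemma ln_div_id {s b} : 0 < s -> 0 < b -> exp (- ln (s / b)) = b / s.
Proof. intros Hs Hb. rewrite exp_Ropp, exp_ln by now apply Rdiv_lt_0_compat. field; lra. Qed.

(** [ln |ell f|] is harmonic and the second derivative of [- ln sin] is [/ sin^2], so
    [has_lap_ln_comp] yields exactly the square of the density. *)
Lemma has_lap_Ueta {O' O beta eta f g} : 0 < beta -> opn O' -> opn O -> (forall z, O z -> O' z) -> biholo O' beta f g ->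
 0 < - ln beta + 2 * eta -> (forall z, O z -> - eta < sg f z < - ln beta + eta) -> has_lap O (Ueta f beta eta) (fun z => exp (2 * Ueta f beta eta z)).
Proof.
intros Hb HO' HO Hsub B He Hs. have b0 := bw_pos He. set (b := bw beta eta) in *. have [He1 He2] := hol_ell Hb HO' B. apply (@hol_sub O' O) in He1; auto.
destruct B as [Hf [_ [Hfa _]]]. apply (@hol_sub O' O) in Hf; auto. have F0 : forall z, O z -> f z <> 0 by (intros; apply (@annulus_neq_0 beta); auto).
have L1 := has_lap_ln HO He1 (fun z Hz => He2 z (Hsub z Hz)).
have L2 := @has_lap_ln_comp O f (fun x => - ln (sin (b * (eta - x)) / b)) (fun x => b * cos (b * (eta - x)) / sin (b * (eta - x))) (fun x => b * b / (sin (b * (eta - x)) * sin (b * (eta - x)))) HO Hf F0.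
have Sp : forall z, O z -> 0 < sin (b * (eta - ln (Cmod (f z)))).
{ intros z Hz. have R1 := bw_range He (Hs z Hz). replace (eta - ln (Cmod (f z))) with (sg f z + eta) by (unfold sg; ring). now apply sin_gt_0. }
have Dm : forall z, O z -> let x := ln (Cmod (f z)) in is_derive (fun x => - ln (sin (b * (eta - x)) / b)) x (b * cos (b * (eta - x)) / sin (b * (eta - x))) /\ is_derive (fun x => b * cos (b * (eta - x)) / sin (b * (eta - x))) x (b * b / (sin (b * (eta - x)) * sin (b * (eta - x)))).
{ intros z Hz x. have S := Sp z Hz. fold x in S. split.
 - auto_derive.
  + replace (eta + - x) with (eta - x) by ring. lra.
  + replace (eta + - x) with (eta - x) by ring. field. lra.
 - auto_derive.
  + replace (eta + - x) with (eta - x) by ring. lra.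
  + replace (eta + - x) with (eta - x) by ring. have Q := sin2_cos2 (b * (eta - x)). unfold Rsqr in Q. set (sn := sin (b * (eta - x))) in *.
   set (cs := cos (b * (eta - x))) in *. transitivity (b * b * (sn * sn + cs * cs) / (sn * sn)); [field; lra|]. rewrite Q. lra. }
have L3 := has_lap_plus L1 (L2 Dm). destruct L3 as [ax [ay [axx [ayy HL]]]]. exists ax, ay, axx, ayy. intros z Hz. have [A1 [A2 [A3 [A4 A5]]]] := HL z Hz.
have Eq : forall w, ln (Cmod (ell f w)) + - ln (sin (b * (eta - ln (Cmod (f w)))) / b) = Ueta f beta eta w.
{ intros w. unfold Ueta, sg, Rminus. fold b. do 5 f_equal. ring. }
split5; auto.
- eapply is_derive_ext; [|an]. intros; simpl; apply Eq.
- eapply is_derive_ext; [|an]. intros; simpl; apply Eq.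
- rewrite <- A5. rewrite <- Eq. fold (ell f z).
 replace (2 * (ln (Cmod (ell f z)) + - ln (sin (b * (eta - ln (Cmod (f z)))) / b))) with ((ln (Cmod (ell f z)) + ln (Cmod (ell f z))) + (- ln (sin (b * (eta - ln (Cmod (f z)))) / b) + - ln (sin (b * (eta - ln (Cmod (f z)))) / b))) by ring.
 have S := Sp z Hz. have P := Cmod_pos (He2 z (Hsub z Hz)). rewrite !exp_plus, ln_div_id, exp_ln by auto. field. lra.
Qed.

Lemma ccont_Ueta_sin {O beta} eta {f g z} : 0 < beta -> opn O -> biholo O beta f g -> O z ->
 ccont (fun w => RtoC (sin (bw beta eta * (sg f w + eta)) / bw beta eta)) z.
Proof.
intros Hb HO B Hz. apply (@ccont_R (fun x => sin (bw beta eta * (x + eta)) / bw beta eta) (sg f)).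
- apply (@ccont_sg O beta f g); auto.
- apply (ex_derive_continuous (V := R_NormedModule)). auto_derive; auto.
Qed.

Lemma ccont_Ueta {O beta eta f g z} : 0 < beta -> opn O -> biholo O beta f g -> O z ->
 0 < sin (bw beta eta * (sg f z + eta)) / bw beta eta -> ccont (fun w => RtoC (Ueta f beta eta w)) z.
Proof.
intros Hb HO B Hz S. unfold Ueta. apply ccont_ext with (fun w => RtoC (ln (Cmod (ell f w))) - RtoC (ln (sin (bw beta eta * (sg f w + eta)) / bw beta eta)))%C.
{ exists 1; split; [lra|]. intros; now rewrite RtoC_minus. }
have [He1 He2] := hol_ell Hb HO B. apply ccont_minus.
- apply ccont_ln_mod; an.
- apply ccont_R.
 + apply (@ccont_Ueta_sin O beta eta f g); auto.
 + apply (ex_derive_continuous (V := R_NormedModule)). eexists. now apply is_derive_ln.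
Qed.

Lemma ccont_u {O u z} : C2_on O u -> O z -> ccont (fun w => RtoC (u w)) z.
Proof. intros H Hz. apply continuous_ccont. apply (H z Hz). an. Qed.

Lemma ccont_Rminus {a b z} : ccont (fun w => RtoC (a w)) z -> ccont (fun w => RtoC (b w)) z -> ccont (fun w => RtoC (a w - b w)) z.
Proof.
intros Ha Hb. apply ccont_ext with (fun w => RtoC (a w) - RtoC (b w))%C.
- exists 1; split; [lra|]. intros; now rewrite RtoC_minus.
- an.
Qed.

Lemma ccont_RtoC_near {a z e} : ccont (fun w => RtoC (a w)) z -> 0 < e -> exists d, 0 < d /\ forall w, Cmod (w - z) < d ->
 a z - e < a w < a z + e.
Proof.
intros H He. have [d [Hd K]] := H e He. exists d; split; auto. intros w Hw. specialize (K w Hw). rewrite <- RtoC_minus, Cmod_R in K. apply Rabs_def2 in K. lra.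
Qed.

Lemma exp_le_inv {x y} : exp x <= exp y -> x <= y.
Proof. intros H. apply Rnot_lt_le. intros L. apply exp_increasing in L. lra. Qed.

Lemma ln_mono {x y} : 0 < x -> x <= y -> ln x <= ln y.
Proof. intros Hx [H| ->]; [left; now apply ln_increasing|lra]. Qed.

(** Comparison on the part of [O] mapped into the smaller annulus ([eta < 0]): its closure is
    compact in [O], so [u] stays bounded there while [Ueta] is infinite at its edge. At a positive
    maximum of [u - Ueta] the Laplacians give [exp (2 * u) <= exp (2 * Ueta)], a contradiction. *)
Lemma u_le_Ueta {O beta eta f g u z1} : 0 < beta -> opn O -> boundedC O -> biholo O beta f g -> C2_on O u ->
 (forall z, O z -> Lap u z = exp (2 * u z)) -> eta < 0 -> 0 < - ln beta + 2 * eta -> O z1 -> - eta < sg f z1 < - ln beta + eta -> u z1 <= Ueta f beta eta z1.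
Proof.
intros Hb HO HBd B HC HL Heta Hpos Hz1 Hs1. apply Rnot_lt_le. intros L. have b0 := bw_pos Hpos. set (O' := fun z => O z /\ - eta < sg f z < - ln beta + eta).
set (D := fun z => u z - Ueta f beta eta z). have Sp : forall z, O' z -> 0 < sin (bw beta eta * (sg f z + eta)) / bw beta eta.
{ intros z [_ Hz]. apply Rdiv_lt_0_compat; auto. apply sin_gt_0; apply (bw_range Hpos Hz). }
have [He1 He2] := hol_ell Hb HO B. have HO' : opn O'.
{ intros z [Hz Hs]. have [r [Hr K]] := HO z Hz. destruct (@ccont_RtoC_near (sg f) z (Rmin (sg f z + eta) (- ln beta + eta - sg f z))) as [d [Hd Kd]].
 - apply (@ccont_sg O beta f g); auto.
 - lra.
 - exists (Rmin r d); split; [an|]. intros w Hw. split.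
  + apply K. lra.
  + specialize (Kd w ltac:(lra)). an. }
destruct (@sup_attained O' D z1 0) as [zs [Hzs [Hge Hmax]]].
- destruct HBd as [M HM]. exists M. intros z [Hz _]; auto.
- split; auto.
- unfold D. lra.
- intros l Hl. have Bh := @biholo_closure O beta (beta * exp (- eta)) (exp eta) f g l B. have E1 : 1 < exp (- eta) by (rewrite <- exp_0; apply exp_increasing; lra).
 have E2 : exp eta < 1 by (rewrite <- exp_0; apply exp_increasing; lra). destruct Bh as [Ol Hfl]; [nra|lra| |].
 { intros e He. have [w [[W1 W2] W3]] := Hl e He. exists w. split; auto. split; auto. have P : 0 < Cmod (f w).
  { apply Cmod_pos, (@annulus_neq_0 beta); auto. destruct B as [_ [_ [X _]]]; auto. }
  unfold sg in W2. rewrite <- (exp_ln (Cmod (f w))) by auto. rewrite <- (exp_ln beta) at 1 by auto. rewrite <- exp_plus. split; left; apply exp_increasing; lra. }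
 have Sl : - eta <= sg f l <= - ln beta + eta.
 { unfold sg. have P : 0 < beta * exp (- eta) by lra. have M1 := ln_mono P (proj1 Hfl). have M2 := @ln_mono (Cmod (f l)) _ ltac:(lra) (proj2 Hfl).
  rewrite ln_exp in M2. rewrite ln_mult, ln_exp in M1 by (auto; apply exp_pos). lra. }
 have [In|Out] := classic (- eta < sg f l < - ln beta + eta).
 + left. have Ol' : O' l by (split; auto). split; auto. apply ccont_Rminus.
  * eapply ccont_u; eauto.
  * apply (@ccont_Ueta O beta eta f g); auto.
 + right. have Z : sin (bw beta eta * (sg f l + eta)) / bw beta eta = 0.
  { have Y : sg f l = - eta \/ sg f l = - ln beta + eta by lra. destruct Y as [Y|Y]; rewrite Y.
   - replace (- eta + eta) with 0 by ring. rewrite Rmult_0_r, sin_0. lra.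
   - replace (bw beta eta * (- ln beta + eta + eta)) with PI by (unfold bw; field; lra). rewrite sin_PI. lra. }
  set (K := u l + 2 - ln (Cmod (ell f l))). have [d1 [Hd1 K1]] := ccont_RtoC_near (ccont_u HC Ol) Rlt_0_1.
  destruct (@ccont_RtoC_near (fun w => ln (Cmod (ell f w))) l 1) as [d2 [Hd2 K2]]; [|lra|].
  { apply ccont_ln_mod; an. }
  have [d3 [Hd3 K3]] := @ccont_RtoC_near _ l (exp (- K)) (ccont_Ueta_sin eta Hb HO B Ol) (exp_pos _). exists (Rmin d1 (Rmin d2 d3)); split; [an|]. intros z Hz Hzl.
  have Q := Rmin_l d1 (Rmin d2 d3). have Q' := Rmin_r d1 (Rmin d2 d3). have Q2 := Rmin_l d2 d3. have Q3 := Rmin_r d2 d3. specialize (K1 z ltac:(lra)).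
  specialize (K2 z ltac:(lra)). specialize (K3 z ltac:(lra)). have S := Sp z Hz. have Y : ln (sin (bw beta eta * (sg f z + eta)) / bw beta eta) <= - K.
  { rewrite <- ln_exp. apply ln_mono; lra. }
  unfold D, Ueta, K in *. lra.
- have X := @max_lap O' u (Ueta f beta eta) (Lap u) (fun z => exp (2 * Ueta f beta eta z)) zs HO' (@has_lap_sub O O' _ _ ltac:(intros z [Y _]; exact Y) (has_lap_C2 HC)).
 have Y : has_lap O' (Ueta f beta eta) (fun z => exp (2 * Ueta f beta eta z)).
 { apply (@has_lap_Ueta O O' beta eta f g); auto.
  - intros z [H _]; exact H.
  - intros z [_ H]; exact H. }
 specialize (X Y Hzs Hmax). rewrite HL in X by apply Hzs. apply exp_le_inv in X. unfold D in Hge. lra.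
Qed.

(** A lower bound of [u] by [gm] times [- ln] of the distance to the boundary, with an arbitrary
    additive constant. The disc condition expresses that [y] is a nearest boundary point of [z]. *)
Definition growth (O : C -> Prop) (u : C -> R) (gm : R) : Prop :=
  forall M, exists del, 0 < del /\ forall z y, O z -> boundaryC O y ->
    (forall w, Cmod (w - z) < Cmod (z - y) -> O w) -> Cmod (z - y) < del ->
    gm * - ln (Cmod (z - y)) + M <= u z.

Lemma closure_boundary {O l} : closureC O l -> ~ O l -> boundaryC O l.
Proof. intros H N. split; auto. intros [e [He K]]. apply N, K. replace (l - l)%C with (RtoC 0) by ring. now rewrite Cmod_0. Qed.

Lemma factor_lower_bound {O u} : boundedC O -> hyperbolic_factor O u -> exists m, forall z, O z -> - m <= u z.
Proof.
intros HB [HC [_ Hinf]]. have [[z1 Hz1]|N] := classic (exists z, O z).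
2:{ exists 0. intros z Hz. exfalso; apply N; eauto. }
destruct (@sup_attained O (fun z => - u z) z1 (- u z1 - 1)) as [zs [Hzs [_ Hm]]]; auto; [lra| |].
- intros l Hl. have [Ol|Nl] := classic (O l).
 + left; split; auto. apply ccont_ext with (fun z => - RtoC (u z))%C.
  * exists 1; split; [lra|]. intros; now rewrite RtoC_opp.
  * apply ccont_opp. eapply ccont_u; eauto.
 + right. have [d [Hd K]] := Hinf (u z1 + 1). exists d; split; auto. intros z Hz Hzl. have X : u z1 + 1 < u z; [|lra]. apply K; auto. exists l. split; auto.
  now apply closure_boundary.
- exists (- u zs). intros z Hz. specialize (Hm z Hz). lra.
Qed.

Lemma sin_lower {y0 y} : 0 < y0 -> y0 <= y <= PI - y0 -> sin y0 <= sin y.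
Proof.
intros H0 Hy. have [h|h] := Rle_dec y (PI / 2).
- apply sin_incr_1; lra.
- rewrite <- (sin_PI_x y). apply sin_incr_1; lra.
Qed.

(** At the boundary, Cauchy's estimate bounds [|ell f|] by a constant over the distance and
    [eta > 0] keeps the sine away from 0, so [Ueta] is at most [- ln] of the distance plus a
    constant; the rate [/ (1 + eps)] for [u] is enough to dominate this by [(1 + eps) * u]. At a
    positive interior maximum the equations would give [exp (2 * eps * (u + m + 1)) < 1 + eps],
    although [u + m >= 0]. *)
Lemma Ueta_le_u_eps {O beta eta eps m f g u z1} : 0 < beta < 1 -> opn O -> boundedC O -> biholo O beta f g ->
 hyperbolic_factor O u -> (forall gm, 0 < gm < 1 -> growth O u gm) -> 0 <= m -> (forall z, O z -> - m <= u z) -> 0 < eta -> 0 < eps -> O z1 ->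
 Ueta f beta eta z1 <= (1 + eps) * u z1 + eps * (m + 1).
Proof.
intros Hb HO HBd B Hu HG Hm0 Hm Heta Heps Hz1. apply Rnot_lt_le. intros L. have lb : ln beta < 0 by (rewrite <- ln_1; apply ln_increasing; lra).
have Hpos : 0 < - ln beta + 2 * eta by lra. have b0 := bw_pos Hpos. set (D := fun z => Ueta f beta eta z - ((1 + eps) * u z + eps * (m + 1))).
have [He1 He2] := @hol_ell O beta f g ltac:(lra) HO B. have B' := B. destruct B' as [Hf [_ [Hfa _]]]. have Rg : forall z, O z -> - eta < sg f z < - ln beta + eta.
{ intros z Hz. have R1 := @sg_range O beta f g z ltac:(lra) B Hz. lra. }
have bE : bw beta eta * (- ln beta + 2 * eta) = PI by (unfold bw; field; lra). have S0 : 0 < sin (bw beta eta * eta) by (apply sin_gt_0; nra).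
have Sp : forall z, O z -> sin (bw beta eta * eta) <= sin (bw beta eta * (sg f z + eta)).
{ intros z Hz. have R1 := @sg_range O beta f g z ltac:(lra) B Hz. apply sin_lower; nra. }
destruct Hu as [HC [HL Hinf]]. have Cont : forall l, O l -> ccont (fun z => RtoC (D z)) l.
{ intros l Ol. apply ccont_Rminus.
 - apply (@ccont_Ueta O beta eta f g); auto; [lra|]. specialize (Sp l Ol). lra.
 - apply (@ccont_R (fun x => (1 + eps) * x + eps * (m + 1)) u); [eapply ccont_u; eauto|]. an. }
set (Cc := ln (2 / beta) - ln (sin (bw beta eta * eta) / bw beta eta)). destruct (HG (/ (1 + eps))) with (M := Rabs Cc) as [del [Hdel KG]].
{ split; [an|]. rewrite <- Rinv_1. apply Rinv_lt_contravar; lra. }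
destruct (@sup_attained O D z1 0) as [zs [Hzs [Hge Hmax]]]; auto.
- unfold D. lra.
- intros l Hl. have [Ol|Nl] := classic (O l); auto. right. exists del; split; auto. intros z Hz Hzl. have [y [Hy1 Hy2]] := nearest_boundary HO HBd Hz.
 have dy : Cmod (z - y) <= Cmod (z - l).
 { apply Rnot_lt_le. intros Lt. apply Nl, Hy2. now rewrite Cmod_minus_sym. }
 have dp : 0 < Cmod (z - y).
 { apply Cmod_gt_0. intros E. apply (boundary_not_in HO Hy1). replace y with (z - (z - y))%C by ring. rewrite E. replace (z - 0)%C with z by ring. auto. }
 have G := KG z y Hz Hy1 Hy2 ltac:(lra). have Dd : Cmod (C_derive f z) <= 2 / Cmod (z - y).
 { apply (@derive_bound_dist O); auto. intros w Hw. split; auto. destruct (Hfa w (Hy2 w Hw)). lra. }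
 have Le : ln (Cmod (ell f z)) <= ln (2 / beta) - ln (Cmod (z - y)).
 { rewrite <- ln_div by (auto; apply Rdiv_lt_0_compat; lra). apply ln_mono; [apply Cmod_pos; auto|]. have [F1 F2] := Hfa z Hz. unfold ell.
  rewrite Cmod_div by (apply Cmod_gt_0; lra). apply Rle_div_l; [lra|]. eapply Rle_trans; [exact Dd|].
  replace (2 / beta / Cmod (z - y) * Cmod (f z)) with (2 / Cmod (z - y) * (Cmod (f z) / beta)) by (field; lra). rewrite <- Rmult_1_r at 1. apply Rmult_le_compat_l.
  - lra.
  - apply Rle_div_r; lra. }
 have Ls : ln (sin (bw beta eta * eta) / bw beta eta) <= ln (sin (bw beta eta * (sg f z + eta)) / bw beta eta).
 { apply ln_mono; [an|]. apply Rmult_le_compat_r; auto. apply Rlt_le, Rinv_0_lt_compat; auto. }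
 have G2 : - ln (Cmod (z - y)) + (1 + eps) * Rabs Cc <= (1 + eps) * u z.
 { apply (Rmult_le_compat_l (1 + eps)) in G; [|lra]. eapply Rle_trans; [|exact G]. right. field. lra. }
 have Q := Rle_abs Cc. have Q0 := Rabs_pos Cc. unfold D, Ueta, Cc in *. nra.
- have X := max_lap HO (@has_lap_Ueta O O beta eta f g ltac:(lra) HO HO ltac:(auto) B Hpos Rg) (has_lap_affine (1 + eps) (eps * (m + 1)) (has_lap_C2 HC)) Hzs Hmax.
 simpl in X. rewrite HL in X by auto. specialize (Hm zs Hzs). have Y : (1 + eps) * u zs + eps * (m + 1) < Ueta f beta eta zs by (unfold D in Hge; lra).
 have Z : exp (2 * ((1 + eps) * u zs + eps * (m + 1))) < (1 + eps) * exp (2 * u zs).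
 { eapply Rlt_le_trans; [|exact X]. apply exp_increasing. lra. }
 replace (2 * ((1 + eps) * u zs + eps * (m + 1))) with (2 * eps * (u zs + m + 1) + 2 * u zs) in Z by ring. rewrite exp_plus in Z. apply Rmult_lt_reg_r in Z; [|an].
 have W : 2 * eps <= 2 * eps * (u zs + m + 1) by nra. have V := exp_ineq1_le (2 * eps * (u zs + m + 1)). lra.
Qed.

Lemma continuous_Ueta_eta {O beta f g z} : 0 < beta < 1 -> biholo O beta f g -> O z ->
 continuous (fun eta => Ueta f beta eta z) 0.
Proof.
intros Hb B Hz. apply (ex_derive_continuous (V := R_NormedModule)). unfold Ueta, bw. have R1 := @sg_range O beta f g z ltac:(lra) B Hz.
have R2 := @bw_range beta 0 (sg f z) ltac:(lra) ltac:(lra). unfold bw in R2. have S := sin_gt_0 _ (proj1 R2) (proj2 R2). have P := @bw_pos beta 0 ltac:(lra).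
unfold bw in P. auto_derive. lra.
Qed.

Lemma limit_le {h : R -> R} {a sgn} : sgn <> 0 -> continuous h 0 -> (exists r, 0 < r /\ forall e, 0 < e < r -> a <= h (sgn * e)) -> a <= h 0.
Proof.
intros Hs Hc [r [Hr H]]. apply Rnot_lt_le. intros L. destruct (proj1 continuous_eps Hc (a - h 0)) as [d [Hd K]]; [lra|]. have P := Rabs_pos_lt _ Hs.
set (e := Rmin r (d / Rabs sgn) / 2). have dp : 0 < d / Rabs sgn by lra. have M0 := Rmin_pos r (d / Rabs sgn) Hr dp. have M1 := Rmin_l r (d / Rabs sgn).
have M2 := Rmin_r r (d / Rabs sgn). have X := H e ltac:(unfold e; lra). have Y := K (sgn * e).
rewrite Rminus_0_r, Rabs_mult, (Rabs_pos_eq e) in Y by (unfold e; lra). have Z : Rabs sgn * e < d.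
{ assert (e < d / Rabs sgn) by (unfold e; lra). apply (Rmult_lt_compat_l (Rabs sgn)) in H0; auto. replace (Rabs sgn * (d / Rabs sgn)) with d in H0 by (field; lra).
 lra. }
lra.
Qed.

(** [Ueta] is continuous in [eta] at 0: the upper bound for [u] is the limit from the negative side,
    the lower one from the positive side, with [eps] adapted to each [eta]. *)
Theorem hyperbolic_factor_unique {O beta f g u z} : 0 < beta < 1 -> opn O -> boundedC O -> biholo O beta f g ->
 hyperbolic_factor O u -> (forall gm, 0 < gm < 1 -> growth O u gm) -> O z -> u z = Ueta f beta 0 z.
Proof.
intros Hb HO HBd B Hu HG Hz. have Cc := continuous_Ueta_eta Hb B Hz. have R1 := @sg_range O beta f g z ltac:(lra) B Hz. destruct Hu as [HC [HL Hinf]].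
apply Rle_antisym.
- apply (@limit_le (fun eta => Ueta f beta eta z) (u z) (-1)); [lra|auto|]. exists (Rmin (- ln beta / 2) (Rmin (sg f z) (- ln beta - sg f z))). split; [an|].
 intros e He. have M3 := Rmin_l (sg f z) (- ln beta - sg f z). have M4 := Rmin_r (sg f z) (- ln beta - sg f z). apply (@u_le_Ueta O beta (-1 * e) f g u); auto; lra.
- have Hu : hyperbolic_factor O u by (split; auto). have [m Hm] := factor_lower_bound HBd Hu. set (m' := Rmax m 0). have m0 : 0 <= m' by apply Rmax_r.
 have Hm' : forall z, O z -> - m' <= u z.
 { intros w Hw. specialize (Hm w Hw). have X := Rmax_l m 0. unfold m'. lra. }
 have Hc2 : continuous (fun eta => - Ueta f beta eta z) 0 by an. have X : - u z <= - Ueta f beta 0 z; [|lra].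
 apply (@limit_le (fun eta => - Ueta f beta eta z) (- u z) 1); auto. exists 1; split; [lra|]. intros e He. rewrite Rmult_1_l. apply Rnot_lt_le. intros L.
 set (dlt := Ueta f beta e z - u z) in *. have dp : 0 < dlt by (unfold dlt; lra). have q0 : 0 < u z + m' + 1 by (specialize (Hm' z Hz); lra).
 have Y := @Ueta_le_u_eps O beta e (dlt / (2 * (u z + m' + 1))) m' f g u z Hb HO HBd B Hu HG m0 Hm' ltac:(lra) ltac:(lra) Hz.
 replace ((1 + dlt / (2 * (u z + m' + 1))) * u z + dlt / (2 * (u z + m' + 1)) * (m' + 1)) with (u z + dlt / 2) in Y by (field; lra). unfold dlt in *. lra.
Qed.

(** * A square root separating the inner complementary component *)
Lemma box_const {X Y E z w} : interval_like X -> interval_like Y -> X (Re z) -> Y (Im z) -> X (Re w) -> Y (Im w) ->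
 (forall v, X (Re v) -> Y (Im v) -> cder E v 0) -> E z = E w.
Proof.
intros [_ CX] [_ CY] X1 Y1 X2 Y2 H. have cvx : forall a b t, 0 <= t <= 1 -> Rmin a b <= a + t * (b - a) <= Rmax a b.
{ intros a b t Ht. unfold Rmin, Rmax. destruct (Rle_dec a b); split; nra. }
transitivity (E (z + RtoC 0 * (w - z))%C); [f_equal; ring|]. transitivity (E (z + RtoC 1 * (w - z))%C); [|f_equal; ring].
apply (@pder_zero_const (fun t => E (z + t * (w - z))%C) 0 1). intros t Ht. rewrite Rmin_left, Rmax_right in Ht by lra.
eapply pder_eq; [apply (@pder_comp E (fun t => z + t * (w - z))%C t 0 (w - z)%C); [apply pder_line|]|ring]. apply H.
- replace (Re (z + RtoC t * (w - z))) with (Re z + t * (Re w - Re z)) by (unfold Re; simpl; ring). apply (CX (Re z) (Re w)); auto.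
- replace (Im (z + RtoC t * (w - z))) with (Im z + t * (Im w - Im z)) by (unfold Im; simpl; ring). apply (CY (Im z) (Im w)); auto.
Qed.

Lemma Cexp_period {z w} : Cexp z = Cexp w -> exists m : Z, z = (w + Ci * RtoC (2 * PI * IZR m))%C.
Proof.
intros E. have R1 : Re z = Re w.
{ have H := f_equal Cmod E. rewrite !Cmod_Cexp in H. now apply exp_inv. }
have E1 : cis (Im z - Im w) = 1.
{ unfold Rminus. rewrite cis_plus, cis_opp. unfold Cexp in E. rewrite R1 in E. have X : cis (Im z) = cis (Im w).
 { have N : RtoC (exp (Re w)) <> 0 by (apply RtoC_neq; have P := exp_pos (Re w); lra).
  replace (cis (Im z)) with (RtoC (exp (Re w)) * cis (Im z) / RtoC (exp (Re w)))%C by (field; auto). rewrite E. field; auto. }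
 rewrite X. apply Ceq; unfold Im; simpl; [|ring]. have S := sin2_cos2 (Im w). unfold Rsqr, Im in S. lra. }
have [m Hm] := sin_neq_1_cos E1. exists m. apply Ceq; unfold Re, Im in *; simpl; an.
Qed.

Lemma Cexp_add_period z m : Cexp (z + Ci * RtoC (2 * PI * IZR m)) = Cexp z.
Proof.
unfold Cexp. replace (Re (z + Ci * RtoC (2 * PI * IZR m))) with (Re z) by (unfold Re; simpl; ring).
replace (Im (z + Ci * RtoC (2 * PI * IZR m))) with (Im z + 2 * IZR m * PI) by (unfold Im; simpl; ring). unfold cis. rewrite cos_plus, sin_plus.
have S := sin_eq_0_1 (2 * IZR m * PI) ltac:(exists (2 * m)%Z; rewrite mult_IZR; ring). have Cc : cos (2 * IZR m * PI) = 1.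
{ replace (2 * IZR m * PI) with (2 * (IZR m * PI)) by ring. rewrite cos_2a_sin. rewrite sin_eq_0_1 by (exists m; auto). ring. }
rewrite S, Cc. apply Ceq; simpl; ring.
Qed.

Lemma Clog_local {w1 z1 : C} : w1 <> 0 -> Cexp z1 = w1 -> exists (P : C -> C) (r : R), 0 < r /\ P w1 = z1 /\ forall w, Cmod (w - w1) < r ->
 Cexp (P w) = w /\ cder P w (/ w)%C.
Proof.
intros H0 E. have P0 := Cmod_pos H0. set (r := Cmod w1 / 2).
destruct (@primitive_box (fun x => Re w1 - r < x < Re w1 + r) (fun y => Im w1 - r < y < Im w1 + r) (fun w => / w)%C (Re w1) (Im w1)) as [P [P1 P2]]; try apply interval_like_oo; try (unfold r; lra).
{ intros z Hx Hy. eexists. apply cder_inv_id. intros Z. subst z. simpl in *. have Q := Cmod_sqr w1. unfold r in *. nra. }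
rewrite Ceta in P1. have Inb : forall w, Cmod (w - w1) < r -> Re w1 - r < Re w < Re w1 + r /\ Im w1 - r < Im w < Im w1 + r.
{ intros w Hw. have A := re_le_Cmod (w - w1). have B := im_le_Cmod (w - w1). rewrite Re_minus in A. rewrite Im_minus in B.
 have A' := Rabs_def2 (Re w - Re w1) r ltac:(lra). have B' := Rabs_def2 (Im w - Im w1) r ltac:(lra). lra. }
have N0 : forall w, Re w1 - r < Re w < Re w1 + r -> Im w1 - r < Im w < Im w1 + r -> w <> 0.
{ intros z Hx Hy Z. subst z. simpl in *. have Q := Cmod_sqr w1. unfold r in *. nra. }
exists (fun w => z1 + P w)%C, r. split; [unfold r; lra|]. split; [rewrite P1; ring|]. intros w Hw. have [I1 I2] := Inb w Hw. split.
- have K : (Cexp (z1 + P w1) / w1)%C = (Cexp (z1 + P w) / w)%C.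
 { apply (@box_const (fun x => Re w1 - r < x < Re w1 + r) (fun y => Im w1 - r < y < Im w1 + r) (fun w => Cexp (z1 + P w) / w)%C); try apply interval_like_oo; try (lra).
  intros v V1 V2. eapply cder_eq.
  - apply (@cder_div (fun w => Cexp (z1 + P w)) (fun w => w)); [an| |an]. apply @cder_comp; [|apply cder_Cexp]. an.
  - field. auto. }
 rewrite P1 in K. replace (z1 + 0)%C with z1 in K by ring. rewrite E in K. replace (Cexp (z1 + P w)) with (Cexp (z1 + P w) / w * w)%C by (field; auto). rewrite <- K.
 field; auto.
- an.
Qed.

Lemma compact_margin {O beta r f g} : opn O -> boundedC O -> biholo O beta f g -> beta < r < 1 -> exists d, 0 < d /\ forall z w, O z ->
 Cmod (f z) = r -> Cmod (w - z) < d -> O w.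
Proof.
intros HO [M HM] B Hr. apply NNPP. intros N.
have S : forall n : nat, exists p : C * C, O (fst p) /\ Cmod (f (fst p)) = r /\ Cmod (snd p - fst p) < / (INR n + 1) /\ ~ O (snd p).
{ intros n. apply NNPP. intros N'. apply N. exists (/ (INR n + 1)). split.
 - have P := pos_INR n. lra.
 - intros z w Hz Hf Hw. apply NNPP. intros N''. apply N'. exists (z, w). auto. }
have [p Hp] := choice_nat _ S. destruct (@cluster_C (fun n => fst (p n)) M) as [l Hl]; [intros n; apply HM, Hp|].
destruct (@biholo_closure O beta r r f g l B) as [Ol _]; try lra.
{ intros e He'. have [n [_ Hn]] := Hl e 0%nat He'. exists (fst (p n)). split; auto. have [Q1 [Q2 _]] := Hp n. split; auto. lra. }
have [e [He K]] := HO l Ol. destruct (@inv_INR_small (e / 2)) as [m Hm]; [lra|]. destruct (Hl (e / 2) m) as [n [Hn1 Hn2]]; [lra|]. have [Q1 [_ [Q3 Q4]]] := Hp n.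
apply Q4, K. have T := Cmod_tri (snd (p n)) (fst (p n)) l. specialize (Hm n Hn1). lra.
Qed.

Lemma connected_locally_constant {K} {I : C -> R} {e a b} : 0 < e -> connectedC K -> (forall x y, K x -> K y -> Cmod (x - y) < e ->
 I x = I y) -> K a -> K b -> I a = I b.
Proof.
intros He HK H Ha Hb. have OP : forall S : C -> Prop, open (fun z => exists x, S x /\ Cmod (z - x) < e / 2).
{ intros S. apply opn_open. intros z [x [Sx Hx]]. exists (e / 2 - Cmod (z - x)). split; [lra|]. intros w Hw. exists x. split; auto. have T := Cmod_tri w z x. lra. }
have Self : forall x, Cmod (x - x) < e / 2.
{ intros x. rewrite Cmod_diag; lra. }
destruct (HK (fun z => exists x, (K x /\ I x = I a) /\ Cmod (z - x) < e / 2) (fun z => exists x, (K x /\ I x <> I a) /\ Cmod (z - x) < e / 2) (OP (fun x => K x /\ I x = I a)) (OP (fun x => K x /\ I x <> I a))) as [C1|C1].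
- intros z Kz. destruct (Req_dec (I z) (I a)); [left|right]; exists z; auto.
- intros z [Kz [[x [[Kx Ix] Hx]] [y [[Ky Iy] Hy]]]]. apply Iy. rewrite <- Ix. apply H; auto. have T := Cmod_tri y z x. rewrite (Cmod_minus_sym y z) in T. lra.
- have [x [[Kx Ix] Hx]] := C1 b Hb. rewrite <- Ix. symmetry. apply H; auto. lra.
- exfalso. have [x [[Kx Ix] Hx]] := C1 a Ha. apply Ix. apply H; auto. rewrite Cmod_minus_sym. lra.
Qed.

Lemma IZR_close {m n} : Rabs (IZR m - IZR n) < 1 -> m = n.
Proof.
intros H. rewrite <- minus_IZR in H. apply Rabs_def2 in H. destruct H as [H1 H2]. apply lt_IZR in H1. rewrite <- opp_IZR in H2. apply lt_IZR in H2. lia.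
Qed.

(** The image under [g] of the circle of radius [r] keeps a distance [e] from [K]. Its winding
    number about [x] is an integer and changes by less than 1 under small moves of [x] in [K], so it
    is constant on the connected set [K]. The real parts vanish because the curve is closed. *)
Lemma winding_same {O K beta r f g a b} : 0 < beta -> opn O -> boundedC O -> biholo O beta f g -> beta < r < 1 -> connectedC K ->
 (forall z, K z -> ~ O z) -> K a -> K b ->
 let d := fun t => (C_derive g (circ 0 r t) * (Ci * (RtoC r * cis t)))%C in CInt (fun t => d t / (g (circ 0 r t) - a))%C 0 (2 * PI) = CInt (fun t => d t / (g (circ 0 r t) - b))%C 0 (2 * PI).
Proof.
intros Hb HO HBd B Hr HK HKO Ha Hbb d. have [e [He Hm]] := compact_margin HO HBd B Hr. have B' := B. destruct B' as [Hf [Hg [Hfa [Hga [Hgf Hfg]]]]].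
have An : forall t, annulus beta (circ 0 r t).
{ intros t. unfold annulus. have X := @Cmod_circ 0 r t ltac:(lra). replace (circ 0 r t - 0)%C with (circ 0 r t) in X by ring. lra. }
have Hg' : forall w, annulus beta w -> ccont (C_derive g) w.
{ intros w Hw. apply (@hol_ccont (annulus beta)); auto. apply hol_derive; auto. apply opn_annulus. }
have Cd : forall t, pcont d t.
{ intros t. apply pcont_mult.
 - apply pcont_comp; [apply pcont_circ|auto].
 - apply pcont_mult; [an|]. apply pcont_mult; an. }
have Dg : forall x t, pder (fun t => g (circ 0 r t) - x)%C t (d t).
{ intros x t. eapply pder_eq.
 - apply @pder_minus; [|an]. apply @pder_comp; [apply pder_circ|]. an.
 - unfold d. ring. }
have Far : forall x t, K x -> e <= Cmod (g (circ 0 r t) - x).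
{ intros x t Kx. apply Rnot_lt_le. intros L. apply (HKO x Kx). apply (Hm (g (circ 0 r t))); auto.
 - rewrite Hfg by auto. have X := @Cmod_circ 0 r t ltac:(lra). replace (circ 0 r t - 0)%C with (circ 0 r t) in X by ring. auto.
 - now rewrite Cmod_minus_sym. }
have N0 : forall x t, K x -> (g (circ 0 r t) - x)%C <> 0.
{ intros x t Kx. apply Cmod_gt_0. have Y := Far x t Kx. lra. }
have Cq : forall x t, K x -> pcont (fun t => d t / (g (circ 0 r t) - x))%C t by an.
have Re0 : forall x, K x -> Re (CInt (fun t => d t / (g (circ 0 r t) - x))%C 0 (2 * PI)) = 0.
{ intros x Kx. change (RInt (fun t => Re (d t / (g (circ 0 r t) - x))%C) 0 (2 * PI) = 0). rewrite (@RInt_FTC (fun t => ln (Cmod (g (circ 0 r t) - x)))).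
 - rewrite circ_2PI. lra.
 - intros t _. apply @is_derive_Cmod_ln; auto.
 - intros t _. apply (Cq x t Kx). }
set (I := fun x => Im (CInt (fun t => d t / (g (circ 0 r t) - x))%C 0 (2 * PI))). have Int : forall x, K x -> exists m : Z, I x = 2 * PI * IZR m.
{ intros x Kx. apply winding_int; auto. now rewrite circ_2PI. }
have Cdm : forall t, continuous (fun t => Cmod (d t)) t by an. set (Md := RInt (fun t => Cmod (d t)) 0 (2 * PI)). have Md0 : 0 <= Md.
{ apply RInt_ge_0; [lra|an|]. intros; apply Cmod_ge_0. }
have EI : I a = I b.
{ apply (@connected_locally_constant K I (e * e / (Md + 1))); auto.
 { lra. }
 intros x y Kx Ky Hxy. have [m Em] := Int x Kx. have [n En] := Int y Ky. rewrite Em, En. f_equal. have D1 : Rabs (I x - I y) <= Md * (Cmod (x - y) / (e * e)).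
 { unfold I. rewrite <- Im_minus. eapply Rle_trans; [apply im_le_Cmod|]. rewrite <- CInt_minus by (apply cintg_pcont; intros t _; now apply Cq). eapply Rle_trans.
  - apply (@CInt_norm _ (fun t => (Cmod (x - y) / (e * e)) * Cmod (d t))); [lra| | |].
   + an.
   + an.
   + intros t _.
    replace (d t / (g (circ 0 r t) - x) - d t / (g (circ 0 r t) - y))%C with (d t * (x - y) / ((g (circ 0 r t) - x) * (g (circ 0 r t) - y)))%C by (field; auto).
    rewrite Cmod_div, !Cmod_mult by (apply Cmult_neq_0; auto). have F1 := Far x t Kx. have F2 := Far y t Ky. have Q1 := Cmod_ge_0 (d t).
    have Q2 := Cmod_ge_0 (x - y). unfold Rdiv. rewrite (Rmult_comm (Cmod (x - y) * / (e * e))), Rmult_assoc. apply Rmult_le_compat_l; auto.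
    apply Rmult_le_compat_l; auto. apply Rinv_le_contravar; nra.
  - rewrite RInt_Rscal by (apply ex_RInt_cont; auto). fold Md. lra. }
 have D2 : Md * (Cmod (x - y) / (e * e)) < 1.
 { apply (Rmult_lt_compat_r (Md + 1)) in Hxy; [|lra]. replace (e * e / (Md + 1) * (Md + 1)) with (e * e) in Hxy by (field; lra).
  replace (Md * (Cmod (x - y) / (e * e))) with (Md * Cmod (x - y) / (e * e)) by (field; lra). apply Rlt_div_l; nra. }
 f_equal. apply IZR_close. rewrite Em, En in D1. replace (2 * PI * IZR m - 2 * PI * IZR n) with (2 * PI * (IZR m - IZR n)) in D1 by ring.
 rewrite Rabs_mult, Rabs_pos_eq in D1 by lra. have P1 : 1 < PI by (have X := PI2_1; lra). nra. }
apply Ceq; [rewrite !Re0; auto|an].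
Qed.

(** Since [a] and [b] lie in one connected part of the complement, [(z - a) / (z - b)] does not wind
    around [O]. On the strip that covers the annulus by [Cexp], its logarithm [L] is therefore
    invariant under [T], and [S = Cexp ((L + q0) / 2)] descends to [O]. *)
Lemma sqrt_branch {O K beta f g a b} : 0 < beta < 1 -> opn O -> boundedC O -> biholo O beta f g -> connectedC K ->
 (forall z, K z -> ~ O z) -> K a -> K b -> exists Phi : C -> C, hol O Phi /\ forall z, O z -> (Phi z * Phi z)%C = ((z - a) / (z - b))%C.
Proof.
intros Hb HO HBd B HK HKO Ha Hbb. have B' := B. destruct B' as [Hf [Hg [Hfa [Hga [Hgf Hfg]]]]]. set (r := (beta + 1) / 2). have Hr : beta < r < 1 by (unfold r; lra).
set (X := fun x => ln beta < x < 0). set (Y := fun _ : R => True). have IX : interval_like X by apply interval_like_oo.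
have IY : interval_like Y by apply interval_like_all. have St : forall z, X (Re z) -> annulus beta (Cexp z).
{ intros z [Z1 Z2]. unfold annulus. rewrite Cmod_Cexp. split.
 - rewrite <- (exp_ln beta) by lra. now apply exp_increasing.
 - rewrite <- exp_0. now apply exp_increasing. }
set (G := fun z => g (Cexp z)). set (G1 := fun z => (C_derive g (Cexp z) * Cexp z)%C). have DG : forall z, X (Re z) -> cder G z (G1 z).
{ intros z Hz. apply (@cder_comp g Cexp); [apply cder_Cexp|]. an. }
have Na : forall x z, K x -> X (Re z) -> (G z - x)%C <> 0.
{ intros x z Kx Hz E. apply (HKO x Kx). replace x with (G z - (G z - x))%C by ring. rewrite E. replace (G z - 0)%C with (G z) by ring. apply Hga, St, Hz. }
have DG1 : forall z, X (Re z) -> exists l, cder G1 z l.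
{ intros z Hz. eexists. apply @cder_mult; [|apply cder_Cexp]. apply @cder_comp; [apply cder_Cexp|]. apply (@hol_cder (annulus beta)); auto. apply hol_derive; auto.
 apply opn_annulus. }
set (lam := fun z => (G1 z / (G z - a) - G1 z / (G z - b))%C). have xr : X (ln r).
{ split; [apply ln_increasing; lra|]. rewrite <- ln_1. apply ln_increasing; lra. }
destruct (@primitive_box X Y lam (ln r) 0) as [L [L0 DL]]; auto; [exact I| |].
{ intros z Hz _. have [l Hl] := DG1 z Hz. eexists. apply @cder_minus; apply @cder_div; auto; try exact Hl.
 - an.
 - an. }
set (T := (Ci * RtoC (2 * PI))%C). have ReT : forall z, Re (z + T) = Re z by (intros z; unfold Re; simpl; ring). have GT : forall z, Cexp (z + T) = Cexp z.
{ intros z. unfold T. replace (2 * PI) with (2 * PI * IZR 1) by ring. apply Cexp_add_period. }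
have LT : forall z, X (Re z) -> L (z + T)%C = L z.
{ have C0 : forall z, X (Re z) -> (L (z + T) - L z)%C = (L ((ln r, 0) + T) - L (ln r, 0%R))%C.
 { intros z Hz. apply (@box_const X Y (fun z => L (z + T) - L z)%C); auto; try exact I. intros v Hv _. eapply cder_eq.
  - apply @cder_minus; [|apply DL; auto; exact I]. apply (@cder_comp L (fun z => z + T)%C v (lam v) 1).
   + an.
   + replace (lam v) with (lam (v + T)%C); [apply DL; [now rewrite ReT|exact I]|]. unfold lam, G, G1. now rewrite GT.
  - ring. }
 (* The increment of [L] over a vertical period is the difference of two winding integrals, one
    about [a] and one about [b]. *)
 have Z : (L ((ln r, 0) + T) - L (ln r, 0%R))%C = 0.
 { replace ((ln r, 0) + T)%C with (ln r, 2 * PI) by (apply Ceq; simpl; ring).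
  rewrite <- (@CInt_FTC (fun y => L (ln r, y)) (fun y => lam (ln r, y) * Ci)%C 0 (2 * PI)).
  - set (d := fun t => (C_derive g (circ 0 r t) * (Ci * (r * cis t)))%C).
   have W : CInt (fun t => d t / (g (circ 0 r t) - a))%C 0 (2 * PI) = CInt (fun t => d t / (g (circ 0 r t) - b))%C 0 (2 * PI) by (apply (@winding_same O K beta r f g a b); auto; lra).
   have Ec : forall t, Cexp (ln r, t) = circ 0 r t.
   { intros t. unfold Cexp, circ; simpl. rewrite exp_ln by lra. ring. }
   have Ec2 : forall t, circ 0 r t = (r * cis t)%C by (intros; unfold circ; ring). have Pc : forall x t, K x -> pcont (fun t => d t / (g (circ 0 r t) - x))%C t.
   { intros x t Kx. have Q : pcont (fun t => G1 (ln r, t) * Ci / (G (ln r, t) - x))%C t.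
    { apply pcont_mult; [apply pcont_mult; [|an]|apply pcont_inv].
     - apply pcont_vline. have [l Hl] := DG1 (ln r, t) xr. an.
     - an.
     - apply pcont_minus; [|an]. apply pcont_vline. an. }
    apply (@pcont_ext (fun t => G1 (ln r, t) * Ci / (G (ln r, t) - x))%C); auto. intros s. unfold G1, G, d. rewrite Ec, <- Ec2. unfold Cdiv. ring. }
   transitivity (CInt (fun t => d t / (g (circ 0 r t) - a) - d t / (g (circ 0 r t) - b))%C 0 (2 * PI)).
   + apply CInt_ext. intros t _. unfold lam, G1, G, d. rewrite Ec, <- Ec2. unfold Cdiv. ring.
   + rewrite CInt_minus by (apply cintg_pcont; intros; apply Pc; auto). rewrite W. ring.
  - intros t _. apply pder_comp; [apply pder_vline|]. apply DL; [an|exact I].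
  - intros t _. apply pcont_mult; [|an]. apply pcont_vline. have [l Hl] := DG1 (ln r, t) xr. apply cder_ccont in Hl.
   apply ccont_minus; apply ccont_mult; auto; (apply ccont_inv; an); apply ccont_minus; apply ccont_const. }
 intros z Hz. specialize (C0 z Hz). rewrite Z in C0. replace (L (z + T)%C) with ((L (z + T) - L z) + L z)%C by ring. rewrite C0. ring. }
set (Q := fun z => ((G z - a) / (G z - b))%C). have Q0 : forall z, X (Re z) -> Q z <> 0.
{ intros z Hz. apply Cmult_neq_0; auto. intros E. apply (f_equal (Cmult (G z - b))) in E. rewrite Cinv_r in E by (apply Na; auto). apply (f_equal Re) in E.
 simpl in E. lra. }
have [q0 [Eq0 _]] := Cexp_surj (Q0 (ln r, 0) xr). set (S := fun z => Cexp (/ 2 * (L z + q0))%C). have SS : forall z, X (Re z) -> (S z * S z)%C = Q z.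
{ intros z Hz. unfold S. rewrite <- Cexp_plus. replace (/ 2 * (L z + q0) + / 2 * (L z + q0))%C with (L z + q0)%C by field.
 have Kc : (Cexp (L z + q0) / Q z)%C = (Cexp (L (ln r, 0%R) + q0) / Q (ln r, 0%R))%C.
 { apply (@box_const X Y (fun z => Cexp (L z + q0) / Q z)%C); auto; try exact I. intros v Hv _.
  have DQ : cder Q v ((G1 v * (G v - b) - (G v - a) * G1 v) / ((G v - b) * (G v - b)))%C.
  { apply (@cder_div (fun z => G z - a)%C (fun z => G z - b)%C); auto.
   - an.
   - an. }
  eapply cder_eq.
  - apply @cder_div; [an| |an]. apply @cder_comp; [|apply cder_Cexp]. apply @cder_plus; [apply DL; auto; exact I|an].
  - unfold lam, Q. field. auto. }
 rewrite L0 in Kc. replace (0 + q0)%C with q0 in Kc by ring. rewrite Eq0 in Kc. replace (Cexp (L z + q0)) with (Cexp (L z + q0) / Q z * Q z)%C by (field; auto).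
 rewrite Kc. field; auto. }
have ST : forall z (m : Z), X (Re z) -> S (z + Ci * RtoC (2 * PI * IZR m))%C = S z.
{ have Sn : forall z (n : nat), X (Re z) -> S (z + Ci * RtoC (2 * PI * INR n))%C = S z.
 { intros z n Hz. induction n.
  - f_equal. rewrite Rmult_0_r. ring.
  - rewrite S_INR.
   replace (z + Ci * RtoC (2 * PI * (INR n + 1)))%C with ((z + Ci * RtoC (2 * PI * INR n)) + T)%C by (unfold T; rewrite Rmult_plus_distr_l, RtoC_plus, Rmult_1_r; ring).
   unfold S. rewrite LT; auto. replace (Re (z + Ci * RtoC (2 * PI * INR n))) with (Re z) by (unfold Re; simpl; ring). auto. }
 intros z m Hz. have [h|h] := Z.le_gt_cases 0 m.
 - rewrite <- (Z2Nat.id m) by auto. rewrite <- INR_IZR_INZ. auto.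
 - set (n := Z.to_nat (- m)). rewrite <- (Sn (z + Ci * RtoC (2 * PI * IZR m))%C n).
  + f_equal. unfold n. rewrite INR_IZR_INZ, Z2Nat.id, opp_IZR by lia. replace (2 * PI * - IZR m) with (- (2 * PI * IZR m)) by ring. rewrite RtoC_opp. ring.
  + replace (Re (z + Ci * RtoC (2 * PI * IZR m))) with (Re z) by (unfold Re; simpl; ring). auto. }
have F0 : forall z, O z -> f z <> 0 by (intros; apply (@annulus_neq_0 beta); auto; lra). have LG : forall z, exists y, O z -> Cexp y = f z.
{ intros z. have [Hz|Nz] := classic (O z).
 - have [y [Hy _]] := Cexp_surj (F0 z Hz). now exists y.
 - exists 0%C. intros; contradiction. }
(* A logarithm of [f z] chosen point by point, without continuity. [S] being periodic, near each
   point it may be exchanged for a holomorphic branch. *)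
set (lg := fun z => proj1_sig (constructive_indefinite_description _ (LG z))). have Hlg : forall z, O z -> Cexp (lg z) = f z.
{ intros z. unfold lg. destruct (constructive_indefinite_description _ (LG z)); auto. }
have XR : forall z y, O z -> Cexp y = f z -> X (Re y).
{ intros z y Hz Hy. have M := Cmod_Cexp y. rewrite Hy in M. have [A1 A2] := Hfa z Hz. rewrite M in A1, A2.
 split; apply exp_lt_inv; [rewrite exp_ln by lra|rewrite exp_0]; auto. }
exists (fun z => S (lg z)). split.
- intros z1 Hz1. have [P [rr [Hrr [P1 HP]]]] := Clog_local (F0 z1 Hz1) (Hlg z1 Hz1). have [r1 [Hr1 K1]] := HO z1 Hz1. have [r2 [Hr2 K2]] := hol_ccont Hf Hz1 rr Hrr.
 eexists. apply cder_derive. apply cder_ext with (fun z => S (P (f z))).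
 + exists (Rmin r1 r2); split; [an|]. intros w Hw. have Ow : O w by (apply K1; eapply Rlt_le_trans; [exact Hw|an]). have Fw := K2 w ltac:(lra).
  have [E1 _] := HP (f w) Fw. destruct (@Cexp_period (P (f w)) (lg w)) as [m Em].
  { rewrite E1. symmetry. an. }
  rewrite Em. apply ST. eapply XR; [exact Ow|an].
 + have Z1 : Cmod (f z1 - f z1) < rr by (replace (f z1 - f z1)%C with (RtoC 0) by ring; now rewrite Cmod_0). have [E1 D1] := HP (f z1) Z1. apply @cder_comp.
  * an.
  * unfold S. apply @cder_comp; [|apply cder_Cexp]. apply cder_scal. apply @cder_plus; [apply DL; [|exact I]|an]. eapply XR; [exact Hz1|an].
- intros z Hz. rewrite SS by (eapply XR; [exact Hz|an]). unfold Q, G. rewrite Hlg by auto. now rewrite Hgf.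
Qed.

(** * Growth of the factor at the inner component *)
Lemma le_div {a b c} : 0 < c -> a * c <= b -> a <= b / c.
Proof. intros. apply (proj1 (Rle_div_r a b c (Rlt_gt _ _ H))); auto. Qed.

Lemma div_le {a b c} : 0 < c -> a <= b * c -> a / c <= b.
Proof. intros. apply (proj2 (Rle_div_l a b c (Rlt_gt _ _ H))); auto. Qed.

Lemma lt_div {a b c} : 0 < c -> a * c < b -> a < b / c.
Proof. intros. apply (proj1 (Rlt_div_r a b c (Rlt_gt _ _ H))); auto. Qed.

Lemma div_lt {a b c} : 0 < c -> a < b * c -> a / c < b.
Proof. intros. apply (proj2 (Rlt_div_l a b c (Rlt_gt _ _ H))); auto. Qed.

Definition growth_on (O S : C -> Prop) (u : C -> R) (gm : R) : Prop :=
  forall M, exists del, 0 < del /\ forall z y, O z -> boundaryC O y -> S y ->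
    (forall w, Cmod (w - z) < Cmod (z - y) -> O w) -> Cmod (z - y) < del ->
    gm * - ln (Cmod (z - y)) + M <= u z.

(* The subsolution is the metric of a punctured disc pulled back by [Phi + Phi z0], damped by
   a power of [|Phi'|]; it is finite at the inner component because [- Phi z0] is an exterior
   value of the square root. *)
Lemma growth_barrier {rho D} m {th} : 0 < rho -> 0 < D -> 0 <= th < 1 -> exists Cc X0, forall (O : C -> Prop) (u : C -> R) (a b : C) (Phi : C ->
 C) (z0 : C), opn O -> boundedC O -> hyperbolic_factor O u -> hol O Phi -> (forall z, O z -> (Phi z * Phi z)%C = ((z - a) / (z - b))%C) -> (forall z, O z ->
 - m <= u z) -> (forall z, O z -> Cmod (z - b) <= D) -> ~ O a -> ~ O b -> 2 * rho <= Cmod (a - b) <= D -> (forall M, exists del, 0 < del /\ forall z, O z ->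
 Cmod (z - a) < del -> th / 2 * - ln (Cmod (z - a)) + M <= u z) -> O z0 -> X0 <= - ln (Cmod (z0 - a)) ->
 (1 + th) / 2 * - ln (Cmod (z0 - a)) - ln (1 + / 2 * - ln (Cmod (z0 - a)) + / 2 * ln D) - Cc <= u z0.
Proof.
intros Hrho HD Hth. set (q1 := rho / (2 * D)). have q1p : 0 < q1 by (apply Rdiv_lt_0_compat; lra).
set (E1 := - ln (/ 2) - / 2 * ln q1 + th * (Rabs (ln (D / 2)) + / 2 * Rabs (ln q1) + 2 * Rabs (ln rho))). set (C := Rabs (E1 + m) + Rabs (ln (rho / (D * D)))).
exists (C + ln 2 - / 2 * ln rho - th * (ln rho - / 2 * ln D - ln D)), (Rabs (ln (rho * rho / (8 * D))) + Rabs (ln rho) + 1).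
intros O u a b Phi z0 HO HBd Hu HPhi Hsq Hm HDb Na Nb Hab Hgr Hz0 HX0. have Hu' := Hu. destruct Hu' as [HC [HL Hinf]]. have za : forall z, O z -> 0 < Cmod (z - a).
{ intros z Hz. apply Cmod_gt_0. intros E. apply Na. replace a with (z - (z - a))%C by ring. rewrite E. replace (z - 0)%C with z by ring; auto. }
have zb : forall z, O z -> 0 < Cmod (z - b).
{ intros z Hz. apply Cmod_gt_0. intros E. apply Nb. replace b with (z - (z - b))%C by ring. rewrite E. replace (z - 0)%C with z by ring; auto. }
have zb0 : forall z, O z -> (z - b)%C <> 0 by (intros; apply Cmod_gt_0; auto). have Msq : forall z, O z -> Cmod (Phi z) * Cmod (Phi z) = Cmod (z - a) / Cmod (z - b).
{ intros z Hz. rewrite <- Cmod_mult, Hsq, Cmod_div by auto. lra. }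
have P0 : forall z, O z -> 0 < Cmod (Phi z).
{ intros z Hz. have X := Msq z Hz. have Y := Rdiv_lt_0_compat _ _ (za z Hz) (zb z Hz). have [E|E] := Req_dec (Cmod (Phi z)) 0; [rewrite E in X|]; lra. }
have LPhi : forall z, O z -> ln (Cmod (Phi z)) = / 2 * (ln (Cmod (z - a)) - ln (Cmod (z - b))).
{ intros z Hz. rewrite <- ln_div, <- Msq, ln_mult by auto. lra. }
have DPhi : forall z, O z -> (2 * (Phi z * C_derive Phi z))%C = ((a - b) / ((z - b) * (z - b)))%C.
{ intros z Hz. apply (@cder_unique (fun w => Phi w * Phi w)%C z).
 - eapply cder_eq; [apply @cder_mult; eapply hol_cder; eauto|ring].
 - apply cder_ext with (fun w => (w - a) / (w - b))%C.
  + have [r [Hr K]] := HO z Hz. exists r; split; auto. intros w Hw. symmetry; auto.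
  + an. }
have MD : forall z, O z -> Cmod (C_derive Phi z) = Cmod (a - b) / (2 * Cmod (Phi z) * (Cmod (z - b) * Cmod (z - b))).
{ intros z Hz. have X := f_equal Cmod (DPhi z Hz). rewrite Cmod_div, !Cmod_mult, Cmod_R, Rabs_pos_eq in X by (try lra; apply Cmult_neq_0; auto). have Y := P0 z Hz.
 have Z := zb z Hz. apply Rmult_eq_reg_l with (2 * Cmod (Phi z)); [|lra]. rewrite Rmult_assoc, X. field. lra. }
have MD0 : forall z, O z -> 0 < Cmod (C_derive Phi z).
{ intros z Hz. rewrite MD by auto. have Y := P0 z Hz. have Z := zb z Hz. lra. }
have LD : forall z, O z -> ln (Cmod (C_derive Phi z)) = ln (Cmod (a - b) / 2) - ln (Cmod (Phi z)) - 2 * ln (Cmod (z - b)).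
{ intros z Hz. have Y := P0 z Hz. have Z := zb z Hz. rewrite MD by auto.
 replace (Cmod (a - b) / (2 * Cmod (Phi z) * (Cmod (z - b) * Cmod (z - b)))) with (Cmod (a - b) / 2 / Cmod (Phi z) / (Cmod (z - b) * Cmod (z - b))) by (field; lra).
 rewrite ln_div, ln_div, ln_mult; try nra. lra. }
have LabU : ln (Cmod (a - b) / 2) <= ln (D / 2) by (apply ln_mono; lra). have LabL : ln rho <= ln (Cmod (a - b) / 2) by (apply ln_mono; lra).
(* [X0] places [z0] so close to [a] that [|Phi z0|] is at most half of [|Phi z|] wherever
   [|z - a| > rho / 2]. *)
have Z1 : ln (Cmod (z0 - a)) < ln rho /\ ln (Cmod (z0 - a)) < ln (rho * rho / (8 * D)).
{ have A1 := Rle_abs (- ln rho). rewrite Rabs_Ropp in A1. have A3 := Rle_abs (- ln (rho * rho / (8 * D))). rewrite Rabs_Ropp in A3. lra. }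
have z0r : Cmod (z0 - a) < rho by (apply ln_lt_inv; auto; apply Z1). have z0q : Cmod (z0 - a) < rho * rho / (8 * D).
{ apply ln_lt_inv; auto; [|an]. lra. }
set (O' := fun z => O z /\ Cmod (z - a) < rho). have HO' : opn O'.
{ intros z [Hz Hs]. have [r [Hr K]] := HO z Hz. exists (Rmin r (rho - Cmod (z - a))). split; [an|]. intros w Hw. have M1 := Rmin_l r (rho - Cmod (z - a)).
 have M2 := Rmin_r r (rho - Cmod (z - a)). split; [apply K; lra|]. have T := Cmod_tri w z a. lra. }
have sub : forall z, O' z -> O z by (intros z [H _]; exact H). have zbr : forall z, Cmod (z - a) < rho -> rho <= Cmod (z - b).
{ intros z Hz. have T := Cmod_tri a z b. rewrite (Cmod_minus_sym a z) in T. lra. }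
have Ple1 : forall z, O' z -> Cmod (Phi z) <= 1.
{ intros z [Hz Hr]. have X := Msq z Hz. have Y := zbr z Hr. assert (Cmod (z - a) / Cmod (z - b) <= 1) by (apply Rle_div_l; lra). nra. }
have Oz0 : O' z0 by (split; auto). set (Ps := fun z => (Phi z + Phi z0)%C). have Ps0 : forall z, O z -> Ps z <> 0.
(* A zero would give equal squares of [Phi] at [z] and [z0]; the Moebius map is injective, so
   [z = z0] and [Phi z0 = 0], which the positive distance of [z0] to [a] forbids. *)
{ intros z Hz E. unfold Ps in E. have X : (Phi z * Phi z)%C = (Phi z0 * Phi z0)%C.
 { replace (Phi z) with ((Phi z + Phi z0) - Phi z0)%C by ring. rewrite E. ring. }
 rewrite !Hsq in X by auto. have Y : ((z - z0) * (a - b))%C = 0.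
 { replace ((z - z0) * (a - b))%C with (((z - a) / (z - b) - (z0 - a) / (z0 - b)) * ((z - b) * (z0 - b)))%C by (field; auto). rewrite X. ring. }
 assert (z = z0).
 { apply Cmod_sub_0. apply (f_equal Cmod) in Y. rewrite Cmod_mult, Cmod_0 in Y. nra. }
 subst z. have Q := P0 z0 Hz0. assert (Phi z0 = 0).
 { replace (Phi z0) with (/ 2 * (Phi z0 + Phi z0))%C by field. rewrite E. ring. }
 rewrite H, Cmod_0 in Q. lra. }
have PsL : forall z, O' z -> Cmod (z - z0) * rho / (D * D) <= Cmod (Ps z).
{ intros z Hz'. have Hz := sub z Hz'. have X : (Ps z * (Phi z - Phi z0))%C = ((z - z0) * (a - b) / ((z - b) * (z0 - b)))%C.
 { transitivity (Phi z * Phi z - Phi z0 * Phi z0)%C; [unfold Ps; ring|]. rewrite !Hsq by auto. field; auto. }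
 apply (f_equal Cmod) in X. rewrite Cmod_div, !Cmod_mult in X by (apply Cmult_neq_0; auto). have Y : Cmod (Phi z - Phi z0) <= 2.
 { eapply Rle_trans; [apply Cmod_triangle|]. rewrite Cmod_opp. have A1 := Ple1 z Hz'. have A2 := Ple1 z0 Oz0. lra. }
 have W : Cmod (z - z0) * Cmod (a - b) / (D * D) <= Cmod (z - z0) * Cmod (a - b) / (Cmod (z - b) * Cmod (z0 - b)).
 { apply Rmult_le_compat_l; [an|]. have B1 := zb z Hz. have B2 := zb z0 Hz0. have B3 := HDb z Hz. have B4 := HDb z0 Hz0. apply Rinv_le_contravar; nra. }
 have Q := Cmod_ge_0 (Ps z). have V : Cmod (z - z0) * (2 * rho) / (D * D) <= Cmod (z - z0) * Cmod (a - b) / (D * D).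
 { apply Rmult_le_compat_r; [apply Rlt_le, Rinv_0_lt_compat; nra|]. an. }
 nra. }
have PsU : forall z, O' z -> ln (Cmod (Ps z)) <= ln 2.
{ intros z Hz'. apply ln_mono; [apply Cmod_pos, Ps0, sub; auto|]. eapply Rle_trans; [apply Cmod_triangle|]. have A1 := Ple1 z Hz'. have A2 := Ple1 z0 Oz0. lra. }
(* [s] is [ln (2 e / |Ps|)]: the punctured disc has radius [2 e], and [|Ps| <= 2] on [O'] gives
   [s >= 1]. *)
set (s := fun z => 1 + ln 2 - ln (Cmod (Ps z))). have s1 : forall z, O' z -> 1 <= s z by (intros z Hz; specialize (PsU z Hz); unfold s; lra).
set (W := fun z => (th * ln (Cmod (C_derive Phi z)) + - C) + (fun x => - x - ln (1 + ln 2 - x)) (ln (Cmod (Ps z)))).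
have WU : forall z, O' z -> W z <= th * ln (Cmod (C_derive Phi z)) - C - ln (Cmod (Ps z)).
{ intros z Hz. have X := s1 z Hz. unfold W. fold (s z). assert (0 <= ln (s z)) by (rewrite <- ln_1; apply ln_mono; lra). lra. }
have HolPs : hol O Ps /\ forall z, O z -> C_derive Ps z = C_derive Phi z.
{ have X : forall z, O z -> cder Ps z (C_derive Phi z).
 { intros z Hz. eapply cder_eq; [apply @cder_plus; an|ring]. }
 split; [eapply hol_intro; exact X|]. intros z Hz. apply cder_C_derive; auto. }
destruct HolPs as [HolPs DPs]. have DPhi0 : forall z, O z -> C_derive Phi z <> 0 by (intros; apply Cmod_gt_0; auto).
have HolD : hol O (C_derive Phi) by (apply hol_derive; auto).
have LapW : has_lap O' W (fun z => th * 0 + / (s z * s z) * (Cmod (C_derive Ps z / Ps z) * Cmod (C_derive Ps z / Ps z))).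
{ apply has_lap_plus.
 - apply has_lap_affine. apply has_lap_ln; auto. apply (@hol_sub O); auto.
 - apply (@has_lap_ln_comp O' Ps (fun x => - x - ln (1 + ln 2 - x)) (fun x => - 1 + / (1 + ln 2 - x)) (fun x => / ((1 + ln 2 - x) * (1 + ln 2 - x)))); auto.
  + apply (@hol_sub O); auto.
  + intros z Hz x. have X := s1 z Hz. unfold s in X. fold x in X. split.
   * auto_derive; [lra|]. field. lra.
   * auto_derive; [lra|]. field. lra. }
have Sub : forall z, O' z -> exp (2 * W z) <= th * 0 + / (s z * s z) * (Cmod (C_derive Ps z / Ps z) * Cmod (C_derive Ps z / Ps z)).
{ intros z Hz'. have Hz := sub z Hz'. rewrite DPs by auto. have S1 := s1 z Hz'. have p0 := Cmod_pos (Ps0 z Hz). rewrite Cmod_div by (apply Ps0; auto).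
 have E : exp (2 * W z) = exp (2 * (th * ln (Cmod (C_derive Phi z)) + - C)) * / (s z * s z) * / (Cmod (Ps z) * Cmod (Ps z)).
 { unfold W. fold (s z).
  replace (2 * (th * ln (Cmod (C_derive Phi z)) + - C + (- ln (Cmod (Ps z)) - ln (s z)))) with (2 * (th * ln (Cmod (C_derive Phi z)) + - C) + (- (ln (s z) + ln (s z)) + - (ln (Cmod (Ps z)) + ln (Cmod (Ps z))))) by ring.
  rewrite exp_plus, exp_plus, !exp_Ropp, !exp_plus, !exp_ln by lra. lra. }
 (* Damping replaces [|Phi'|] by [|Phi'|^th]. Since [|Phi'|] is bounded below on [O'] by
    [rho / (D * D)], the constant [C] makes the damped density no larger than the original one. *)
 rewrite E. have F : exp (2 * (th * ln (Cmod (C_derive Phi z)) + - C)) <= Cmod (C_derive Phi z) * Cmod (C_derive Phi z).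
 { rewrite <- (exp_ln (Cmod (C_derive Phi z))) at 2 3 by auto. rewrite <- exp_plus. have L1 : ln (rho / (D * D)) <= ln (Cmod (C_derive Phi z)).
  { apply ln_mono; [an|]. rewrite MD by auto. have A1 := Ple1 z Hz'. have A2 := P0 z Hz. have A3 := HDb z Hz. have A4 := zb z Hz.
   have A8 : 0 < 2 * Cmod (Phi z) * (Cmod (z - b) * Cmod (z - b)) by lra. apply (proj1 (Rle_div_r (rho / (D * D)) (Cmod (a - b)) _ (Rlt_gt _ _ A8))).
   have A5 : Cmod (z - b) * Cmod (z - b) / (D * D) <= 1 by (apply Rle_div_l; nra). have A7 : Cmod (Phi z) * (Cmod (z - b) * Cmod (z - b) / (D * D)) <= 1 by nra. nra. }
  have L2 := Rle_abs (- ln (rho / (D * D))). rewrite Rabs_Ropp in L2. have L4 := Rabs_pos (ln (rho / (D * D))).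
  destruct (Rle_lt_or_eq_dec (2 * (th * ln (Cmod (C_derive Phi z)) + - C)) (ln (Cmod (C_derive Phi z)) + ln (Cmod (C_derive Phi z)))) as [h|h].
  - unfold C. assert ((1 - th) * ln (Cmod (C_derive Phi z)) >= - Rabs (ln (rho / (D * D)))) by nra. lra.
  - left. now apply exp_increasing.
  - rewrite h. lra. }
 replace (th * 0 + / (s z * s z) * (Cmod (C_derive Phi z) / Cmod (Ps z) * (Cmod (C_derive Phi z) / Cmod (Ps z)))) with (Cmod (C_derive Phi z) * Cmod (C_derive Phi z) * / (s z * s z) * / (Cmod (Ps z) * Cmod (Ps z))) by (field; lra).
 apply Rmult_le_compat_r; [apply Rlt_le, Rinv_0_lt_compat; nra|]. apply Rmult_le_compat_r; [apply Rlt_le, Rinv_0_lt_compat; nra|]. lra. }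
have Main : W z0 <= u z0.
{ apply Rnot_lt_le. intros L. destruct (@sup_attained O' (fun z => W z - u z) z0 0) as [zs [Hzs [Hge Hmax]]]; auto; [|lra| |].
 - destruct HBd as [Mb HMb]. exists Mb. intros z Hz; auto.
 - intros l Hl. have [Ol|Nl] := classic (O' l).
  { left. split; auto. apply ccont_Rminus; [|eapply ccont_u; eauto]. unfold W.
   apply ccont_ext with (fun z => (th * RtoC (ln (Cmod (C_derive Phi z))) + RtoC (- C)) + RtoC ((fun x => (- x - ln (1 + ln 2 - x))%R) (ln (Cmod (Ps z)))))%C.
   { exists 1; split; [lra|]. intros. now rewrite !RtoC_plus, RtoC_mult. }
   apply ccont_plus.
   - apply ccont_plus; [|an]. apply ccont_mult; [an|]. apply ccont_ln_mod; an.
   - apply (@ccont_R (fun x => - x - ln (1 + ln 2 - x)) (fun z => ln (Cmod (Ps z)))).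
    + apply ccont_ln_mod; an.
    + apply (ex_derive_continuous (V := R_NormedModule)). auto_derive. have X := s1 l Ol. unfold s in X. lra. }
  (* Three kinds of limit points. Away from [a], [W] is below [- m] and hence below [u]. At a
     complementary point near but different from [a], [W] is bounded while [u] tends to infinity. At
     [a] itself, [W] grows like [th / 2] times [- ln |z - a|], which is the hypothesis on [u]. *)
  right. have [far|close] := Rlt_dec (rho / 2) (Cmod (l - a)).
  + exists (Cmod (l - a) - rho / 2); split; [lra|]. intros z Hz' Hzl. have Hz := sub z Hz'. have zfar : rho / 2 < Cmod (z - a).
   { have T := Cmod_tri l z a. rewrite (Cmod_minus_sym l z) in T. lra. }
   have X := WU z Hz'. have Y := Hm z Hz. have A1 : q1 <= Cmod (Phi z) * Cmod (Phi z).
   { rewrite Msq by auto. apply le_div; auto. have A := HDb z Hz. apply Rle_trans with (rho / (2 * D) * D); [apply Rmult_le_compat_l; [fold q1|]; lra|].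
    replace (rho / (2 * D) * D) with (rho / 2) by (field; lra). lra. }
   have A2 : Cmod (Phi z0) * Cmod (Phi z0) <= q1 / 4.
   { rewrite Msq by auto. apply div_le; auto. have A := zbr z0 z0r. apply Rle_trans with (q1 / 4 * rho); [|an].
    replace (q1 / 4 * rho) with (rho * rho / (8 * D)) by (unfold q1; field; lra). lra. }
   have A3 := P0 z Hz. have A5 : Cmod (Phi z0) <= Cmod (Phi z) / 2 by (apply Rnot_lt_le; intros Lt; nra). have A6 : Cmod (Phi z) / 2 <= Cmod (Ps z).
   { unfold Ps. have T := Cmod_rev_tri (Phi z) (- Phi z0). rewrite Cmod_opp in T. replace (Phi z - - Phi z0)%C with (Phi z + Phi z0)%C in T by ring. lra. }
   have A7 : ln (Cmod (Phi z)) >= / 2 * ln q1.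
   { apply ln_mono in A1; auto. rewrite ln_mult in A1 by auto. lra. }
   have A8 : ln (/ 2) + / 2 * ln q1 <= ln (Cmod (Ps z)).
   { apply Rle_trans with (ln (Cmod (Phi z) / 2)); [|apply ln_mono; lra]. unfold Rdiv. rewrite ln_mult by lra. lra. }
   have A9 : ln (Cmod (C_derive Phi z)) <= Rabs (ln (D / 2)) + / 2 * Rabs (ln q1) + 2 * Rabs (ln rho).
   { rewrite LD by auto. have B2 := Rle_abs (- ln q1). rewrite Rabs_Ropp in B2. have B3 := Rle_abs (- ln rho). rewrite Rabs_Ropp in B3.
    have B4 : ln rho <= ln (Cmod (z - b)) by (apply ln_mono; auto; apply zbr, Hz'). lra. }
   have A10 : th * ln (Cmod (C_derive Phi z)) <= th * (Rabs (ln (D / 2)) + / 2 * Rabs (ln q1) + 2 * Rabs (ln rho)) by lra. unfold C, E1 in *. lra.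
  + have NOl : ~ O l by (intros Ol; apply Nl; split; auto; lra). have lz0 : 0 < Cmod (l - z0).
   { apply Cmod_gt_0. intros E. apply NOl. replace l with ((l - z0) + z0)%C by ring. rewrite E. replace (0 + z0)%C with z0 by ring; auto. }
   set (Bq := - ln (Cmod (l - z0) / 2 * rho / (D * D)) + th * (ln (D / 2) - 3 / 2 * ln rho) - C).
   have WB : forall z, O' z -> Cmod (z - l) < Cmod (l - z0) / 2 -> W z <= th / 2 * - ln (Cmod (z - a)) + Bq.
   { intros z Hz' Hzl. have X := WU z Hz'. have A1 : Cmod (l - z0) / 2 <= Cmod (z - z0).
    { have T := Cmod_tri l z z0. rewrite (Cmod_minus_sym l z) in T. lra. }
    have A3 : ln (Cmod (l - z0) / 2 * rho / (D * D)) <= ln (Cmod (Ps z)).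
    { apply ln_mono; [an|]. eapply Rle_trans; auto. apply Rmult_le_compat_r; [apply Rlt_le, Rinv_0_lt_compat; nra|]. an. }
    have B4 : ln rho <= ln (Cmod (z - b)) by (apply ln_mono; auto; apply zbr, Hz').
    have A4 : ln (Cmod (C_derive Phi z)) <= / 2 * - ln (Cmod (z - a)) + (ln (D / 2) - 3 / 2 * ln rho).
    { rewrite LD, LPhi by auto. lra. }
    have A5 : th * ln (Cmod (C_derive Phi z)) <= th * (/ 2 * - ln (Cmod (z - a)) + (ln (D / 2) - 3 / 2 * ln rho)) by lra. unfold Bq. lra. }
   have [Ea|Ea] := Req_dec (Cmod (l - a)) 0.
   * assert (l = a) by (apply Cmod_sub_0; lra). subst l. have [d [Hd K]] := Hgr Bq. exists (Rmin d (Cmod (a - z0) / 2)); split; [an|]. intros z Hz' Hzl.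
    have M1 := Rmin_l d (Cmod (a - z0) / 2). have M2 := Rmin_r d (Cmod (a - z0) / 2). specialize (K z (sub z Hz') ltac:(lra)). specialize (WB z Hz' ltac:(lra)). lra.
   * have [d [Hd K]] := Hinf (th / 2 * - ln (Cmod (l - a) / 2) + Bq). have bl : boundaryC O l.
    { apply closure_boundary; auto. intros e He. have [w [Ww Ww']] := Hl e He. exists w; auto. }
    exists (Rmin d (Rmin (Cmod (l - z0) / 2) (Cmod (l - a) / 2))); split; [an|]. intros z Hz' Hzl. have M1 := Rmin_l d (Rmin (Cmod (l - z0) / 2) (Cmod (l - a) / 2)).
    have M2 := Rmin_r d (Rmin (Cmod (l - z0) / 2) (Cmod (l - a) / 2)). have M3 := Rmin_l (Cmod (l - z0) / 2) (Cmod (l - a) / 2).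
    have M4 := Rmin_r (Cmod (l - z0) / 2) (Cmod (l - a) / 2). specialize (K z (sub z Hz') ltac:(exists l; split; auto; lra)). specialize (WB z Hz' ltac:(lra)).
    have A1 : Cmod (l - a) / 2 <= Cmod (z - a).
    { have T := Cmod_tri l z a. rewrite (Cmod_minus_sym l z) in T. lra. }
    have A2 : ln (Cmod (l - a) / 2) <= ln (Cmod (z - a)) by (apply ln_mono; lra). have A3 : th / 2 * - ln (Cmod (z - a)) <= th / 2 * - ln (Cmod (l - a) / 2) by lra.
    lra.
 - have X := max_lap HO' LapW (has_lap_sub sub (has_lap_C2 HC)) Hzs Hmax. rewrite HL in X by auto. have Y := Sub zs Hzs.
  have Z : exp (2 * W zs) <= exp (2 * u zs) by lra. apply exp_le_inv in Z. lra. }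
(* At [z0] the term [- ln |Ps|] contributes one half of [- ln |z0 - a|], and [th * ln |Phi'|] a
   further [th / 2] of it: the rate improves from [th / 2] to [(1 + th) / 2], up to a double
   logarithm. *)
eapply Rle_trans; [|exact Main]. have E2 : Ps z0 = (2 * Phi z0)%C by (unfold Ps; ring). unfold W.
rewrite E2, Cmod_mult, Cmod_R, Rabs_pos_eq, ln_mult, LD by (auto; lra). rewrite LPhi by auto. set (X := - ln (Cmod (z0 - a))).
have B1 : ln (Cmod (z0 - b)) <= ln D by (apply ln_mono; auto). have B2 : ln rho <= ln (Cmod (z0 - b)) by (apply ln_mono; auto; now apply zbr).
replace (ln (Cmod (z0 - a))) with (- X) by (unfold X; ring). have A0 : 0 < 1 + ln 2 - (ln 2 + / 2 * (- X - ln (Cmod (z0 - b)))).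
{ unfold X. lra. }
have A1 : ln (1 + ln 2 - (ln 2 + / 2 * (- X - ln (Cmod (z0 - b))))) <= ln (1 + / 2 * X + / 2 * ln D) by (apply ln_mono; lra).
have A2 : th * (ln rho - / 2 * ln D - ln D + / 2 * X) <= th * (ln (Cmod (a - b) / 2) - / 2 * (- X - ln (Cmod (z0 - b))) - 2 * ln (Cmod (z0 - b))) by lra. lra.
Qed.

Lemma ln_sublinear {k} c M : 0 < k -> exists X1, forall X, X1 <= X -> 0 < 1 + / 2 * X + c /\ ln (1 + / 2 * X + c) + M <= k * X.
Proof.
intros Hk. exists (Rmax (2 * (Rabs c)) ((k * (1 + c) - 1 - ln k + M) / (k / 2))). intros X HX.
have A1 := Rmax_l (2 * (Rabs c)) ((k * (1 + c) - 1 - ln k + M) / (k / 2)). have A2 := Rmax_r (2 * (Rabs c)) ((k * (1 + c) - 1 - ln k + M) / (k / 2)).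
have A3 := Rle_abs (- c). rewrite Rabs_Ropp in A3. have P : 0 < 1 + / 2 * X + c by lra. have L : ln (k * (1 + / 2 * X + c)) <= k * (1 + / 2 * X + c) - 1.
{ have Y := exp_ineq1_le (ln (k * (1 + / 2 * X + c))). rewrite exp_ln in Y; [lra|]. lra. }
rewrite ln_mult in L by auto. have Q : (k * (1 + c) - 1 - ln k + M) / (k / 2) * (k / 2) <= X * (k / 2) by lra.
replace ((k * (1 + c) - 1 - ln k + M) / (k / 2) * (k / 2)) with (k * (1 + c) - 1 - ln k + M) in Q by (field; lra). lra.
Qed.

Lemma ln_large X : exists del, 0 < del /\ forall d, 0 < d < del -> X <= - ln d.
Proof. exists (exp (- X)). split; [an|]. intros d [H1 H2]. apply ln_increasing in H2; auto. rewrite ln_exp in H2. lra. Qed.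

(** Two uses of the barrier suffice for each [gm]: [th = 0] gives every rate below one half, in
    particular [gm / 2], which is what [th = gm] requires; the second use gives the rate
    [(1 + gm) / 2], larger than [gm]. The surplus [(1 - gm) / 2] absorbs the logarithmic terms both
    times. *)
Lemma growth_inner {O K beta gm f g u b1 b2} : 0 < beta < 1 -> opn O -> boundedC O -> biholo O beta f g ->
 hyperbolic_factor O u -> connectedC K -> (forall z, K z -> ~ O z) -> K b1 -> K b2 -> b1 <> b2 -> 0 < gm < 1 -> growth_on O K u gm.
Proof.
intros Hb HO HBd B Hu HK HKO K1 K2 H12 Hgm. have [m Hm] := factor_lower_bound HBd Hu. have HBd' := HBd. destruct HBd' as [MB HMB]. have Hu' := Hu.
destruct Hu' as [_ [_ Hinf]]. have p12 : 0 < Cmod (b1 - b2).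
{ apply Cmod_gt_0. intros E. apply H12. apply Cmod_sub_0. rewrite E, Cmod_0. lra. }
set (rho := Cmod (b1 - b2) / 4). set (D := Rabs MB + Rabs MB + Cmod b1 + Cmod b2 + Cmod b1 + Cmod b2 + 1). have HD : 0 < D by (unfold D; lra).
have [C0 [X0 G0]] := @growth_barrier rho D m 0 ltac:(unfold rho; lra) HD ltac:(lra).
have [C1 [X1 G1]] := @growth_barrier rho D m gm ltac:(unfold rho; lra) HD ltac:(lra).
(* One of [b1], [b2] is at distance at least [|b1 - b2| / 2] from [a]. Hence [rho] and [D], and with
   them the constants of the barrier, do not depend on [a]. *)
have pick : forall a, K a -> boundaryC O a -> exists b, K b /\ 2 * rho <= Cmod (a - b) <= D /\ forall z, O z -> Cmod (z - b) <= D.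
{ intros a Ka [Ca _]. have Ba : Cmod a <= MB + 1.
 { have [w [Ow Hw]] := Ca 1 ltac:(lra). have T := HMB w Ow. have T2 := Cmod_rev_tri a w. rewrite Cmod_minus_sym in T2. lra. }
 have S : forall x b, Cmod (x - b) <= Cmod x + Cmod b.
 { intros x b. eapply Rle_trans; [apply Cmod_triangle|]. rewrite Cmod_opp. lra. }
 have [h|h] := Rle_dec (2 * rho) (Cmod (a - b1)).
 - exists b1. split; [auto|split].
  + specialize (S a b1). unfold D. lra.
  + intros z Hz. specialize (S z b1). specialize (HMB z Hz). unfold D; lra.
 - exists b2. split; [auto|split; [split|]].
  + have T := Cmod_tri b1 a b2. rewrite (Cmod_minus_sym b1 a) in T. unfold rho in *. lra.
  + specialize (S a b2). unfold D. lra.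
  + intros z Hz. specialize (S z b2). specialize (HMB z Hz). unfold D; lra. }
have dz : forall a z, ~ O a -> O z -> 0 < Cmod (z - a).
{ intros a z Na Hz. apply Cmod_gt_0. intros E. apply Na. replace a with (z - (z - a))%C by ring. rewrite E. replace (z - 0)%C with z by ring; auto. }
have Step0 : forall a, K a -> boundaryC O a -> forall M, exists del, 0 < del /\ forall z, O z -> Cmod (z - a) < del -> gm / 2 * - ln (Cmod (z - a)) + M <= u z.
{ intros a Ka Ba M. have [b [Kb [Hab HDb]]] := pick a Ka Ba. have [Phi [HPhi Hsq]] := sqrt_branch Hb HO HBd B HK HKO Ka Kb.
 have [X2 HX2] := @ln_sublinear ((1 - gm) / 2) (/ 2 * ln D) (C0 + M) ltac:(lra). have [del [Hdel Hln]] := ln_large (Rmax X0 X2). exists del; split; auto.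
 intros z Hz Hza. specialize (Hln _ (conj (dz a z (HKO a Ka) Hz) Hza)). have A1 := Rmax_l X0 X2. have A2 := Rmax_r X0 X2.
 specialize (G0 O u a b Phi z HO HBd Hu HPhi Hsq Hm HDb (HKO a Ka) (HKO b Kb) Hab).
 have Y := G0 ltac:(intros M'; have [d [Hd Kd]] := Hinf M'; exists d; split; auto; intros w Hw Hwa; assert (M' < u w) by (apply Kd; eauto); lra) Hz ltac:(lra).
 have [_ Z] := HX2 (- ln (Cmod (z - a))) ltac:(lra). lra. }
intros M. have [X2 HX2] := @ln_sublinear ((1 - gm) / 2) (/ 2 * ln D) (C1 + M) ltac:(lra). have [del [Hdel Hln]] := ln_large (Rmax X1 X2). exists del; split; auto.
intros z a Hz Ba Ka _ Hza. have [b [Kb [Hab HDb]]] := pick a Ka Ba. have [Phi [HPhi Hsq]] := sqrt_branch Hb HO (ex_intro _ MB HMB) B HK HKO Ka Kb.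
specialize (Hln _ (conj (dz a z (HKO a Ka) Hz) Hza)). have A1 := Rmax_l X1 X2. have A2 := Rmax_r X1 X2.
have Y := G1 O u a b Phi z HO (ex_intro _ MB HMB) Hu HPhi Hsq Hm HDb (HKO a Ka) (HKO b Kb) Hab (Step0 a Ka Ba) Hz ltac:(lra).
have [_ Z] := HX2 (- ln (Cmod (z - a))) ltac:(lra). lra.
Qed.

(** * Vanishing by reflection in circles, and the absence of punctures *)

Lemma RInt_zero_pos {f : R -> R} {a b t0} : a < b -> (forall t, continuous f t) -> (forall t, 0 <= f t) -> RInt f a b <= 0 -> a <= t0 <= b -> f t0 = 0.
Proof.
intros Hab Hc H0 HI Ht. have [P|] := Rle_lt_or_eq_dec 0 (f t0) (H0 t0); auto. destruct (proj1 continuous_eps (Hc t0) (f t0 / 2)) as [d [Hd K]]; [lra|].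
set (p := Rmax a (t0 - d / 2)). set (q := Rmin b (t0 + d / 2)). have E : forall x y, ex_RInt f x y by an. have p1 := Rmax_l a (t0 - d / 2).
have p2 := Rmax_r a (t0 - d / 2). have q1 := Rmin_l b (t0 + d / 2). fold p in p1, p2. have pq : p < q by (apply Rmax_case; apply Rmin_case; lra).
rewrite <- (RInt_Chasles f a p b), <- (RInt_Chasles f p q b) in HI by auto. unfold plus in HI; simpl in HI. have A1 : 0 <= RInt f a p by (apply RInt_ge_0; auto).
have A2 : 0 <= RInt f q b by (apply RInt_ge_0; auto). have A3 : RInt (fun _ => f t0 / 2) p q <= RInt f p q.
{ apply RInt_le; auto; [lra|an|]. intros x Hx. specialize (K x). assert (Rabs (x - t0) < d) by lra. specialize (K H). apply Rabs_def2 in K. lra. }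
rewrite RInt_Rconst in A3. nra.
Qed.

Lemma bounded_on_compact {S h} : boundedC S -> (forall l, closureC S l -> ccont h l) -> exists M, forall z, S z -> Cmod (h z) <= M.
Proof.
intros [B HB] Hc. apply NNPP. intros N. destruct (choice_nat (fun n z => S z /\ INR n < Cmod (h z))) as [z Hz].
{ intros n. apply NNPP. intros N'. apply N. exists (INR n). intros z Sz. apply Rnot_lt_le. intros L. eauto. }
destruct (@cluster_C z B) as [l Hl]; [intros n; apply HB, Hz|]. have Cl : closureC S l.
{ intros e He. have [n [_ Hn]] := Hl e 0%nat He. exists (z n). split; auto. apply Hz. }
have [d [Hd K]] := Hc l Cl 1 ltac:(lra). destruct (nfloor_ex (Rabs (Cmod (h l)) + 1)) as [m Hm]; [an|]. have [n [Hn1 Hn2]] := Hl d (m + 1)%nat Hd.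
specialize (K (z n) Hn2). have [_ Z] := Hz n. have T := Cmod_le_plus (h (z n)) (h l). apply le_INR in Hn1. rewrite plus_INR in Hn1. simpl in Hn1. an.
Qed.

Lemma cder_conj_conj {f z l} : cder f (Cconj z) l -> cder (fun w => Cconj (f (Cconj w))) z (Cconj l).
Proof.
intros H eps He. have [d [Hd K]] := H eps He. exists d. split; auto. intros w Hw. rewrite <- (Cmod_conj (w - z)), Cminus_conj in *.
rewrite <- Cmod_conj, !Cminus_conj, Cmult_conj, !Cconj_conj, Cminus_conj. auto.
Qed.

Lemma circ_mean_const {H z0 a b s s'} : 0 <= a -> hol (ann z0 a b) H -> a < s < b -> a < s' < b ->
 CInt (fun t => H (circ z0 s t)) 0 (2 * PI) = CInt (fun t => H (circ z0 s' t)) 0 (2 * PI).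
Proof.
intros Ha HH Hs Hs'. apply (@pder_zero_const (fun r => CInt (fun t => H (circ z0 r t)) 0 (2 * PI))). intros r Hr.
have Hr' : a < r < b by (unfold Rmin, Rmax in Hr; destruct Rle_dec; lra). apply (@circ_mean_pder H (C_derive H) z0 r (Rmin (r - a) (b - r))); [lra|]. intros q t Hq.
apply Rabs_def2 in Hq. have A := @ann_circ z0 a b q t Ha ltac:(lra). split; [an|eapply ccont_derive]; eauto. apply opn_ann.
Qed.

(* The pairing of [h] on the circle of radius [s] with [h] on its reflection in the circle of radius [rho] does not depend on [s],
   being a mean of a holomorphic function. *)
Lemma hardy_vanish {h z0 r1 r2 sinf rho t0} : 0 <= r1 -> hol (ann z0 r1 r2) h -> 0 < sinf -> r1 < rho < r2 -> r1 < rho * rho / sinf < r2 ->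
 (forall e, 0 < e -> exists s, r1 < s < r2 /\ Rabs (s - sinf) < e /\ L2circ h z0 s < e) -> 0 <= t0 <= 2 * PI -> h (circ z0 rho t0) = 0.
Proof.
intros Hr1 Hh Hs Hrho Hq HL Ht0. set (q := rho * rho / sinf) in *. set (a := (r1 + Rmin q rho) / 2). set (b := (q + r2) / 2).
have Hab : r1 < a < q /\ a < rho /\ q < b < r2 by (unfold a, b, Rmin; destruct Rle_dec; lra). have hc : forall z, ann z0 r1 r2 z -> ccont h z by an.
have cont : forall r, r1 < r < r2 -> forall t, continuous (fun t => Cmod (h (circ z0 r t))) t.
{ intros r Hr t. apply continuous_circ_mod. intros s. apply hc, ann_circ; auto. }
destruct (@bounded_on_compact (fun z => a <= Cmod (z - z0) <= b) h) as [M HM].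
- exists (b + Cmod z0). intros z Hz. have T := Cmod_le_plus z z0. lra.
- intros l Hl. apply hc. destruct (Hl (Rmin (a - r1) (r2 - b))) as [w [Hw1 Hw2]]; [lra|]. have T1 := Cmod_tri w l z0. have T2 := Cmod_tri l w z0.
 rewrite (Cmod_minus_sym l w) in T2. split; lra.
- have M0 : 0 <= M by (eapply Rle_trans; [apply Cmod_ge_0|apply (HM (circ z0 q 0))]; rewrite Cmod_circ; lra). set (G := fun u : C => Cconj (h (z0 + Cconj u)%C)).
 (* [G] is [h] conjugated in argument and value, hence holomorphic, and the conjugate of
    [rho^2 / (w - z0)] is the reflected point relative to [z0]; on the circle of radius [rho] the
    product [H] is [|h|^2]. *)
 set (H := fun w => (h w * G (RtoC (rho * rho) / (w - z0)))%C).
 have refl : forall s t, 0 < s -> (RtoC (rho * rho) / (circ z0 s t - z0))%C = Cconj (RtoC (rho * rho / s) * cis t).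
 { intros s t Hs'. unfold circ. replace (z0 + s * cis t - z0)%C with (s * cis t)%C by ring. have S := sin2_cos2 t. unfold Rsqr in S.
  have E : (cis t * Cconj (cis t))%C = 1 by (apply Ceq; simpl; lra). have N := cis_neq_0 t. assert (RtoC s <> 0) by lra. rewrite RtoC_div, Cmult_conj by lra.
  replace (Cconj (RtoC (rho * rho) / s)) with (RtoC (rho * rho) / s)%C by (rewrite <- RtoC_div by lra; apply Ceq; simpl; ring).
  replace (Cconj (cis t)) with (/ cis t)%C by (rewrite <- (Cmult_1_r (/ cis t)), <- E; field; auto). field. auto. }
 have main : forall s, r1 < s < r2 -> r1 < rho * rho / s < r2 -> CInt (fun t => h (circ z0 s t) * Cconj (h (circ z0 (rho * rho / s) t)))%C 0 (2 * PI) = RtoC (L2circ h z0 rho).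
 { intros s H1 H2. have s0 : 0 < s by lra. set (p := (r1 + Rmin rho (rho * rho / s)) / 2).
  have Hp : r1 < p /\ p < rho /\ p < rho * rho / s by (unfold p, Rmin; destruct Rle_dec; lra). set (l := Rmax r1 (rho * rho / r2)).
  set (u := Rmin r2 (rho * rho / p)). have Hl : r1 <= l /\ rho * rho / r2 <= l by (split; [apply Rmax_l|apply Rmax_r]).
  have rng : forall r, r1 < r < r2 -> r1 < rho * rho / r -> p < rho * rho / r < r2 -> l < r < u.
  { intros r A1 A2 A3. have E : rho * rho / r * r = rho * rho by (field; lra).
   split; [apply Rmax_lub_lt; [lra|apply div_lt; nra]|apply Rmin_glb_lt; [lra|apply lt_div; nra]]. }
  have HH : hol (ann z0 l u) H.
  { intros z [A1 A2]. have B2 := Rmin_l r2 (rho * rho / p). have B3 := Rmin_r r2 (rho * rho / p). fold u in B2, B3. set (r := Cmod (z - z0)) in *.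
   have zn : (z - z0)%C <> 0 by (apply Cmod_gt_0; fold r; lra). eexists. apply cder_derive, (@cder_mult h (fun w => G (RtoC (rho * rho) / (w - z0))%C)).
   - eapply hol_cder; [exact Hh|]. unfold ann. fold r. lra.
   - apply (@cder_comp G (fun w => RtoC (rho * rho) / (w - z0))%C); [an|].
    apply (@cder_conj_conj (fun x => h (z0 + x)%C)), (@cder_comp h (fun x => z0 + x)%C); [an|]. eapply hol_cder; [exact Hh|]. unfold ann.
    replace (z0 + Cconj (RtoC (rho * rho) / (z - z0)) - z0)%C with (Cconj (RtoC (rho * rho) / (z - z0))) by ring.
    rewrite Cmod_conj, Cmod_div, Cmod_R, Rabs_pos_eq by (auto; lra). fold r. assert (rho * rho / p * p = rho * rho) by (field; lra).
    assert (rho * rho / r2 * r2 = rho * rho) by (field; lra). split; [apply lt_div; nra|apply div_lt; nra]. }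
  transitivity (CInt (fun t => H (circ z0 s t)) 0 (2 * PI)); [|rewrite (@circ_mean_const H z0 l u s rho); auto; try lra].
  - apply CInt_ext. intros t _. unfold H, G. rewrite refl, Cconj_conj by auto. an.
  - transitivity (CInt (fun t => RtoC (Cmod (h (circ z0 rho t)) * Cmod (h (circ z0 rho t)))) 0 (2 * PI)).
   + apply CInt_ext. intros t _. unfold H, G. rewrite refl, Cconj_conj by lra. replace (rho * rho / rho) with rho by (field; lra). fold (circ z0 rho t).
    rewrite Cmod_sqr. apply Ceq; unfold Re, Im; simpl; ring.
   + apply Ceq; auto. simpl. rewrite RInt_Rconst. ring.
  - apply rng; lra.
  - apply rng; try lra; replace (rho * rho / rho) with rho by (field; lra); lra. }
 have sq : forall r, r1 < r < r2 -> ex_RInt (fun t => Cmod (h (circ z0 r t)) * Cmod (h (circ z0 r t))) 0 (2 * PI) by an. have L0 : L2circ h z0 rho <= 0.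
 { apply Rnot_lt_le. intros P. set (L := L2circ h z0 rho) in *.
  have ct : continuous (fun s => rho * rho / s) sinf by (apply (ex_derive_continuous (V := R_NormedModule)); auto_derive; lra).
  destruct (proj1 continuous_eps ct (Rmin (q - a) (b - q))) as [d [Hd K]]; [lra|]. set (e := Rmin d (L * L / (16 * (M * M + 1)))). have MM : 0 <= M * M by lra.
  have ep : 0 < e by lra. have [s [Hs1 [Hs2 Hs3]]] := HL e ep.
  have Hs' : a < rho * rho / s < b by (specialize (K s ltac:(lra)); apply Rabs_def2 in K; fold q in K; lra).
  (* The arithmetic-geometric inequality is weighted so that, with this [e], it ends in
     [L <= PI / 8 * L + L / 4], which is impossible for positive [L]. *)
  have B : L <= RInt (fun t => L / 16 + 4 * (M * M) / L * (Cmod (h (circ z0 s t)) * Cmod (h (circ z0 s t)))) 0 (2 * PI).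
  { have EL : L = Cmod (L) by (rewrite Cmod_R, Rabs_pos_eq; lra). rewrite EL at 1. rewrite <- (main s) at 1 by lra. apply CInt_norm; [lra| | |].
   - apply cintg_pcont. intros t _. apply pcont_mult; [|apply pcont_conj]; (apply pcont_comp; [apply pcont_circ|apply hc, ann_circ; lra]).
   - an.
   - intros t _. rewrite Cmod_mult, Cmod_conj. have Z := HM (circ z0 (rho * rho / s) t) ltac:(rewrite Cmod_circ; lra). set (x := Cmod (h (circ z0 s t))).
    apply Rle_trans with (x * M); [apply Rmult_le_compat_l; auto; apply Cmod_ge_0|]. have Y := Rle_0_sqr (L / 4 - 2 * (M * x)). unfold Rsqr in Y.
    apply Rmult_le_reg_l with L; auto. replace (L * (L / 16 + 4 * (M * M) / L * (x * x))) with (L * L / 16 + 4 * (M * M) * (x * x)) by (field; lra). nra. }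
  rewrite RInt_Rplus, RInt_Rconst, RInt_Rscal in B by (auto using ex_RInt_Rconst, ex_RInt_Rscal). fold (L2circ h z0 s) in B.
  have X : 4 * (M * M) / L * L2circ h z0 s <= 4 * (M * M) / L * (L * L / (16 * (M * M + 1))) by (apply Rmult_le_compat_l; [apply Rmult_le_pos; [lra|left; lra]|lra]).
  replace (4 * (M * M) / L * (L * L / (16 * (M * M + 1)))) with (L / 4 * (M * M / (M * M + 1))) in X by (field; lra).
  assert (M * M / (M * M + 1) <= 1) by (apply div_le; lra). have Pi := PI_4. nra. }
 have Z : Cmod (h (circ z0 rho t0)) * Cmod (h (circ z0 rho t0)) = 0.
 { apply (@RInt_zero_pos (fun t => Cmod (h (circ z0 rho t)) * Cmod (h (circ z0 rho t))) 0 (2 * PI) t0); auto; [lra| |an]. intros t. an. }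
 apply Cmod_eq_0. nra.
Qed.

Lemma stay_below {phi : R -> R} {p q a} b : (forall t, continuous phi t) -> p <= q -> (forall t, phi t < p \/ q < phi t) -> phi a < p -> phi b < p.
Proof.
intros Hc Hpq H Ha. have [|Hb] := H b; auto. destruct (IVT_gen phi a b p) as [x [_ Hx]].
- intros t. apply continuity_pt_filterlim, Hc.
- split; [an|eapply Rle_trans; [|apply Rmax_r]; lra].
- destruct (H x); lra.
Qed.

Lemma biholo_proper_inv {O beta r f g} : opn O -> boundedC O -> biholo O beta f g -> 0 < r ->
 exists eta, 0 < eta /\ forall w, annulus beta w -> (Cmod w < beta + eta \/ 1 - eta < Cmod w) -> exists y, boundaryC O y /\ Cmod (g w - y) < r.
Proof.
intros HO [M HM] B Hr. have B' := B. destruct B' as [Hf [Hg [Hfa [Hga [Hgf Hfg]]]]]. apply NNPP. intros N.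
destruct (choice_nat (fun n w => annulus beta w /\ (Cmod w < beta + / (INR n + 1) \/ 1 - / (INR n + 1) < Cmod w) /\ forall y, boundaryC O y -> r <= Cmod (g w - y))) as [w Hw].
{ intros n. apply NNPP. intros N'. apply N. exists (/ (INR n + 1)). split.
 - have P := pos_INR n. lra.
 - intros w Aw Hw. apply NNPP. intros N''. apply N'. exists w. split; [auto|split; auto]. intros y Hy. apply Rnot_lt_le. intros L. eauto. }
destruct (@cluster_C (fun n => g (w n)) M) as [l Hl]; [intros n; apply HM, Hga, Hw|]. have [Ol|Nl] := classic (O l).
- have [F1 F2] := Hfa l Ol. set (e := Rmin (Cmod (f l) - beta) (1 - Cmod (f l)) / 2). have e1 := Rmin_l (Cmod (f l) - beta) (1 - Cmod (f l)).
 have e2 := Rmin_r (Cmod (f l) - beta) (1 - Cmod (f l)).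
 have e0 : 0 < e by (unfold e; assert (0 < Rmin (Cmod (f l) - beta) (1 - Cmod (f l))) by (apply Rmin_pos; lra); lra). have [d [Hd K]] := hol_ccont Hf Ol e e0.
 have [m Hm] := inv_INR_small e0. have [n [Hn1 Hn2]] := Hl d m Hd. specialize (K _ Hn2). have [W1 [W2 _]] := Hw n. rewrite Hfg in K by auto. specialize (Hm n Hn1).
 have T1 := Cmod_le_plus (w n) (f l). have T2 := Cmod_le_plus (f l) (w n). rewrite Cmod_minus_sym in T2. unfold e in *. lra.
- have [n [_ Hn]] := Hl r 0%nat Hr. have [W1 [W2 W3]] := Hw n. assert (r <= Cmod (g (w n) - l)); [|lra]. apply W3. apply closure_boundary; auto. intros e He.
 have [n' [_ Hn']] := Hl e 0%nat He. exists (g (w n')). split; auto. apply Hga, Hw.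
Qed.

(* The images under [g] of circles close to the corresponding end of the annulus shrink to [a],
   so that [g - a] would vanish. *)
Lemma biholo_no_puncture {O beta r0 f g a} : 0 < beta < 1 -> opn O -> boundedC O -> biholo O beta f g -> 0 < r0 -> ~ O a ->
 (forall z, 0 < Cmod (z - a) < r0 -> O z) -> False.
Proof.
intros Hb HO HBd B Hr0 Na Hp. have B' := B. destruct B' as [Hf [Hg [Hfa [Hga [Hgf Hfg]]]]]. have Ba : boundaryC O a.
{ apply closure_boundary; auto. intros e He. exists (a + RtoC (Rmin e r0 / 2))%C. have M0 : 0 < Rmin e r0 by lra. have M1 := Rmin_l e r0. have M2 := Rmin_r e r0.
 replace (a + RtoC (Rmin e r0 / 2) - a)%C with (RtoC (Rmin e r0 / 2)) by ring. rewrite Cmod_R. split; [|lra]. apply Hp.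
 replace (a + RtoC (Rmin e r0 / 2) - a)%C with (RtoC (Rmin e r0 / 2)) by ring. rewrite Cmod_R. lra. }
have bd : forall y, boundaryC O y -> y = a \/ r0 <= Cmod (y - a).
{ intros y Hy. have [|h] := Rle_dec r0 (Cmod (y - a)); auto. left. apply Cmod_sub_0. apply Rnot_lt_le. intros L. apply (boundary_not_in HO Hy). apply Hp. lra. }
have AnnA : forall w, ann 0 beta 1 w -> annulus beta w.
{ intros w Hw. unfold ann in Hw. replace (w - 0)%C with w in Hw by ring. an. }
have cmod : forall s t, 0 <= s -> Cmod (circ 0 s t) = s.
{ intros s t Hs. have X := Cmod_circ 0 t Hs. replace (circ 0 s t - 0)%C with (circ 0 s t) in X by ring. lra. }
(* The image of a circle near an end of the annulus stays within [r] of the boundary, whose other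
   points are at distance at least [r0] from [a]. Being close to [a] at one point, it is close to
   [a] throughout by the intermediate value theorem. *)
have small : forall e, 0 < e -> exists s, beta < s < 1 /\ (s < beta + e \/ 1 - e < s) /\ L2circ (fun w => g w - a)%C 0 s < e.
{ intros e He. set (r := Rmin (r0 / 2) (Rmin 1 (e / (4 * PI)) / 1)). have r1 := Rmin_l (r0 / 2) (Rmin 1 (e / (4 * PI)) / 1).
 have r2 := Rmin_r (r0 / 2) (Rmin 1 (e / (4 * PI)) / 1). fold r in r1, r2. have r3 := Rmin_l 1 (e / (4 * PI)). have r4 := Rmin_r 1 (e / (4 * PI)).
 have rp : 0 < r by lra. have [eta [He1 He2]] := biholo_proper_inv HO HBd B rp. have [d [Hd Kd]] := @biholo_proper O beta (Rmin e eta) f g HO HBd B ltac:(lra).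
 have m1 := Rmin_l e eta. have m2 := Rmin_r e eta. set (z := (a + RtoC (Rmin d r / 2))%C). have n0 : 0 < Rmin d r by lra. have n1 := Rmin_l d r.
 have n2 := Rmin_r d r. have za : Cmod (z - a) = Rmin d r / 2.
 { unfold z. replace (a + RtoC (Rmin d r / 2) - a)%C with (RtoC (Rmin d r / 2)) by ring. rewrite Cmod_R, Rabs_pos_eq; lra. }
 have Hz : O z by (apply Hp; lra). have Side := Kd z a Hz Ba ltac:(lra). have [F1 F2] := Hfa z Hz. exists (Cmod (f z)). split; [lra|split; [lra|]].
 have Acirc : forall t, annulus beta (circ 0 (Cmod (f z)) t) by (intros t; unfold annulus; rewrite cmod; lra).
 destruct (@unit_circle_cis (f z / RtoC (Cmod (f z)))) as [t0 Et0].
 { rewrite Cmod_div, Cmod_R, Rabs_pos_eq by (try apply RtoC_neq; lra). field. lra. }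
 have E0 : circ 0 (Cmod (f z)) t0 = f z.
 { unfold circ. rewrite <- Et0. field. an. }
 have bdl : forall t, Cmod (g (circ 0 (Cmod (f z)) t) - a) < r.
 { intros t. apply (@stay_below (fun t => Cmod (g (circ 0 (Cmod (f z)) t) - a)) r r t0 t); [|lra| |].
  - intros s. apply (@continuous_circ_mod (fun w => g w - a)%C). intros s'. an.
  - intros s. destruct (He2 (circ 0 (Cmod (f z)) s) (Acirc s)) as [y [Hy1 Hy2]]; [rewrite cmod; lra|]. destruct (bd y Hy1) as [->|Hy3]; auto.
   have T := Cmod_tri y (g (circ 0 (Cmod (f z)) s)) a. rewrite (Cmod_minus_sym y (g (circ 0 (Cmod (f z)) s))) in T. lra.
  - rewrite E0, Hgf by auto. lra. }
 apply Rle_lt_trans with (RInt (fun _ => r) 0 (2 * PI)).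
 - apply RInt_le; [lra| |an|].
  + apply ex_RInt_cont. intros t.
   apply (continuous_mult (K := R_AbsRing)); apply (@continuous_circ_mod (fun w => g w - a)%C); intros s'; (apply ccont_minus; an); (eapply hol_ccont; an).
  + intros t _. have X := bdl t. have Y := Cmod_ge_0 (g (circ 0 (Cmod (f z)) t) - a). nra.
 - rewrite RInt_Rconst. apply Rle_lt_trans with ((2 * PI - 0) * (e / (4 * PI))); [an|]. replace ((2 * PI - 0) * (e / (4 * PI))) with (e / 2) by (field; lra). lra. }
have Hh : hol (ann 0 beta 1) (fun w => g w - a)%C.
{ apply (@hol_intro _ _ (C_derive g)). intros w Hw. an. }
have Fin : forall rho, beta < rho < 1 -> (g (circ 0 rho 0) - a)%C = 0 -> False.
{ intros rho Hrho E. assert (g (circ 0 rho 0) = a) by (apply Cmod_sub_0; rewrite E, Cmod_0; lra). apply Na. rewrite <- H. apply Hga. unfold annulus.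
 rewrite cmod; lra. }
have Dich : (forall e, 0 < e -> exists s, beta < s < 1 /\ Rabs (s - 1) < e /\ L2circ (fun w => g w - a)%C 0 s < e) \/ (forall e, 0 < e -> exists s, beta < s < 1 /\ Rabs (s - beta) < e /\ L2circ (fun w => g w - a)%C 0 s < e).
{ apply NNPP. intros N. apply not_or_and in N. destruct N as [N1 N2]. apply not_all_ex_not in N1. destruct N1 as [e1 N1]. apply not_all_ex_not in N2.
 destruct N2 as [e2 N2]. destruct (small (Rmin e1 e2)) as [s [S1 [S2 S3]]]; [an|]. have m1 := Rmin_l e1 e2. have m2 := Rmin_r e1 e2. destruct S2 as [S2|S2].
 - apply N2. exists s. an.
 - apply N1. exists s. an. }
destruct Dich as [HD|HD].
- apply (Fin ((1 + beta) / 2)); [lra|]. apply (@hardy_vanish (fun w => g w - a)%C 0 beta 1 1 ((1 + beta) / 2) 0); auto; try lra. split; nra.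
(* This radius lies in the annulus, and so does its reflection [4 * beta / (1 + beta)^2] with
   respect to the inner circle. *)
- apply (Fin (2 * beta / (1 + beta))).
 { split; [apply (proj1 (Rlt_div_r _ _ (1 + beta) ltac:(lra)))|apply (proj2 (Rlt_div_l _ _ (1 + beta) ltac:(lra)))]; nra. }
 apply (@hardy_vanish (fun w => g w - a)%C 0 beta 1 beta (2 * beta / (1 + beta)) 0); auto; try lra.
 + split; [apply (proj1 (Rlt_div_r _ _ (1 + beta) ltac:(lra)))|apply (proj2 (Rlt_div_l _ _ (1 + beta) ltac:(lra)))]; nra.
 + replace (2 * beta / (1 + beta) * (2 * beta / (1 + beta)) / beta) with (4 * beta / ((1 + beta) * (1 + beta))) by (field; lra).
  assert (0 < (1 + beta) * (1 + beta)) by lra.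
  split; [apply (proj1 (Rlt_div_r _ _ ((1 + beta) * (1 + beta)) ltac:(lra)))|apply (proj2 (Rlt_div_l _ _ ((1 + beta) * (1 + beta)) ltac:(lra)))]; nra.
Qed.

(** * Components of the complement *)
Lemma connectedC_union {F z} : (forall K, F K -> connectedC K /\ K z) -> connectedC (fun w => exists K, F K /\ K w).
Proof.
intros HF U V HU HV Cov Dis.
have H : forall A B : C -> Prop, open A -> open B -> (forall w, (exists K, F K /\ K w) -> A w \/ B w) -> (forall w, ~ ((exists K, F K /\ K w) /\ A w /\ B w)) -> A z -> forall w, (exists K, F K /\ K w) -> A w.
{ intros A B HA HB CAB DAB Az w [K [FK Kw]]. have [HK Kz] := HF K FK. destruct (HK A B HA HB) as [X|X]; eauto.
 - intros x [Kx X]. apply (DAB x). split; eauto.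
 - exfalso. apply (DAB z). split; eauto. }
have [[K FK]|N] := classic (exists K, F K).
- destruct (Cov z) as [X|X]; [exists K; split; auto; apply HF; auto| |].
 + left. apply (H U V); auto.
 + right. apply (H V U); auto. intros w Hw. destruct (Cov w Hw); auto. intros w [X1 [X2 X3]]. apply (Dis w). auto.
- left. intros w [K [FK _]]. exfalso; eauto.
Qed.

Lemma componentC_exists {S z} : S z -> exists K, componentC S K /\ K z.
Proof.
intros Sz. set (F := fun K : C -> Prop => (connectedC K /\ K z) /\ forall w, K w -> S w). have Pt : F (fun w => w = z).
{ split; [split; auto|intros w ->; auto]. intros U V _ _ Cov _. destruct (Cov z eq_refl); [left|right]; intros w ->; auto. }
exists (fun w => exists K, F K /\ K w). split; [|exists (fun w => w = z); auto].
split; [exists z, (fun w => w = z); auto|split; [intros w [K [[_ FK] Kw]]; auto|split]].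
- apply (@connectedC_union F z). intros K [HK _]; auto.
- intros K' HK' Sub SK' w Kw. exists K'. split; auto. split; auto. split; auto. apply Sub. exists (fun w => w = z); auto.
Qed.

Lemma componentC_meet {S K K' z} : componentC S K -> componentC S K' -> K z -> K' z -> forall w, K w -> K' w.
Proof.
intros [_ [SK [CK MK]]] [_ [SK' [CK' MK']]] Kz Kz' w Kw. set (F := fun L : C -> Prop => L = K \/ L = K'). apply (MK' (fun w => exists L, F L /\ L w)).
- apply (@connectedC_union F z). intros L [-> | ->]; auto.
- intros x Kx. exists K'. unfold F; auto.
- intros x [L [[-> | ->] Lx]]; auto.
- exists K. unfold F; auto.
Qed.

Lemma componentC_closed {S K l} : (forall x, closureC S x -> S x) -> componentC S K -> closureC K l -> K l.
Proof.
intros HS [_ [SK [CK MK]]] Hl. apply (MK (closureC K)); auto.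
- intros U V HU HV Cov Dis. have Sub : forall x, K x -> closureC K x.
 { intros x Kx e He. exists x. replace (x - x)%C with (RtoC 0) by ring. now rewrite Cmod_0. }
 have H : forall A B : C -> Prop, open B -> (forall w, closureC K w -> A w \/ B w) -> (forall w, ~ (closureC K w /\ A w /\ B w)) -> (forall w, K w -> A w) -> forall w, closureC K w -> A w.
 { intros A B HB CAB DAB KA w Hw. have [|Bw] := CAB w Hw; auto. exfalso. have [e [He X]] := open_opn HB w Bw. have [x [Kx Hx]] := Hw e He. apply (DAB x). an. }
 destruct (CK U V HU HV) as [X|X]; auto.
 + intros z [Kz [Uz Vz]]. apply (Dis z); auto.
 + left. apply (H U V); auto.
 + right. apply (H V U); auto. intros w Hw; destruct (Cov w Hw); auto. intros w [X1 [X2 X3]]. apply (Dis w); auto.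
- intros x Kx e He. exists x. replace (x - x)%C with (RtoC 0) by ring. now rewrite Cmod_0.
- intros x Hx. apply HS. intros e He. have [w [Kw Hw]] := Hx e He. exists w; auto.
Qed.

Lemma compl_closed {O x} : opn O -> closureC (fun z => ~ O z) x -> ~ O x.
Proof. intros HO Hx Ox. have [e [He X]] := HO x Ox. have [w [Nw Hw]] := Hx e He. an. Qed.

(** The complement split into two disjoint closed parts, of which [K] will be the outer one. The two
    distinct points of [Kin] are what the square root of [(z - a) / (z - b)] requires. *)
Definition two_sided (O K Kin : C -> Prop) : Prop :=
  (forall z, ~ O z -> K z \/ Kin z) /\ (forall z, K z -> ~ O z) /\ (forall z, Kin z -> ~ O z) /\
  (forall z, K z -> ~ Kin z) /\ (forall z, closureC K z -> K z) /\ (forall z, closureC Kin z -> Kin z) /\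
  connectedC Kin /\ exists b1 b2, Kin b1 /\ Kin b2 /\ b1 <> b2.

(** The point at issue is that the other component is not a single point: it would be an isolated
    boundary point, excluded by [biholo_no_puncture]. *)
Lemma doubly_connected_two_sided {O K beta f g} : 0 < beta < 1 -> boundedC O -> doubly_connected O -> biholo O beta f g ->
 componentC (fun z => ~ O z) K -> exists Kin, two_sided O K Kin.
Proof.
intros Hb HBd [[_ [HO _]] [K1 [K2 [C1 [C2 [[z12 [Z1 Z2]] Hall]]]]]] B HK. apply open_opn in HO. set (S := fun z => ~ O z) in *.
have SC : forall x, closureC S x -> S x by (intros x; apply compl_closed; auto). have D12 : forall z, K1 z -> ~ K2 z.
{ intros z A1 A2. apply Z2. eapply (@componentC_meet S K1 K2 z); eauto. }
have Ex : exists Kin, componentC S Kin /\ (forall z, K z -> ~ Kin z) /\ forall L, componentC S L -> (forall z, L z -> K z) \/ (forall z, L z -> Kin z).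
{ have [E|E] := Hall K HK; [exists K2|exists K1]; (split; [auto|split]).
 - intros z Kz. apply D12, E, Kz.
 - intros L HL. have [E'|E'] := Hall L HL; [left|right]; intros z Lz; [apply E|]; apply E'; auto.
 - intros z Kz Q. apply (D12 z); auto. apply E, Kz.
 - intros L HL. have [E'|E'] := Hall L HL; [right|left]; intros z Lz; [|apply E]; apply E'; auto. }
destruct Ex as [Kin [HKin [Dis Cov]]]. exists Kin. have cK : forall z, closureC K z -> K z by (intros z; apply (@componentC_closed S); auto).
have cKin : forall z, closureC Kin z -> Kin z by (intros z; apply (@componentC_closed S); auto). have Cov' : forall z, ~ O z -> K z \/ Kin z.
{ intros z Nz. have [L [HL Lz]] := @componentC_exists S z Nz. destruct (Cov L HL); auto. }
split; auto. split; [apply HK|]. split; [apply HKin|]. split; auto. split; auto. split; auto. split; [apply HKin|]. apply NNPP. intros N.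
destruct HKin as [[a Ka] [SK _]]. have One : forall z, Kin z -> z = a by (intros z Kz; apply NNPP; intros Q; apply N; eauto).
have Far : exists r0, 0 < r0 /\ forall z, Cmod (z - a) < r0 -> ~ K z.
{ apply NNPP. intros N'. apply (Dis a); auto. apply cK. intros e He. apply NNPP. intros N''. apply N'. exists e. split; auto. intros z Hz Kz. eauto. }
destruct Far as [r0 [Hr0 Far]]. apply (biholo_no_puncture Hb HO HBd B Hr0 (SK a Ka)). intros z [Hz1 Hz2]. apply NNPP. intros Nz.
have [X|X] := Cov' z Nz; [apply (Far z); auto|]. rewrite (One z X) in Hz1. replace (a - a)%C with (RtoC 0) in Hz1 by ring. rewrite Cmod_0 in Hz1. lra.
Qed.

Lemma two_sided_boundary {O K Kin y} : opn O -> two_sided O K Kin -> boundaryC O y -> boundaryC K y \/ Kin y.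
Proof.
intros HO [Cov [KO _]] Hy. have [Ky|] := Cov y (boundary_not_in HO Hy); auto. left. split.
- intros e He. exists y. replace (y - y)%C with (RtoC 0) by ring. now rewrite Cmod_0.
- intros [e [He X]]. destruct Hy as [Hy _]. have [w [Ow Hw]] := Hy e He. apply (KO w); auto.
Qed.

(** * Periodic functions and moving frames *)
Lemma periodic_Z {A} (f : R -> A) T m t : (forall t, f (t + T) = f t) -> f (t + IZR m * T) = f t.
Proof.
intros H. have N : forall n t, f (t + INR n * T) = f t.
{ induction n as [|n IH]; intros x; [f_equal; simpl; ring|]. rewrite S_INR. replace (x + (INR n + 1) * T) with (x + INR n * T + T) by ring. now rewrite H. }
have [h|h] := Z_le_dec 0 m.
- rewrite <- (Z2Nat.id m h), <- INR_IZR_INZ. apply N.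
- rewrite <- (N (Z.to_nat (- m)) (t + IZR m * T)). f_equal. rewrite INR_IZR_INZ, Z2Nat.id, opp_IZR by lia. ring.
Qed.

Lemma period_reduce {T} a t : 0 < T -> exists m : Z, a <= t + IZR m * T < a + T.
Proof.
intros HT. have [H1 H2] := base_Int_part ((t - a) / T). exists (- Int_part ((t - a) / T))%Z. rewrite opp_IZR. have E : t - a = (t - a) / T * T by (field; lra). nra.
Qed.

Lemma periodic_bounded {f : R -> R} {T} : 0 < T -> (forall t, f (t + T) = f t) -> (forall t, continuous f t) -> exists M, forall t, Rabs (f t) <= M.
Proof.
intros HT Hp Hc. have Hc' : forall c, 0 <= c <= T -> continuity_pt f c by (intros c _; apply continuity_pt_filterlim, Hc).
have [p [P1 _]] := continuity_ab_maj f 0 T ltac:(lra) Hc'. have [q [Q1 _]] := continuity_ab_min f 0 T ltac:(lra) Hc'. exists (Rmax (Rabs (f p)) (Rabs (f q))).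
intros t. have [m Hm] := period_reduce 0 t HT. rewrite <- (periodic_Z f T m t Hp). set (x := t + IZR m * T) in *. specialize (P1 x ltac:(lra)).
specialize (Q1 x ltac:(lra)). have B := Rle_abs (- f q). rewrite Rabs_Ropp in B. have M1 := Rmax_l (Rabs (f p)) (Rabs (f q)).
have M2 := Rmax_r (Rabs (f p)) (Rabs (f q)). an.
Qed.

Definition bdd (f : R -> R) : Prop := exists M, forall t, Rabs (f t) <= M.

Lemma bdd_mult {f g} : bdd f -> bdd g -> bdd (fun t => f t * g t).
Proof. intros [M HM] [N HN]. exists (M * N). intros t. rewrite Rabs_mult. apply Rmult_le_compat; auto; apply Rabs_pos. Qed.

Lemma bdd_minus {f g} : bdd f -> bdd g -> bdd (fun t => f t - g t).
Proof. intros [M HM] [N HN]. exists (M + N). intros t. eapply Rle_trans; [apply Rabs_triang|]. rewrite Rabs_Ropp. specialize (HM t). specialize (HN t). lra. Qed.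

Lemma is_derive_Rdiv {f g : R -> R} {x l m : R} : is_derive f x l -> is_derive g x m -> g x <> 0 ->
 is_derive (fun t => f t / g t) x ((l * g x - f x * m) / (g x * g x)).
Proof. intros Hf Hg H. eapply is_derive_eq; [apply is_derive_div; eauto|]. field. auto. Qed.

Set Implicit Arguments.
(* [tau] is the unit tangent, [sp] the speed and [kap] the curvature of [gam]. *)
Record frame (T : R) (gam tau : R -> C) (sp kap kap1 : R -> R) (B : R) : Prop := {
  fr_T : 0 < T;
  fr_B : 1 <= B;
  fr_gamT : forall t, gam (t + T) = gam t;
  fr_tauT : forall t, tau (t + T) = tau t;
  fr_spT : forall t, sp (t + T) = sp t;
  fr_kapT : forall t, kap (t + T) = kap t;
  fr_inj : forall s t, 0 <= s < T -> 0 <= t < T -> gam s = gam t -> s = t;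
  fr_gam : forall t, pder gam t (RtoC (sp t) * tau t);
  fr_tau : forall t, pder tau t (Ci * RtoC (kap t * sp t) * tau t);
  fr_tau1 : forall t, Cmod (tau t) = 1;
  fr_spc : forall t, continuous sp t;
  fr_sp : forall t, / B <= sp t <= B;
  fr_kap : forall t, is_derive kap t (kap1 t);
  fr_kapB : forall t, Rabs (kap t) <= B;
  fr_kap1B : forall t, Rabs (kap1 t) <= B }.
Unset Implicit Arguments.

Lemma frame_exists {alpha T gam} : C3alpha_closed_curve alpha T gam ->
 exists tau kap1 B, frame T gam tau (speed gam) (curvature gam) kap1 B /\ forall t, (RtoC (speed gam t) * tau t)%C = (Derive (gx gam) t, Derive (gy gam) t).
Proof.
intros [HT [Hper [Hinj [Hd [Hc [_ Hreg]]]]]]. set (x1 := Derive (gx gam)). set (y1 := Derive (gy gam)). set (x2 := Derive_n (gx gam) 2).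
set (y2 := Derive_n (gy gam) 2). set (x3 := Derive_n (gx gam) 3). set (y3 := Derive_n (gy gam) 3).
have dx0 : forall t, is_derive (gx gam) t (x1 t) by (intros t; apply Derive_correct, (Hd t 1%nat); lia).
have dy0 : forall t, is_derive (gy gam) t (y1 t) by (intros t; apply Derive_correct, (Hd t 1%nat); lia).
have dx1 : forall t, is_derive x1 t (x2 t) by (intros t; apply Derive_correct, (Hd t 2%nat); lia).
have dy1 : forall t, is_derive y1 t (y2 t) by (intros t; apply Derive_correct, (Hd t 2%nat); lia).
have dx2 : forall t, is_derive x2 t (x3 t) by (intros t; apply Derive_correct, (Hd t 3%nat); lia).
have dy2 : forall t, is_derive y2 t (y3 t) by (intros t; apply Derive_correct, (Hd t 3%nat); lia).
have px : forall k t, Derive_n (gx gam) k (t + T) = Derive_n (gx gam) k t.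
{ intros k t. rewrite <- Derive_n_comp_trans. apply Derive_n_ext. intros s. unfold gx. now rewrite Hper. }
have py : forall k t, Derive_n (gy gam) k (t + T) = Derive_n (gy gam) k t.
{ intros k t. rewrite <- Derive_n_comp_trans. apply Derive_n_ext. intros s. unfold gy. now rewrite Hper. }
have px1 : forall t, x1 (t + T) = x1 t by (intros t; apply (px 1%nat)). have py1 : forall t, y1 (t + T) = y1 t by (intros t; apply (py 1%nat)).
set (sp := speed gam). set (kap := curvature gam). have q0 : forall t, 0 < x1 t ^ 2 + y1 t ^ 2.
{ intros t. have N := Hreg t. fold x1 y1 in N. have A := pow2_ge_0 (x1 t). have B := pow2_ge_0 (y1 t).
 have [E1|E1] := Req_dec (x1 t) 0; [have [E2|E2] := Req_dec (y1 t) 0|].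
 - exfalso. apply N. now rewrite E1, E2.
 - assert (0 < y1 t ^ 2) by (apply pow2_gt_0; auto). lra.
 - assert (0 < x1 t ^ 2) by (apply pow2_gt_0; auto). lra. }
have sp0 : forall t, 0 < sp t by (intros t; apply sqrt_lt_R0, q0). have sp2 : forall t, sp t * sp t = x1 t * x1 t + y1 t * y1 t.
{ intros t. unfold sp, speed. fold x1 y1. rewrite sqrt_sqrt; [ring|]. specialize (q0 t). lra. }
set (sp1 := fun t => (x1 t * x2 t + y1 t * y2 t) * / sp t). have dsp : forall t, is_derive sp t (sp1 t).
{ intros t. unfold sp, speed. fold x1 y1. eapply is_derive_eq.
 - apply is_derive_sqrt; auto. apply @is_derive_Rplus; [apply is_derive_pow, dx1|apply is_derive_pow, dy1].
 - unfold sp1. have P := sp0 t. change (sqrt (x1 t ^ 2 + y1 t ^ 2)) with (sp t). simpl. field. lra. }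
have psp : forall t, sp (t + T) = sp t by (intros t; unfold sp, speed; fold x1 y1; now rewrite px1, py1). have pk : forall t, kap (t + T) = kap t.
{ intros t. unfold kap, curvature. now rewrite px1, py1, psp, px, py. }
have dcont : forall (f : R -> R) l t, is_derive f t l -> continuous f t by an. have bx1 : bdd x1 by (apply (@periodic_bounded x1 T); eauto).
have by1 : bdd y1 by (apply (@periodic_bounded y1 T); eauto). have bx2 : bdd x2 by (apply (periodic_bounded HT (px 2%nat)); eauto).
have by2 : bdd y2 by (apply (periodic_bounded HT (py 2%nat)); eauto). have bx3 : bdd x3 by (apply (periodic_bounded HT (px 3%nat)); apply Hc).
have by3 : bdd y3 by (apply (periodic_bounded HT (py 3%nat)); apply Hc). have bsp : bdd sp by (apply (@periodic_bounded sp T); eauto).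
have bisp : bdd (fun t => / sp t).
{ apply (@periodic_bounded _ T); auto; [intros; now rewrite psp|]. intros t. apply (ex_derive_continuous (V := R_NormedModule)). eexists. apply is_derive_inv; auto.
 apply Rgt_not_eq, sp0. }
set (N := fun t => x1 t * y2 t - y1 t * x2 t). have bN : bdd N by (apply bdd_minus; apply bdd_mult; auto). set (N1 := fun t => x1 t * y3 t - y1 t * x3 t).
have bN1 : bdd N1 by (apply bdd_minus; apply bdd_mult; auto). have kE : forall t, kap t = N t * (/ sp t * (/ sp t * / sp t)).
{ intros t. unfold kap, curvature, N. fold x1 y1 x2 y2 sp. specialize (sp0 t). field. lra. }
have bkap : bdd kap.
{ destruct (@bdd_mult N (fun t => / sp t * (/ sp t * / sp t))) as [M HM]; [auto|repeat apply bdd_mult; auto|]. exists M. intros t. rewrite kE. an. }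
(* The quotient rule for [N / sp^3], written with products of [/ sp] so that boundedness can be read
   off factor by factor. *)
set (kap1 := fun t => N1 t * (/ sp t * (/ sp t * / sp t)) - (N t * (3 - 0)) * ((sp1 t) * (/ sp t * (/ sp t * (/ sp t * / sp t))))). have bkap1 : bdd kap1.
{ apply bdd_minus; [apply bdd_mult; repeat apply bdd_mult; auto|]. apply bdd_mult.
 - apply bdd_mult; auto. exists (Rabs (3 - 0)); intros; lra.
 - apply bdd_mult; [|repeat apply bdd_mult; auto]. apply bdd_mult; auto. destruct (@bdd_mult x1 x2) as [M1 H1]; auto. destruct (@bdd_mult y1 y2) as [M2 H2]; auto.
  exists (M1 + M2). intros t. eapply Rle_trans; [apply Rabs_triang|]. specialize (H1 t). specialize (H2 t). lra. }
have dN : forall t, is_derive N t (N1 t).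
{ intros t. eapply is_derive_eq.
 - apply @is_derive_Rminus.
  + an.
  + an.
 - unfold N1. ring. }
have dkap : forall t, is_derive kap t (kap1 t).
{ intros t. apply is_derive_ext with (fun t => N t / (sp t * (sp t * sp t))).
 { intros s. rewrite kE. specialize (sp0 s). have X : N s / (sp s * (sp s * sp s)) = N s * (/ sp s * (/ sp s * / sp s)) by (field; lra). lra. }
 eapply is_derive_eq.
 - apply @is_derive_Rdiv; [an|an|]. specialize (sp0 t). assert (0 < sp t * sp t) by lra. nra.
 - unfold kap1. specialize (sp0 t). field. lra. }
exists (fun t => (x1 t / sp t, y1 t / sp t)), kap1. destruct bsp as [M1 B1]. destruct bisp as [M2 B2]. destruct bkap as [M3 B3]. destruct bkap1 as [M4 B4].
set (B := 1 + Rabs M1 + Rabs M2 + Rabs M3 + Rabs M4). exists B. split.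
2:{ intros t. specialize (sp0 t). apply Ceq; simpl; field; fold sp; lra. }
have tau1 : forall t, pder (fun t => (x1 t / sp t, y1 t / sp t)) t (Ci * RtoC (kap t * sp t) * (x1 t / sp t, y1 t / sp t)).
{ intros t. have P := sp0 t. have Q := sp2 t. eapply pder_eq.
 - apply @pder_pair; [apply @is_derive_Rdiv; an|apply @is_derive_Rdiv; an].
 - rewrite kE. unfold N, sp1. apply Ceq; simpl.
  + transitivity ((x2 t * (sp t * sp t) - x1 t * (x1 t * x2 t + y1 t * y2 t)) / (sp t * (sp t * sp t))); [field; lra|]. rewrite Q at 1. field. lra.
  + transitivity ((y2 t * (sp t * sp t) - y1 t * (x1 t * x2 t + y1 t * y2 t)) / (sp t * (sp t * sp t))); [field; lra|]. rewrite Q at 1. field. lra. }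
split; auto.
- unfold B; lra.
- intros t. now rewrite px1, py1, psp.
- intros t. have P := sp0 t. eapply pder_eq.
 + apply @pder_pair; an.
 + apply Ceq; simpl; fold sp; field; lra.
- intros t. have P := sp0 t. have Q := sp2 t. unfold Cmod; simpl. transitivity (sqrt 1); [f_equal|apply sqrt_1].
 transitivity ((x1 t * x1 t + y1 t * y1 t) / (sp t * sp t)); [field; lra|]. rewrite <- Q. field. lra.
- intros t. an.
- intros t. specialize (sp0 t). specialize (B1 t). specialize (B2 t). split; [|unfold B; lra]. rewrite <- Rinv_inv. apply Rinv_le_contravar; [an|unfold B; lra].
- intros t. specialize (B3 t). unfold B; lra.
- intros t. specialize (B4 t). unfold B; lra.
Qed.

Definition dot (a b : C) : R := Re (Cconj a * b).

Lemma Cmod_conj a : Cmod (Cconj a) = Cmod a.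
Proof. unfold Cmod; simpl. f_equal. ring. Qed.

Lemma dot_le a b : Rabs (dot a b) <= Cmod a * Cmod b.
Proof. eapply Rle_trans; [apply re_le_Cmod|]. rewrite Cmod_mult, Cmod_conj. lra. Qed.

Lemma dot_self a : dot a a = Cmod a * Cmod a.
Proof. rewrite Cmod_sqr. unfold dot, Re, Im; simpl. ring. Qed.

Lemma Cmod_Ci_mult a : Cmod (Ci * a) = Cmod a.
Proof. rewrite Cmod_mult. replace (Cmod Ci) with 1; [ring|]. unfold Cmod; simpl. transitivity (sqrt 1); [symmetry; apply sqrt_1|f_equal; ring]. Qed.

Lemma is_derive_dot a {c t d} : pder c t d -> is_derive (fun s => dot a (c s)) t (dot a d).
Proof. intros H. apply (pder_scal (Cconj a) H). Qed.

Lemma is_derive_cont_pt {f : R -> R} {x l : R} : is_derive f x l -> continuity_pt f x.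
Proof. intros H. apply continuity_pt_filterlim. apply (ex_derive_continuous (V := R_NormedModule)). exists l; exact H. Qed.

Lemma frame_tau_lip {T gam tau sp kap kap1 B} : frame T gam tau sp kap kap1 B ->
 forall s t, Cmod (tau s - tau t) <= B * B * Rabs (s - t).
Proof.
intros F. have H : forall s t, s <= t -> Cmod (tau t - tau s) <= B * B * (t - s).
{ intros s t Hst. apply (@pder_lip tau (fun t => Ci * RtoC (kap t * sp t) * tau t)%C); auto.
 - intros; apply (fr_tau F).
 - intros r _. rewrite <- Cmult_assoc, Cmod_Ci_mult, Cmod_mult, (fr_tau1 F), Rmult_1_r, Cmod_R, Rabs_mult. have A := fr_kapB F r. have A2 := fr_sp F r.
  have A3 := fr_B F. assert (0 < / B) by lra. an. }
intros s t. have [h|h] := Rle_dec s t.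
- rewrite Cmod_minus_sym, Rabs_minus_sym, Rabs_pos_eq by lra. auto.
- rewrite Rabs_pos_eq by lra. apply H. lra.
Qed.

(** For parameters closer than [L] the tangent stays within one half of [tau t], so the chord
    projects on [tau t] with at least half of its arc; for the remaining ones compactness and
    injectivity within a period give a positive minimum. *)
Lemma frame_bilip {T gam tau sp kap kap1 B} : frame T gam tau sp kap kap1 B ->
 exists c, 0 < c /\ forall t t', Rabs (t' - t) <= T / 2 -> c * Rabs (t' - t) <= Cmod (gam t' - gam t).
Proof.
intros F. have HB := fr_B F. have HT := fr_T F. have iB : 0 < / B by lra. set (L := / (2 * (B * B))). have L0 : 0 < L by (apply Rinv_0_lt_compat; nra).
have Loc : forall t t', Rabs (t' - t) <= L -> / (2 * B) * Rabs (t' - t) <= Cmod (gam t' - gam t).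
{ intros t t' H. destruct (MVT_gen (fun r => dot (tau t) (gam r)) t t' (fun r => dot (tau t) (RtoC (sp r) * tau r))) as [r [Hr E]].
 - intros x _. apply is_derive_dot, (fr_gam F).
 - intros x _. eapply is_derive_cont_pt, is_derive_dot, (fr_gam F).
 - have D : / 2 <= dot (tau t) (tau r).
  { have X := frame_tau_lip F r t. have Y : Rabs (r - t) <= L.
   { unfold Rmin, Rmax in Hr. destruct (Rle_dec t t'); revert H; unfold Rabs; repeat destruct Rcase_abs; lra. }
   have Z : B * B * Rabs (r - t) <= / 2.
   { apply Rle_trans with (B * B * L); [an|]. right. unfold L. field. lra. }
   have W := dot_le (tau t) (tau r - tau t). rewrite (fr_tau1 F) in W.
   have V : dot (tau t) (tau r) = dot (tau t) (tau t) + dot (tau t) (tau r - tau t) by (unfold dot; simpl; ring). rewrite dot_self, (fr_tau1 F) in V.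
   apply Rabs_le_between in W. lra. }
  have E1 : dot (tau t) (gam t' - gam t) = sp r * dot (tau t) (tau r) * (t' - t).
  { transitivity (dot (tau t) (gam t') - dot (tau t) (gam t)); [unfold dot; simpl; ring|]. rewrite E. unfold dot; simpl. ring. }
  have W := dot_le (tau t) (gam t' - gam t). rewrite (fr_tau1 F), E1, Rabs_mult, Rmult_1_l in W. eapply Rle_trans; [|exact W]. apply Rmult_le_compat_r; [an|].
  have S := fr_sp F r. rewrite Rabs_pos_eq by nra. rewrite Rinv_mult, Rmult_comm. an. }
have Far : exists c0, 0 < c0 /\ forall t t', L <= Rabs (t' - t) <= T / 2 -> c0 <= Cmod (gam t' - gam t).
{ apply NNPP. intros N.
 destruct (choice_nat (fun n (p : C) => (L <= Rabs (snd p - fst p) <= T / 2 /\ 0 <= fst p < T) /\ Cmod (gam (snd p) - gam (fst p)) < / (INR n + 1))) as [p Hp].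
 { intros n. apply NNPP. intros N'. apply N. exists (/ (INR n + 1)). split.
  - have P := pos_INR n. lra.
  - intros t t' H. apply Rnot_lt_le. intros Lt. apply N'. have [m Hm] := period_reduce 0 t HT. exists (t + IZR m * T, t' + IZR m * T). simpl.
   rewrite !(periodic_Z gam T) by apply (fr_gamT F). replace (t' + IZR m * T - (t + IZR m * T)) with (t' - t) by ring. lra. }
 destruct (@cluster_C p (Rabs T + (Rabs T + Rabs T))) as [l Hl].
 { intros n. have [[H1 H2] _] := Hp n. eapply Rle_trans; [apply Cmod_le_Re_Im|]. unfold Re, Im.
  apply Rplus_le_compat; apply Rabs_le; destruct H1 as [_ H1]; apply Rabs_le_between in H1; lra. }
 have gc : forall t, pcont gam t by (intros t; eapply pder_pcont, (fr_gam F)). have Eq : gam (snd l) = gam (fst l).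
 { apply Cmod_sub_0. apply le_epsilon. intros e He. have [d1 [D1 K1]] := proj1 (@pcont_eps gam (fst l)) (gc _) (e / 4) ltac:(lra).
  have [d2 [D2 K2]] := proj1 (@pcont_eps gam (snd l)) (gc _) (e / 4) ltac:(lra). destruct (@inv_INR_small (e / 4)) as [m Hm]; [lra|].
  destruct (Hl (Rmin d1 d2) m) as [n [Hn1 Hn2]]; [an|]. have M1 := Rmin_l d1 d2. have M2 := Rmin_r d1 d2. have R1 := re_le_Cmod (p n - l).
  have R2 := im_le_Cmod (p n - l). rewrite Re_minus in R1. rewrite Im_minus in R2. unfold Re, Im in R1, R2. specialize (K1 (fst (p n)) ltac:(lra)).
  specialize (K2 (snd (p n)) ltac:(lra)). have [_ Hp3] := Hp n. specialize (Hm n Hn1). have T1 := Cmod_tri (gam (snd l)) (gam (snd (p n))) (gam (fst l)).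
  have T2 := Cmod_tri (gam (snd (p n))) (gam (fst (p n))) (gam (fst l)). rewrite (Cmod_minus_sym (gam (snd l)) (gam (snd (p n)))) in T1. lra. }
 have Dl : L / 2 < Rabs (snd l - fst l) < 3 * T / 4.
 { set (e := Rmin (L / 8) (T / 16)). have ep : 0 < e by lra. have [n [_ Hn]] := Hl e 0%nat ep. have [[H1 _] _] := Hp n. have R1 := re_le_Cmod (p n - l).
  have R2 := im_le_Cmod (p n - l). rewrite Re_minus in R1. rewrite Im_minus in R2. unfold Re, Im in R1, R2. have A1 : Rabs (fst (p n) - fst l) < e by lra.
  have A2 : Rabs (snd (p n) - snd l) < e by lra. apply Rabs_def2 in A1. apply Rabs_def2 in A2. revert H1. unfold Rabs. repeat destruct Rcase_abs; lra. }
 have [m1 Hm1] := period_reduce 0 (fst l) HT. have [m2 Hm2] := period_reduce 0 (snd l) HT.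
 have Q := fr_inj F ltac:(split; [apply Hm1|lra]) ltac:(split; [apply Hm2|lra]). rewrite !(periodic_Z gam T) in Q by apply (fr_gamT F). specialize (Q (eq_sym Eq)).
 have E : snd l - fst l = IZR (m1 - m2) * T by (rewrite minus_IZR; lra). rewrite E, Rabs_mult, (Rabs_pos_eq T) in Dl by lra.
 have [Z0|Z0] := Z.eq_dec (m1 - m2) 0; [rewrite Z0, Rabs_R0 in Dl; lra|]. assert (1 <= Rabs (IZR (m1 - m2))) by (rewrite <- abs_IZR; apply IZR_le; lia). nra. }
destruct Far as [c0 [C0 Far]]. exists (Rmin (/ (2 * B)) (c0 / T)). have M1 := Rmin_l (/ (2 * B)) (c0 / T). have M2 := Rmin_r (/ (2 * B)) (c0 / T). split; [an|].
intros t t' H. have [h|h] := Rle_dec (Rabs (t' - t)) L.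
- eapply Rle_trans; auto. an.
- eapply Rle_trans; [|apply Far; lra]. apply Rle_trans with (c0 / T * T); [apply Rmult_le_compat; try lra|right; field; lra]. apply Rlt_le, Rmin_pos; an.
Qed.

(** Positive reach: the normal component of a chord is quadratic in the chord, so discs of a fixed
    radius touching the curve at [gam t] contain none of its points. [frame_tube] states this in
    terms of distances. *)
Lemma frame_normal {T gam tau sp kap kap1 B} : frame T gam tau sp kap kap1 B ->
 exists Cn, 0 < Cn /\ forall t t', Rabs (dot (Ci * tau t) (gam t' - gam t)) <= Cn * (Cmod (gam t' - gam t) * Cmod (gam t' - gam t)).
Proof.
intros F. have [c [Hc Bil]] := frame_bilip F. have HB := fr_B F. have HT := fr_T F. have iB : 0 < / B by lra. exists (B * (B * B) / (c * c)). split; [an|].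
have H : forall t t', Rabs (t' - t) <= T / 2 -> Rabs (dot (Ci * tau t) (gam t' - gam t)) <= B * (B * B) / (c * c) * (Cmod (gam t' - gam t) * Cmod (gam t' - gam t)).
{ intros t t' Ht. destruct (MVT_gen (fun r => dot (Ci * tau t) (gam r)) t t' (fun r => dot (Ci * tau t) (RtoC (sp r) * tau r))) as [r [Hr E]].
 - intros x _. apply is_derive_dot, (fr_gam F).
 - intros x _. eapply is_derive_cont_pt, is_derive_dot, (fr_gam F).
 - have E1 : dot (Ci * tau t) (gam t' - gam t) = sp r * dot (Ci * tau t) (tau r - tau t) * (t' - t).
  { transitivity (dot (Ci * tau t) (gam t') - dot (Ci * tau t) (gam t)); [unfold dot; simpl; ring|]. rewrite E. unfold dot; simpl. ring. }
  rewrite E1, !Rabs_mult. have W := dot_le (Ci * tau t) (tau r - tau t). rewrite Cmod_Ci_mult, (fr_tau1 F), Rmult_1_l in W. have X := frame_tau_lip F r t.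
  have Y : Rabs (r - t) <= Rabs (t' - t).
  { unfold Rmin, Rmax in Hr. destruct (Rle_dec t t'); unfold Rabs; repeat destruct Rcase_abs; lra. }
  have S := fr_sp F r. have Z := Bil t t' Ht. set (d := Rabs (t' - t)) in *. have A : Rabs (dot (Ci * tau t) (tau r - tau t)) <= B * B * d.
  { eapply Rle_trans; [exact W|]. eapply Rle_trans; [exact X|]. an. }
  apply Rle_trans with (B * (B * B * d) * d).
  { an. }
  replace (B * (B * B * d) * d) with (B * (B * B) / (c * c) * (c * d * (c * d))) by (field; lra). apply Rmult_le_compat_l; [apply Rlt_le, Rdiv_lt_0_compat; nra|].
  an. }
intros t t'. have [m Hm] := period_reduce (t - T / 2) t' HT. rewrite <- (periodic_Z gam T m t' (fr_gamT F)). apply H. an.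
Qed.

Definition tube (gam tau : R -> C) (s t : R) : C := (gam t + RtoC s * (Ci * tau t))%C.

Lemma frame_tube {T gam tau sp kap kap1 B} : frame T gam tau sp kap kap1 B -> exists dl, 0 < dl /\ forall s t t', 0 <= s <= dl ->
 s <= Cmod (tube gam tau s t - gam t').
Proof.
intros F. have [Cn [HC Hn]] := frame_normal F. exists (/ (2 * Cn)). split; [an|]. intros s t t' Hs. specialize (Hn t t'). set (g := (gam t' - gam t)%C) in *.
have E : Cmod (tube gam tau s t - gam t') * Cmod (tube gam tau s t - gam t') = s * s - 2 * s * dot (Ci * tau t) g + Cmod g * Cmod g.
{ have N1 : Cmod (Ci * tau t) * Cmod (Ci * tau t) = 1 by (rewrite Cmod_Ci_mult, (fr_tau1 F); ring). set (n := (Ci * tau t)%C) in *.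
 transitivity (s * s * (Cmod n * Cmod n) - 2 * s * dot n g + Cmod g * Cmod g); [|rewrite N1; ring]. rewrite !Cmod_sqr. unfold dot; simpl. ring. }
apply Rabs_le_between in Hn. set (G := Cmod g * Cmod g) in *. have G0 : 0 <= G by (apply Rle_0_sqr).
have X : 2 * s * Cn <= 1 by (apply Rle_trans with (2 * / (2 * Cn) * Cn); [an|right; field; lra]). have Q := Cmod_ge_0 (tube gam tau s t - gam t'). nra.
Qed.

(* The model solution attached to the osculating circle at [gam t]. *)
Definition vmod (gam tau : R -> C) (kap : R -> R) (t : R) (z : C) : R :=
  dot (Ci * tau t) (z - gam t) - kap t / 2 * (Cmod (z - gam t) * Cmod (z - gam t)).

(** Frenet's equations cancel everything except the derivative of the curvature. At distance [O(s)]
    from the curve, moving the foot point by [O(s)] therefore changes the model by [O(s^3)] only. *)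
Lemma is_derive_vmod {T gam tau sp kap kap1 B} (t : R) z : frame T gam tau sp kap kap1 B ->
 is_derive (fun t => vmod gam tau kap t z) t (- (kap1 t / 2) * (Cmod (z - gam t) * Cmod (z - gam t))).
Proof.
intros F. have G := fr_gam F t. have K := fr_kap F t. have W : pder (fun t => z - gam t)%C t (- (RtoC (sp t) * tau t)) by an.
have N : pder (fun t => Ci * tau t)%C t (Ci * (Ci * RtoC (kap t * sp t) * tau t)) by (apply pder_scal, (fr_tau F)). have A := pder_mult (pder_conj N) W.
destruct A as [A _]. have D := pder_mult (pder_conj W) W. destruct D as [D _].
apply is_derive_ext with (fun t => Re (Cconj (Ci * tau t) * (z - gam t)) - kap t * (/ 2 * Re (Cconj (z - gam t) * (z - gam t)))).
{ intros r. unfold vmod. fold (dot (Ci * tau r) (z - gam r)). fold (dot (z - gam r) (z - gam r)). rewrite dot_self. lra. }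
eapply is_derive_eq.
- an.
- rewrite Cmod_sqr. simpl. field.
Qed.

(** * The collar of the outer curve *)
Lemma path_stays {O c a b} : opn O -> (forall r, pcont c r) -> a <= b -> O (c a) -> (forall r, a <= r <= b -> ~ boundaryC O (c r)) ->
 O (c b).
Proof.
intros HO Hc Hab Oa Hnb. set (E := fun r => a <= r <= b /\ forall r', a <= r' <= r -> O (c r')). have Ea : E a.
{ split; [lra|]. intros r' Hr'. replace r' with a by lra; auto. }
destruct (completeness E) as [m [M1 M2]]; [exists b; intros r [Hr _]; lra|exists a; auto|]. have Am : a <= m <= b by (split; [an|apply M2; intros r [Hr _]; lra]).
have below : forall r, a <= r < m -> O (c r).
{ intros r Hr. apply NNPP. intros N. assert (m <= r); [|lra]. apply M2. intros x [Hx Kx]. apply Rnot_lt_le. intros L. apply N, Kx. lra. }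
have Om : O (c m).
{ apply NNPP. intros N. have [Lt|Eq] := Rle_lt_or_eq_dec a m ltac:(lra); [|subst; auto]. apply (Hnb m Am). apply closure_boundary; auto. intros e He.
 have [d [Hd K]] := proj1 pcont_eps (Hc m) e He. have X1 := Rmax_l a (m - d / 2). have X2 := Rmax_r a (m - d / 2).
 have X3 : Rmax a (m - d / 2) < m by (apply Rmax_lub_lt; lra). exists (c (Rmax a (m - d / 2))). split; auto. apply K. an. }
have [Lt|Eq] := Rle_lt_or_eq_dec m b ltac:(lra); [|subst; auto]. have [e [He Ke]] := HO (c m) Om. have [d [Hd K]] := proj1 pcont_eps (Hc m) e He.
have X1 := Rmin_l b (m + d / 2). have X2 := Rmin_r b (m + d / 2). have X3 : m < Rmin b (m + d / 2) by (apply Rmin_glb_lt; lra).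
assert (Rmin b (m + d / 2) <= m); [|lra]. apply M1. split; [lra|]. intros r' Hr'. have [h|h] := Rlt_dec r' m; [apply below; lra|]. apply Ke, K. an.
Qed.

Lemma disc_inside {O z w s} : opn O -> O z -> (forall y, boundaryC O y -> s <= Cmod (z - y)) -> Cmod (w - z) < s -> O w.
Proof.
intros HO Oz Hd Hw. replace w with ((fun r => z + r * (w - z))%C 1) by ring. apply (@path_stays O (fun r => z + r * (w - z))%C 0 1); auto; try lra.
- intros r. an.
- replace (z + RtoC 0 * (w - z))%C with z by ring. auto.
- intros r Hr Hb. specialize (Hd _ Hb). replace (z - (z + r * (w - z)))%C with (RtoC (- r) * (w - z))%C in Hd by (rewrite RtoC_opp; ring).
 rewrite Cmod_mult, Cmod_R, Rabs_Ropp, Rabs_pos_eq in Hd by lra. have Q := Cmod_ge_0 (w - z). nra.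
Qed.

Lemma is_derive_min {f : R -> R} {c l : R} : is_derive f c l -> (forall x, f c <= f x) -> l = 0.
Proof.
intros H Hm. have pr : derivable_pt f c by (apply ex_derive_Reals_0; exists l; exact H). rewrite <- (is_derive_unique f c l H), <- (Derive_Reals f c pr).
apply (deriv_minimum f (c - 1) (c + 1) c pr); try lra. intros; apply Hm.
Qed.

(* [s] and [t] are the distance to the boundary and the parameter of the foot point. *)
Definition collar (O : C -> Prop) (gam tau : R -> C) (kap : R -> R) (v : C -> R) (dl C0 : R) : Prop :=
  0 < dl /\ 0 <= C0 /\ forall s t, 0 < s < dl -> boundaryC O (gam t) /\
    (forall z, Cmod (z - tube gam tau s t) < s -> O z) /\
    (forall y, boundaryC O y -> s <= Cmod (tube gam tau s t - y)) /\
    (forall z, Cmod (z - tube gam tau s t) <= s / 2 -> Rabs (v z - vmod gam tau kap t z) <= C0 * (s * s * s)).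

Lemma Cmod_tube {T gam tau sp kap kap1 B s} t : frame T gam tau sp kap kap1 B -> 0 <= s -> Cmod (tube gam tau s t - gam t) = s.
Proof.
intros F Hs. unfold tube. replace (gam t + s * (Ci * tau t) - gam t)%C with (s * (Ci * tau t))%C by ring.
rewrite Cmod_mult, Cmod_Ci_mult, (fr_tau1 F), Cmod_R, Rabs_pos_eq; lra.
Qed.

Lemma Rpower_3_le {d alpha} : 0 < d <= 1 -> 0 < alpha -> Rpower d (3 + alpha) <= d * d * d.
Proof.
intros Hd Ha. rewrite Rpower_plus. replace 3 with (INR 3) by (simpl; ring). rewrite Rpower_pow by lra. assert (Rpower d alpha <= 1).
{ unfold Rpower. rewrite <- exp_0. assert (ln d <= 0) by (rewrite <- ln_1; apply ln_mono; lra).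
 destruct (Rle_lt_or_eq_dec (alpha * ln d) 0) as [h|h]; [nra|left; apply exp_increasing; auto|rewrite h; lra]. }
assert (0 < d * d * d) by lra. nra.
Qed.

(** The expansion holds at each [z] with respect to its own foot point, whereas a model fixed on a
    whole disc is wanted. The nearest boundary point of [z] is some [gam t'] with [t'] within [O(s)]
    of [t]; the expansion there is the model at [t'] up to [O(d^3)], and [is_derive_vmod] carries it
    back to [t]. *)
Lemma collar_exists {O K Kin alpha T B M3 gam tau kap1 u c3} : opn O -> boundedC O -> two_sided O K Kin ->
 frame T gam tau (speed gam) (curvature gam) kap1 B -> (forall t, (RtoC (speed gam t) * tau t)%C = (Derive (gx gam) t, Derive (gy gam) t)) ->
 (forall y, boundaryC K y <-> exists t, 0 <= t < T /\ y = gam t) -> inward_left_normal O gam -> 0 < alpha -> third_coefficient O alpha gam u c3 ->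
 (forall t, Rabs (c3 (gam t)) <= M3) -> exists dl C0, collar O gam tau (curvature gam) (fun z => exp (- u z)) dl C0.
Proof.
intros HO HBd TS F Hsp HK Hin Hal [eps [Cst [Heps H3]]] HM3. have HB := fr_B F. have HT := fr_T F. have TS' := TS.
destruct TS' as [Cov [KO [KinO [Dis [cK [cKin _]]]]]]. have gred : forall t, exists t', 0 <= t' < T /\ gam t = gam t'.
{ intros t. have [m Hm] := period_reduce 0 t HT. exists (t + IZR m * T). split; [lra|]. now rewrite periodic_Z by apply (fr_gamT F). }
have gK : forall t, K (gam t).
{ intros t. apply cK, HK. an. }
have bd : forall y, boundaryC O y -> (exists t, y = gam t) \/ Kin y.
{ intros y Hy. have [X|X] := two_sided_boundary HO TS Hy; auto. apply HK in X. destruct X as [t [_ E]]. eauto. }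
have gcont : forall t, pcont gam t by (intros t; eapply pder_pcont, (fr_gam F)). have Sep : exists e1, 0 < e1 /\ forall t w, Kin w -> e1 <= Cmod (gam t - w).
{ apply NNPP. intros N. have gB : exists M, forall t, Cmod (gam t) <= M.
 { destruct (@periodic_bounded (fun t => Re (gam t)) T HT) as [M1 B1]; [intros; now rewrite (fr_gamT F)|intros t; apply (proj1 (gcont t))|].
  destruct (@periodic_bounded (fun t => Im (gam t)) T HT) as [M2 B2]; [intros; now rewrite (fr_gamT F)|an|]. exists (M1 + M2). intros t.
  eapply Rle_trans; [apply Cmod_le_Re_Im|]. specialize (B1 t). specialize (B2 t). lra. }
 destruct gB as [M HM]. destruct (choice_nat (fun n (p : R * C) => Kin (snd p) /\ Cmod (gam (fst p) - snd p) < / (INR n + 1))) as [p Hp].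
 { intros n. apply NNPP. intros N'. apply N. exists (/ (INR n + 1)). split; [apply Rinv_0_lt_compat; have P := pos_INR n; lra|]. intros t w Kw. apply Rnot_lt_le.
  intros L. apply N'. exists (t, w). auto. }
 destruct (@cluster_C (fun n => gam (fst (p n))) M) as [l Hl]; auto. apply (Dis l).
 - apply cK. intros e He. have [n [_ Hn]] := Hl e 0%nat He. exists (gam (fst (p n))); auto.
 - apply cKin. intros e He. destruct (@inv_INR_small (e / 2)) as [m Hm]; [lra|]. destruct (Hl (e / 2) m) as [n [Hn1 Hn2]]; [lra|]. have [P1 P2] := Hp n.
  exists (snd (p n)). split; auto. specialize (Hm n Hn1). have Tr := Cmod_tri (snd (p n)) (gam (fst (p n))) l.
  rewrite (Cmod_minus_sym (snd (p n)) (gam (fst (p n)))) in Tr. lra. }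
destruct Sep as [e1 [He1 Sep]]. have [d1 [Hd1 Tub]] := frame_tube F. have [c [Hc Bil]] := frame_bilip F.
(* Here [3 / c * s] bounds [|t' - t|], [B / 2] bounds half of [kap1], and [(2 + 3 * B / c) * s]
   bounds the distance from [z] to the points of the curve in between. *)
set (C1 := 3 / c * (B / 2 * ((2 + 3 * B / c) * (2 + 3 * B / c)))). have bc : 0 < 3 * B / c by lra. have C1p : 0 < C1.
{ unfold C1. lra. }
set (M := Rabs M3 + Rabs Cst). have Mp : 0 <= M by (unfold M; have Q1 := Rabs_pos M3; have Q2 := Rabs_pos Cst; lra).
set (dl := Rmin (Rmin d1 (e1 / 4)) (Rmin (Rmin (eps / 2) (1 / 2)) (Rmin (/ (8 * B)) (/ (8 * (C1 + 1)))))). have dl0 : 0 < dl by lra.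
have bds : forall s t y, 0 < s < dl -> boundaryC O y -> s <= Cmod (tube gam tau s t - y).
{ intros s t y Hs Hy. have [[t' ->]|Ky] := bd y Hy; [apply Tub; lra|]. have X := Sep t y Ky. have Y := Cmod_tri (gam t) (tube gam tau s t) y.
 rewrite (Cmod_minus_sym (gam t) (tube gam tau s t)), (Cmod_tube t F) in Y by lra. lra. }
(* The inward normal enters [O] only for a length depending on [t]; since no boundary point is met
   before depth [dl], [path_stays] extends this to a uniform depth. *)
have tO : forall s t, 0 < s < dl -> O (tube gam tau s t).
{ intros s t Hs. have [s0 [Hs0 I]] := Hin t. have S := fr_sp F t. have iB : 0 < / B by lra. set (a := Rmin (s / 2) (s0 / 2 * speed gam t)). have a0 : 0 < a by lra.
 apply (@path_stays O (fun r => tube gam tau r t) a s); auto; try lra.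
 - intros r. eapply pder_pcont. apply pder_line.
 - have Y : 0 < a / speed gam t < s0.
  { split; [an|]. apply Rle_lt_trans with (s0 / 2); [|lra]. apply div_le; lra. }
  replace (tube gam tau a t) with (Cplus (gam t) (Cmult (RtoC (a / speed gam t)) (Ropp (Derive (gy gam) t), Derive (gx gam) t))); auto. unfold tube. f_equal.
  replace (Ropp (Derive (gy gam) t), Derive (gx gam) t) with (Ci * (Derive (gx gam) t, Derive (gy gam) t))%C.
  2:{ apply Ceq; simpl; ring. }
  rewrite <- Hsp. transitivity (RtoC (a / speed gam t * speed gam t) * (Ci * tau t))%C; [rewrite RtoC_mult; ring|]. do 2 f_equal. field. lra.
 - intros r Hr Hb. specialize (bds r t _ ltac:(lra) Hb). replace (tube gam tau r t - tube gam tau r t)%C with (RtoC 0) in bds by ring. rewrite Cmod_0 in bds. lra. }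
have gb : forall t, boundaryC O (gam t).
{ intros t. apply closure_boundary; auto. intros e He. have M1 := Rmin_l e dl. have M2 := Rmin_r e dl. have M0 : 0 < Rmin e dl by lra.
 exists (tube gam tau (Rmin e dl / 2) t). split; [apply tO; lra|]. rewrite (Cmod_tube t F); lra. }
exists dl, (M * 27 / 8 + C1). split; [auto|split; [lra|]]. intros s t Hs. split; [auto|split; [|split; auto]].
{ intros z Hz. apply (@disc_inside O (tube gam tau s t) z s); auto. }
intros z Hz. set (z0 := tube gam tau s t) in *. have Oz : O z by (apply (@disc_inside O z0 z s); auto; [apply tO; auto|intros; apply bds; auto|lra]).
have [y [Hy Hyd]] := nearest_boundary HO HBd Oz. have zg : Cmod (z - gam t) <= 3 / 2 * s.
{ have X := Cmod_tri z z0 (gam t). unfold z0 in X at 2. rewrite (Cmod_tube t F) in X by lra. lra. }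
have dmin : forall w, ~ O w -> Cmod (z - y) <= Cmod (z - w).
{ intros w Nw. apply Rnot_lt_le. intros L. apply Nw, Hyd. rewrite Cmod_minus_sym. auto. }
have dle : Cmod (z - y) <= 3 / 2 * s by (eapply Rle_trans; [an|exact zg]).
have gy3 : Cmod (gam t - y) <= 3 * s by (have X := Cmod_tri (gam t) z y; rewrite (Cmod_minus_sym (gam t) z) in X; lra).
have [[t1 E1]|Ky] := bd y Hy; [|have X := Sep t y Ky; lra]. have [m Hm] := period_reduce (t - T / 2) t1 HT. set (t' := t1 + IZR m * T) in *.
have E : y = gam t' by (rewrite E1; symmetry; apply periodic_Z, (fr_gamT F)). clear E1. subst y. set (d := Cmod (z - gam t')) in *. have d0 : 0 < d.
{ apply Cmod_gt_0. intros X. apply (KO (gam t') (gK t')). replace (gam t') with (z - (z - gam t'))%C by ring. rewrite X. replace (z - 0)%C with z by ring; auto. }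
have tt : Rabs (t' - t) <= 3 / c * s.
{ have X := Bil t t' ltac:(lra). rewrite Cmod_minus_sym in X. replace (3 / c * s) with (3 * s / c) by (field; lra). apply le_div; auto. lra. }
have crit : dot (tau t') (z - gam t') = 0.
{ have W : forall r, pder (fun r => z - gam r)%C r (- (RtoC (speed gam r) * tau r)).
 { intros r. eapply pder_eq; [apply @pder_minus; [an|apply (fr_gam F)]|ring]. }
 have Dv := pder_mult (pder_conj (W t')) (W t'). destruct Dv as [Dv _]. apply is_derive_min in Dv.
 - have X : -2 * speed gam t' * dot (tau t') (z - gam t') = 0.
  { rewrite <- Dv. unfold dot; simpl. ring. }
  have S := fr_sp F t'. have iB : 0 < / B by lra. have [Y|Y] := Rmult_integral _ _ X; lra.
 - intros x. change (dot (z - gam t') (z - gam t') <= dot (z - gam x) (z - gam x)). rewrite !dot_self. have X := dmin (gam x) (KO _ (gK x)). fold d. an. }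
set (lam := dot (Ci * tau t') (z - gam t')). have lam2 : lam * lam = d * d.
{ transitivity ((Cmod (tau t') * Cmod (tau t')) * (d * d)); [|rewrite (fr_tau1 F); ring].
 transitivity (lam * lam + dot (tau t') (z - gam t') * dot (tau t') (z - gam t')); [rewrite crit; ring|]. unfold d, lam. rewrite !Cmod_sqr.
 unfold dot, Re, Im; simpl. ring. }
have vm' : vmod gam tau (curvature gam) t' z = lam - curvature gam t' / 2 * (d * d) by auto.
have Var : Rabs (vmod gam tau (curvature gam) t' z - vmod gam tau (curvature gam) t z) <= C1 * (s * s * s).
{ destruct (MVT_gen (fun r => vmod gam tau (curvature gam) r z) t t' (fun r => - (kap1 r / 2) * (Cmod (z - gam r) * Cmod (z - gam r)))) as [r [Hr Er]].
 - intros x _. eapply is_derive_vmod; eauto.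
 - intros x _. eapply is_derive_cont_pt, is_derive_vmod; eauto.
 - rewrite Er, Rabs_mult, Rmult_comm. have Y : Rabs (r - t) <= Rabs (t' - t).
  { unfold Rmin, Rmax in Hr. destruct (Rle_dec t t'); unfold Rabs; repeat destruct Rcase_abs; lra. }
  have gl : Cmod (gam t - gam r) <= B * Rabs (r - t).
  { have H : forall p q, p <= q -> Cmod (gam q - gam p) <= B * (q - p).
   { intros p q Hpq. apply (@pder_lip gam (fun t => RtoC (speed gam t) * tau t)%C); auto.
    - intros; apply (fr_gam F).
    - intros x _. have S := fr_sp F x. have iB : 0 < / B by lra. rewrite Cmod_mult, (fr_tau1 F), Cmod_R, Rabs_pos_eq; lra. }
   have [h|h] := Rle_dec r t.
   - rewrite Rabs_minus_sym, Rabs_pos_eq by lra. auto.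
   - rewrite Cmod_minus_sym, Rabs_pos_eq by lra. apply H. lra. }
  have zr : Cmod (z - gam r) <= (2 + 3 * B / c) * s.
  { have X := Cmod_tri z (gam t) (gam r). assert (B * Rabs (r - t) <= B * (3 / c * s)) by lra. lra. }
  rewrite Rabs_mult, Rabs_Ropp, (Rabs_pos_eq (Cmod (z - gam r) * Cmod (z - gam r))) by nra. have K1 := fr_kap1B F r. unfold Rdiv at 1.
  rewrite Rabs_mult, (Rabs_pos_eq (/ 2)) by lra.
  replace (C1 * (s * s * s)) with (3 / c * s * (B / 2 * ((2 + 3 * B / c) * s * ((2 + 3 * B / c) * s)))) by (unfold C1; field; lra). an. }
have vlow : s / 4 <= vmod gam tau (curvature gam) t z.
{ unfold vmod. have A1 : s / 2 <= dot (Ci * tau t) (z - gam t).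
 { have X : dot (Ci * tau t) (z - gam t) = s * dot (Ci * tau t) (Ci * tau t) + dot (Ci * tau t) (z - z0).
  { unfold dot; simpl. ring. }
  have Y := dot_le (Ci * tau t) (z - z0). rewrite dot_self in X. rewrite Cmod_Ci_mult, (fr_tau1 F) in X, Y. apply Rabs_le_between in Y. lra. }
 have kB := fr_kapB F t. have Q := Cmod_ge_0 (z - gam t). have A2 : Cmod (z - gam t) * Cmod (z - gam t) <= 9 / 4 * (s * s) by nra.
 have A3 : s * (8 * B) <= 1 by (apply Rle_trans with (/ (8 * B) * (8 * B)); [an|right; field; lra]).
 have A4 : curvature gam t / 2 * (Cmod (z - gam t) * Cmod (z - gam t)) <= B / 2 * (9 / 4 * (s * s)) by (apply Rle_trans with (B / 2 * (Cmod (z - gam t) * Cmod (z - gam t))); an).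
 have A5 : B / 2 * (9 / 4 * (s * s)) <= s / 4 by nra. lra. }
have C1s : C1 * (s * s * s) <= s / 8.
{ have X : s * (8 * (C1 + 1)) <= 1 by (apply Rle_trans with (/ (8 * (C1 + 1)) * (8 * (C1 + 1))); [an|right; field; lra]). nra. }
(* So far [lam = d] or [lam = - d]. The negative sign would make the model at [t'] negative, while
   it differs by at most [s / 8] from the model at [t], which is at least [s / 4]. *)
have lamd : lam = d.
{ have X : (lam - d) * (lam + d) = 0 by lra. have [Y|Y] := Rmult_integral _ _ X; [lra|auto]. apply Rabs_le_between in Var. have kB := fr_kapB F t'.
 apply Rabs_le_between in kB. have A3 : s * (8 * B) <= 1 by (apply Rle_trans with (/ (8 * B) * (8 * B)); [an|right; field; lra]).
 have A4 : - curvature gam t' * d <= 1 by (apply Rle_trans with (B * (3 / 2 * s)); nra). nra. }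
have H3' := H3 z t' Oz. cbv zeta in H3'. fold d in H3'. have X := H3' ltac:(intros w Hw; apply dmin, (boundary_not_in HO Hw)) ltac:(lra).
have P := @Rpower_3_le d alpha ltac:(lra) Hal. have Pp : 0 < Rpower d (3 + alpha) by apply exp_pos.
have d3 : d * d * d <= 27 / 8 * (s * s * s) by (apply Rle_trans with (9 / 4 * (s * s) * (3 / 2 * s)); [apply Rmult_le_compat; nra|lra]).
have Main : Rabs (exp (- u z) - vmod gam tau (curvature gam) t' z) <= M * (d * d * d).
{ rewrite vm', lamd.
 replace (exp (- u z) - (d - curvature gam t' / 2 * (d * d))) with ((exp (- u z) - (d - / 2 * curvature gam t' * d ^ 2 + c3 (gam t') * d ^ 3)) + c3 (gam t') * (d * d * d)) by (field).
 eapply Rle_trans; [apply Rabs_triang|]. rewrite Rabs_mult, (Rabs_pos_eq (d * d * d)) by lra. have A1 := HM3 t'.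
 have A5 : Cst * Rpower d (3 + alpha) <= Rabs Cst * (d * d * d) by (apply Rle_trans with (Rabs Cst * Rpower d (3 + alpha)); an).
 have A6 : Rabs (c3 (gam t')) * (d * d * d) <= Rabs M3 * (d * d * d) by lra. unfold M. lra. }
replace (exp (- u z) - vmod gam tau (curvature gam) t z) with ((exp (- u z) - vmod gam tau (curvature gam) t' z) + (vmod gam tau (curvature gam) t' z - vmod gam tau (curvature gam) t z)) by ring.
eapply Rle_trans; [apply Rabs_triang|]. assert (M * (d * d * d) <= M * (27 / 8 * (s * s * s))) by lra. lra.
Qed.

(** Near the outer curve the expansion gives [exp (- u) <= Q * d], a growth of rate 1; the inner
    component is [growth_inner]. *)
Lemma growth_all {O K Kin alpha beta T B M3 f g gam tau kap1 u c3 gm} : 0 < beta < 1 -> opn O ->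
 boundedC O -> biholo O beta f g -> hyperbolic_factor O u -> two_sided O K Kin -> frame T gam tau (speed gam) (curvature gam) kap1 B -> (forall y, boundaryC K y <->
 exists t, 0 <= t < T /\ y = gam t) -> 0 < alpha -> third_coefficient O alpha gam u c3 -> (forall t, Rabs (c3 (gam t)) <= M3) -> 0 < gm < 1 -> growth O u gm.
Proof.
intros Hb HO HBd Bi Hu TS F HK Hal [eps [Cst [Heps H3]]] HM3 Hgm M. have TS' := TS. destruct TS' as [_ [_ [KinO [_ [_ [_ [Kc [b1 [b2 [K1 [K2 K12]]]]]]]]]]].
have [d1 [Hd1 G1]] := growth_inner Hb HO HBd Bi Hu Kc KinO K1 K2 K12 Hgm M. set (Q := 1 + B + Rabs M3 + Rabs Cst).
have [d2 [Hd2 L2]] := ln_large ((M + ln Q) / (1 - gm)). exists (Rmin (Rmin d1 d2) (Rmin eps 1)). have A1 := Rmin_l (Rmin d1 d2) (Rmin eps 1).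
have A2 := Rmin_r (Rmin d1 d2) (Rmin eps 1). have A3 := Rmin_l d1 d2. have A4 := Rmin_r d1 d2. have A5 := Rmin_l eps 1. have A6 := Rmin_r eps 1. split; [an|].
intros z y Oz Hy Hd Hzy. have [Ky|Ky] := two_sided_boundary HO TS Hy; [|apply G1; auto; lra]. apply HK in Ky. destruct Ky as [t [_ ->]].
set (d := Cmod (z - gam t)) in *. have NO : forall w, boundaryC O w -> d <= Cmod (z - w).
{ intros w Hw. apply Rnot_lt_le. intros L. apply (boundary_not_in HO Hw), Hd. rewrite Cmod_minus_sym; auto. }
have d0 : 0 < d.
{ apply Cmod_gt_0. intros X. apply (boundary_not_in HO Hy). replace (gam t) with (z - (z - gam t))%C by ring. rewrite X. replace (z - 0)%C with z by ring; auto. }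
have X := H3 z t Oz NO ltac:(fold d; lra). fold d in X. have P := @Rpower_3_le d alpha ltac:(lra) Hal. have Pp : 0 < Rpower d (3 + alpha) by apply exp_pos.
have kB := fr_kapB F t. have cB := HM3 t. have Up : exp (- u z) <= Q * d.
{ apply Rabs_le_between in kB. apply Rabs_le_between in cB. have B1 := Rle_abs M3.
 have Y1 : Cst * Rpower d (3 + alpha) <= Rabs Cst * (d * d * d) by (apply Rle_trans with (Rabs Cst * Rpower d (3 + alpha)); an). have d2p : d * d <= d by nra.
 have d3p : d * d * d <= d by nra. have Y2 : - / 2 * curvature gam t * d ^ 2 <= B * d by (apply Rle_trans with (B * (d * d)); [nra|an]).
 have Y3 : c3 (gam t) * d ^ 3 <= Rabs M3 * d by (apply Rle_trans with (Rabs M3 * (d * d * d)); [nra|an]). have Y4 : Rabs Cst * (d * d * d) <= Rabs Cst * d by lra.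
 unfold Q. lra. }
apply ln_mono in Up; [|an]. rewrite ln_exp, ln_mult in Up by (unfold Q; lra). specialize (L2 d ltac:(lra)).
have Y : (M + ln Q) / (1 - gm) * (1 - gm) <= - ln d * (1 - gm) by lra. replace ((M + ln Q) / (1 - gm) * (1 - gm)) with (M + ln Q) in Y by (field; lra). lra.
Qed.

Lemma factor_formula {O beta f g u z} : 0 < beta < 1 -> opn O -> boundedC O -> biholo O beta f g ->
 hyperbolic_factor O u -> (forall gm, 0 < gm < 1 -> growth O u gm) -> O z -> exp (- u z) * (bw beta 0 * Cmod (ell f z)) = sin (bw beta 0 * sg f z).
Proof.
intros Hb HO HBd Bi Hu HG Oz. rewrite (hyperbolic_factor_unique Hb HO HBd Bi Hu HG Oz). have lb : ln beta < 0 by (rewrite <- ln_1; apply ln_increasing; lra).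
have b0 : 0 < bw beta 0 by (apply bw_pos; lra). have S := @sg_range O beta f g z ltac:(lra) Bi Oz. have S1 := @bw_range beta 0 (sg f z) ltac:(lra) ltac:(lra).
have l0 : 0 < Cmod (ell f z).
{ apply Cmod_pos. unfold ell. have D := biholo_derive_neq_0 HO Bi Oz. have N : f z <> 0 by (apply (@annulus_neq_0 beta); [lra|apply Bi; auto]). intros E. apply D.
 replace (C_derive f z) with (C_derive f z / f z * f z)%C by (field; auto). rewrite E. ring. }
unfold Ueta. rewrite Rplus_0_r in *. have s0 : 0 < sin (bw beta 0 * sg f z) by (apply sin_gt_0; lra). set (q := sin (bw beta 0 * sg f z)) in *.
replace (- (ln (Cmod (ell f z)) - ln (q / bw beta 0))) with (ln (q / bw beta 0) + - ln (Cmod (ell f z))) by ring.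
rewrite exp_plus, exp_Ropp, !exp_ln; auto; [field; lra|]. lra.
Qed.

Lemma biholo_swap {O beta f g} : 0 < beta < 1 -> biholo O beta f g ->
 biholo O beta (fun z => RtoC beta / f z)%C (fun w => g (RtoC beta / w)%C).
Proof.
intros Hb [Hf [Hg [Hfa [Hga [Hgf Hfg]]]]]. have b0 : RtoC beta <> 0 by lra. have N : forall w, annulus beta w -> w <> 0 by (intros w; apply annulus_neq_0; lra).
have A : forall w, annulus beta w -> annulus beta (beta / w)%C.
{ intros w Hw. have W := N w Hw. destruct Hw as [H1 H2]. unfold annulus. rewrite Cmod_div, Cmod_R, Rabs_pos_eq by (auto; lra).
 split; [apply lt_div|apply div_lt]; nra. }
have I : forall w : C, w <> 0 -> (beta / (beta / w))%C = w by (intros; field; auto). split; [|split; [|split; [|split; [|split]]]].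
- apply (@hol_intro _ _ (fun z => beta * - (C_derive f z / (f z * f z)))%C). intros z Oz. an.
- apply (@hol_intro _ _ (fun w => C_derive g (beta / w) * (beta * - / (w * w)))%C). intros w Aw. an.
- intros z Oz. auto.
- intros w Aw. auto.
- intros z Oz. rewrite I; auto.
- intros w Aw. rewrite Hfg by auto. auto.
Qed.

(* Each collar lies near one end of the annulus; inverting the annulus makes it the outer one. *)
Lemma collar_outer_end {O beta f0 g0 gam tau kap v T B sp kap1 dl C0} : 0 < beta < 1 -> opn O -> boundedC O -> biholo O beta f0 g0 -> frame T gam tau sp kap kap1 B -> collar O gam tau kap v dl C0 ->
 exists f g, biholo O beta f g /\ forall eta, 0 < eta -> exists d, 0 < d /\ forall s t, 0 < s < d -> 1 - eta < Cmod (f (tube gam tau s t)).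
Proof.
intros Hb HO HBd Bi F [Hdl [_ Hcol]]. have inO : forall s t, 0 < s < dl -> O (tube gam tau s t).
{ intros s t Hs. apply (Hcol s t Hs). replace (tube gam tau s t - tube gam tau s t)%C with (RtoC 0) by ring. rewrite Cmod_0. lra. }
have near : forall s t, 0 < s -> Cmod (tube gam tau s t - gam t) = s by (intros; eapply Cmod_tube; eauto; lra). set (e0 := (1 - beta) / 4).
have e0p : 0 < e0 by (unfold e0; lra). have [d0 [Hd0 K0]] := biholo_proper HO HBd Bi e0p. set (d1 := Rmin d0 dl). have d1p : 0 < d1 by lra.
have dich : forall s t, 0 < s < d1 -> Cmod (f0 (tube gam tau s t)) < beta + e0 \/ 1 - e0 < Cmod (f0 (tube gam tau s t)).
{ intros s t Hs. apply (K0 _ (gam t)); [apply inO; lra|apply (Hcol s t ltac:(lra))|]. rewrite near; lra. }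
have cont : forall (c : R -> C), (forall r, pcont c r) -> (forall r, O (c r)) -> forall r, continuous (fun r => Cmod (f0 (c r))) r.
{ intros c Hc Oc r. apply (@pcont_comp (fun z => RtoC (Cmod (f0 z))) c); auto. apply ccont_Cmod. eapply hol_ccont; [apply Bi|auto]. }
have tubet : forall s r, pcont (fun t => tube gam tau s t) r.
{ intros s r. apply pcont_plus; [eapply pder_pcont, (fr_gam F)|]. apply pcont_mult; [an|]. apply pcont_mult; [an|]. eapply pder_pcont, (fr_tau F). }
have same : forall s t s' t', 0 < s < d1 -> 0 < s' < d1 -> Cmod (f0 (tube gam tau s t)) < beta + e0 -> Cmod (f0 (tube gam tau s' t')) < beta + e0.
{ intros s t s' t' Hs Hs' H. have H1 : Cmod (f0 (tube gam tau s t')) < beta + e0.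
 { apply (@stay_below (fun t => Cmod (f0 (tube gam tau s t))) (beta + e0) (1 - e0) t t'); auto; [|unfold e0; lra]. apply cont; auto. intros; apply inO; lra. }
 (* A path between the two depths defined for all real [r] that never leaves the interval between
    them. *)
 set (p := fun r => s + (s' - s) * (sin r * sin r)). have pr : forall r, 0 < p r < d1.
 { intros r. have X := SIN_bound r. assert (0 <= sin r * sin r <= 1) by nra. unfold p. have [h|h] := Rle_dec s s'; nra. }
 have E0 : p 0 = s by (unfold p; rewrite sin_0; ring). have E1 : p (PI / 2) = s' by (unfold p; rewrite sin_PI2; ring). rewrite <- E1.
 apply (@stay_below (fun r => Cmod (f0 (tube gam tau (p r) t'))) (beta + e0) (1 - e0) 0 (PI / 2)); auto; [|unfold e0; lra|now rewrite E0].
 apply cont; [|intros; apply inO; specialize (pr r); lra]. intros r. apply pcont_plus; [an|]. apply pcont_mult; [|an]. apply pcont_RtoC.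
 apply (ex_derive_continuous (V := R_NormedModule)). unfold p. auto_derive. auto. }
have refine : forall eta, 0 < eta -> exists d, 0 < d /\ d <= d1 /\ forall s t, 0 < s < d -> Cmod (f0 (tube gam tau s t)) < beta + Rmin eta e0 \/ 1 - Rmin eta e0 < Cmod (f0 (tube gam tau s t)).
{ intros eta He. have [d2 [Hd2 K2]] := @biholo_proper O beta (Rmin eta e0) f0 g0 HO HBd Bi ltac:(lra). exists (Rmin d1 d2). split; [an|]. have m1 := Rmin_l d1 d2.
 have m2 := Rmin_r d1 d2. split; auto. intros s t Hs. apply (K2 _ (gam t)); [apply inO; lra|apply (Hcol s t ltac:(lra))|]. rewrite near; lra. }
have [Low|High] := dich (d1 / 2) 0 ltac:(lra).
- exists (fun z => beta / f0 z)%C, (fun w => g0 (beta / w)%C). split; [apply biholo_swap; auto|]. intros eta He.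
 destruct (refine (beta * eta)) as [d [Hd [Hd1 K]]]; [nra|]. exists d. split; auto. intros s t Hs. have L := same (d1 / 2) 0 s t ltac:(lra) ltac:(lra) Low.
 have m1 := Rmin_l (beta * eta) e0. have m2 := Rmin_r (beta * eta) e0. destruct Bi as [_ [_ [Hfa _]]]. have [F1 F2] := Hfa _ (inO s t ltac:(lra)).
 rewrite Cmod_div, Cmod_R, Rabs_pos_eq by (try (apply Cmod_gt_0); lra). apply lt_div; [lra|]. have [X|X] := K s t Hs; [|unfold e0 in *; lra]. nra.
- exists f0, g0. split; auto. intros eta He. have [d [Hd [Hd1 K]]] := refine eta He. exists d. split; auto. intros s t Hs. have m1 := Rmin_l eta e0.
 have m2 := Rmin_r eta e0. have [X|X] := K s t Hs; [|lra]. have L := same s t (d1 / 2) 0 ltac:(lra) ltac:(lra) ltac:(lra). unfold e0 in *. lra.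
Qed.

(** * Stability of the Schwarz lemma *)
Lemma CInt_conj {f a b} : cintg f a b -> CInt (fun t => Cconj (f t)) a b = Cconj (CInt f a b).
Proof.
intros [A B]. unfold CInt. apply Ceq; unfold Im in *; simpl; auto. rewrite (RInt_ext _ (fun t => -1 * snd (f t))); [rewrite RInt_Rscal; auto; ring|]. intros t _.
lra.
Qed.

Lemma Cmod_exists_unit w : exists a : C, Cmod a = 1 /\ (Cconj a * w)%C = RtoC (Cmod w).
Proof.
have [E|E] := Req_dec (Cmod w) 0.
- exists 1%C. split; [apply Cmod_1|]. apply Cmod_eq_0 in E. rewrite E, Cmod_0. ring.
- have P := Cmod_ge_0 w. have N : RtoC (Cmod w) <> 0 by lra. exists (w / RtoC (Cmod w))%C. split.
 + rewrite Cmod_div, Cmod_R, Rabs_pos_eq by auto. field. auto.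
 + have X : (Cconj w * w)%C = (RtoC (Cmod w) * RtoC (Cmod w))%C.
  { rewrite <- RtoC_mult, Cmod_sqr. apply Ceq; unfold Re, Im; simpl; ring. }
  replace (Cconj (w / RtoC (Cmod w)) * w)%C with ((Cconj w * w) / RtoC (Cmod w))%C.
  2:{ unfold Cdiv. rewrite Cmult_conj, Cinv_conj by auto. replace (Cconj (RtoC (Cmod w))) with (RtoC (Cmod w)) by (apply Ceq; simpl; ring). ring. }
  rewrite X. field. auto.
Qed.

(** The hypothesis is infinitesimal: [h] stretches the hyperbolic metric by at most [1 + eps]. Were
    the bound to fail along a ray, then at the maximum of the excess [phi] one has [|h| > m], so the
    stretching bound makes the derivative of [phi] negative there, and [phi] would be larger just
    before. *)
Lemma schwarz_ray {h h1 : C -> C} {r eps x} : 0 < r <= 1 -> 0 <= eps -> h 0 = 0%C -> (forall x, Cmod x < r -> cder h x (h1 x)) -> (forall x, Cmod x < r ->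
 Cmod (h1 x) * (1 - Cmod x * Cmod x) <= (1 + eps) * (1 - Cmod (h x) * Cmod (h x))) -> Cmod x < r -> Cmod (h x) <= (1 + eps) * Cmod x.
Proof.
intros Hr He H0 Hd Hb Hx. apply Rnot_lt_le. intros L. have [a [a1 Ea]] := Cmod_exists_unit (h x). have x0 : x <> 0.
{ intros ->. rewrite H0, Cmod_0 in L. lra. }
have rp := Cmod_pos x0. set (r1 := Cmod x) in *. set (xi := (x / r1)%C). have N : RtoC r1 <> 0 by lra.
have xi1 : Cmod xi = 1 by (unfold xi; rewrite Cmod_div, Cmod_R, Rabs_pos_eq by lra; unfold r1; field; fold r1; lra).
have pm : forall s, 0 <= s -> Cmod (s * xi) = s by (intros s Hs; rewrite Cmod_mult, xi1, Cmod_R, Rabs_pos_eq; lra).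
set (phi := fun s => dot a (h (RtoC s * xi)%C) - (1 + eps) * s). have Dphi : forall s, 0 <= s <= r1 -> is_derive phi s (dot a (h1 (s * xi)%C * xi) - (1 + eps)).
{ intros s Hs. eapply is_derive_eq.
 - apply @is_derive_Rminus.
  + apply is_derive_dot. apply @pder_comp.
   * eapply pder_eq; [apply (@pder_mult RtoC (fun _ => xi)); [apply (@pder_RtoC (fun s => s) s 1), (is_derive_id (K := R_AbsRing))|an]|]. instantiate (1 := xi).
    ring.
   * apply Hd. rewrite pm; lra.
  + apply @is_derive_Rmult; an.
 - an. }
destruct (continuity_ab_maj phi 0 r1 ltac:(lra)) as [m [M1 M2]].
{ intros c Hc. eapply is_derive_cont_pt, Dphi; auto. }
have Pm : 0 < phi m.
{ apply Rlt_le_trans with (phi r1); [|apply M1; lra]. unfold phi. replace (r1 * xi)%C with x by (unfold xi; field; auto). unfold dot. rewrite Ea. simpl. lra. }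
have m0 : 0 < m.
{ have [|E] := Rle_lt_or_eq_dec 0 m ltac:(lra); auto. subst m. unfold phi in Pm. replace (RtoC 0 * xi)%C with (RtoC 0) in Pm by ring. rewrite H0 in Pm.
 unfold dot in Pm; simpl in Pm. lra. }
set (y := (m * xi)%C). have ym : Cmod y = m by (apply pm; lra). have hy : m < Cmod (h y).
{ have X := dot_le a (h y). have Y := Rle_abs (dot a (h y)). unfold phi in Pm. fold y in Pm. nra. }
have Neg : dot a (h1 y * xi) - (1 + eps) < 0.
{ have X := dot_le a (h1 y * xi). rewrite a1, Cmod_mult, xi1 in X. have Z := Hb y ltac:(lra). rewrite ym in Z.
 have Z2 : Cmod (h1 y) * (1 - m * m) < (1 + eps) * (1 - m * m).
 { eapply Rle_lt_trans; [exact Z|]. apply Rmult_lt_compat_l; [lra|]. nra. }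
 assert (0 < 1 - m * m) by nra. apply Rmult_lt_reg_r in Z2; lra. }
set (l := dot a (h1 y * xi) - (1 + eps)) in *. have [d [Hd0 K]] := proj1 (@is_derive_eps phi m l) (Dphi m ltac:(lra)) (- l / 2) ltac:(lra).
set (q := Rmin (d / 2) (m / 2)). have q0 : 0 < q by lra. specialize (K (m - q)). replace (m - q - m) with (- q) in K by ring.
rewrite Rabs_Ropp, Rabs_pos_eq in K by lra. specialize (K ltac:(lra)). apply Rabs_le_between in K. have X := M1 (m - q) ltac:(lra). nra.
Qed.

(** Caratheodory's inequality: a Fourier coefficient of the non-negative function [2 * (c - Re F)]
    is bounded by its integral. The conditions on [e] remove the contributions of the constant and
    of the conjugate of [F]. *)
Lemma extremal_coefficient {F e c delta} : (forall t, pcont F t) -> (forall t, pcont e t) -> (forall t, Cmod (e t) = 1) ->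
 (forall t, Re (F t) <= c) -> 2 * PI * c - Re (CInt F 0 (2 * PI)) <= delta -> CInt e 0 (2 * PI) = 0 -> CInt (fun t => F t * Cconj (e t))%C 0 (2 * PI) = 0 ->
 Cmod (CInt (fun t => F t * e t)%C 0 (2 * PI)) <= 2 * delta.
Proof.
intros HF He e1 Hc Hd I1 I2. have G : forall f, (forall t, pcont f t) -> cintg f 0 (2 * PI) by an.
have E : CInt (fun t => RtoC (2 * (c - Re (F t))) * e t)%C 0 (2 * PI) = (- CInt (fun t => F t * e t)%C 0 (2 * PI))%C.
{ rewrite (@CInt_ext _ (fun t => (RtoC (2 * c) * e t - F t * e t) - Cconj (F t * Cconj (e t)))%C).
 2:{ intros t _. destruct (F t) as [p q]. apply Ceq; simpl; ring. }
 have A1 : forall t, pcont (fun t => RtoC (2 * c) * e t)%C t by an. have A2 : forall t, pcont (fun t => F t * e t)%C t by an.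
 have A3 : forall t, pcont (fun t => F t * Cconj (e t))%C t by an. rewrite CInt_minus, CInt_minus, CInt_conj, I2, CInt_scal, I1; auto.
 - apply Ceq; simpl; ring.
 - an.
 - an. }
have cR : forall t, continuous (fun t => 2 * (c - Re (F t))) t.
{ intros t. apply (continuous_mult (fun _ => 2) (fun t => c - Re (F t))); [an|].
 apply (continuous_minus (fun _ => c) (fun t => Re (F t))); [an|apply (proj1 (HF t))]. }
have B : Cmod (CInt (fun t => RtoC (2 * (c - Re (F t))) * e t)%C 0 (2 * PI)) <= RInt (fun t => 2 * (c - Re (F t))) 0 (2 * PI).
{ apply CInt_norm; [lra| |apply ex_RInt_cont; auto|].
 - apply G. intros t. apply pcont_mult; auto. apply pcont_RtoC. auto.
 - intros t _. rewrite Cmod_mult, e1, Cmod_R, Rabs_pos_eq; [lra|]. specialize (Hc t). lra. }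
rewrite E, Cmod_opp in B. eapply Rle_trans; [exact B|]. have HR : ex_RInt (fun t => Re (F t)) 0 (2 * PI) by (apply ex_RInt_cont; intros t; apply (proj1 (HF t))).
rewrite RInt_Rscal, RInt_Rminus, RInt_Rconst; auto; [|an|apply ex_RInt_Rminus; auto; apply ex_RInt_Rconst].
change (Re (CInt F 0 (2 * PI))) with (RInt (fun t => Re (F t)) 0 (2 * PI)) in Hd. lra.
Qed.

(** On the circle of radius [p = r / 2], [F] is [h x * p / x] up to a rotation. By [schwarz_ray] its
    real part is at most [(1 + eps) * p], while [1 - eps <= |h1 0|] puts its mean within
    [2 * eps * p] of that bound; the next two Taylor coefficients are then of order [eps]. *)
Lemma schwarz_stability {h h1 h2 h3 : C -> C} {r eps} : 0 < r <= 1 -> 0 <= eps -> h 0 = 0%C -> (forall x, Cmod x < r ->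
 cder h x (h1 x) /\ cder h1 x (h2 x) /\ cder h2 x (h3 x)) -> (forall x, Cmod x < r ->
 Cmod (h1 x) * (1 - Cmod x * Cmod x) <= (1 + eps) * (1 - Cmod (h x) * Cmod (h x))) -> 1 - eps <= Cmod (h1 0) ->
 Cmod (h2 0) <= 16 * eps / r * 2 /\ Cmod (h3 0) <= 48 * eps / (r * r) * 4.
Proof.
intros Hr He H0 Hd Hb Hl. have PI0 := PI_RGT_0. set (p := r / 2).
have d0 : forall x, disc 0 r x <-> Cmod x < r by (intros x; unfold disc; replace (x - 0)%C with x by ring; tauto).
have Hol : hol (disc 0 r) h by (apply (@hol_intro _ _ h1); intros x Hx; apply Hd, d0; auto).
have Loc : forall f g : C -> C, (forall x, Cmod x < r -> f x = g x) -> forall x, Cmod x < r -> exists e, 0 < e /\ forall w, Cmod (w - x) < e -> f w = g w.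
{ intros f g E x Hx. exists (r - Cmod x). split; [lra|]. intros w Hw. apply E. have T := Cmod_le_plus w x. lra. }
have D1 : forall x, Cmod x < r -> C_derive h x = h1 x by (intros; apply cder_C_derive, Hd; auto). have D2 : forall x, Cmod x < r -> C_derive (C_derive h) x = h2 x.
{ intros x Hx. apply cder_C_derive. apply cder_ext with h1; [apply Loc; auto; intros; symmetry; auto|apply Hd; auto]. }
have D3 : forall x, Cmod x < r -> C_derive (C_derive (C_derive h)) x = h3 x.
{ intros x Hx. apply cder_C_derive. apply cder_ext with h2; [apply Loc; auto; intros; symmetry; auto|apply Hd; auto]. }
have z0 : Cmod 0 < r by (rewrite Cmod_0; lra). have [I0 [I1 [I2 I3]]] := @cauchy_center h 0 p r ltac:(unfold p; lra) Hol. rewrite D1, D2, D3, H0 in * by auto.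
have Ix : CInt (fun t => (fun x => x * h x)%C (circ 0 p t)) 0 (2 * PI) = 0.
{ destruct (@cauchy_center (fun x => x * h x)%C 0 p r ltac:(unfold p; lra)) as [X _].
 - apply (@hol_intro _ _ (fun x => 1 * h x + x * h1 x)%C). intros x Hx. apply @cder_mult; [an|apply Hd, d0; auto].
 - rewrite X. ring. }
have C1 : forall x : C, C_derive (fun _ => 1%C) x = 0 by (intros; apply cder_C_derive, cder_const). have C2 : forall x : C, C_derive (C_derive (fun _ => 1%C)) x = 0.
{ intros x. apply cder_C_derive. apply cder_ext with (fun _ => 0%C); [exists 1; split; an|an]. }
destruct (@cauchy_center (fun _ => 1%C) 0 p r ltac:(unfold p; lra)) as [_ [J1 [J2 _]]].
{ apply (@hol_intro _ _ (fun _ => 0%C)). intros; apply cder_const. }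
rewrite C1 in J1. rewrite C2 in J2. have [a [a1 Ea]] := Cmod_exists_unit (h1 0). set (F := fun t => (Cconj a * (h (circ 0 p t) * / cis t))%C).
have hc : forall t, pcont (fun t => h (circ 0 p t)) t.
{ intros t. apply pcont_comp; [apply pcont_circ|]. eapply cder_ccont. apply Hd, d0. unfold disc. rewrite Cmod_circ; unfold p; lra. }
have ic : forall t, pcont (fun t => / cis t)%C t by (intros; apply pcont_inv; [apply cis_neq_0|an]).
have pF : forall t, pcont F t by (intros t; apply pcont_mult; an). have ub : forall t, Cmod (h (circ 0 p t)) <= (1 + eps) * p.
{ intros t. have Y : Cmod (circ 0 p t) = p by (replace (circ 0 p t) with (circ 0 p t - 0)%C by ring; apply Cmod_circ; unfold p; lra). rewrite <- Y at 2.
 apply (@schwarz_ray h h1 r eps); auto; [intros; apply Hd; auto|unfold p in *; lra]. }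
have reF : forall t, Re (F t) <= (1 + eps) * p.
{ intros t. eapply Rle_trans; [|apply (ub t)]. eapply Rle_trans; [apply Rle_abs|]. eapply Rle_trans; [apply re_le_Cmod|]. unfold F.
 rewrite !Cmod_mult, Cmod_conj, a1, Cmod_inv, Cmod_cis by apply cis_neq_0. lra. }
have mean : 2 * PI * ((1 + eps) * p) - Re (CInt F 0 (2 * PI)) <= 2 * PI * p * (2 * eps).
{ unfold F. rewrite CInt_scal by (apply cintg_pcont; intros; apply pcont_mult; auto). rewrite I1.
 replace (Cconj a * (RtoC (2 * PI) * p * h1 0))%C with (RtoC (2 * PI) * p * (Cconj a * h1 0))%C by ring. rewrite Ea, <- !RtoC_mult.
 change (Re (RtoC (2 * PI * p * Cmod (h1 0)))) with (2 * PI * p * Cmod (h1 0)). have Q : 0 < PI * p by (unfold p; nra).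
 assert (PI * p * (1 - eps) <= PI * p * Cmod (h1 0)) by lra. lra. }
have cc : forall t, Cconj (/ cis t) = cis t.
{ intros t. rewrite Cinv_conj by apply cis_neq_0. rewrite <- cis_opp. have N := cis_neq_0 (- t). have X : (cis t * cis (- t))%C = 1.
 { rewrite <- cis_plus. replace (t + - t) with 0 by ring. apply cis_0. }
 replace (cis t) with (cis t * cis (- t) / cis (- t))%C by (field; auto). rewrite X. field; auto. }
have i1 : forall t, Cmod (/ cis t) = 1 by (intros; rewrite Cmod_inv, Cmod_cis by apply cis_neq_0; apply Rinv_1).
have cinv : forall t, (/ cis t * cis t)%C = 1 by (intros t; have N := cis_neq_0 t; field; auto).
have hcint : forall f, (forall t, pcont f t) -> cintg f 0 (2 * PI) by an. have X2 := extremal_coefficient pF ic i1 reF mean.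
have X3 := extremal_coefficient pF (fun t => pcont_pow 2 (ic t)) ltac:(intros t; simpl; rewrite !Cmod_mult, i1, Cmod_1; ring) reF mean. split.
- have Y : Cmod (CInt (fun t => F t * / cis t)%C 0 (2 * PI)) <= 2 * (2 * PI * p * (2 * eps)).
 { apply X2.
  - rewrite (@CInt_ext _ (fun t => 1 * / cis t)%C) by (intros; ring). rewrite J1. ring.
  - rewrite (@CInt_ext _ (fun t => Cconj a * h (circ 0 p t))%C).
   + rewrite CInt_scal by auto. rewrite I0. ring.
   + intros t _. rewrite cc. unfold F. transitivity (Cconj a * h (circ 0 p t) * (/ cis t * cis t))%C; [ring|rewrite cinv; ring]. }
 rewrite (@CInt_ext _ (fun t => Cconj a * (h (circ 0 p t) * (/ cis t) ^ 2))%C) in Y by (intros; unfold F; ring).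
 rewrite CInt_scal, I2, !Cmod_mult, Cmod_conj, a1 in Y.
 2:{ apply hcint. intros. apply pcont_mult; auto. apply pcont_pow; auto. }
 rewrite Cmod_pow, !Cmod_R, !Rabs_pos_eq in Y by (unfold p; lra). replace (16 * eps / r * 2) with (8 * eps / p * 2) by (unfold p; field; lra). unfold Rdiv at 1.
 apply Rmult_le_reg_l with (PI * p * p); [unfold p; assert (0 < PI * r) by nra; nra|].
 replace (PI * p * p * (8 * eps * / p * 2)) with (16 * (PI * p * eps)) by (unfold p; field; lra).
 assert (0 <= PI * p * eps) by (apply Rmult_le_pos; [apply Rmult_le_pos; unfold p; lra|lra]). lra.
- have Y : Cmod (CInt (fun t => F t * (/ cis t) ^ 2)%C 0 (2 * PI)) <= 2 * (2 * PI * p * (2 * eps)).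
 { apply X3.
  - rewrite (@CInt_ext _ (fun t => 1 * (/ cis t) ^ 2)%C) by (intros; ring). rewrite J2. ring.
  - rewrite (@CInt_ext _ (fun t => (Cconj a * / p) * (fun x => x * h x) (circ 0 p t))%C).
   + rewrite CInt_scal, Ix; [ring|]. apply hcint. intros. apply pcont_mult; auto. apply pcont_circ.
   + intros t _. simpl. rewrite !Cmult_conj, cc. replace (Cconj 1) with (RtoC 1) by (apply Ceq; simpl; ring). unfold F.
    have N : RtoC p <> 0 by (apply RtoC_neq; unfold p; lra). transitivity (Cconj a * h (circ 0 p t) * cis t * (/ cis t * cis t))%C; [ring|rewrite cinv].
    unfold circ at 2. field. auto. }
 rewrite (@CInt_ext _ (fun t => Cconj a * (h (circ 0 p t) * (/ cis t) ^ 3))%C) in Y by (intros; unfold F; ring).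
 rewrite CInt_scal, I3, !Cmod_mult, Cmod_conj, a1 in Y.
 2:{ apply hcint. intros. apply pcont_mult; auto. apply pcont_pow; auto. }
 rewrite Cmod_pow, !Cmod_R, !Rabs_pos_eq in Y by (unfold p; lra). replace (48 * eps / (r * r) * 4) with (48 * eps * / (p * p)) by (unfold p; field; lra).
 have pp : 0 < PI * p by (unfold p; nra). have p3 : 0 < PI * p * p * p by (apply Rmult_lt_0_compat; unfold p; lra). apply Rmult_le_reg_l with (PI * p * p * p); auto.
 replace (PI * p * p * p * (48 * eps * / (p * p))) with (48 * (PI * p * eps)) by (unfold p; field; lra). assert (0 <= PI * p * eps) by lra. lra.
Qed.

(** * The developing map and its Schwarzian derivative *)

Definition lel (f : C -> C) (z : C) : C := (C_derive (ell f) z / ell f z)%C.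

(** Twice the Schwarzian derivative of the local developing map [f ^ (- i k)]. *)
Definition quad (f : C -> C) (k : R) (z : C) : C :=
  (2 * C_derive (lel f) z - lel f z * lel f z + RtoC (k * k) * (ell f z * ell f z))%C.

Lemma ell_neq_0 {O beta f g z} : 0 < beta -> opn O -> biholo O beta f g -> O z -> ell f z <> 0.
Proof. intros Hb HO Bi. apply (proj2 (hol_ell Hb HO Bi)). Qed.

Lemma hol_lel {O beta f g} : 0 < beta -> opn O -> biholo O beta f g -> hol O (lel f).
Proof.
intros Hb HO Bi. have HE := proj1 (hol_ell Hb HO Bi). have HE1 := hol_derive HO HE.
apply (@hol_intro _ _ (fun z => (C_derive (C_derive (ell f)) z * ell f z - C_derive (ell f) z * C_derive (ell f) z) / (ell f z * ell f z))%C). intros z Oz.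
have N := ell_neq_0 Hb HO Bi Oz. eapply cder_eq; [apply @cder_div; an|]. auto.
Qed.

(* A local developing map: [E] is an isometry from the metric [k |ell| / sin (k sg)] to the upper half plane. *)
Lemma developing_map {O beta} k {s f g z0} : 0 < beta < 1 -> opn O -> biholo O beta f g -> 0 < s ->
 (forall z, Cmod (z - z0) < s -> O z) -> exists E : C -> C, E z0 = cis (k * sg f z0) /\ forall z, Cmod (z - z0) < s / 2 ->
 cder E z (- (Ci * RtoC k * ell f z) * E z) /\ Im (E z) = Cmod (E z) * sin (k * sg f z) /\ E z <> 0.
Proof.
intros Hb HO Bi Hs Hd. have HE := proj1 (@hol_ell O beta f g ltac:(lra) HO Bi). set (X := fun x => Re z0 - s / 2 < x < Re z0 + s / 2).
set (Y := fun y => Im z0 - s / 2 < y < Im z0 + s / 2). have IX : interval_like X by apply interval_like_oo. have IY : interval_like Y by apply interval_like_oo.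
have box : forall z, X (Re z) -> Y (Im z) -> Cmod (z - z0) < s.
{ intros z Hx Hy. eapply Rle_lt_trans; [apply Cmod_le_Re_Im|]. rewrite Re_minus, Im_minus. unfold X, Y in *. assert (Rabs (Re z - Re z0) < s / 2) by lra.
 assert (Rabs (Im z - Im z0) < s / 2) by lra. lra. }
have inbox : forall z, Cmod (z - z0) < s / 2 -> X (Re z) /\ Y (Im z).
{ intros z Hz. have A := re_le_Cmod (z - z0). have B := im_le_Cmod (z - z0). rewrite Re_minus in A. rewrite Im_minus in B. apply Rabs_le_between in A.
 apply Rabs_le_between in B. unfold X, Y. lra. }
destruct (@primitive_box X Y (ell f) (Re z0) (Im z0) IX IY) as [P [P0 HP]]; [unfold X; lra|unfold Y; lra| |].
{ intros z Hx Hy. exists (C_derive (ell f) z). an. }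
rewrite Ceta in P0. have fP : forall z, X (Re z) -> Y (Im z) -> (f z * Cexp (- P z))%C = f z0.
{ intros z Hx Hy. transitivity (f z0 * Cexp (- P z0))%C.
 - apply (@box_const X Y (fun z => f z * Cexp (- P z))%C); auto.
  + apply inbox. rewrite Cmod_diag. lra.
  + apply inbox. rewrite Cmod_diag. lra.
  + intros w Wx Wy. have N : f w <> 0 by (apply (@annulus_neq_0 beta); [lra|apply Bi; auto]). eapply cder_eq.
   * apply @cder_mult; [eapply hol_cder; [apply Bi|auto]|]. apply @cder_comp; [an|apply cder_Cexp].
   * unfold ell. field. auto.
 - rewrite P0. replace (- RtoC 0)%C with (RtoC 0) by ring. unfold Cexp; simpl. rewrite exp_0, cis_0. ring. }
have sgP : forall z, X (Re z) -> Y (Im z) -> sg f z = sg f z0 - Re (P z).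
{ intros z Hx Hy. have E := f_equal Cmod (fP z Hx Hy). rewrite Cmod_mult, Cmod_Cexp in E. have N : f z <> 0 by (apply (@annulus_neq_0 beta); [lra|apply Bi; auto]).
 apply Cmod_pos in N. unfold sg. rewrite <- E, ln_mult, ln_exp by (auto; apply exp_pos). replace (Re (- P z)) with (- Re (P z)) by (unfold Re; simpl; ring). ring. }
exists (fun z => Cexp (Ci * RtoC (k * sg f z0) - Ci * k * P z)%C). split.
- rewrite P0. unfold Cexp. replace (Ci * RtoC (k * sg f z0) - Ci * k * 0)%C with (Ci * RtoC (k * sg f z0))%C by ring.
 replace (Re (Ci * RtoC (k * sg f z0))) with 0 by (simpl; ring). replace (Im (Ci * RtoC (k * sg f z0))) with (k * sg f z0) by (simpl; ring). rewrite exp_0. ring.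
- intros z Hz. have [Hx Hy] := inbox z Hz. split; [|split; [|apply Cexp_neq_0]].
 + eapply cder_eq.
  * apply @cder_comp; [|apply cder_Cexp]. an.
  * ring.
 + rewrite Cmod_Cexp. set (w := (Ci * RtoC (k * sg f z0) - Ci * k * P z)%C). have Iw : Im w = k * sg f z.
  { rewrite (sgP z Hx Hy). unfold Re; simpl. ring. }
  rewrite <- Iw. simpl. ring.
Qed.

(** The model [A + Re (e * (z - z0)) - kap / 2 * |z - z0|^2] is the reciprocal density of the
    hyperbolic metric of a round region, normalised by [|e|^2 + 2 * kap * A = 1]; the Moebius map
    [M] uniformises it with [M 0 = z0], that is, [|M'| * (1 - |x|^2)] is twice the model at [M x].
    Composed with the developing map and a Cayley transform, [M] becomes a self-map [h] to which
    [schwarz_stability] applies: the upper bound on the model controls the stretching, the lower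
    bound at [z0] gives [1 - eps <= |h' 0|]. *)
Lemma mobius_estimate {O beta k s A kap eps f g v z0 e} : 0 < beta < 1 -> opn O -> biholo O beta f g -> 0 < s ->
 0 < k -> (forall z, Cmod (z - z0) < s -> O z) -> (forall z, O z -> 0 < k * sg f z < PI) -> (forall z, O z -> v z * (k * Cmod (ell f z)) = sin (k * sg f z)) ->
 0 < A <= 9 / 8 * s -> Cmod e <= 5 / 4 -> Cmod e * Cmod e + 2 * kap * A = 1 -> 0 <= eps <= 1 / 2 -> (forall z, Cmod (z - z0) < s / 2 ->
 A + Re (e * (z - z0)) - kap / 2 * (Cmod (z - z0) * Cmod (z - z0)) <= (1 + eps) * v z) -> (1 - eps) * v z0 <= A ->
 Cmod (RtoC A * (lel f z0 + RtoC (k * cos (k * sg f z0) / sin (k * sg f z0)) * ell f z0) + e) <= 256 * eps /\ A * A * Cmod (quad f k z0) <= 300000 * eps.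
Proof.
intros Hb HO Bi Hs Hk Hd Hsg Hv HA He HeA Heps Hup Hlow. have HE := proj1 (@hol_ell O beta f g ltac:(lra) HO Bi). have HL := @hol_lel O beta f g ltac:(lra) HO Bi.
have [E [E0 HEd]] := developing_map k Hb HO Bi Hs Hd. have z0z0 : Cmod (z0 - z0) = 0 by (replace (z0 - z0)%C with (RtoC 0) by ring; apply Cmod_0).
have Oz0 : O z0 by (apply Hd; lra). set (th := k * sg f z0) in *. have Hth : 0 < th < PI by (apply Hsg; auto). have Sth : 0 < sin th by (apply sin_gt_0; lra).
set (Y := (E z0 - Cconj (E z0))%C). have EY : Y = (2 * Ci * RtoC (sin th))%C.
{ unfold Y. rewrite E0. apply Ceq; simpl; ring. }
set (m := RtoC (2 * A)). set (D := fun x => (1 - e * x)%C). set (M := fun x => (z0 + m * x / D x)%C). set (M1 := fun x => (m / (D x * D x))%C).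
have D0 : forall x, Cmod x < 1 / 8 -> 27 / 32 <= Cmod (D x).
{ intros x Hx. have X := Cmod_rev_tri 1 (e * x). rewrite Cmod_1, Cmod_mult in X. fold (D x) in X. have P := Cmod_ge_0 e. nra. }
have Dn : forall x, Cmod x < 1 / 8 -> D x <> 0 by (intros x Hx; apply Cmod_gt_0; specialize (D0 x Hx); lra).
have Mr : forall x, Cmod x < 1 / 8 -> Cmod (M x - z0) < s / 2.
{ intros x Hx. unfold M. replace (z0 + m * x / D x - z0)%C with (m * x / D x)%C by ring. rewrite Cmod_div, Cmod_mult by auto. unfold m.
 rewrite Cmod_R, Rabs_pos_eq by lra. specialize (D0 x Hx). apply div_lt; [lra|]. nra. }
have cD : forall x, cder D x (- e)%C.
{ intros x. eapply cder_eq; [apply @cder_minus; [an|apply cder_scal, cder_id]|ring]. }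
have cM : forall x, Cmod x < 1 / 8 -> cder M x (M1 x).
{ intros x Hx. eapply cder_eq.
 - apply @cder_plus; [an|]. an.
 - unfold M1. replace (m * 1 * D x - m * x * - e)%C with m; [field; auto|]. unfold D. ring. }
have cM1 : forall x, Cmod x < 1 / 8 -> cder M1 x (M1 x * (2 * e / D x))%C.
{ intros x Hx. unfold M1. eapply cder_eq.
 - apply (@cder_div (fun _ => m) (fun x => D x * D x)%C); [apply Cmult_neq_0; auto|an|apply @cder_mult; auto].
 - field. auto. }
set (c := (- (Ci * k))%C). set (n := fun z => (lel f z + c * ell f z)%C). set (n1 := fun z => (C_derive (lel f) z + c * C_derive (ell f) z)%C).
have cn : forall z, O z -> cder n z (n1 z).
{ intros z Oz. apply cder_plus; an. }
set (E1 := fun z => (c * ell f z * E z)%C). have cE : forall z, Cmod (z - z0) < s / 2 -> cder E z (E1 z).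
{ intros z Hz. eapply cder_eq; [apply HEd; auto|]. unfold E1, c. ring. }
have cE1 : forall z, Cmod (z - z0) < s / 2 -> cder E1 z (E1 z * n z)%C.
{ intros z Hz. have Oz : O z by (apply Hd; lra). have N := @ell_neq_0 O beta f g z ltac:(lra) HO Bi Oz. eapply cder_eq.
 - apply @cder_mult; an.
 - unfold E1, n, lel. field. auto. }
set (W := fun x => (E (M x) - Cconj (E z0))%C). set (G := fun x => (E1 (M x) * M1 x)%C). have ImE : forall z, Cmod (z - z0) < s / 2 -> 0 < Im (E z).
{ intros z Hz. have [_ [-> N]] := HEd z Hz. apply Rmult_lt_0_compat; [apply Cmod_pos; auto|]. apply sin_gt_0; apply Hsg, Hd; lra. }
have ImE0 : Im (E z0) = sin th by (rewrite E0; reflexivity). have Wn : forall x, Cmod x < 1 / 8 -> W x <> 0.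
{ intros x Hx X. apply (f_equal Im) in X. unfold W in X. rewrite Im_minus in X. have P := ImE _ (Mr x Hx).
 replace (Im (Cconj (E z0))) with (- sin th) in X by (rewrite <- ImE0; reflexivity). change (Im 0) with 0 in X. lra. }
have cW : forall x, Cmod x < 1 / 8 -> cder W x (G x).
{ intros x Hx. eapply cder_eq.
 - apply @cder_minus; [|an]. an.
 - unfold G. ring. }
have cG : forall x, Cmod x < 1 / 8 -> cder G x (G x * (n (M x) * M1 x + 2 * e / D x))%C.
{ intros x Hx. unfold G. eapply cder_eq.
 - apply (@cder_mult (fun x => E1 (M x)) M1); auto. an.
 - ring. }
(* [h] is [(E (M x) - E z0) / (E (M x) - Cconj (E z0))], the Cayley transform at [E z0]. [Q] is
   [h'' / h'] and [Q1] its derivative, so [Q1 - Q^2 / 2] is the Schwarzian derivative of [h]. *)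
set (h := fun x => (1 - Y / W x)%C). set (h1 := fun x => (Y * G x / (W x * W x))%C). set (Q := fun x => (n (M x) * M1 x + 2 * e / D x - 2 * G x / W x)%C).
set (Q1 := fun x => (n1 (M x) * (M1 x * M1 x) + n (M x) * (M1 x * (2 * e / D x)) + 2 * (e * e) / (D x * D x) - 2 * (G x * (n (M x) * M1 x + 2 * e / D x)) / W x + 2 * (G x * G x) / (W x * W x))%C).
have ch : forall x, Cmod x < 1 / 8 -> cder h x (h1 x).
{ intros x Hx. eapply cder_eq.
 - apply @cder_minus; [an|]. an.
 - unfold h1. field. auto. }
have ch1 : forall x, Cmod x < 1 / 8 -> cder h1 x (h1 x * Q x)%C.
{ intros x Hx. unfold h1. eapply cder_eq.
 - apply @cder_div; [apply Cmult_neq_0; auto|an|apply @cder_mult; auto].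
 - unfold Q. field. auto. }
have cQ : forall x, Cmod x < 1 / 8 -> cder Q x (Q1 x).
{ intros x Hx. eapply cder_eq.
 - apply @cder_minus; [apply @cder_plus|].
  + apply @cder_mult; auto. apply @cder_comp; [an|apply cn, Hd]. have X := Mr x Hx. lra.
  + an.
  + an.
 - unfold Q1. field. auto. }
have ch2 : forall x, Cmod x < 1 / 8 -> cder (fun x => h1 x * Q x)%C x (h1 x * (Q x * Q x + Q1 x))%C.
{ intros x Hx. eapply cder_eq; [apply @cder_mult; auto|]. ring. }
have M0 : M 0 = z0 by (unfold M, D; field; intros X; apply (f_equal Re) in X; simpl in X). have Dz : D 0 = 1%C by (unfold D; ring).
have M10 : M1 0 = m by (unfold M1; rewrite Dz; field). have W0 : W 0 = Y by (unfold W; rewrite M0; reflexivity). have sn : RtoC (sin th) <> 0 by lra.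
have Cn : Ci <> 0 by (intros X; apply (f_equal Im) in X; simpl in X; lra). have Yn : Y <> 0 by (rewrite EY; repeat apply Cmult_neq_0; auto; apply RtoC_neq; lra).
have h0 : h 0 = 0%C by (unfold h; rewrite W0; field; auto). have z8 : Cmod 0 < 1 / 8 by (rewrite Cmod_0; lra).
have ME1 : forall z, Cmod (z - z0) < s / 2 -> Cmod (E1 z) * v z = Im (E z).
{ intros z Hz. have [_ [-> _]] := HEd z Hz. rewrite <- Hv by (apply Hd; lra). unfold E1, c. rewrite !Cmod_mult, Cmod_opp, Cmod_Ci_mult, Cmod_R, Rabs_pos_eq by lra.
 ring. }
have MY : Cmod Y = 2 * sin th by (rewrite EY, <- Cmult_assoc, Cmod_mult, Cmod_Ci_mult, !Cmod_R, !Rabs_pos_eq; lra).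
have Key : forall x, Cmod x < 1 / 8 -> Cmod (h1 x) * (1 - Cmod x * Cmod x) <= (1 + eps) * (1 - Cmod (h x) * Cmod (h x)).
{ intros x Hx. have Wx := Wn x Hx. have Wp := Cmod_pos Wx. have Mx := Mr x Hx.
 have Hh : 1 - Cmod (h x) * Cmod (h x) = 4 * Im (E (M x)) * sin th / (Cmod (W x) * Cmod (W x)).
 { replace (h x) with ((E (M x) - E z0) / W x)%C by (unfold h, W, Y; field; auto). rewrite Cmod_div by auto.
  apply Rmult_eq_reg_r with (Cmod (W x) * Cmod (W x)); [|nra].
  replace (4 * Im (E (M x)) * sin th / (Cmod (W x) * Cmod (W x)) * (Cmod (W x) * Cmod (W x))) with (4 * Im (E (M x)) * sin th) by (field; lra).
  replace ((1 - Cmod (E (M x) - E z0) / Cmod (W x) * (Cmod (E (M x) - E z0) / Cmod (W x))) * (Cmod (W x) * Cmod (W x))) with (Cmod (W x) * Cmod (W x) - Cmod (E (M x) - E z0) * Cmod (E (M x) - E z0)) by (field; lra).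
  rewrite !Cmod_sqr, <- ImE0. unfold Im; simpl. ring. }
 rewrite Hh. unfold h1. rewrite Cmod_div, !Cmod_mult, MY by (apply Cmult_neq_0; auto).
 have vm : Cmod (M1 x) * (1 - Cmod x * Cmod x) = 2 * (A + Re (e * (M x - z0)) - kap / 2 * (Cmod (M x - z0) * Cmod (M x - z0))).
 { have Dx := Dn x Hx. have Dp := Cmod_pos Dx. unfold M1, M. replace (z0 + m * x / D x - z0)%C with (m * x / D x)%C by ring.
  rewrite !Cmod_div, !Cmod_mult by (auto; apply Cmult_neq_0; auto). unfold m. rewrite Cmod_R, Rabs_pos_eq by lra.
  have R1 : Re (e * (RtoC (2 * A) * x / D x)) = 2 * A * Re (e * x * Cconj (D x)) / (Cmod (D x) * Cmod (D x)).
  { replace (e * (RtoC (2 * A) * x / D x))%C with (RtoC (2 * A / (Cmod (D x) * Cmod (D x))) * (e * x * Cconj (D x)))%C.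
   - simpl. lra.
   - have X : (Cconj (D x) * D x)%C = RtoC (Cmod (D x) * Cmod (D x)) by (rewrite Cmod_sqr; apply Ceq; simpl; ring).
    have N : RtoC (Cmod (D x) * Cmod (D x)) <> 0 by (apply RtoC_neq; nra). rewrite RtoC_div by nra.
    apply (f_equal (fun w => w * / D x * / RtoC (Cmod (D x) * Cmod (D x)))%C) in X.
    replace (RtoC (Cmod (D x) * Cmod (D x)) * / D x * / RtoC (Cmod (D x) * Cmod (D x)))%C with (/ D x)%C in X by (field; auto). unfold Cdiv. rewrite <- X. field.
    auto. }
  rewrite R1. apply Rmult_eq_reg_r with (Cmod (D x) * Cmod (D x)); [|nra]. transitivity (2 * A * (1 - Cmod x * Cmod x)); [field; lra|].
  transitivity (2 * (A * (Cmod (D x) * Cmod (D x)) + 2 * A * Re (e * x * Cconj (D x)) - 2 * kap * A * A * (Cmod x * Cmod x))); [|field; lra].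
  replace (2 * kap * A * A) with (A * (1 - Cmod e * Cmod e)) by (rewrite <- HeA; ring). rewrite !Cmod_sqr. unfold Re, Im; simpl. ring. }
 replace (2 * sin th * Cmod (G x) / (Cmod (W x) * Cmod (W x)) * (1 - Cmod x * Cmod x)) with (2 * sin th / (Cmod (W x) * Cmod (W x)) * (Cmod (E1 (M x)) * (Cmod (M1 x) * (1 - Cmod x * Cmod x)))) by (unfold G; rewrite Cmod_mult; field; lra).
 replace ((1 + eps) * (4 * Im (E (M x)) * sin th / (Cmod (W x) * Cmod (W x)))) with (2 * sin th / (Cmod (W x) * Cmod (W x)) * (2 * (1 + eps) * Im (E (M x)))) by (field; lra).
 apply Rmult_le_compat_l; [apply Rlt_le, Rdiv_lt_0_compat; nra|]. rewrite <- (ME1 _ Mx). have X := Hup _ Mx. have P := Cmod_ge_0 (E1 (M x)). nra. }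
have vz : Cmod (E1 z0) * v z0 = sin th by (rewrite ME1; auto; rewrite z0z0; lra). have Low : 1 - eps <= Cmod (h1 0).
{ unfold h1. rewrite W0. unfold G. rewrite M0, M10. rewrite Cmod_div, !Cmod_mult, MY by (apply Cmult_neq_0; auto). unfold m. rewrite Cmod_R, Rabs_pos_eq by lra.
 replace (2 * sin th * (Cmod (E1 z0) * (2 * A)) / (2 * sin th * (2 * sin th))) with (Cmod (E1 z0) * A / sin th) by (field; lra). apply le_div; auto.
 have P := Cmod_ge_0 (E1 z0). nra. }
(* With radius [1 / 8] the two bounds are [256 * eps] and [12288 * eps]; dividing by
   [|h1 0| >= 1 / 2] doubles them. *)
destruct (@schwarz_stability h h1 (fun x => h1 x * Q x)%C (fun x => h1 x * (Q x * Q x + Q1 x))%C (1 / 8) eps) as [S2 S3]; auto; try lra. rewrite Cmod_mult in S2, S3.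
have Q0 : Q 0 = (2 * (A * (lel f z0 + RtoC (k * cos th / sin th) * ell f z0) + e))%C.
{ unfold Q, G. rewrite M0, M10, Dz, W0, EY. unfold E1, n, m, c. rewrite E0, RtoC_div, !RtoC_mult by lra.
 replace (cis th) with (RtoC (cos th) + Ci * RtoC (sin th))%C by (apply Ceq; simpl; ring). field. auto. }
(* The Schwarzian derivative at 0: it ignores the Cayley transform and is multiplied by the square
   of [M' 0 = 2 * A], while that of [E] is [quad / 2]. *)
have Q10 : (Q1 0 + Q 0 * Q 0 - RtoC (3 / 2) * (Q 0 * Q 0))%C = (RtoC (2 * (A * A)) * quad f k z0)%C.
{ have N := @ell_neq_0 O beta f g z0 ltac:(lra) HO Bi Oz0. unfold Q, Q1. rewrite M0, M10. unfold n1, n, quad, m, c. rewrite RtoC_div by lra. rewrite !RtoC_mult.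
 replace (C_derive (ell f) z0) with (lel f z0 * ell f z0)%C by (unfold lel; field; auto). set (lz := lel f z0). set (l1 := C_derive (lel f) z0).
 set (ee := ell f z0). transitivity (RtoC 2 * A * (RtoC 2 * A) * (l1 - (lz * lz + k * k * (Ci * Ci) * (ee * ee)) / 2))%C; [field; auto|]. rewrite CiCi. field. }
have q0 : Cmod (Q 0) <= 512 * eps.
{ assert (1 / 2 * Cmod (Q 0) <= Cmod (h1 0) * Cmod (Q 0)) by lra. lra. }
split.
- rewrite Q0, Cmod_mult, Cmod_R, Rabs_pos_eq in q0 by lra. lra.
- have q1 : Cmod (Q 0 * Q 0 + Q1 0) <= 24576 * eps.
 { assert (1 / 2 * Cmod (Q 0 * Q 0 + Q1 0) <= Cmod (h1 0) * Cmod (Q 0 * Q 0 + Q1 0)) by lra. lra. }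
 apply (f_equal Cmod) in Q10. rewrite Cmod_mult, Cmod_R, Rabs_pos_eq in Q10 by nra. have Tr := Cmod_triangle (Q 0 * Q 0 + Q1 0) (- (RtoC (3 / 2) * (Q 0 * Q 0))).
 rewrite Cmod_opp, !Cmod_mult, Cmod_R, Rabs_pos_eq in Tr by lra.
 replace (Q 0 * Q 0 + Q1 0 + - (RtoC (3 / 2) * (Q 0 * Q 0)))%C with (Q1 0 + Q 0 * Q 0 - RtoC (3 / 2) * (Q 0 * Q 0))%C in Tr by ring.
 have q2 : Cmod (Q 0) * Cmod (Q 0) <= 256 * (512 * eps) by lra. lra.
Qed.

(** * Riccati functions *)
(** The logarithmic derivatives of [E' ^ (- 1 / 2)] ([sig = 1]) and [E * E' ^ (- 1 / 2)]
    ([sig = -1]), two solutions of [y'' + quad / 4 * y = 0], where [E] is the developing map. Hence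
    both satisfy the Riccati equation of [cder_rho]. *)
Definition rho (f : C -> C) (k sig : R) (z : C) : C := (/ 2 * (- lel f z + Ci * RtoC (sig * k) * ell f z))%C.

Lemma cder_rho {O beta} k {sig f g z} : 0 < beta -> opn O -> biholo O beta f g -> sig * sig = 1 -> O z ->
 cder (rho f k sig) z (- (/ 4 * quad f k z) - rho f k sig z * rho f k sig z)%C.
Proof.
intros Hb HO Bi Hs Oz. have [HE NE] := hol_ell Hb HO Bi. have HL := hol_lel Hb HO Bi. unfold rho. eapply cder_eq.
- an.
- unfold quad. replace (C_derive (ell f) z) with (lel f z * ell f z)%C by (unfold lel; field; auto).
 replace (RtoC (k * k)) with (- (Ci * RtoC (sig * k) * (Ci * RtoC (sig * k))))%C.
 + field.
 + replace (Ci * RtoC (sig * k) * (Ci * RtoC (sig * k)))%C with (Ci * Ci * (RtoC (sig * k) * RtoC (sig * k)))%C by ring. rewrite CiCi, <- RtoC_mult.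
  replace (sig * k * (sig * k)) with (sig * sig * (k * k)) by ring. rewrite Hs, Rmult_1_l. ring.
Qed.

Lemma rho_sum f k z : (rho f k 1 z + rho f k (-1) z)%C = (- lel f z)%C.
Proof. unfold rho. rewrite !RtoC_mult. field. Qed.

Lemma rho_diff f k z : (rho f k 1 z - rho f k (-1) z)%C = (Ci * RtoC k * ell f z)%C.
Proof. unfold rho. rewrite !RtoC_mult. field. Qed.

Lemma Re_conj_sum a d : Re (Cconj d * a + Cconj a * d) = 2 * dot a d.
Proof. unfold dot; simpl. ring. Qed.

(** Along [r' = q - r^2] the logarithm of [1 + |r|^2] has derivative [- 2 * Re r] up to a bounded
    error, because the cubic terms cancel. The uncancelled [Re r] is matched later by the logarithm
    of [|ell|]. *)
Lemma riccati_log_bound r q : Rabs (2 * dot r (q - r * r) / (1 + Cmod r * Cmod r) + 2 * Re r) <= Cmod q + 1.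
Proof.
have Q := Cmod_ge_0 q. set (m := Cmod r) in *. have E : dot r (q - r * r) = dot r q - m * m * Re r.
{ unfold m. rewrite Cmod_sqr. unfold dot, Re, Im; simpl. ring. }
rewrite E. replace (2 * (dot r q - m * m * Re r) / (1 + m * m) + 2 * Re r) with ((2 * dot r q + 2 * Re r) / (1 + m * m)) by (field; nra). have A := dot_le r q.
fold m in A. have B := re_le_Cmod r. fold m in B. apply Rabs_le_between in A. apply Rabs_le_between in B.
have H : 2 * m <= 1 + m * m by (have S := Rle_0_sqr (m - 1); unfold Rsqr in S; lra). apply Rabs_le. split; [apply le_div; nra|apply div_le; nra].
Qed.

Lemma Rabs_mult_le {a b A B} : Rabs a <= A -> Rabs b <= B -> Rabs (a * b) <= A * B.
Proof. intros. rewrite Rabs_mult. an. Qed.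

(** The real algebra behind [collar_asymptotics]: [(p, q)] is the unit vector of [n * ell], [(c, g)]
    are cosine and sine of [k * sg], [y] and [x] are the real and imaginary parts of
    [n * (rho+ + rho-)]. On the unit circle [1 + p] is quadratic in [q] and [1 - c] quadratic in
    [g], so first order information on [q] and [g] determines [1 + c * p] up to the third order. *)
Lemma unit_asymptotics {K s p q c g v y x le k kap} : 1 <= K -> 0 < s -> 8 * K * s <= 1 -> p * p + q * q = 1 -> c * c + g * g = 1 -> 0 <= c ->
 g = v * (k * le) -> Rabs le <= K -> Rabs k <= K -> Rabs (v - s) <= K * (s * s) -> Rabs y <= 2 * K -> Rabs x <= 2 * K -> Rabs kap <= K ->
 Rabs (p - s * y + 1 - kap * s) <= K * (s * s) -> Rabs (q - s * x) <= K * (s * s) ->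
 p <= - / 2 /\ Rabs (y + kap) <= 10 * (K * K) * s /\ Rabs q <= 3 * K * s /\ Rabs (1 + c * p - s * v * (/ 2 * (x * x + k * le * p * (k * le * p)))) <= 100 * (K * K * K * K * K * K * K * K) * (s * s * s).
Proof.
intros HK Hs HKs. set (K8 := K * K * K * K * K * K * K * K). set (K4 := K * K * K * K). have E8 : K8 = K4 * K4 by (unfold K8, K4; ring). have K2 : 1 <= K * K by nra.
have KK4 : K * K <= K4 by (unfold K4; nra). have K3 : K * K * K <= K4 by (unfold K4; nra). have K48 : K4 <= K8 by (rewrite E8; nra). have s3p : 0 < s * s * s by lra.
have Q83 : 0 < K8 * (s * s * s) by lra. have s1 : s <= 1 / 8 by nra. have X20 : 2 * (K + s * (9 * (K * K))) <= 20 * (K * K) by nra.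
intros Hpq Hcg Hc Hg Hle Hk Hv Hy Hx Hkap Hp Hq. have Kss : K * (s * s) <= K * s * (1 / 8) by nra. have qB : Rabs q <= 3 * K * s.
{ replace q with ((q - s * x) + s * x) by ring. eapply Rle_trans; [apply Rabs_triang|]. have X := @Rabs_mult_le s x s (2 * K) ltac:(lra) Hx. nra. }
have q2 : q * q <= 9 * (K * K) * (s * s).
{ have X := Rabs_mult_le qB qB. lra. }
have pB : p <= - / 2.
{ have X := @Rabs_mult_le s y s (2 * K) ltac:(lra) Hy. have Y := @Rabs_mult_le kap s K s Hkap ltac:(lra). lra. }
set (b := 1 + p). have b0 : 0 <= b <= q * q.
{ have E : b * (1 - p) = q * q by (unfold b; nra). nra. }
split; [auto|split; [|split; auto]].
{ apply Rmult_le_reg_l with s; auto. rewrite <- (Rabs_pos_eq s) at 1 by lra. rewrite <- Rabs_mult.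
 replace (s * (y + kap)) with (b - (p - s * y + 1 - kap * s)) by (unfold b; ring). eapply Rle_trans; [apply Rabs_triang|]. rewrite Rabs_Ropp, Rabs_pos_eq by lra.
 nra. }
have vB : Rabs v <= 2 * s.
{ replace v with ((v - s) + s) by ring. eapply Rle_trans; [apply Rabs_triang|]. rewrite (Rabs_pos_eq s) by lra. nra. }
have kl : Rabs (k * le) <= K * K by (apply Rabs_mult_le; auto). have gB : Rabs g <= 2 * s * (K * K) by (rewrite Hg; apply Rabs_mult_le; auto).
have g2 : g * g <= 2 * s * (K * K) * (2 * s * (K * K)).
{ have X := Rabs_mult_le gB gB. lra. }
set (a := 1 - c). have a0 : 0 <= a <= g * g.
{ have E : a * (1 + c) = g * g by (unfold a; nra). nra. }
have E1 : 1 + c * p = / 2 * (g * g + q * q) + / 2 * ((a - b) * (a - b)).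
{ replace (g * g) with (1 - c * c) by lra. replace (q * q) with (1 - p * p) by lra. unfold a, b. field. }
have A1 : Rabs (a - b) <= 9 * K4 * (s * s).
{ assert (K * K * (s * s) <= K4 * (s * s)) by lra. assert (g * g <= 4 * K4 * (s * s)) by (eapply Rle_trans; [exact g2|right; unfold K4; ring]). an. }
have A2 := Rabs_mult_le A1 A1. have B1 : Rabs ((q - s * x) * (q + s * x)) <= K * (s * s) * (5 * K * s).
{ apply Rabs_mult_le; auto. eapply Rle_trans; [apply Rabs_triang|]. have X := @Rabs_mult_le s x s (2 * K) ltac:(lra) Hx. lra. }
have B2 : Rabs (s * (x * x) * (s - v)) <= s * (2 * K * (2 * K)) * (K * (s * s)).
{ apply Rabs_mult_le; [|rewrite Rabs_minus_sym; auto]. apply Rabs_mult_le; [an|]. apply Rabs_mult_le; auto. }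
have B3 : Rabs ((k * le * (k * le)) * (v * (v - s + s * (q * q)))) <= K * K * (K * K) * (2 * s * (K * (s * s) + s * (9 * (K * K) * (s * s)))).
{ apply Rabs_mult_le; [apply Rabs_mult_le; auto|]. apply Rabs_mult_le; auto. eapply Rle_trans; [apply Rabs_triang|]. apply Rplus_le_compat; auto.
 rewrite Rabs_pos_eq; an. }
replace (1 + c * p - s * v * (/ 2 * (x * x + k * le * p * (k * le * p)))) with (/ 2 * ((a - b) * (a - b)) + / 2 * ((q - s * x) * (q + s * x)) + / 2 * (s * (x * x) * (s - v)) + / 2 * ((k * le * (k * le)) * (v * (v - s + s * (q * q))))).
2:{ rewrite E1, Hg. replace (k * le * p * (k * le * p)) with (k * le * (k * le) * (p * p)) by ring. replace (p * p) with (1 - q * q) by lra. field. }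
have H2 : Rabs (/ 2) = / 2 by (apply Rabs_pos_eq; lra). eapply Rle_trans; [apply Rabs_triang|]. eapply Rle_trans; [apply Rplus_le_compat_r, Rabs_triang|].
eapply Rle_trans; [apply Rplus_le_compat_r, Rplus_le_compat_r, Rabs_triang|]. rewrite !(Rabs_mult (/ 2)), H2. set (s3 := s * s * s) in *.
have D1 : 9 * K4 * (s * s) * (9 * K4 * (s * s)) <= 11 * K8 * s3.
{ replace (9 * K4 * (s * s) * (9 * K4 * (s * s))) with (81 * K8 * s3 * s) by (rewrite E8; unfold s3; ring). assert (K8 * s3 * s <= K8 * s3 * (1 / 8)) by lra. lra. }
have D2 : K * (s * s) * (5 * K * s) <= 5 * K8 * s3.
{ replace (K * (s * s) * (5 * K * s)) with (5 * (K * K) * s3) by (unfold s3; ring). an. }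
have D3 : s * (2 * K * (2 * K)) * (K * (s * s)) <= 4 * K8 * s3.
{ replace (s * (2 * K * (2 * K)) * (K * (s * s))) with (4 * (K * K * K) * s3) by (unfold s3; ring). an. }
have D4 : K * K * (K * K) * (2 * s * (K * (s * s) + s * (9 * (K * K) * (s * s)))) <= 20 * K8 * s3.
{ replace (K * K * (K * K) * (2 * s * (K * (s * s) + s * (9 * (K * K) * (s * s))))) with (K4 * (2 * (K + s * (9 * (K * K)))) * s3) by (unfold s3, K4; ring).
 assert (K4 * (2 * (K + s * (9 * (K * K)))) <= K4 * (20 * K4)) by lra. lra. }
lra.
Qed.

Lemma RInt_close {f g : R -> R} {a b E} : a <= b -> ex_RInt f a b -> ex_RInt g a b -> (forall t, a <= t <= b -> Rabs (f t - g t) <= E) ->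
 Rabs (RInt f a b - RInt g a b) <= (b - a) * E.
Proof. intros Hab Hf Hg HE. rewrite <- RInt_Rminus by auto. eapply Rle_trans; [apply abs_RInt_le_const; auto|lra]. apply ex_RInt_Rminus; auto. Qed.

Lemma ccont_path {c p} : pcont c (Im p) -> ccont (fun q => c (Im q)) p.
Proof.
intros H e He. have [d [Hd K]] := proj1 pcont_eps H e He. exists d. split; auto. intros q Hq. apply K. rewrite <- Im_minus.
eapply Rle_lt_trans; [apply im_le_Cmod|an].
Qed.

(** * Identity theorem and Fenchel's inequality *)
Lemma circ_surj {z0 z} : z <> z0 -> exists t, 0 <= t <= 2 * PI /\ z = circ z0 (Cmod (z - z0)) t.
Proof.
intros N. have P : 0 < Cmod (z - z0).
{ apply Cmod_gt_0. intros E. apply N. apply Cmod_sub_0. rewrite E, Cmod_0. lra. }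
have Q : RtoC (Cmod (z - z0)) <> 0 by lra. destruct (@unit_circle_cis ((z - z0) / RtoC (Cmod (z - z0)))) as [t Et].
{ rewrite Cmod_div, Cmod_R, Rabs_pos_eq by lra. field. lra. }
have [m Hm] := @period_reduce (2 * PI) 0 t ltac:(lra). exists (t + IZR m * (2 * PI)). split; [lra|]. unfold circ. rewrite periodic_Z by apply cis_2PI. rewrite <- Et.
field. auto.
Qed.

(** Continuation by reflection. If [H] vanishes on the disc of radius [m < r], choose [s < m] with
    [s * r > m * m]: [hardy_vanish], applied to the circle of radius [s], gives zeros up to the
    radius [sqrt (s * r)], beyond [m]. *)
Lemma identity_disc {H z0 r r0} : 0 < r0 -> hol (disc z0 r) H -> (forall z, disc z0 r0 z -> H z = 0) -> forall z, disc z0 r z -> H z = 0.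
Proof.
intros Hr0 Hol Hz z Hzr. have [h|h] := Rle_dec r r0; [apply Hz; unfold disc in *; lra|]. set (E := fun p => p <= r /\ forall z, disc z0 p z -> H z = 0).
destruct (completeness E) as [m [M1 M2]]; [exists r; intros p [Hp _]; lra|exists r0; split; auto; lra|]. have m0 : r0 <= m by (apply M1; split; auto; lra).
have mr : m <= r by (apply M2; intros p [Hp _]; lra). have inm : forall z, disc z0 m z -> H z = 0.
{ intros w Hw. apply NNPP. intros N. assert (m <= Cmod (w - z0)); [|unfold disc in Hw; lra]. apply M2. intros p [Hp Kp]. apply Rnot_lt_le. intros L. an. }
have [Lt|Eq] := Rle_lt_or_eq_dec m r mr; [|subst; auto]. set (s := (m + m * m / r) / 2). have mm : m * m / r < m by (apply div_lt; nra).
have mmr : m * m / r * r = m * m by (field; lra). have mm0 : 0 < m * m / r by lra. have Hs : m * m / r < s < m by (unfold s; lra). set (p := Rmin r (sqrt (s * r))).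
have sq : m < sqrt (s * r).
{ rewrite <- (sqrt_square m) by lra. apply sqrt_lt_1; nra. }
have pm : m < p by (apply Rmin_glb_lt; auto). assert (p <= m); [|lra]. apply M1. split; [lra|]. intros w Hw. unfold disc in Hw.
have [a|a] := Rlt_dec (Cmod (w - z0)) m; auto. have wz : w <> z0.
{ intros ->. apply a. rewrite Cmod_diag. lra. }
have [t [Ht Ew]] := circ_surj wz. rewrite Ew. set (q := Cmod (w - z0)) in *. have q2 : q * q < s * r.
{ rewrite <- sqrt_sqrt by nra. apply Rmult_le_0_lt_compat; lra. }
apply (@hardy_vanish H z0 0 r s q t); try lra.
- intros x [_ Hx]. an.
- split; [an|apply div_lt; lra].
- intros e He. exists s. split; [lra|split; [an|]]. apply Rle_lt_trans with 0; auto. right.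
 transitivity (RInt (fun _ => 0) 0 (2 * PI)); [|rewrite RInt_Rconst; apply Rmult_0_r]. apply RInt_ext. intros x _. rewrite inm, Cmod_0; [an|]. unfold disc.
 rewrite Cmod_circ; lra.
Qed.

Lemma identity_theorem {O H z1 r1} : opn O -> connectedC O -> hol O H -> O z1 -> 0 < r1 -> (forall z, disc z1 r1 z -> H z = 0) ->
 forall z, O z -> H z = 0.
Proof.
intros HO Con Hol O1 Hr1 Hz. set (U := fun z => exists r, 0 < r /\ forall w, disc z r w -> H w = 0).
set (V := fun z => exists r, 0 < r /\ forall w, disc z r w -> O w /\ ~ U w). have HU : opn U.
{ intros z [r [Hr K]]. exists (r / 2). split; [lra|]. intros w Hw. exists (r / 2). split; [lra|]. intros x Hx. apply K. unfold disc in *. have T := Cmod_tri x w z.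
 lra. }
have HV : opn V.
{ intros z [r [Hr K]]. exists (r / 2). split; [lra|]. intros w Hw. exists (r / 2). split; [lra|]. intros x Hx. apply K. unfold disc in *. have T := Cmod_tri x w z.
 lra. }
have self : forall z r, 0 < r -> disc z r z by (intros; apply disc_center; auto). destruct (Con U V (opn_open HU) (opn_open HV)) as [C1|C1].
- intros z Oz. have [|N] := classic (U z); auto. right. have [r [Hr K]] := HO z Oz. exists (r / 2). split; [lra|]. intros w Hw. unfold disc in Hw.
 split; [apply K; lra|]. intros [r' [Hr' K']]. apply N. exists (r / 2 - Cmod (w - z)). split; [lra|]. intros x Hx. apply (@identity_disc H w (r / 2) r' Hr').
 + intros y Hy. apply Hol, K. unfold disc in Hy. have T := Cmod_tri y w z. lra.
 + auto.
 + unfold disc in *. have T := Cmod_tri x z w. rewrite (Cmod_minus_sym z w) in T. lra.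
- intros z [_ [Uz [r [Hr K]]]]. apply (K z); auto.
- intros z Oz. have [r [Hr K]] := C1 z Oz. auto.
- exfalso. have [r [Hr K]] := C1 z1 O1. apply (K z1); auto. exists r1. auto.
Qed.

Lemma frame_angle {T gam tau sp kap kap1 B} : frame T gam tau sp kap kap1 B -> exists th : R ->
 R, (forall t, is_derive th t (kap t * sp t)) /\ forall t, tau t = cis (th t).
Proof.
intros F. have [a Ea] := unit_circle_cis (fr_tau1 F 0).
have kc : forall t, continuous kap t by (intros t; apply (ex_derive_continuous (V := R_NormedModule)); eexists; apply (fr_kap F)).
have c : forall t, continuous (fun t => kap t * sp t) t by (intros t; apply (continuous_mult kap sp); [an|apply (fr_spc F)]).
exists (fun t => a + RInt (fun t => kap t * sp t) 0 t). have D : forall t, is_derive (fun t => a + RInt (fun t => kap t * sp t) 0 t) t (kap t * sp t).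
{ intros t. eapply is_derive_eq; [apply @is_derive_Rplus; [an|]|apply Rplus_0_l].
 apply (is_derive_RInt (fun t => kap t * sp t) (fun t => RInt (fun t => kap t * sp t) 0 t) 0 t); auto. exists (mkposreal 1 Rlt_0_1). intros y _.
 apply (RInt_correct (V := R_CompleteNormedModule)). an. }
split; auto. intros t. set (th := fun t => a + RInt (fun t => kap t * sp t) 0 t) in *. have E : (tau t * Cconj (cis (th t)))%C = (tau 0 * Cconj (cis (th 0)))%C.
{ apply (@pder_zero_const (fun t => tau t * Cconj (cis (th t)))%C t 0). intros r _. eapply pder_eq.
 - apply (@pder_mult tau (fun t => Cconj (cis (th t)))); [apply (fr_tau F)|apply @pder_conj, @pder_cis_comp, D].
 - generalize (cis (th r)) (tau r) (kap r * sp r). intros x y w. apply Ceq; simpl; ring. }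
have th0 : th 0 = a by (unfold th; rewrite RInt_point; apply Rplus_0_r). rewrite th0, Ea in E. have U : forall x, (cis x * Cconj (cis x))%C = 1.
{ intros x. rewrite <- cis_opp, <- cis_plus. replace (x + - x) with 0 by ring. apply cis_0. }
rewrite U in E. transitivity (tau t * (cis (th t) * Cconj (cis (th t))))%C; [rewrite U; ring|].
replace (tau t * (cis (th t) * Cconj (cis (th t))))%C with (tau t * Cconj (cis (th t)) * cis (th t))%C by ring. rewrite E. apply Cmult_1_l.
Qed.

(* If the total curvature were smaller, all tangents would lie in an open half plane. *)
Lemma fenchel {T gam tau sp kap kap1 B} : frame T gam tau sp kap kap1 B -> 2 * PI <= RInt (fun t => Rabs (kap t) * sp t) 0 T.
Proof.
intros F. have [th [Dth Eth]] := frame_angle F. have HT := fr_T F. have PI0 := PI_RGT_0.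
have spp : forall t, 0 < sp t by (intros t; have X := fr_sp F t; have Y := fr_B F; assert (0 < / B) by (apply Rinv_0_lt_compat; lra); lra).
have kc : forall t, continuous kap t by (intros t; apply (ex_derive_continuous (V := R_NormedModule)); eexists; apply (fr_kap F)). have spc := fr_spc F.
have c : forall t, continuous (fun t => kap t * sp t) t by an. have ex : forall a b, ex_RInt (fun t => Rabs (kap t) * sp t) a b by an.
have Var : forall a b, a <= b -> Rabs (th b - th a) <= RInt (fun t => Rabs (kap t) * sp t) a b.
{ intros a b Hab. rewrite <- (@RInt_FTC th (fun t => kap t * sp t) a b) by auto. eapply Rle_trans; [apply abs_RInt_le; auto; apply ex_RInt_cont; auto|]. right.
 apply RInt_ext. intros t _. have X : Rabs (kap t * sp t) = Rabs (kap t) * sp t by (rewrite Rabs_mult, (Rabs_pos_eq (sp t)); auto; apply Rlt_le, spp). lra. }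
have Per : cis (th T) = cis (th 0) by (rewrite <- !Eth, <- Rplus_0_l at 1; apply (fr_tauT F)). have Mul : exists m : Z, th T - th 0 = 2 * PI * IZR m.
{ apply sin_neq_1_cos. unfold Rminus. rewrite cis_plus, Per, <- cis_plus. replace (th 0 + - th 0) with 0 by ring. apply cis_0. }
(* A non-zero rotation index gives the bound at once. Otherwise [th] takes equal values at 0 and
   [T], and its variation is at least twice its oscillation. *)
destruct Mul as [m Em]. have [m0|m0] := Z.eq_dec m 0.
2:{ eapply Rle_trans; [|apply Var; lra]. rewrite Em, Rabs_mult, Rabs_pos_eq by lra. assert (1 <= Rabs (IZR m)) by (rewrite <- abs_IZR; apply IZR_le; lia). nra. }
subst m. have tc : forall x, 0 <= x <= T -> continuity_pt th x by (intros x _; eapply is_derive_cont_pt, Dth).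
have [t2 [H2 I2]] := continuity_ab_maj th 0 T ltac:(lra) tc. have [t1 [H1 I1]] := continuity_ab_min th 0 T ltac:(lra) tc. have Osc : PI <= th t2 - th t1.
{ apply Rnot_lt_le. intros L. set (ph := (th t1 + th t2) / 2).
 have D : forall t, is_derive (fun t => dot (cis ph) (gam t)) t (dot (cis ph) (RtoC (sp t) * tau t)) by (intros t; apply is_derive_dot, (fr_gam F)).
 destruct (MVT_gen (fun t => dot (cis ph) (gam t)) 0 T (fun t => dot (cis ph) (RtoC (sp t) * tau t))) as [x [Hx E]].
 - intros; apply D.
 - intros. eapply is_derive_cont_pt, D.
 - rewrite Rmin_left, Rmax_right in Hx by lra. rewrite <- (Rplus_0_l T) in E at 1. rewrite (fr_gamT F) in E.
  have E2 : dot (cis ph) (RtoC (sp x) * tau x) = sp x * cos (th x - ph).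
  { rewrite Eth, cos_minus. unfold dot; simpl. ring. }
  have X2 := H2 x Hx. have X1 := H1 x Hx. assert (0 < cos (th x - ph)) by (apply cos_gt_0; unfold ph; lra).
  assert (0 < sp x * cos (th x - ph)) by (apply Rmult_lt_0_compat; auto). nra. }
have Split : forall a b, 0 <= a -> a <= b -> b <= T -> PI <= Rabs (th b - th a) -> 2 * PI <= RInt (fun t => Rabs (kap t) * sp t) 0 T.
{ intros a b Ha Hab Hb HO. rewrite <- (RInt_Chasles _ 0 a T), <- (RInt_Chasles _ a b T) by auto. unfold plus; simpl. have A1 := Var 0 a Ha. have A2 := Var a b Hab.
 have A3 := Var b T Hb. assert (Rabs (th b - th a) <= Rabs (th a - th 0) + Rabs (th T - th b)).
 { replace (th b - th a) with (- (th a - th 0) + - (th T - th b)) by lra. eapply Rle_trans; [apply Rabs_triang|]. rewrite !Rabs_Ropp. lra. }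
 lra. }
have [h|h] := Rle_dec t1 t2.
- apply (Split t1 t2); try Lra.lra. lra.
- apply (Split t2 t1); try lra. rewrite Rabs_minus_sym; lra.
Qed.

Lemma le_eps_small {x y C} : 0 <= C -> (forall e, 0 < e -> exists s, 0 < s < e /\ x <= y + e + C * s) -> x <= y.
Proof.
intros HC H. apply le_epsilon. intros e He. set (e' := Rmin (e / 2) (e / (2 * (C + 1)))). destruct (H e') as [s [Hs K]]; [an|]. assert (C * s <= e / 2); [|lra].
apply Rle_trans with (C * (e / (2 * (C + 1)))); [an|]. replace (C * (e / (2 * (C + 1)))) with (e / 2 * (C / (C + 1))) by (field; lra).
rewrite <- (Rmult_1_r (e / 2)) at 2. apply Rmult_le_compat_l; [lra|]. apply div_le; lra.
Qed.

(** * Boundary regularity *)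
Set Implicit Arguments.
(* [v] is the hyperbolic density in terms of [f], and the collar lies at the outer end of the annulus. *)
Record hyp_collar (O : C -> Prop) (beta k : R) (f g : C -> C) (v : C -> R) (T : R) (gam tau : R -> C) (sp kap kap1 : R -> R) (B dl C0 : R) : Prop := {
  hc_beta : 0 < beta < 1;
  hc_k : 0 < k;
  hc_O : opn O;
  hc_bi : biholo O beta f g;
  hc_fr : frame T gam tau sp kap kap1 B;
  hc_col : collar O gam tau kap v dl C0;
  hc_sg : forall z, O z -> 0 < k * sg f z < PI;
  hc_v : forall z, O z -> v z * (k * Cmod (ell f z)) = sin (k * sg f z);
  hc_end : forall eta, 0 < eta -> exists d, 0 < d /\ forall s t, 0 < s < d -> 1 - eta < Cmod (f (tube gam tau s t)) }.
Unset Implicit Arguments.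

Section Collar.
Context {O : C -> Prop} {beta k : R} {f g : C -> C} {v : C -> R} {T : R} {gam tau : R -> C} {sp kap kap1 : R -> R} {B dl C0 : R}.
Context (H : hyp_collar O beta k f g v T gam tau sp kap kap1 B dl C0).

Local Notation tb := (tube gam tau).

Lemma hc_in : forall s t, 0 < s < dl -> O (tb s t).
Proof. intros s t Hs. have [_ [_ X]] := hc_col H. apply (X s t Hs). replace (tb s t - tb s t)%C with (RtoC 0) by ring. rewrite Cmod_0. lra. Qed.

(** [mobius_estimate] in the disc of radius [s] about the point at depth [s]. [A] is the value of
    the osculating model there and [e] encodes its gradient. The relative error is
    [eps = 8 * C0 * (s * s)], because [v >= s / 8] turns the collar error [C0 * s^3] into a multiple
    of [v]; as [A] is comparable to [s], the bound for [quad] is uniform. *)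
Lemma collar_estimate : exists d C1, 0 < d <= dl /\ 0 <= C1 /\ d * B <= 1 / 8 /\ d <= 1 /\ forall s t, 0 < s < d ->
 let z := tb s t in Rabs (v z - (s - kap t / 2 * (s * s))) <= C1 * (s * s * s) /\ C1 * (s * s) <= 1 / 8 /\ Cmod (RtoC (s - kap t / 2 * (s * s)) * (Ci * tau t * (lel f z + RtoC (k * cos (k * sg f z) / sin (k * sg f z)) * ell f z)) + RtoC (1 - kap t * s)) <= C1 * (s * s) /\ Cmod (quad f k z) <= C1.
Proof.
destruct H as [Hb Hk HO Bi F Col Hsg Hv _]. destruct Col as [Hdl [HC0 Col]]. have HB := fr_B F. set (C1 := 10000000 * (C0 + 1)).
have C1p : 0 < C1 by (unfold C1; lra). set (d := Rmin (Rmin dl 1) (Rmin (/ (8 * B)) (/ (8 * C1)))). have d3 := Rmin_l dl 1. have d4 := Rmin_r dl 1.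
have d5 := Rmin_l (/ (8 * B)) (/ (8 * C1)). have d6 := Rmin_r (/ (8 * B)) (/ (8 * C1)).
have dB : d * B <= 1 / 8 by (apply Rle_trans with (/ (8 * B) * B); [an|right; field; lra]).
have dC : d * C1 <= 1 / 8 by (apply Rle_trans with (/ (8 * C1) * C1); [an|right; field; lra]). exists d, C1. split; [lra|split; [lra|split; [auto|split; [lra|]]]].
intros s t Hs z. have [_ [Hdisc [_ Hvm]]] := Col s t ltac:(lra). fold z in Hdisc, Hvm. have kB := fr_kapB F t. apply Rabs_le_between in kB.
have ssC : C1 * (s * s) <= 1 / 8 by nra. have t1 := fr_tau1 F t. set (n := (Ci * tau t)%C). have n1 : Cmod n = 1 by (unfold n; rewrite Cmod_Ci_mult; auto).
have nn : (n * Cconj n)%C = 1.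
{ transitivity (RtoC (Cmod n * Cmod n)); [|rewrite n1; f_equal; ring]. rewrite Cmod_sqr. apply Ceq; simpl; ring. }
set (A := s - kap t / 2 * (s * s)). set (e := (RtoC (1 - kap t * s) * Cconj n)%C). have ks : - (1 / 8) <= kap t * s <= 1 / 8 by nra.
have HA : 15 / 16 * s <= A <= 17 / 16 * s by (unfold A; nra).
have Me : Cmod e = 1 - kap t * s by (unfold e; rewrite Cmod_mult, Cmod_conj, n1, Cmod_R, Rabs_pos_eq; lra).
have Evm : forall w, vmod gam tau kap t w = A + Re (e * (w - z)) - kap t / 2 * (Cmod (w - z) * Cmod (w - z)).
{ intros w. unfold vmod. fold n. replace (w - gam t)%C with (s * n + (w - z))%C by (unfold z, tube, n; ring). set (y := (w - z)%C). unfold A, e.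
 replace (Cmod (s * n + y) * Cmod (s * n + y)) with (s * s * (Cmod n * Cmod n) + 2 * s * dot n y + Cmod y * Cmod y).
 2:{ rewrite !Cmod_sqr. unfold dot; simpl. ring. }
 replace (dot n (s * n + y)) with (s * (Cmod n * Cmod n) + dot n y).
 2:{ rewrite <- dot_self. unfold dot; simpl. ring. }
 replace (Re (RtoC (1 - kap t * s) * Cconj n * y)) with ((1 - kap t * s) * dot n y) by (unfold dot; simpl; ring). rewrite n1. field. }
set (eps := 8 * C0 * (s * s)). have e0 : 0 <= eps <= 1 / 2 by (unfold eps, C1 in *; assert (0 <= C0 * (s * s)) by (apply Rmult_le_pos; nra); split; nra).
have Elow : forall w, Cmod (w - z) < s / 2 -> s / 4 <= vmod gam tau kap t w.
{ intros w Hw. rewrite Evm. have X := re_le_Cmod (e * (w - z)). rewrite Cmod_mult, Me in X. apply Rabs_le_between in X.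
 have P3 : (1 - kap t * s) * Cmod (w - z) <= 9 / 8 * (s / 2) by lra.
 have P4 : kap t / 2 * (Cmod (w - z) * Cmod (w - z)) <= B / 2 * (s / 2 * (s / 2)) by (apply Rle_trans with (B / 2 * (Cmod (w - z) * Cmod (w - z))); an).
 have P5 : B / 2 * (s / 2 * (s / 2)) <= s / 64 by nra. lra. }
have C0s : C0 * (s * s) <= 1 / 80000000 by (unfold C1 in ssC; nra). have zz : Cmod (z - z) = 0 by (replace (z - z)%C with (RtoC 0) by ring; apply Cmod_0).
have Az : vmod gam tau kap t z = A by (rewrite Evm, zz; replace (z - z)%C with (RtoC 0) by ring; simpl; ring). have Vz := Hvm z ltac:(lra). rewrite Az in Vz.
destruct (@mobius_estimate O beta k s A (kap t) eps f g v z e Hb HO Bi ltac:(lra) Hk Hdisc Hsg Hv) as [S1 S2]; try lra.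
- rewrite Me. unfold A. field.
- intros w Hw. rewrite <- Evm. have X := Elow w Hw. have Y := Hvm w ltac:(lra). apply Rabs_le_between in Y. assert (s / 8 <= v w) by nra. unfold eps.
 assert (C0 * (s * s * s) <= 8 * C0 * (s * s) * v w); [|lra]. replace (C0 * (s * s * s)) with (8 * (C0 * (s * s)) * (s / 8)) by field. an.
- apply Rabs_le_between in Vz. unfold eps. assert (0 <= C0 * (s * s)) by lra. replace (C0 * (s * s * s)) with (C0 * (s * s) * s) in * by ring.
 set (c := C0 * (s * s)) in *. replace (8 * C0 * (s * s)) with (8 * c) in * by (unfold c; ring). nra.
- split; [|split; [auto|split]].
 + eapply Rle_trans; [exact Vz|]. apply Rmult_le_compat_r; [lra|unfold C1; lra].
 + replace (A * (n * (lel f z + RtoC (k * cos (k * sg f z) / sin (k * sg f z)) * ell f z)) + RtoC (1 - kap t * s))%C with (n * (A * (lel f z + RtoC (k * cos (k * sg f z) / sin (k * sg f z)) * ell f z) + e))%C.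
  * rewrite Cmod_mult, n1, Rmult_1_l. eapply Rle_trans; [exact S1|]. unfold eps, C1. nra.
  * unfold e. rewrite Cmult_plus_distr_l. replace (n * (RtoC (1 - kap t * s) * Cconj n))%C with (RtoC (1 - kap t * s) * (n * Cconj n))%C by ring. rewrite nn. ring.
 + have AA : 225 / 256 * (s * s) <= A * A by nra. have X : 225 / 256 * (s * s) * Cmod (quad f k z) <= 300000 * eps.
  { eapply Rle_trans; [|exact S2]. an. }
  unfold eps in X. unfold C1. nra.
Qed.

Lemma pder_tube_s s t : pder (fun s => tb s t) s (Ci * tau t).
Proof. apply pder_line. Qed.

Lemma pcont_tube_t s t : pcont (fun t => tb s t) t.
Proof.
have F := hc_fr H. apply pcont_plus; [eapply pder_pcont, (fr_gam F)|]. apply pcont_mult; [an|]. apply pcont_mult; [an|]. eapply pder_pcont, (fr_tau F).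
Qed.

Lemma tube_bounded {h s} : 0 < s < dl -> (forall z, O z -> ccont h z) -> exists M, 0 <= M /\ forall t, Cmod (h (tb s t)) <= M.
Proof.
intros Hs Hh. have F := hc_fr H. destruct (@periodic_bounded (fun t => Cmod (h (tb s t))) T (fr_T F)) as [M HM].
- intros t. unfold tube. now rewrite (fr_gamT F), (fr_tauT F).
- intros t. apply (@pcont_comp (fun z => RtoC (Cmod (h z))) (fun t => tb s t)); [eapply pcont_tube_t; eauto|]. apply ccont_Cmod, Hh. eapply hc_in; eauto.
- exists M. split; [eapply Rle_trans; [apply Rabs_pos|apply (HM 0)]|]. intros t. eapply Rle_trans; [apply Rle_abs|an].
Qed.

(* Along a normal the logarithm of [(1 + |R+|^2) (1 + |R-|^2) / |ell|^2], where [R] is [n * rho], has bounded derivative because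
   both [R] solve the same Riccati equation. Hence [1 / ell] is Lipschitz, and it cannot be small since [sg] tends to [0]. *)
Lemma collar_bounded : exists d M, 0 < d /\ 0 <= M /\ forall s t, 0 < s < d ->
 let z := tb s t in Cmod (ell f z) <= M /\ Cmod (rho f k 1 z) <= M /\ Cmod (rho f k (-1) z) <= M.
Proof.
have [d0 [C1 [Hd0 [HC1 [HdB [Hd1 Est]]]]]] := collar_estimate. have Hin := hc_in. have TB := fun h s => @tube_bounded h s.
destruct H as [Hb Hk HO Bi F Col Hsg Hv Hend]. have [HE NE] := @hol_ell O beta f g ltac:(lra) HO Bi.
have CR : forall sig z, sig * sig = 1 -> O z -> cder (rho f k sig) z (- (/ 4 * quad f k z) - rho f k sig z * rho f k sig z)%C.
{ intros sig z Hs Oz. apply (@cder_rho O beta k sig f g z); auto; lra. }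
have one1 : 1 * 1 = 1 by lra. have one2 : -1 * -1 = 1 by lra. set (K0 := 2 * (C1 + 1)). set (n := fun t => (Ci * tau t)%C).
have n1 : forall t, Cmod (n t) = 1 by (intros t; unfold n; rewrite Cmod_Ci_mult; apply (fr_tau1 F)). set (R := fun sig s t => (n t * rho f k sig (tb s t))%C).
have Rm : forall sig s t, Cmod (R sig s t) = Cmod (rho f k sig (tb s t)) by (intros; unfold R; rewrite Cmod_mult, n1; ring).
set (q := fun s t => (- (n t * n t * (/ 4 * quad f k (tb s t))))%C).
have dR : forall sig s t, sig * sig = 1 -> 0 < s < d0 -> pder (fun s => R sig s t) s (q s t - R sig s t * R sig s t).
{ intros sig s t Hs Hst. eapply pder_eq.
 - apply pder_scal. apply @pder_comp; [apply pder_tube_s|apply CR; auto; apply Hin; lra].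
 - unfold q, R, n. ring. }
have qB : forall s t, 0 < s < d0 -> Cmod (q s t) <= C1.
{ intros s t Hs. unfold q. rewrite Cmod_opp, !Cmod_mult, !n1. have [_ [_ [_ X]]] := Est s t Hs. rewrite Cmod_inv, Cmod_R, Rabs_pos_eq by (try apply RtoC_neq; lra).
 lra. }
set (X := fun t s => ln (1 + Cmod (R 1 s t) * Cmod (R 1 s t)) + ln (1 + Cmod (R (-1) s t) * Cmod (R (-1) s t)) - 2 * ln (Cmod (ell f (tb s t)))).
have dX : forall t s, 0 < s < d0 -> exists l, is_derive (X t) s l /\ Rabs l <= K0.
{ intros t s Hs.
 have Dln : forall sig, sig * sig = 1 -> is_derive (fun s => ln (1 + Cmod (R sig s t) * Cmod (R sig s t))) s (2 * dot (R sig s t) (q s t - R sig s t * R sig s t) / (1 + Cmod (R sig s t) * Cmod (R sig s t))).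
 { intros sig Hsig. have D := dR sig s t Hsig Hs. set (d := (q s t - R sig s t * R sig s t)%C) in *. have [D2 _] := pder_mult (pder_conj D) D.
  apply is_derive_ext with (fun s => ln (1 + Re (Cconj (R sig s t) * R sig s t))).
  { intros r. fold (dot (R sig r t) (R sig r t)). now rewrite dot_self. }
  eapply is_derive_eq.
  - apply @is_derive_Rcomp.
   + apply is_derive_ln. fold (dot (R sig s t) (R sig s t)). rewrite dot_self. nra.
   + an.
  - fold (dot (R sig s t) (R sig s t)). rewrite dot_self. replace (Re (Cconj d * R sig s t + Cconj (R sig s t) * d)) with (2 * dot (R sig s t) d).
   2:{ rewrite Re_conj_sum. lra. }
   nra. }
 have Oz : O (tb s t) by (apply Hin; lra). have De : is_derive (fun s => ln (Cmod (ell f (tb s t)))) s (Re (C_derive (ell f) (tb s t) * n t / ell f (tb s t))).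
 { apply @is_derive_Cmod_ln; auto. apply pder_comp; [apply pder_tube_s|an]. }
 eexists. split.
 - apply @is_derive_Rminus.
  + an.
  + an.
 - have B1 := riccati_log_bound (R 1 s t) (q s t). have B2 := riccati_log_bound (R (-1) s t) (q s t). have Q := qB s t Hs.
  have E : Re (C_derive (ell f) (tb s t) * n t / ell f (tb s t)) = - (Re (R 1 s t) + Re (R (-1) s t)).
  { replace (C_derive (ell f) (tb s t) * n t / ell f (tb s t))%C with (- (n t * - lel f (tb s t)))%C by (unfold lel; field; apply NE; auto).
   rewrite <- (rho_sum f k). rewrite Cmult_plus_distr_l. an. }
  apply Rabs_le_between in B1. apply Rabs_le_between in B2. unfold K0. lra. }
set (s1 := d0 / 2). destruct (TB (rho f k 1) s1 ltac:(unfold s1; lra)) as [M1 [M1p B1]]; [an|].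
destruct (TB (rho f k (-1)) s1 ltac:(unfold s1; lra)) as [M2 [M2p B2]]; [an|]. destruct (TB (fun z => / ell f z)%C s1 ltac:(unfold s1; lra)) as [M3 [M3p B3]].
{ intros z Oz. an. }
have lnle : forall x, 0 < x -> ln x <= x - 1.
{ intros x Hx. have Y := exp_ineq1_le (ln x). rewrite exp_ln in Y; lra. }
set (Xm := M1 * M1 + M2 * M2 + 2 * M3 + K0). have Xs : forall t s, 0 < s < s1 -> X t s <= Xm.
{ intros t s Hs. have D := fun r (Hr : 0 < r < d0) => dX t r Hr. have Hlip : Rabs (X t s1 - X t s) <= K0 * (s1 - s).
 (* A derivative selected from the existence statement [dX]; outside the interval the value 0 is a
    placeholder. *)
 { set (DX := fun r => match Rlt_dec 0 r with left a => match Rlt_dec r d0 with left b => proj1_sig (constructive_indefinite_description _ (D r (conj a b))) | right _ => 0 end | right _ => 0 end).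
  have HDX : forall r, 0 < r < d0 -> is_derive (X t) r (DX r) /\ Rabs (DX r) <= K0.
  { intros r Hr. unfold DX. destruct (Rlt_dec 0 r); [|lra]. destruct (Rlt_dec r d0); [|lra]. apply proj2_sig. }
  destruct (MVT_gen (X t) s s1 DX) as [c [Hc E]].
  - intros x Hx. rewrite Rmin_left, Rmax_right in Hx by lra. apply HDX. unfold s1 in *; lra.
  - intros x Hx. rewrite Rmin_left, Rmax_right in Hx by lra. eapply is_derive_cont_pt, HDX. unfold s1 in *; lra.
  - rewrite Rmin_left, Rmax_right in Hc by lra. rewrite E, Rabs_mult, (Rabs_pos_eq (s1 - s)) by lra. apply Rmult_le_compat_r; [lra|]. apply HDX. unfold s1 in *; lra. }
 apply Rabs_le_between in Hlip. have X1 : X t s1 <= M1 * M1 + M2 * M2 + 2 * M3.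
 { unfold X. rewrite !Rm. have Y3 := B3 t. have P1 := Cmod_ge_0 (rho f k 1 (tb s1 t)). have P2 := Cmod_ge_0 (rho f k (-1) (tb s1 t)).
  have Z1 := lnle (1 + Cmod (rho f k 1 (tb s1 t)) * Cmod (rho f k 1 (tb s1 t))) ltac:(nra).
  have Z2 := lnle (1 + Cmod (rho f k (-1) (tb s1 t)) * Cmod (rho f k (-1) (tb s1 t))) ltac:(nra). have N := NE _ (Hin s1 t ltac:(unfold s1; lra)).
  have Np := Cmod_pos N. rewrite Cmod_inv in Y3 by auto. have Z3 := lnle (/ Cmod (ell f (tb s1 t))) ltac:(lra). rewrite ln_Rinv in Z3 by auto.
  assert (Cmod (rho f k 1 (tb s1 t)) * Cmod (rho f k 1 (tb s1 t)) <= M1 * M1) by (apply Rmult_le_compat; auto).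
  assert (Cmod (rho f k (-1) (tb s1 t)) * Cmod (rho f k (-1) (tb s1 t)) <= M2 * M2) by (apply Rmult_le_compat; auto). lra. }
 assert (K0 * (s1 - s) <= K0) by (assert (0 <= K0) by (unfold K0; lra); assert (s1 - s <= 1) by (unfold s1 in *; lra); nra). unfold Xm. lra. }
set (X2 := exp Xm). have X2p : 0 < X2 by apply exp_pos.
have Prod : forall t s, 0 < s < s1 -> (1 + Cmod (R 1 s t) * Cmod (R 1 s t)) * (1 + Cmod (R (-1) s t) * Cmod (R (-1) s t)) <= X2 * (Cmod (ell f (tb s t)) * Cmod (ell f (tb s t))).
{ intros t s Hs. have Y := Xs t s Hs. unfold X in Y. have N := Cmod_pos (NE _ (Hin s t ltac:(unfold s1 in *; lra))).
 set (a := 1 + Cmod (R 1 s t) * Cmod (R 1 s t)) in *. set (b := 1 + Cmod (R (-1) s t) * Cmod (R (-1) s t)) in *. set (e := Cmod (ell f (tb s t))) in *.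
 have ap : 0 < a by (unfold a; nra). have bp : 0 < b by (unfold b; nra). have Z : ln (a * b) <= ln (X2 * (e * e)).
 { rewrite !ln_mult by (auto; apply Rmult_lt_0_compat; auto). unfold X2. rewrite ln_exp. lra. }
 apply Rnot_lt_le. intros L. apply ln_increasing in L; [lra|]. lra. }
set (X3 := X2 + 1). have NL : forall t s s', 0 < s -> s <= s' -> s' < s1 -> Cmod (/ ell f (tb s' t) - / ell f (tb s t)) <= X3 * (s' - s).
{ intros t s s' Hs Hss Hs'. apply (@pder_lip (fun s => / ell f (tb s t))%C (fun s => (R 1 s t + R (-1) s t) / ell f (tb s t))%C); auto.
 - intros r Hr. have Or : O (tb r t) by (apply Hin; unfold s1 in *; lra). eapply pder_eq.
  + apply @pder_inv; auto. apply @pder_comp; [apply pder_tube_s|an].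
  + replace (R 1 r t + R (-1) r t)%C with (n t * - lel f (tb r t))%C by (rewrite <- (rho_sum f k); unfold R; ring). unfold lel, n. field. an.
 - intros r Hr. have Or : O (tb r t) by (apply Hin; unfold s1 in *; lra). have Np := Cmod_pos (NE _ Or). rewrite Cmod_div by (apply NE; auto). apply div_le; auto.
  have Y := Prod t r ltac:(lra). have Tr := Cmod_triangle (R 1 r t) (R (-1) r t). set (a := Cmod (R 1 r t)) in *. set (b := Cmod (R (-1) r t)) in *.
  set (e := Cmod (ell f (tb r t))) in *. eapply Rle_trans; [exact Tr|]. apply Rnot_lt_le. intros L.
  have L2 : X3 * e * (X3 * e) < (a + b) * (a + b) by (apply Rmult_le_0_lt_compat; auto; apply Rmult_le_pos; unfold X3; lra).
  have L3 : (a + b) * (a + b) <= 2 * ((1 + a * a) * (1 + b * b)).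
  { have A1 := Rle_0_sqr (a - b). unfold Rsqr in A1. have A2 := Rle_0_sqr (a * b). unfold Rsqr in A2. lra. }
  have L4 : 2 * (X2 * (e * e)) <= X3 * e * (X3 * e).
  { unfold X3. replace ((X2 + 1) * e * ((X2 + 1) * e)) with ((X2 * X2 + 2 * X2 + 1) * (e * e)) by ring. rewrite <- Rmult_assoc. apply Rmult_le_compat_r; nra. }
  lra. }
(* At depth [s'] one has [v >= s' / 2] and [v * k * |ell| <= eta0], hence
   [/ |ell| >= 4 * (X3 + 1) * s']. The Lipschitz constant [X3] lets [/ |ell|] lose at most [X3 * s']
   on the way to the curve, so it stays above [s']. *)
set (eta0 := k / (8 * (X3 + 1))). have X3p : 1 < X3 by (unfold X3; lra). have eta0p : 0 < eta0 by (apply Rdiv_lt_0_compat; lra).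
destruct (Hend (1 - exp (- (eta0 / k)))) as [d2 [Hd2 Hf]].
{ assert (exp (- (eta0 / k)) < exp 0); [|rewrite exp_0 in *; lra]. apply exp_increasing. assert (0 < eta0 / k) by lra. lra. }
set (s' := Rmin s1 d2 / 2). have m1 := Rmin_l s1 d2. have m2 := Rmin_r s1 d2. have m0 : 0 < Rmin s1 d2 by (apply Rmin_pos; unfold s1; lra).
have Lo : forall s t, 0 < s < s' -> Cmod (ell f (tb s t)) <= / s'.
{ intros s t Hs. have Hs' : 0 < s' < s1 /\ s' < d2 by (unfold s'; lra). have Y := NL t s s' ltac:(lra) ltac:(lra) ltac:(lra).
 have O' : O (tb s' t) by (apply Hin; unfold s1 in *; lra). have Os : O (tb s t) by (apply Hin; unfold s1 in *; lra). have F' := Hf s' t ltac:(lra).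
 replace (1 - (1 - exp (- (eta0 / k)))) with (exp (- (eta0 / k))) in F' by ring. have S1 : k * sg f (tb s' t) <= eta0.
 { unfold sg. apply ln_increasing in F'; [|an]. rewrite ln_exp in F'. apply Rle_trans with (k * (eta0 / k)); [an|right; field; lra]. }
 have [G1 G2] := Hsg _ O'. have S2 : sin (k * sg f (tb s' t)) <= eta0 by (have Z := sin_lt_x _ G1; lra). have [V1 [V2 _]] := Est s' t ltac:(unfold s1 in *; lra).
 apply Rabs_le_between in V1. have kB := fr_kapB F t. apply Rabs_le_between in kB. have Vl : s' / 2 <= v (tb s' t).
 { assert (C1 * (s' * s' * s') <= 1 / 8 * s') by (replace (C1 * (s' * s' * s')) with (C1 * (s' * s') * s') by ring; apply Rmult_le_compat_r; lra).
  assert (B * s' <= 1 / 8) by (assert (s' <= d0) by (unfold s1 in *; lra); have HB := fr_B F; nra). assert (kap t / 2 * (s' * s') <= s' / 16) by nra. lra. }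
 have V3 := Hv _ O'. have Np := Cmod_pos (NE _ O'). have T1 := Cmod_le_plus (/ ell f (tb s' t)) (/ ell f (tb s t)). rewrite !Cmod_inv in T1 by (apply NE; auto).
 set (e' := Cmod (ell f (tb s' t))) in *. set (e := Cmod (ell f (tb s t))) in *. have Z1 : k * (s' / 2) <= eta0 * / e'.
 { apply Rmult_le_reg_r with e'; auto. replace (eta0 * / e' * e') with eta0 by (field; lra). apply Rle_trans with (v (tb s' t) * (k * e')); [|lra].
  replace (k * (s' / 2) * e') with (s' / 2 * (k * e')) by ring. an. }
 have Z2 : / e' <= / e + X3 * s' by (assert (X3 * (s' - s) <= X3 * s') by (apply Rmult_le_compat_l; lra); lra).
 have Z4 : k = eta0 * (8 * (X3 + 1)) by (unfold eta0; field; lra). have Z6 : s' <= / e by nra. rewrite <- (Rinv_inv e). apply Rinv_le_contravar; lra. }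
exists s', ((X2 + 1) * / s'). have Hs' : 0 < s' < s1 by (unfold s'; lra). have is0 : 0 < / s' by lra. split; [lra|split; [an|]]. intros s t Hs z.
have L := Lo s t Hs. fold z in L. have Y := Prod t s ltac:(lra). rewrite !Rm in Y. fold z in Y. have r1 := Cmod_ge_0 (rho f k 1 z).
have r2 := Cmod_ge_0 (rho f k (-1) z). have Y2 : X2 * (Cmod (ell f z) * Cmod (ell f z)) <= X2 * (/ s' * / s') by lra. set (i := / s') in *.
have sq : forall x, 0 <= x -> x * x <= X2 * (i * i) -> x <= (X2 + 1) * i.
{ intros x Hx Hx2. apply Rnot_lt_le. intros Lt. assert ((X2 + 1) * i * ((X2 + 1) * i) < x * x) by (apply Rmult_le_0_lt_compat; auto; apply Rmult_le_pos; lra).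
 assert (X2 * (i * i) <= (X2 + 1) * i * ((X2 + 1) * i)) by (replace ((X2 + 1) * i * ((X2 + 1) * i)) with ((X2 * X2 + 2 * X2 + 1) * (i * i)) by ring; apply Rmult_le_compat_r; nra).
 lra. }
split; [nra|split; apply sq; nra].
Qed.

(** As [k * cot (k * sg) * |ell|] equals [cos (k * sg) / v], [collar_estimate] becomes a single
    relation, up to [O(s^2)], between the unit vector [mu] of [n * ell] and
    [Sg = n * (rho+ + rho-)]; [n * (rho+ - rho-)] is a multiple of [mu]. The last conclusion
    expresses the normal derivative of [ln v] through the Riccati functions with an error small
    enough for a second order expansion of its integral. *)
Lemma collar_asymptotics : exists d K, 0 < d <= dl /\ d <= 1 /\ d * B <= 1 / 8 /\ 1 <= K /\ forall s t, 0 < s < d ->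
 let z := tb s t in let n := (Ci * tau t)%C in let R := fun sig => (n * rho f k sig z)%C in s / 2 <= v z <= 2 * s /\ (Rabs (Re (R 1) + kap t / 2) <= K * s /\ Rabs (Re (R (-1)) + kap t / 2) <= K * s) /\ (Rabs (Im (R 1)) <= K /\ Rabs (Im (R (-1))) <= K) /\ (Re (n * ell f z) < 0 /\ Rabs (Im (n * ell f z)) <= K * s) /\ Rabs (Re (- (n * (lel f z + RtoC (k * cos (k * sg f z) / sin (k * sg f z)) * ell f z))) - (Re (R 1) + Re (R (-1)) + / v z - s * (Im (R 1) * Im (R 1) + Im (R (-1)) * Im (R (-1))))) <= K * (s * s).
Proof.
have [d0 [C1 [Hd0 [HC1 [HdB [Hd1 Est]]]]]] := collar_estimate. have [d1 [M [Hd1p [HM Bd]]]] := collar_bounded. have Hin := hc_in.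
destruct H as [Hb Hk HO Bi F Col Hsg Hv Hend]. have [HE NE] := @hol_ell O beta f g ltac:(lra) HO Bi. have HB := fr_B F.
destruct (Hend (1 - exp (- (1 / k)))) as [d2 [Hd2 Hf]].
{ assert (exp (- (1 / k)) < exp 0); [|rewrite exp_0 in *; lra]. apply exp_increasing. assert (0 < 1 / k) by lra. lra. }
set (k2 := k * M * (k * M)). have k20 : 0 <= k2 by (unfold k2; nra). have BM : 0 <= B * M by lra. set (K := 1 + k + B + M + 3 * C1 + 4 * k2 + B * M).
have K1 : 1 <= K by (unfold K; lra). set (K8 := K * K * K * K * K * K * K * K). have K8p : K * K * K <= K8 /\ K <= K8 /\ 1 <= K8 /\ K * K <= K8.
{ have a2 : 1 <= K * K by nra. set (x := K * K * K). have a3 : 1 <= x by (unfold x; nra). replace K8 with (x * x * (K * K)) by (unfold K8, x; ring).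
 assert (x <= x * x) by nra. assert (x * x <= x * x * (K * K)) by nra. assert (K <= x) by (unfold x; nra). assert (K * K <= x) by (unfold x; nra). lra. }
set (d := Rmin (Rmin d0 d1) (Rmin d2 (/ (8 * K)))). have e1 := Rmin_l (Rmin d0 d1) (Rmin d2 (/ (8 * K))). have e2 := Rmin_r (Rmin d0 d1) (Rmin d2 (/ (8 * K))).
fold d in e1, e2. have e3 := Rmin_l d0 d1. have e4 := Rmin_r d0 d1. have e5 := Rmin_l d2 (/ (8 * K)). have e6 := Rmin_r d2 (/ (8 * K)). exists d, (200 * K8).
split; [an|]. split; [lra|split; [nra|split; [lra|]]]. intros s t Hs z n R. have [V1 [V2 [V3 _]]] := Est s t ltac:(lra). have [B1 [B2 B3]] := Bd s t ltac:(lra).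
fold z in V1, V3, B1, B2, B3. fold n in V3. have Oz : O z by (apply Hin; lra). have Np := Cmod_pos (NE z Oz). have Vz := Hv z Oz. have [G1 _] := Hsg z Oz.
have n1 : Cmod n = 1 by (unfold n; rewrite Cmod_Ci_mult; apply (fr_tau1 F)). have kB := fr_kapB F t. have Hth : k * sg f z < 1.
{ have X := Hf s t ltac:(lra). fold z in X. replace (1 - (1 - exp (- (1 / k)))) with (exp (- (1 / k))) in X by ring. unfold sg.
 apply ln_increasing in X; [|apply exp_pos]. rewrite ln_exp in X. apply Rlt_le_trans with (k * (1 / k)); [an|right; field; lra]. }
have PI2 := PI2_1. set (th := k * sg f z) in *. have C0' : 0 < cos th by (apply cos_gt_0; lra).
have SC : cos th * cos th + sin th * sin th = 1 by (have X := sin2_cos2 th; unfold Rsqr in X; lra). set (le := Cmod (ell f z)) in *. set (vz := v z) in *.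
have Ks : 8 * K * s <= 1 by (apply Rle_trans with (8 * K * / (8 * K)); [an|right; field; lra]).
have kBs : Rabs (kap t / 2 * (s * s)) <= B / 2 * (s * s) by (apply Rabs_mult_le; [apply Rabs_mult_le; auto; rewrite Rabs_pos_eq; lra|rewrite Rabs_pos_eq; nra]).
have C1s : C1 * (s * s * s) <= 1 / 8 * s by (replace (C1 * (s * s * s)) with (C1 * (s * s) * s) by ring; apply Rmult_le_compat_r; lra).
have C1s2 : C1 * (s * s * s) <= C1 * (s * s) by (apply Rmult_le_compat_l; nra). have Bss : B / 2 * (s * s) <= s / 16 by nra.
have vs : s / 2 <= vz <= 2 * s by (apply Rabs_le_between in V1; apply Rabs_le_between in kBs; lra). set (A := s - kap t / 2 * (s * s)) in *.
set (mu := (n * ell f z / le)%C). have ln0 : RtoC le <> 0 by lra. have nel : (n * ell f z)%C = (le * mu)%C by (unfold mu; field; auto).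
have mu1 : Cmod mu = 1 by (unfold mu; rewrite Cmod_div, Cmod_mult, n1, Cmod_R, Rabs_pos_eq by lra; fold le; field; lra). set (Sg := (n * - lel f z)%C).
have ES : Sg = (R 1 + R (-1))%C by (unfold Sg, R; rewrite <- (rho_sum f k); ring). have ED : (R 1 - R (-1))%C = (Ci * RtoC (k * le) * mu)%C.
{ transitivity (n * (rho f k 1 z - rho f k (-1) z))%C; [unfold R; ring|]. rewrite rho_diff. transitivity (Ci * k * (n * ell f z))%C; [ring|]. rewrite nel, RtoC_mult.
 ring. }
have SB : Cmod Sg <= 2 * M.
{ rewrite ES. eapply Rle_trans; [apply Cmod_triangle|]. unfold R. rewrite !Cmod_mult, n1. lra. }
have cot : k * cos th / sin th * le = cos th / vz by (rewrite <- Vz; field; lra). have Est2 : Cmod (mu - s * Sg + RtoC (1 - kap t * s)) <= K * (s * s).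
{ replace (mu - s * Sg + RtoC (1 - kap t * s))%C with ((A * (n * (lel f z + RtoC (k * cos th / sin th) * ell f z)) + RtoC (1 - kap t * s)) + RtoC (1 - A * (cos th / vz)) * mu + RtoC (A - s) * Sg)%C.
 2:{ rewrite <- cot. rewrite !RtoC_minus, (RtoC_mult A), (RtoC_mult _ le).
  replace (n * (lel f z + RtoC (k * cos th / sin th) * ell f z))%C with (- Sg + RtoC (k * cos th / sin th) * (n * ell f z))%C by (unfold Sg; ring). rewrite nel.
  ring. }
 eapply Rle_trans; [apply Cmod_triangle|]. eapply Rle_trans; [apply Rplus_le_compat_r, Cmod_triangle|]. rewrite Cmod_mult, Cmod_mult, mu1, !Cmod_R.
 have X1 : Rabs (1 - A * (cos th / vz)) <= 4 * k2 * (s * s) + 2 * C1 * (s * s).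
 { replace (1 - A * (cos th / vz)) with ((1 - cos th) + cos th * ((vz - A) / vz)) by (field; lra). eapply Rle_trans; [apply Rabs_triang|]. apply Rplus_le_compat.
  - have c1 : cos th <= 1 by apply COS_bound. rewrite Rabs_pos_eq by lra. have X : 1 - cos th <= sin th * sin th by nra. eapply Rle_trans; [exact X|]. rewrite <- Vz.
   replace (4 * k2 * (s * s)) with (2 * s * (k * M) * (2 * s * (k * M))) by (unfold k2; ring). an.
  - rewrite <- Rmult_1_l. apply Rabs_mult_le; [rewrite Rabs_pos_eq by lra; apply COS_bound|]. unfold Rdiv. rewrite Rabs_mult, Rabs_inv, (Rabs_pos_eq vz) by lra.
   apply div_le; [lra|]. apply Rle_trans with (2 * C1 * (s * s) * (s / 2)); [an|]. an. }
 have X2 : Rabs (A - s) * Cmod Sg <= B * M * (s * s).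
 { apply Rle_trans with (B / 2 * (s * s) * (2 * M)); [|an]. apply Rmult_le_compat; auto; [an|an|]. unfold A.
  replace (s - kap t / 2 * (s * s) - s) with (- (kap t / 2 * (s * s))) by ring. rewrite Rabs_Ropp. auto. }
 assert (K * (s * s) >= (3 * C1 + 4 * k2 + B * M) * (s * s)) by (apply Rle_ge, Rmult_le_compat_r; [lra|unfold K; lra]). lra. }
have rS := re_le_Cmod Sg. have iS := im_le_Cmod Sg. have rE := re_le_Cmod (mu - s * Sg + RtoC (1 - kap t * s)).
have iE := im_le_Cmod (mu - s * Sg + RtoC (1 - kap t * s)).
destruct (@unit_asymptotics K s (Re mu) (Im mu) (cos th) (sin th) vz (Re Sg) (Im Sg) le k (kap t)) as [U1 [U2 [U3 U4]]]; try lra.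
- rewrite <- Cmod_sqr, mu1. ring.
- unfold K. lra.
- unfold K. lra.
- replace (vz - s) with ((vz - A) + - (kap t / 2 * (s * s))) by (unfold A; ring). eapply Rle_trans; [apply Rabs_triang|]. rewrite Rabs_Ropp.
 assert (K * (s * s) >= (C1 + B / 2) * (s * s)) by (apply Rle_ge, Rmult_le_compat_r; [lra|unfold K; lra]). lra.
- unfold K. lra.
- unfold K. lra.
- unfold K. lra.
- eapply Rle_trans; [|exact Est2]. eapply Rle_trans; [|exact rE]. right. f_equal. simpl. ring.
- eapply Rle_trans; [|exact Est2]. eapply Rle_trans; [|exact iE]. right. f_equal. simpl. ring.
- have RS : Re Sg = Re (R 1) + Re (R (-1)) by (rewrite ES; reflexivity). have IS : Im Sg = Im (R 1) + Im (R (-1)) by (rewrite ES; reflexivity).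
 have RD : Re (R 1) - Re (R (-1)) = - (k * le * Im mu).
 { rewrite <- Re_minus, ED. simpl. ring. }
 have ID : Im (R 1) - Im (R (-1)) = k * le * Re mu.
 { rewrite <- Im_minus, ED. simpl. ring. }
 have kl : Rabs (k * le * Im mu) <= K * K * (3 * K * s).
 { apply Rabs_mult_le; auto. apply Rabs_mult_le; rewrite Rabs_pos_eq; unfold K; lra. }
 have K3s : K * K * (3 * K * s) <= 3 * K8 * s by (replace (K * K * (3 * K * s)) with (3 * (K * K * K) * s) by ring; apply Rmult_le_compat_r; lra).
 have K2s : 10 * (K * K) * s <= 10 * K8 * s by lra. apply Rabs_le_between in U2. apply Rabs_le_between in kl. split; auto. split; [an|]. split.
 { have KM : M <= 200 * K8 by (assert (M <= K) by (unfold K; lra); lra). split; (eapply Rle_trans; [apply im_le_Cmod|]); unfold R; rewrite Cmod_mult, n1; lra. }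
 split.
 { rewrite nel. replace (Re (RtoC le * mu)) with (le * Re mu) by (simpl; ring). replace (Im (RtoC le * mu)) with (le * Im mu) by (simpl; ring). split; [nra|].
  eapply Rle_trans; [apply (@Rabs_mult_le le (Im mu) K (3 * K * s)); auto; rewrite Rabs_pos_eq; unfold K; lra|]. lra. }
 set (w := (n * (lel f z + RtoC (k * cos th / sin th) * ell f z))%C). have Ew : Re (- w) = Re Sg - cos th / vz * Re mu.
 { rewrite <- cot. unfold w.
  replace (- (n * (lel f z + RtoC (k * cos th / sin th) * ell f z)))%C with (Sg - RtoC (k * cos th / sin th) * (n * ell f z))%C by (unfold Sg; ring). rewrite nel.
  simpl. ring. }
 rewrite Ew, RS.
 replace (Re (R 1) + Re (R (-1)) - cos th / vz * Re mu - (Re (R 1) + Re (R (-1)) + / vz - s * (Im (R 1) * Im (R 1) + Im (R (-1)) * Im (R (-1))))) with (- ((1 + cos th * Re mu - s * vz * (/ 2 * (Im Sg * Im Sg + k * le * Re mu * (k * le * Re mu)))) / vz)).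
 2:{ rewrite <- ID, IS. field. lra. }
 rewrite Rabs_Ropp. unfold Rdiv. rewrite Rabs_mult, Rabs_inv, (Rabs_pos_eq vz) by lra. apply div_le; [lra|]. eapply Rle_trans; [exact U4|]. fold K8.
 apply Rle_trans with (200 * K8 * (s * s) * (s / 2)); [an|]. an.
Qed.

(** * Integral identities on the parallel curves *)
Definition nr (sig s t : R) : C := (Ci * tau t * rho f k sig (tb s t))%C.

Definition nl (s t : R) : C := (Ci * tau t * ell f (tb s t))%C.

(** The logarithmic derivative of [v] along the inward normal, as [is_derive_v] shows. *)
Definition wv (s t : R) : R :=
  let z := tb s t in
  Re (- (Ci * tau t * (lel f z + RtoC (k * cos (k * sg f z) / sin (k * sg f z)) * ell f z))).

Lemma is_derive_v {s} t : 0 < s < dl -> is_derive (fun s => v (tb s t)) s (v (tb s t) * wv s t).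
Proof.
intros Hs. have Hin := hc_in. destruct H as [Hb Hk HO Bi F Col Hsg Hv _]. have [HE NE] := @hol_ell O beta f g ltac:(lra) HO Bi. set (z := tb s t).
have Oz : O z by (apply Hin; auto). have Np := Cmod_pos (NE z Oz). have [G1 G2] := Hsg z Oz. have S0 : 0 < sin (k * sg f z) by (apply sin_gt_0; auto).
have De : is_derive (fun s => ln (Cmod (ell f (tb s t)))) s (Re (C_derive (ell f) z * (Ci * tau t) / ell f z)).
{ apply @is_derive_Cmod_ln; auto. apply pder_comp; [apply pder_tube_s|an]. }
have fn : f z <> 0 by (apply (@annulus_neq_0 beta); [lra|apply Bi; auto]).
have Df : is_derive (fun s => ln (Cmod (f (tb s t)))) s (Re (C_derive f z * (Ci * tau t) / f z)).
{ apply @is_derive_Cmod_ln; auto. apply pder_comp; [apply pder_tube_s|eapply hol_cder; [apply Bi|auto]]. }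
have Df' : is_derive (fun s => - ln (Cmod (f (tb s t)))) s (- Re (C_derive f z * (Ci * tau t) / f z)) by (apply (is_derive_opp (V := R_NormedModule)); exact Df).
have De' : is_derive (fun s => - ln (Cmod (ell f (tb s t)))) s (- Re (C_derive (ell f) z * (Ci * tau t) / ell f z)) by (apply (is_derive_opp (V := R_NormedModule)); exact De).
apply is_derive_ext_loc with (fun s => sin (k * - ln (Cmod (f (tb s t)))) * (/ k * exp (- ln (Cmod (ell f (tb s t)))))).
{ have m0 : 0 < Rmin s (dl - s) by lra. exists (mkposreal _ m0). intros r Hr. have X : Rabs (r - s) < Rmin s (dl - s) by auto. have X1 := Rmin_l s (dl - s).
 have X2 := Rmin_r s (dl - s). apply Rabs_def2 in X. have Or : O (tb r t) by (apply Hin; lra). have Npr := Cmod_pos (NE _ Or). have Y := Hv _ Or. unfold sg in Y.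
 rewrite exp_Ropp, exp_ln by auto. change (sin (k * - ln (Cmod (f (tb r t)))) * (/ k * / Cmod (ell f (tb r t))) = v (tb r t)). rewrite <- Y. field. lra. }
eapply is_derive_eq.
- an.
- fold z. change (- ln (Cmod (f z))) with (sg f z). rewrite exp_Ropp, exp_ln by auto.
 have V : v z = sin (k * sg f z) / (k * Cmod (ell f z)) by (rewrite <- (Hv z Oz); field; lra). rewrite V. unfold wv. fold z.
 have E1 : (C_derive (ell f) z * (Ci * tau t) / ell f z)%C = (Ci * tau t * lel f z)%C by (unfold lel; field; auto).
 have E2 : (C_derive f z * (Ci * tau t) / f z)%C = (Ci * tau t * ell f z)%C by (unfold ell; field; auto). rewrite E1, E2. set (n := (Ci * tau t)%C).
 replace (Re (- (n * (lel f z + RtoC (k * cos (k * sg f z) / sin (k * sg f z)) * ell f z)))) with (- (Re (n * lel f z) + k * cos (k * sg f z) / sin (k * sg f z) * Re (n * ell f z))).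
 2:{ generalize (lel f z) (ell f z) n (k * cos (k * sg f z) / sin (k * sg f z)). intros a b c x. simpl. ring. }
 generalize (Re (n * lel f z)) (Re (n * ell f z)). intros a b. field. lra.
Qed.

Lemma pder_tube_t s t : pder (fun t => tb s t) t (RtoC (sp t * (1 - kap t * s)) * tau t).
Proof.
have F := hc_fr H. eapply pder_eq.
- apply @pder_plus; [apply (fr_gam F)|]. apply pder_scal, pder_scal, (fr_tau F).
- replace (s * (Ci * (Ci * RtoC (kap t * sp t) * tau t)))%C with (Ci * Ci * (s * RtoC (kap t * sp t) * tau t))%C by ring.
 rewrite CiCi, !RtoC_mult, RtoC_minus, RtoC_mult. ring.
Qed.

Lemma collar_continuity {s} : 0 < s < dl -> (forall sig t, sig * sig = 1 ->
 pcont (nr sig s) t) /\ (forall t, pcont (nl s) t) /\ (forall t, continuous kap t) /\ (forall t, continuous (fun t => sp t * (1 - kap t * s)) t).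
Proof.
intros Hs. have Hin := hc_in. have PT := fun t => pcont_tube_t s t. destruct H as [Hb Hk HO Bi F Col Hsg Hv _]. have [HE NE] := @hol_ell O beta f g ltac:(lra) HO Bi.
have tc : forall t, pcont (fun t => Ci * tau t)%C t by (intros t; apply pcont_mult; [an|eapply pder_pcont, (fr_tau F)]).
have kc : forall t, continuous kap t by (intros t; apply (ex_derive_continuous (V := R_NormedModule)); eexists; apply (fr_kap F)). split; [|split; [|split; auto]].
- intros sig t Hsig. apply pcont_mult; auto. apply pcont_comp; auto. eapply cder_ccont. apply (@cder_rho O beta k sig f g); auto; lra.
- intros t. apply pcont_mult; auto. apply pcont_comp; auto. an.
- intros t. apply (continuous_mult sp (fun t => 1 - kap t * s)); [apply (fr_spc F)|]. an.
Qed.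

(** The sum of the real parts integrates to the change of argument of [ell]. In the imaginary parts
    the contribution of [lel] is the increment of [ln |ell|] over a closed curve, hence 0, and that
    of [ell] is the change of argument of [f], which is positive because [Re (n * ell)] is negative;
    this gives [1 <= m']. *)
Lemma collar_winding {s} : 0 < s < dl -> (forall t, 0 < sp t * (1 - kap t * s)) -> (forall t, Re (nl s t) < 0) ->
 exists m m' : Z, (1 <= m')%Z /\ RInt (fun t => sp t * (1 - kap t * s) * (Re (nr 1 s t) + Re (nr (-1) s t))) 0 T = 2 * PI * IZR m /\ RInt (fun t => sp t * (1 - kap t * s) * Im (nr 1 s t)) 0 T = - (PI * k * IZR m') /\ RInt (fun t => sp t * (1 - kap t * s) * Im (nr (-1) s t)) 0 T = PI * k * IZR m'.
Proof.
intros Hs Hj Hneg. have Hin := hc_in. have PT := fun t => pder_tube_t s t. have [cR [cE [ck cj]]] := collar_continuity Hs.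
destruct H as [Hb Hk HO Bi F Col Hsg Hv _]. have [HE NE] := @hol_ell O beta f g ltac:(lra) HO Bi. have HT := fr_T F. have HL := @hol_lel O beta f g ltac:(lra) HO Bi.
have PI0 := PI_RGT_0. set (j := fun t => sp t * (1 - kap t * s)) in *. have Hj' : forall t, 0 < j t by auto. have per : forall (h : C -> C), h (tb s T) = h (tb s 0).
{ intros h. rewrite <- (Rplus_0_l T) at 1. unfold tube. now rewrite (fr_gamT F), (fr_tauT F). }
have zc : forall t, pcont (fun t => RtoC (j t) * tau t)%C t by (intros t; apply pcont_mult; [an|eapply pder_pcont, (fr_tau F)]).
have tc : forall t, pcont (fun t => tb s t) t by an.
have W : forall (h h1 : C -> C), (forall z, O z -> cder h z (h1 z) /\ ccont h1 z /\ h z <> 0) -> exists m : Z, RInt (fun t => Im (h1 (tb s t) / h (tb s t) * (RtoC (j t) * tau t))) 0 T = 2 * PI * IZR m.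
{ intros h h1 Hh. destruct (@winding_int (fun t => h (tb s t)) (fun t => h1 (tb s t) * (RtoC (j t) * tau t))%C 0 T) as [m Em].
 - intros t. have [A1 [A2 A3]] := Hh _ (Hin s t Hs). split; [an|split; auto]. apply pcont_mult; auto. apply pcont_comp; auto.
 - an.
 - exists m. rewrite <- Em. apply RInt_ext. intros t _. have [_ [_ A3]] := Hh _ (Hin s t Hs). f_equal. field. auto. }
destruct (W (ell f) (C_derive (ell f))) as [m Em].
{ intros z Oz. split; [an|split; auto]. eapply hol_ccont; [apply hol_derive; eauto|auto]. }
destruct (W f (C_derive f)) as [m' Em'].
{ intros z Oz. split; [eapply hol_cder; [apply Bi|auto]|split; [exact (hol_ccont (hol_derive HO (proj1 Bi)) Oz)|]].
 apply (@annulus_neq_0 beta); [lra|apply Bi; auto]. }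
have Zr : RInt (fun t => Re (lel f (tb s t) * (RtoC (j t) * tau t))) 0 T = 0.
{ transitivity (ln (Cmod (ell f (tb s T))) - ln (Cmod (ell f (tb s 0)))); [|apply Rminus_diag_eq; now rewrite per].
 apply (@RInt_FTC (fun t => ln (Cmod (ell f (tb s t))))).
 - intros t _.
  replace (lel f (tb s t) * (RtoC (j t) * tau t))%C with (C_derive (ell f) (tb s t) * (RtoC (j t) * tau t) / ell f (tb s t))%C by (unfold lel; field; auto).
  apply @is_derive_Cmod_ln; auto. an.
 - intros t _. have X : pcont (fun t => lel f (tb s t) * (RtoC (j t) * tau t))%C t; [|apply (proj1 X)]. apply pcont_mult; auto. apply pcont_comp; auto. an. }
have exE : ex_RInt (fun t => - (j t * Re (nl s t))) 0 T.
{ apply ex_RInt_cont. intros t. apply (continuous_opp (fun t => j t * Re (nl s t))). apply (continuous_mult j); auto. apply (cE t). }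
have Em2 : RInt (fun t => - (j t * Re (nl s t))) 0 T = 2 * PI * IZR m'.
{ rewrite <- Em'. apply RInt_ext. intros t _. fold (ell f (tb s t)). unfold nl. generalize (ell f (tb s t)). intros e.
 have X : - (j t * Re (Ci * tau t * e)) = Im (e * (RtoC (j t) * tau t)) by (simpl; ring). lra. }
exists m, m'. split; [|split].
- have P : 0 < RInt (fun t => - (j t * Re (nl s t))) 0 T.
 { apply RInt_gt_0; auto.
  - intros t _. specialize (Hj' t). specialize (Hneg t). nra.
  - intros t _. apply (continuous_opp (fun t => j t * Re (nl s t))). apply (continuous_mult j); auto. apply (cE t). }
 have mp : 0 < IZR m' by nra. apply lt_IZR in mp. lia.
- rewrite <- Em. apply RInt_ext. intros t _. fold (lel f (tb s t)). fold (j t). replace (Re (nr 1 s t) + Re (nr (-1) s t)) with (Re (Ci * tau t * - lel f (tb s t))).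
 + generalize (lel f (tb s t)). intros e. simpl. ring.
 + rewrite <- (rho_sum f k), Cmult_plus_distr_l. an.
- have Key : forall sig, sig * sig = 1 -> RInt (fun t => j t * Im (nr sig s t)) 0 T = - (sig * (PI * k * IZR m')).
 { intros sig Hsig. transitivity (RInt (fun t => / 2 * (- Re (lel f (tb s t) * (RtoC (j t) * tau t))) + (- (sig * k / 2)) * (- (j t * Re (nl s t)))) 0 T).
  - apply RInt_ext. intros t _. unfold nr, nl, rho. generalize (lel f (tb s t)) (ell f (tb s t)). intros a b. simpl. field.
  - have exL : ex_RInt (fun t => Re (lel f (tb s t) * (RtoC (j t) * tau t))) 0 T.
   { apply ex_RInt_cont. intros t. have X : pcont (fun t => lel f (tb s t) * (RtoC (j t) * tau t))%C t; [|apply (proj1 X)]. apply pcont_mult; auto.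
    apply pcont_comp; auto. an. }
   have exL' : ex_RInt (fun t => - Re (lel f (tb s t) * (RtoC (j t) * tau t))) 0 T by (apply (ex_RInt_opp (V := R_NormedModule)); auto).
   set (A := fun t => - Re (lel f (tb s t) * (RtoC (j t) * tau t))). set (E := fun t => - (j t * Re (nl s t))). fold E in exE, Em2. have IA : RInt A 0 T = 0.
   { transitivity (- RInt (fun t => Re (lel f (tb s t) * (RtoC (j t) * tau t))) 0 T); [exact (RInt_opp _ 0 T exL)|]. lra. }
   change (RInt (fun t => / 2 * A t + - (sig * k / 2) * E t) 0 T = - (sig * (PI * k * IZR m'))).
   rewrite RInt_Rplus, RInt_Rscal, RInt_Rscal, Em2 by (auto; apply ex_RInt_Rscal; auto). lra. }
 split.
 + have Y : - (1 * (PI * k * IZR m')) = - (PI * k * IZR m') by lra. rewrite <- Y. apply Key. ring.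
 + have Y : - (-1 * (PI * k * IZR m')) = PI * k * IZR m' by lra. rewrite <- Y. apply Key. ring.
Qed.

Lemma ccont_v_wv {s} t : 0 < s < dl -> ccont (fun p => RtoC (v (tb (Re p) (Im p)))) (s, t) /\ ccont (fun p => RtoC (wv (Re p) (Im p))) (s, t).
Proof.
intros Hs. have Hin := hc_in. destruct H as [Hb Hk HO Bi F Col Hsg Hv _]. have [HE NE] := @hol_ell O beta f g ltac:(lra) HO Bi.
have HL := @hol_lel O beta f g ltac:(lra) HO Bi.
have tc : ccont (fun p => Ci * tau (Im p))%C (s, t) by (apply ccont_mult; [an|apply ccont_path; eapply pder_pcont, (fr_tau F)]).
have cT : ccont (fun p => tb (Re p) (Im p)) (s, t).
{ apply ccont_plus; [apply ccont_path; eapply pder_pcont, (fr_gam F)|]. an. }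
set (z := tb s t). have Oz : O z by (apply Hin; auto). have Np := Cmod_pos (NE z Oz). have [G1 G2] := Hsg z Oz.
have S0 : 0 < sin (k * sg f z) by (apply sin_gt_0; auto). have cs : ccont (fun z => RtoC (sg f z)) z by (apply (@ccont_sg O beta f g); auto; lra).
have dcont : forall (h : R -> R) x, ex_derive h x -> continuous h x by (intros h x X; apply (ex_derive_continuous (V := R_NormedModule)); exact X). split.
- apply (@ccont_comp (fun z => RtoC (v z)) (fun p => tb (Re p) (Im p))); auto.
 apply ccont_ext with (fun z => RtoC (sin (k * sg f z)) * / (k * RtoC (Cmod (ell f z))))%C.
 + have [r [Hr K]] := HO z Oz. exists r. split; auto. intros w Hw. have Ow := K w Hw. rewrite <- (Hv w Ow), !RtoC_mult. field.
  split; apply RtoC_neq; [apply Rgt_not_eq, Cmod_pos, NE; auto|lra].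
 + apply ccont_mult; [apply (@ccont_R (fun x => sin (k * x)) (sg f)); auto; apply dcont; auto_derive; auto|]. apply ccont_inv; [|an].
  change (k * RtoC (Cmod (ell f z)) <> 0)%C. an.
- apply ccont_Re. apply ccont_opp. apply ccont_mult; auto.
 apply (@ccont_comp (fun z => lel f z + RtoC (k * cos (k * sg f z) / sin (k * sg f z)) * ell f z)%C (fun p => tb (Re p) (Im p))); auto. apply ccont_plus; [an|].
 apply ccont_mult; [|an]. apply (@ccont_R (fun x => k * cos (k * x) / sin (k * x)) (sg f)); auto. apply dcont. auto_derive. change (sin (k * sg f z) <> 0). lra.
Qed.

(** Two expansions of [V s], the integral of [v] at depth [s] weighted by the speed of [gam]: the
    given expansion of [v] yields [s * L - s^2 / 2 * K1 + s^3 * C3], and [collar_asymptotics] yields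
    [V' = L - s * K1 - s^2 * (K2 / 2 + X s)]. Equality of the second order terms of [V'] is the
    claim. *)
Lemma collar_energy {alpha M3 Cst d3 c3} : 0 < alpha -> 0 < d3 -> (forall t, Rabs (c3 t) <= M3) -> ex_RInt (fun t => c3 t * sp t) 0 T ->
 (forall s t, 0 < s < d3 -> Rabs (v (tb s t) - (s - kap t / 2 * (s * s) + c3 t * (s * s * s))) <= Cst * Rpower s (3 + alpha)) -> forall e, 0 < e ->
 exists s, 0 < s < e /\ Rabs (/ 2 * RInt (fun t => kap t * kap t * sp t) 0 T + 3 * RInt (fun t => c3 t * sp t) 0 T + RInt (fun t => (Im (nr 1 s t) * Im (nr 1 s t) + Im (nr (-1) s t) * Im (nr (-1) s t)) * sp t) 0 T) <= e.
Proof.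
intros Hal Hd3 HM3 Ic3 Exp e He. have [d0 [K [Hd0 [Hd01 [HdB [HK As]]]]]] := collar_asymptotics. have F := hc_fr H. have HB := fr_B F. have HT := fr_T F.
have Cont := fun s Hs => @collar_continuity s Hs. have iB : 0 < / B by lra. have spc := fr_spc F. have spB := fr_sp F. have kB := fr_kapB F.
set (xx := fun s t => Im (nr 1 s t) * Im (nr 1 s t) + Im (nr (-1) s t) * Im (nr (-1) s t)). set (yy := fun s t => Re (nr 1 s t) + Re (nr (-1) s t)).
set (d := Rmin (Rmin d0 d3) (1 / 2)). have da := Rmin_l (Rmin d0 d3) (1 / 2). have db := Rmin_r (Rmin d0 d3) (1 / 2). have dc := Rmin_l d0 d3.
have dd := Rmin_r d0 d3. fold d in da, db. set (Q := Rabs M3 + Rabs Cst). have Q0 : 0 <= Q by (unfold Q; have X1 := Rabs_pos M3; have X2 := Rabs_pos Cst; lra).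
have V3 : forall s t, 0 < s < d -> Rabs (v (tb s t) - (s - kap t / 2 * (s * s))) <= Q * (s * s * s).
{ intros s t Hs. replace (v (tb s t) - (s - kap t / 2 * (s * s))) with ((v (tb s t) - (s - kap t / 2 * (s * s) + c3 t * (s * s * s))) + c3 t * (s * s * s)) by ring.
 have P := @Rpower_3_le s alpha ltac:(lra) Hal. have Pp : 0 < Rpower s (3 + alpha) by apply exp_pos. eapply Rle_trans; [apply Rabs_triang|].
 have X := Exp s t ltac:(lra). have Y := @Rabs_mult_le (c3 t) (s * s * s) (Rabs M3) (s * s * s) ltac:(eapply Rle_trans; an) ltac:(lra).
 assert (Cst * Rpower s (3 + alpha) <= Rabs Cst * (s * s * s)) by (apply Rle_trans with (Rabs Cst * Rpower s (3 + alpha)); an). unfold Q. lra. }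
have Y1 : forall s t, 0 < s < d -> Rabs (yy s t + kap t) <= 2 * K * s /\ Rabs (yy s t) <= B + 2 * K.
{ intros s t Hs. have [_ [[A1 A2] _]] := As s t ltac:(lra). fold (nr 1 s t) in A1. fold (nr (-1) s t) in A2. have X : Rabs (yy s t + kap t) <= 2 * K * s.
 { unfold yy. apply Rabs_le_between in A1. apply Rabs_le_between in A2. an. }
 split; auto. replace (yy s t) with ((yy s t + kap t) + - kap t) by ring. eapply Rle_trans; [apply Rabs_triang|]. rewrite Rabs_Ropp. have Z := kB t.
 assert (2 * K * s <= 2 * K) by nra. lra. }
have X1 : forall s t, 0 < s < d -> Rabs (xx s t) <= 2 * (K * K).
{ intros s t Hs. have [_ [_ [[A1 A2] _]]] := As s t ltac:(lra). fold (nr 1 s t) in A1. fold (nr (-1) s t) in A2. eapply Rle_trans; [apply Rabs_triang|].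
 have Z1 := Rabs_mult_le A1 A1. have Z2 := Rabs_mult_le A2 A2. lra. }
(* The approximation of [v * wv]. Expanding [v] gives [- kap / 2 * s^2 * yy]; it is written as
   [- kap * s^2 * yy], which completes the length element of the parallel curve, plus
   [kap / 2 * s^2 * yy], where [yy] is replaced by [- kap]. *)
set (G := fun s t => 1 + s * ((1 - kap t * s) * yy s t) - s * s * (/ 2 * (kap t * kap t)) - s * s * xx s t).
set (CC := 2 * K + Q * (B + 2 * K) + B * K + 2 * (K * K) * (Q + B)). have CC0 : 0 <= CC.
{ unfold CC. assert (0 <= Q * (B + 2 * K)) by lra. assert (0 <= B * K) by lra. assert (0 <= 2 * (K * K) * (Q + B)) by lra. lra. }
have Gv : forall s t, 0 < s < d -> Rabs (v (tb s t) * wv s t - G s t) <= CC * (s * s * s).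
{ intros s t Hs. have [A0 [_ [_ [_ A5]]]] := As s t ltac:(lra). have [B1 B2] := Y1 s t Hs. have B4 := V3 s t Hs. set (vz := v (tb s t)) in *.
 replace (vz * wv s t - G s t) with (vz * (wv s t - (yy s t + / vz - s * xx s t)) + (vz - (s - kap t / 2 * (s * s))) * yy s t + kap t / 2 * (s * s) * (yy s t + kap t) - s * (vz - s) * xx s t).
 2:{ unfold G. field. lra. }
 have D1 : Rabs (vz * (wv s t - (yy s t + / vz - s * xx s t))) <= 2 * s * (K * (s * s)) by (apply Rabs_mult_le; auto; rewrite Rabs_pos_eq; lra).
 have D2 := Rabs_mult_le B4 B2.
 have D3 : Rabs (kap t / 2 * (s * s)) <= B / 2 * (s * s) by (apply Rabs_mult_le; [apply Rabs_mult_le; auto; rewrite Rabs_pos_eq; lra|rewrite Rabs_pos_eq; lra]).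
 have D4 := Rabs_mult_le D3 B1. have D5 : Rabs (vz - s) <= (Q + B) * (s * s).
 { replace (vz - s) with ((vz - (s - kap t / 2 * (s * s))) + - (kap t / 2 * (s * s))) by ring. eapply Rle_trans; [apply Rabs_triang|]. rewrite Rabs_Ropp.
  assert (Q * (s * s * s) <= Q * (s * s)) by (apply Rmult_le_compat_l; auto; rewrite <- (Rmult_1_r (s * s)) at 2; apply Rmult_le_compat_l; lra). lra. }
 have D6 : Rabs (s * (vz - s) * xx s t) <= s * ((Q + B) * (s * s)) * (2 * (K * K)) by (apply Rabs_mult_le; auto; apply Rabs_mult_le; auto; rewrite Rabs_pos_eq; lra).
 eapply Rle_trans; [apply Rabs_triang|]. rewrite Rabs_Ropp. eapply Rle_trans; [apply Rplus_le_compat_r, Rabs_triang|].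
 eapply Rle_trans; [apply Rplus_le_compat_r, Rplus_le_compat_r, Rabs_triang|].
 apply Rle_trans with (2 * s * (K * (s * s)) + Q * (s * s * s) * (B + 2 * K) + B / 2 * (s * s) * (2 * K * s) + s * ((Q + B) * (s * s)) * (2 * (K * K))); [lra|].
 right. unfold CC. field. }
have kc : forall t, continuous kap t by (apply (Cont (d / 2)); lra).
have mulc : forall a b : R -> R, (forall t, continuous a t) -> (forall t, continuous b t) -> forall t, continuous (fun t => a t * b t) t by an.
have Isp : ex_RInt sp 0 T by an. have Ik : ex_RInt (fun t => kap t * sp t) 0 T by an. have Ikk : ex_RInt (fun t => kap t * kap t * sp t) 0 T by an.
have one1 : 1 * 1 = 1 by lra. have one2 : -1 * -1 = 1 by lra. have yc : forall s, 0 < s < d -> forall t, continuous (yy s) t.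
{ intros s Hs t. have [c1 _] := Cont s ltac:(lra).
 apply (continuous_plus (fun t => Re (nr 1 s t)) (fun t => Re (nr (-1) s t))); [apply (proj1 (c1 1 t one1))|apply (proj1 (c1 (-1) t one2))]. }
have xc : forall s, 0 < s < d -> forall t, continuous (xx s) t.
{ intros s Hs t. have [c1 _] := Cont s ltac:(lra).
 apply (continuous_plus (fun t => Im (nr 1 s t) * Im (nr 1 s t)) (fun t => Im (nr (-1) s t) * Im (nr (-1) s t))); apply mulc; intros r; an. }
have Ixx : forall s, 0 < s < d -> ex_RInt (fun t => xx s t * sp t) 0 T by an.
have Ijy : forall s, 0 < s < d -> ex_RInt (fun t => sp t * (1 - kap t * s) * yy s t) 0 T by an. set (L := RInt sp 0 T). set (K1 := RInt (fun t => kap t * sp t) 0 T).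
set (K2 := RInt (fun t => kap t * kap t * sp t) 0 T). set (C3 := RInt (fun t => c3 t * sp t) 0 T). set (X := fun s => RInt (fun t => xx s t * sp t) 0 T).
set (Jy := fun s => RInt (fun t => sp t * (1 - kap t * s) * yy s t) 0 T). set (CJ := B * (2 * K + B * (B + 2 * K)) * T).
have CJ0 : 0 < CJ by (repeat apply Rmult_lt_0_compat; assert (0 < B * (B + 2 * K)) by (apply Rmult_lt_0_compat; lra); lra).
have Jest : forall s, 0 < s < d -> Rabs (Jy s + K1) <= CJ * s.
{ intros s Hs. replace (Jy s + K1) with (Jy s - RInt (fun t => -1 * (kap t * sp t)) 0 T) by (rewrite RInt_Rscal by auto; unfold K1; ring).
 replace (CJ * s) with ((T - 0) * (B * ((2 * K + B * (B + 2 * K)) * s))) by (unfold CJ; ring). apply RInt_close; [lra|an|an|]. intros t _.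
 replace (sp t * (1 - kap t * s) * yy s t - -1 * (kap t * sp t)) with (sp t * ((yy s t + kap t) + - (kap t * s * yy s t))) by ring. have [B1 B2] := Y1 s t Hs.
 have S := spB t. apply Rabs_mult_le; [an|]. eapply Rle_trans; [apply Rabs_triang|]. rewrite Rabs_Ropp.
 have Z := @Rabs_mult_le (kap t * s) (yy s t) (B * s) (B + 2 * K) ltac:(apply Rabs_mult_le; auto; rewrite Rabs_pos_eq; lra) B2. lra. }
have Jint : forall s, 0 < s < d -> exists m : Z, Jy s = 2 * PI * IZR m.
{ intros s Hs. destruct (@collar_winding s ltac:(lra)) as [m [m' [_ [E _]]]].
 - intros t. have S := spB t. have kt := kB t. assert (kap t * s <= B * s) by lra. assert (B * s <= d0 * B) by (rewrite Rmult_comm; apply Rmult_le_compat_r; lra).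
  lra.
 - intros t. have [_ [_ [_ [[A _] _]]]] := As s t ltac:(lra). exact A.
 - exists m. exact E. }
set (dJ := Rmin d (/ (CJ + 1))). have smallJ : forall s, 0 < s < dJ -> CJ * s <= 1.
{ intros s Hs. apply Rle_trans with (CJ * / (CJ + 1)); [an|]. apply div_le; lra. }
(* [Jy s] is [2 * PI] times an integer and within [CJ * s] of [- K1], so the integer does not change
   and equality is exact. An error of order [s] here would be of the same order in [V1] as the terms
   sought. *)
have JK : forall s, 0 < s < dJ -> Jy s = - K1.
{ intros s Hs. have [m Em] := Jint s ltac:(lra). have All : forall s', 0 < s' < dJ -> Rabs (2 * PI * IZR m + K1) <= CJ * s'.
 { intros s' Hs'. have [m2 Em2] := Jint s' ltac:(lra). have E1 := Jest s ltac:(lra). have E2 := Jest s' ltac:(lra). rewrite Em2 in E2. replace m with m2; auto.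
  apply IZR_close. have S1 := smallJ s Hs. have S2 := smallJ s' Hs'. apply Rabs_le_between in E1. apply Rabs_le_between in E2. have P := PI2_1. apply Rabs_def1; nra. }
 have Z : Rabs (2 * PI * IZR m + K1) <= 0.
 { apply le_epsilon. intros ep Hep. set (s' := Rmin (dJ / 2) (ep / CJ)). eapply Rle_trans; [apply (All s'); lra|]. apply Rle_trans with (CJ * (ep / CJ)); [an|].
  right. field. lra. }
 apply Rabs_le_between in Z. lra. }
set (V := fun s => RInt (fun t => v (tb s t) * sp t) 0 T). set (V1 := fun s => RInt (fun t => v (tb s t) * wv s t * sp t) 0 T).
have slice : forall (h : R -> R -> R) s t, ccont (fun p => RtoC (h (Re p) (Im p))) (s, t) -> continuous (h s) t.
{ intros h s t Hh. have Y := pcont_vline Hh. apply (proj1 Y). }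
have vc : forall s, 0 < s < d -> forall t, continuous (fun t => v (tb s t)) t.
{ intros s Hs t. apply (slice (fun s t => v (tb s t))). apply (@ccont_v_wv s t ltac:(lra)). }
have wc : forall s, 0 < s < d -> forall t, continuous (fun t => wv s t) t.
{ intros s Hs t. apply slice. apply (@ccont_v_wv s t ltac:(lra)). }
have DV : forall s, 0 < s < d -> is_derive V s (V1 s).
{ intros s Hs. apply (@RInt_param (fun s t => v (tb s t) * sp t) (fun s t => v (tb s t) * wv s t * sp t)).
 - exists (Rmin s (d - s)). split; [an|]. intros r Hr t. have r1 := Rmin_l s (d - s). have r2 := Rmin_r s (d - s). apply Rabs_def2 in Hr. split.
  + eapply is_derive_eq; [apply (@is_derive_Rmult (fun s => v (tb s t)) (fun _ => sp t)); [eapply is_derive_v; eauto; lra|an]|ring].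
  + apply mulc; auto. apply vc. lra.
 - intros t. have [c1 c2] := @ccont_v_wv s t ltac:(lra). apply ccont_ext with (fun p => RtoC (v (tb (Re p) (Im p))) * RtoC (wv (Re p) (Im p)) * RtoC (sp (Im p)))%C.
  + exists 1. split; [lra|]. intros w _. now rewrite !RtoC_mult.
  + apply ccont_mult; [an|]. apply (@ccont_path (fun t => RtoC (sp t))). an. }
have V1est : forall s, 0 < s < dJ -> Rabs (V1 s - (L - s * K1 - s * s * (/ 2 * K2 + X s))) <= CC * B * T * (s * s * s).
{ intros s Hs.
 have EG : RInt (fun t => sp t + s * (sp t * (1 - kap t * s) * yy s t) + (- (s * s)) * (/ 2 * (kap t * kap t * sp t) + xx s t * sp t)) 0 T = L - s * K1 - s * s * (/ 2 * K2 + X s).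
 { have Ijys := Ijy s ltac:(lra). have Ixs := Ixx s ltac:(lra).
  have i1 : ex_RInt (fun t => s * (sp t * (1 - kap t * s) * yy s t)) 0 T by (apply ex_RInt_Rscal; auto).
  have i2 : ex_RInt (fun t => / 2 * (kap t * kap t * sp t)) 0 T by an.
  have i3 : ex_RInt (fun t => / 2 * (kap t * kap t * sp t) + xx s t * sp t) 0 T by (apply ex_RInt_Rplus; auto).
  have i4 : ex_RInt (fun t => (- (s * s)) * (/ 2 * (kap t * kap t * sp t) + xx s t * sp t)) 0 T by (apply ex_RInt_Rscal; auto).
  have i5 : ex_RInt (fun t => sp t + s * (sp t * (1 - kap t * s) * yy s t)) 0 T by (apply ex_RInt_Rplus; auto). rewrite RInt_Rplus by auto.
  rewrite RInt_Rplus by auto. rewrite RInt_Rscal by auto. rewrite RInt_Rscal by auto. rewrite RInt_Rplus by auto. rewrite RInt_Rscal by auto. fold (Jy s). fold L.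
  fold K2. fold (X s). rewrite JK by auto. lra. }
 rewrite <- EG. replace (CC * B * T * (s * s * s)) with ((T - 0) * (CC * (s * s * s) * B)) by ring. apply @RInt_close; [lra| | |].
 - apply ex_RInt_cont. apply mulc; auto. apply mulc; [apply vc; lra|apply wc; lra].
 - have Ijys := Ijy s ltac:(lra). have Ixs := Ixx s ltac:(lra). apply ex_RInt_Rplus; [apply ex_RInt_Rplus; auto; apply ex_RInt_Rscal; auto|]. apply ex_RInt_Rscal.
  apply ex_RInt_Rplus; auto. an.
 - intros t _.
  replace (v (tb s t) * wv s t * sp t - (sp t + s * (sp t * (1 - kap t * s) * yy s t) + (- (s * s)) * (/ 2 * (kap t * kap t * sp t) + xx s t * sp t))) with ((v (tb s t) * wv s t - G s t) * sp t) by (unfold G; field).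
  have S := spB t. apply Rabs_mult_le; [apply Gv; lra|an]. }
have Vest : forall s, 0 < s < d -> Rabs (V s - (s * L - s * s / 2 * K1 + s * s * s * C3)) <= Rabs Cst * B * T * Rpower s (3 + alpha).
{ intros s Hs. have EG : RInt (fun t => (s * sp t + (- (s * s / 2)) * (kap t * sp t)) + s * s * s * (c3 t * sp t)) 0 T = s * L - s * s / 2 * K1 + s * s * s * C3.
 { have i1 : ex_RInt (fun t => s * sp t) 0 T by an. have i2 : ex_RInt (fun t => (- (s * s / 2)) * (kap t * sp t)) 0 T by an.
  have i3 : ex_RInt (fun t => s * s * s * (c3 t * sp t)) 0 T by (apply ex_RInt_Rscal; auto).
  have i4 : ex_RInt (fun t => s * sp t + (- (s * s / 2)) * (kap t * sp t)) 0 T by an. rewrite RInt_Rplus by auto. rewrite RInt_Rplus by auto.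
  rewrite RInt_Rscal, RInt_Rscal, RInt_Rscal by auto. fold L. fold K1. fold C3. lra. }
 rewrite <- EG. replace (Rabs Cst * B * T * Rpower s (3 + alpha)) with ((T - 0) * (Rabs Cst * Rpower s (3 + alpha) * B)) by ring. apply @RInt_close; [lra| | |].
 - an.
 - apply ex_RInt_Rplus; [an|]; apply ex_RInt_Rscal; auto.
 - intros t _.
  replace (v (tb s t) * sp t - (s * sp t + - (s * s / 2) * (kap t * sp t) + s * s * s * (c3 t * sp t))) with ((v (tb s t) - (s - kap t / 2 * (s * s) + c3 t * (s * s * s))) * sp t) by field.
  have S := spB t. apply Rabs_mult_le; [|an]. eapply Rle_trans; [apply Exp; lra|]. apply Rmult_le_compat_r; [apply Rlt_le, exp_pos|an]. }
set (CF := Rabs Cst * B * T). have CF0 : 0 <= CF by (apply Rmult_le_pos; an). set (CG := CC * B * T). have CG0 : 0 <= CG by (apply Rmult_le_pos; an).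
(* [s2] keeps the third order error of [V1] below half of [e] between [s] and [2 * s]; [s3] does the
   same for the difference quotient of the error of [V], whose bound grows by the factor [P2] from
   [s] to [2 * s]. *)
set (P2 := Rpower 2 (3 + alpha)). have P2p : 0 < P2 by apply exp_pos. set (s1 := Rmin (dJ / 4) (e / 4)). set (s2 := e / (4 * (CG + 1))).
have s2p : 0 < s2 by (apply Rdiv_lt_0_compat; lra). set (s3 := Rpower (e / (2 * (CF * (P2 + 1) + 1))) (/ alpha)). have s3p : 0 < s3 by apply exp_pos.
have cfp : 0 <= CF * (P2 + 1) by lra. set (s := Rmin s1 (Rmin s2 s3)). have a3 := Rmin_l s2 s3. have a4 := Rmin_r s2 s3. have sp0 : 0 < s by lra.
set (FF := fun s => V s - (s * L - s * s / 2 * K1 + s * s * s * C3)). have DF : forall r, 0 < r < d -> is_derive FF r (V1 r - (L - r * K1 + 3 * (r * r) * C3)).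
{ intros r Hr. eapply is_derive_eq.
 - apply @is_derive_Rminus; auto. instantiate (1 := L - r * K1 + 3 * (r * r) * C3). auto_derive; auto. field.
 - lra. }
(* The expansion of [V] cannot be differentiated, but the mean value theorem on [[s, 2 * s]] yields
   a point [c] at which [V1] has the expected value up to [o(s^2)]. *)
destruct (MVT_gen FF s (2 * s) (fun r => V1 r - (L - r * K1 + 3 * (r * r) * C3))) as [c [Hc E]].
{ intros x Hx. rewrite Rmin_left, Rmax_right in Hx by lra. apply DF. lra. }
{ intros x Hx. rewrite Rmin_left, Rmax_right in Hx by lra. eapply is_derive_cont_pt, DF. lra. }
rewrite Rmin_left, Rmax_right in Hc by lra. exists c. split; [lra|]. have E1 := Vest s ltac:(lra). have E2 := Vest (2 * s) ltac:(lra). fold (FF s) in E1.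
fold (FF (2 * s)) in E2. have Rp : Rpower s (3 + alpha) <= s * s * s * (e / (2 * (CF * (P2 + 1) + 1))).
{ rewrite Rpower_plus. replace 3 with (INR 3) by (simpl; ring). rewrite Rpower_pow by lra. simpl. replace (s * (s * (s * 1))) with (s * s * s) by ring.
 apply Rmult_le_compat_l; [an|]. apply Rle_trans with (Rpower s3 alpha); [apply Rle_Rpower_l; lra|]. unfold s3. rewrite Rpower_mult.
 replace (/ alpha * alpha) with 1 by (field; lra). rewrite Rpower_1; [lra|]. lra. }
have R2 : Rpower (2 * s) (3 + alpha) = P2 * Rpower s (3 + alpha) by (unfold P2; rewrite Rpower_mult_distr; lra). rewrite R2 in E2. have E3 := V1est c ltac:(lra).
fold CG in E3. fold CF in E1, E2. set (D := V1 c - (L - c * K1 + 3 * (c * c) * C3)) in *. have Dbd : Rabs D <= CF * (P2 + 1) * Rpower s (3 + alpha) / s.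
{ apply le_div; auto. rewrite <- (Rabs_pos_eq s) at 1 by lra. rewrite <- Rabs_mult. replace (D * s) with (D * (2 * s - s)) by ring. rewrite <- E.
 eapply Rle_trans; [apply Rabs_triang|]. rewrite Rabs_Ropp. lra. }
have Dbd2 : Rabs D <= s * s * (e / 2).
{ eapply Rle_trans; [exact Dbd|]. apply div_le; auto. apply Rle_trans with (CF * (P2 + 1) * (s * s * s * (e / (2 * (CF * (P2 + 1) + 1))))); [an|].
 replace (s * s * (e / 2) * s) with ((CF * (P2 + 1) + 1) * (s * s * s * (e / (2 * (CF * (P2 + 1) + 1))))) by (field; lra). apply Rmult_le_compat_r; [|lra].
 apply Rmult_le_pos; [an|]. apply Rlt_le, Rdiv_lt_0_compat; lra. }
have Fin : Rabs (c * c * (/ 2 * K2 + 3 * C3 + X c)) <= c * c * e.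
{ replace (c * c * (/ 2 * K2 + 3 * C3 + X c)) with ((V1 c - (L - c * K1 - c * c * (/ 2 * K2 + X c))) - D) by (unfold D; field).
 eapply Rle_trans; [apply Rabs_triang|]. rewrite Rabs_Ropp. assert (CG * (c * c * c) <= c * c * (e / 2)).
 { replace (CG * (c * c * c)) with (c * c * (CG * c)) by ring. apply Rmult_le_compat_l; [nra|]. apply Rle_trans with (CG * (2 * s2)); [an|]. unfold s2.
  replace (CG * (2 * (e / (4 * (CG + 1))))) with (CG / (CG + 1) * (e / 2)) by (field; lra).
  apply Rle_trans with (1 * (e / 2)); [apply Rmult_le_compat_r; [lra|]; apply div_le; lra|lra]. }
 assert (s * s * (e / 2) <= c * c * (e / 2)) by lra. lra. }
rewrite Rabs_mult, Rabs_pos_eq in Fin by nra. apply Rmult_le_reg_l in Fin; auto. nra.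
Qed.

(** * The case of equality *)
(** With [c = 2 * PI / L] and [c0 = PI * k / L], the deficits in Cauchy-Schwarz are completed
    squares: the integral of [(|kap| - c)^2], and [D s], the integral of
    [(Im nr+ + c0)^2 + (Im nr- - c0)^2]. The hypothesis bounds [D s] by half of [2 * PI * c - K2] up
    to small terms, while Fenchel's inequality gives [2 * PI * c <= K2]; so the first deficit is 0
    and the second tends to 0. Since [k * Re nl] is the difference of the two imaginary parts and
    [2 * c0 = k * c], [nl] tends to [- c] in mean square. *)
Lemma equality_case {C3} : (forall e, 0 < e ->
 exists s, 0 < s < e /\ Rabs (/ 2 * RInt (fun t => kap t * kap t * sp t) 0 T + 3 * C3 + RInt (fun t => (Im (nr 1 s t) * Im (nr 1 s t) + Im (nr (-1) s t) * Im (nr (-1) s t)) * sp t) 0 T) <= e) ->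
 - (RInt sp 0 T * C3) = 2 * PI ^ 2 / 3 * (k ^ 2 + 1) -> 0 < RInt sp 0 T /\ (forall t, Rabs (kap t) = 2 * PI / RInt sp 0 T) /\ forall e, 0 < e ->
 exists s, 0 < s < e /\ RInt (fun t => Cmod (nl s t + RtoC (2 * PI / RInt sp 0 T)) * Cmod (nl s t + RtoC (2 * PI / RInt sp 0 T)) * sp t) 0 T <= e.
Proof.
intros En Eq. have Hk := hc_k H. have [d0 [K [Hd0 [Hd01 [HdB [HK As]]]]]] := collar_asymptotics. have F := hc_fr H. have HB := fr_B F. have HT := fr_T F.
have Cont := fun s Hs => @collar_continuity s Hs. have PI0 := PI_RGT_0. have iB : 0 < / B by lra. have spc := fr_spc F. have spB := fr_sp F. have kB := fr_kapB F.
have Isp : ex_RInt sp 0 T by an. set (L := RInt sp 0 T) in *. have Lp : 0 < L by (apply RInt_gt_0; auto; intros t _; specialize (spB t); lra). split; auto.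
set (c := 2 * PI / L). have cp : 0 < c by (apply Rdiv_lt_0_compat; lra). have cL : c * L = 2 * PI by (unfold c; field; lra).
have kc : forall t, continuous kap t by (apply (Cont (d0 / 2)); lra).
have mulc : forall a b : R -> R, (forall t, continuous a t) -> (forall t, continuous b t) -> forall t, continuous (fun t => a t * b t) t by an.
have plusc : forall a b : R -> R, (forall t, continuous a t) -> (forall t, continuous b t) -> forall t, continuous (fun t => a t + b t) t by an.
have cstc : forall (a : R) (t : R), continuous (fun _ : R => a) t by an. set (K2 := RInt (fun t => kap t * kap t * sp t) 0 T) in *.
have ka : forall t, continuous (fun t => Rabs (kap t)) t by an. have Fe := fenchel F. set (A := RInt (fun t => Rabs (kap t) * sp t) 0 T) in *.
set (q := fun t => (Rabs (kap t) + - c) * (Rabs (kap t) + - c) * sp t). have qc : forall t, continuous q t by (apply mulc; auto; apply mulc; apply plusc).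
have q0 : forall t, 0 <= q t by (intros t; apply Rmult_le_pos; [apply Rle_0_sqr|specialize (spB t); lra]). have Eq2 : RInt q 0 T = K2 - 2 * c * A + c * c * L.
{ have i1 : ex_RInt (fun t => kap t * kap t * sp t) 0 T by an. have i2 : ex_RInt (fun t => Rabs (kap t) * sp t) 0 T by an.
 have i3 : ex_RInt (fun t => (- (2 * c)) * (Rabs (kap t) * sp t)) 0 T by an.
 have i4 : ex_RInt (fun t => kap t * kap t * sp t + (- (2 * c)) * (Rabs (kap t) * sp t)) 0 T by an. have i5 : ex_RInt (fun t => c * c * sp t) 0 T by an.
 transitivity (RInt (fun t => (kap t * kap t * sp t + (- (2 * c)) * (Rabs (kap t) * sp t)) + c * c * sp t) 0 T).
 - apply RInt_ext. intros t _. have X : q t = (kap t * kap t * sp t + (- (2 * c)) * (Rabs (kap t) * sp t)) + c * c * sp t; auto. unfold q.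
  rewrite <- (Rabs_pos_eq (kap t * kap t)) by apply Rle_0_sqr. rewrite Rabs_mult. ring.
 - rewrite RInt_Rplus by auto. rewrite RInt_Rplus by auto. rewrite RInt_Rscal, RInt_Rscal by auto. fold K2. fold A. fold L. lra. }
have K2lo : 2 * PI * c <= K2.
{ have P : 0 <= RInt q 0 T by (apply RInt_ge_0; an). rewrite Eq2 in P. assert (c * (2 * PI) <= c * A) by lra. replace (c * c * L) with (c * (c * L)) in P by ring.
 rewrite cL in P. lra. }
set (c0 := PI * k / L). have c0L : c0 * L = PI * k by (unfold c0; field; lra). have c0p : 0 < c0 by (apply Rdiv_lt_0_compat; nra).
set (x := fun sig s t => Im (nr sig s t)). have one1 : 1 * 1 = 1 by lra. have one2 : -1 * -1 = 1 by lra.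
have xc : forall sig s, sig * sig = 1 -> 0 < s < d0 -> forall t, continuous (x sig s) t by (intros sig s Hsig Hs t; apply (proj2 (proj1 (Cont s ltac:(lra)) sig t Hsig))).
set (D := fun s => RInt (fun t => ((x 1 s t + c0) * (x 1 s t + c0) + (x (-1) s t + - c0) * (x (-1) s t + - c0)) * sp t) 0 T).
have Dint : forall s, 0 < s < d0 -> forall t, continuous (fun t => ((x 1 s t + c0) * (x 1 s t + c0) + (x (-1) s t + - c0) * (x (-1) s t + - c0)) * sp t) t by an.
set (X := fun s => RInt (fun t => (x 1 s t * x 1 s t + x (-1) s t * x (-1) s t) * sp t) 0 T). set (CD := 4 * c0 * (T * (B * (B * K)))).
have CD0 : 0 <= CD by (apply Rmult_le_pos; an). have Dest : forall s, 0 < s < d0 -> 0 <= D s <= X s - 2 * PI * (k * k) * (c / 2) + CD * s.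
{ intros s Hs. split.
 { apply RInt_ge_0; [lra|an|]. intros t _. apply Rmult_le_pos; [|specialize (spB t); lra]. apply Rplus_le_le_0_compat; apply Rle_0_sqr. }
 have jp : forall t, 0 < sp t * (1 - kap t * s).
 { intros t. have S := spB t. have kt := kB t. assert (kap t * s <= B * s) by lra. assert (B * s <= d0 * B) by (rewrite Rmult_comm; apply Rmult_le_compat_r; lra).
  lra. }
 destruct (@collar_winding s ltac:(lra) jp) as [m [m' [Hm' [_ [I1 I2]]]]].
 { intros t. have [_ [_ [_ [[Y _] _]]]] := As s t ltac:(lra). exact Y. }
 have Ix : forall sig, sig * sig = 1 -> ex_RInt (fun t => x sig s t * sp t) 0 T by an.
 have Cl : forall sig, sig * sig = 1 -> Rabs (RInt (fun t => x sig s t * sp t) 0 T - RInt (fun t => sp t * (1 - kap t * s) * x sig s t) 0 T) <= (T - 0) * (B * (B * s) * K).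
 { intros sig Hsig. apply RInt_close; [lra|auto|an|]. intros t _.
  replace (x sig s t * sp t - sp t * (1 - kap t * s) * x sig s t) with (sp t * (kap t * s) * x sig s t) by ring. have S := spB t.
  have [_ [_ [[Y1 Y2] _]]] := As s t ltac:(lra). apply Rabs_mult_le; [apply Rabs_mult_le; [an|apply Rabs_mult_le; auto; rewrite Rabs_pos_eq; lra]|].
  have sg : sig = 1 \/ sig = -1 by (assert ((sig - 1) * (sig + 1) = 0) by lra; apply Rmult_integral in H0; lra). destruct sg as [-> | ->]; an. }
 have L1 := Cl 1 one1. have L2 := Cl (-1) one2. unfold x in L1 at 2, L2 at 2. set (J1 := RInt (fun t => x 1 s t * sp t) 0 T) in *.
 set (J2 := RInt (fun t => x (-1) s t * sp t) 0 T) in *. have ED : D s = X s + 2 * c0 * (J1 - J2) + 2 * (c0 * c0) * L.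
 { have i1 : ex_RInt (fun t => (x 1 s t * x 1 s t + x (-1) s t * x (-1) s t) * sp t) 0 T by an.
  have i4 : ex_RInt (fun t => x 1 s t * sp t - x (-1) s t * sp t) 0 T by an. have i5 : ex_RInt (fun t => 2 * c0 * (x 1 s t * sp t - x (-1) s t * sp t)) 0 T by an.
  have i6 : ex_RInt (fun t => (x 1 s t * x 1 s t + x (-1) s t * x (-1) s t) * sp t + 2 * c0 * (x 1 s t * sp t - x (-1) s t * sp t)) 0 T by an.
  have i7 : ex_RInt (fun t => 2 * (c0 * c0) * sp t) 0 T by an.
  transitivity (RInt (fun t => ((x 1 s t * x 1 s t + x (-1) s t * x (-1) s t) * sp t + 2 * c0 * (x 1 s t * sp t - x (-1) s t * sp t)) + 2 * (c0 * c0) * sp t) 0 T).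
  - apply RInt_ext. intros t _. an.
  - rewrite RInt_Rplus by auto. rewrite RInt_Rplus by auto. rewrite RInt_Rscal, RInt_Rscal by auto. rewrite RInt_Rminus by auto. an. }
 have m1 : 1 <= IZR m' by (apply IZR_le; auto). apply Rabs_le_between in L2. have JJ : J1 - J2 <= - (2 * (PI * k)) + 2 * ((T - 0) * (B * (B * s) * K)).
 { assert (PI * k * 1 <= PI * k * IZR m') by lra. lra. }
 assert (2 * c0 * (J1 - J2) <= 2 * c0 * (- (2 * (PI * k)) + 2 * ((T - 0) * (B * (B * s) * K)))) by lra.
 have e1 : 2 * c0 * (- (2 * (PI * k)) + 2 * ((T - 0) * (B * (B * s) * K))) + 2 * (c0 * c0) * L = - (2 * PI * (k * k) * (c / 2)) + CD * s.
 { replace (2 * (c0 * c0) * L) with (2 * c0 * (c0 * L)) by ring. rewrite c0L. unfold CD, c0, c. lra. }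
 lra. }
have EqC : - (3 * C3) = PI * c * (k * k + 1).
{ apply Rmult_eq_reg_l with L; [|lra]. transitivity (3 * - (L * C3)); [ring|]. rewrite Eq. transitivity (PI * (c * L) * (k * k + 1)); [rewrite cL; field|ring]. }
have Small : forall e, 0 < e -> exists s, 0 < s < e /\ s < d0 /\ 0 <= D s <= PI * c - / 2 * K2 + e + CD * s.
{ intros e He. destruct (En (Rmin e d0)) as [s [Hs Es]]; [an|]. have r1 := Rmin_l e d0. have r2 := Rmin_r e d0. exists s. have [D0 D1] := Dest s ltac:(lra).
 change (Rabs (/ 2 * K2 + 3 * C3 + X s) <= Rmin e d0) in Es. lra. }
have K2hi : K2 <= 2 * PI * c.
{ apply (@le_eps_small K2 (2 * PI * c) (2 * CD)); [lra|]. intros e He. destruct (Small (e / 2)) as [s [S1 [S2 [S3 S4]]]]; [lra|]. exists s. lra. }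
split.
- intros t. have [m Hm] := period_reduce 0 t HT. rewrite <- (periodic_Z kap T m t (fr_kapT F)). set (t' := t + IZR m * T) in *. have Z : q t' = 0.
 { apply (@RInt_zero_pos q 0 T t'); auto; [|lra]. rewrite Eq2. assert (c * (2 * PI) <= c * A) by lra. replace (c * c * L) with (c * (c * L)) by ring. rewrite cL.
  lra. }
 apply Rmult_integral in Z. destruct Z as [Z|Z]; [|specialize (spB t'); lra]. apply Rmult_integral in Z. lra.
- intros e He. set (Ce := 2 / (k * k)). have Cep : 0 < Ce by (apply Rdiv_lt_0_compat; nra).
 set (e' := Rmin (e / 2) (Rmin 1 (e / (2 * (Ce * (1 + CD) + K * K * L + 1))))). have KL : 0 <= K * K * L by lra. have CC : 0 <= Ce * (1 + CD) by lra.
 destruct (Small e') as [s [S1 [S2 [S3 S4]]]]; [an|]. exists s. split; [lra|].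
 apply Rle_trans with (RInt (fun t => Ce * (((x 1 s t + c0) * (x 1 s t + c0) + (x (-1) s t + - c0) * (x (-1) s t + - c0)) * sp t) + K * K * (s * s) * sp t) 0 T).
 + have cE := proj1 (proj2 (Cont s ltac:(lra))).
  have j2 : ex_RInt (fun t => Ce * (((x 1 s t + c0) * (x 1 s t + c0) + (x (-1) s t + - c0) * (x (-1) s t + - c0)) * sp t) + K * K * (s * s) * sp t) 0 T.
  { apply ex_RInt_Rplus; apply ex_RInt_Rscal; auto. apply ex_RInt_cont, Dint. lra. }
  apply RInt_le; [lra|an|an|].
  * intros t _. have S := spB t. have [_ [_ [_ [[_ Y] _]]]] := As s t ltac:(lra). change (Rabs (Im (nl s t)) <= K * s) in Y.
   have Ed : x 1 s t - x (-1) s t = k * Re (nl s t).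
   { unfold x, nr, nl. rewrite <- Im_minus.
    replace (Ci * tau t * rho f k 1 (tb s t) - Ci * tau t * rho f k (-1) (tb s t))%C with (Ci * tau t * (rho f k 1 (tb s t) - rho f k (-1) (tb s t)))%C by ring.
    rewrite rho_diff. generalize (ell f (tb s t)). intros b. simpl. ring. }
   rewrite Cmod_sqr. replace (Re (nl s t + RtoC c)) with (((x 1 s t + c0) - (x (-1) s t + - c0)) / k).
   2:{ transitivity (Re (nl s t) + c); auto. replace (x 1 s t + c0 - (x (-1) s t + - c0)) with (k * Re (nl s t) + 2 * c0) by (rewrite <- Ed; ring). unfold c0, c.
    field. lra. }
   replace (Im (nl s t + RtoC c)) with (Im (nl s t)) by (simpl; ring). have Y2 := Rabs_mult_le Y Y. generalize dependent (x 1 s t).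
   generalize dependent (x (-1) s t). intros b a _. set (a' := a + c0). set (b' := b + - c0). rewrite <- Rmult_assoc. rewrite <- Rmult_plus_distr_r.
   apply Rmult_le_compat_r; [lra|]. apply Rplus_le_compat; [|lra].
   replace ((a' - b') / k * ((a' - b') / k)) with (/ (k * k) * ((a' - b') * (a' - b'))) by (field; lra).
   replace (Ce * (a' * a' + b' * b')) with (/ (k * k) * (2 * (a' * a' + b' * b'))) by (unfold Ce; field; lra).
   apply Rmult_le_compat_l; [apply Rlt_le, Rinv_0_lt_compat; nra|]. have Z := Rle_0_sqr (a' + b'). unfold Rsqr in Z. lra.
 + have i1 : ex_RInt (fun t => ((x 1 s t + c0) * (x 1 s t + c0) + (x (-1) s t + - c0) * (x (-1) s t + - c0)) * sp t) 0 T by (apply ex_RInt_cont, Dint; lra).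
  rewrite RInt_Rplus by (apply ex_RInt_Rscal; auto). rewrite RInt_Rscal, RInt_Rscal by auto. fold (D s). fold L.
  assert (Ce * D s <= Ce * ((1 + CD) * e')) by (apply Rmult_le_compat_l; assert (CD * s <= CD * e') by (apply Rmult_le_compat_l; lra); lra).
  assert (K * K * (s * s) * L <= K * K * L * e').
  { replace (K * K * (s * s) * L) with (K * K * L * (s * s)) by ring. apply Rmult_le_compat_l; auto. apply Rle_trans with (1 * s); an. }
  assert (e' * (2 * (Ce * (1 + CD) + K * K * L + 1)) <= e) by (apply Rle_trans with (e / (2 * (Ce * (1 + CD) + K * K * L + 1)) * (2 * (Ce * (1 + CD) + K * K * L + 1))); [an|right; field; lra]).
  lra.
Qed.

(** Constant curvature [sig * c] makes [gam t + sig / c * n] a fixed point [c0], and the parallel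
    curves become circles about it. The function [h w], which is [(z - c0) * ell f z - sig] in the
    rotated coordinate [z = c0 + u0 * w], is holomorphic on an annulus having [|w| = / c] as one
    edge, and its mean square tends to 0 along circles approaching that edge; [hardy_vanish] gives
    zeros inside. The sign [sig] is left undecided. *)
Lemma circle_case {c} : 0 < c -> c * RInt sp 0 T = 2 * PI -> (forall t, Rabs (kap t) = c) -> (forall e, 0 < e ->
 exists s, 0 < s < e /\ RInt (fun t => Cmod (nl s t + RtoC c) * Cmod (nl s t + RtoC c) * sp t) 0 T <= e) ->
 exists (c0 z1 : C) (sig r1 : R), (sig = 1 \/ sig = -1) /\ 0 < r1 /\ forall z, disc z1 r1 z -> O z /\ ((z - c0) * ell f z)%C = RtoC sig.
Proof.
intros Hc cL Hkap Small. have F := hc_fr H. have HT := fr_T F. have Hin := hc_in. have Hdl : 0 < dl by apply (hc_col H).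
have HE := proj1 (hol_ell (proj1 (hc_beta H)) (hc_O H) (hc_bi H)). have Cont := fun s Hs => @collar_continuity s Hs.
have kc : forall t, continuous kap t by (apply (Cont (dl / 2)); lra). have spc := fr_spc F.
have Hsig : exists sig, (sig = 1 \/ sig = -1) /\ forall t, kap t = sig * c.
{ have nz : forall t, kap t < 0 \/ 0 < kap t.
 { intros t. have X := Hkap t. have [a|[a|a]] := Rtotal_order (kap t) 0; auto. rewrite a, Rabs_R0 in X. lra. }
 have [N|N] := nz 0.
 - exists (-1). split; auto. intros t. have X : kap t < 0 by (apply (@stay_below kap 0 0 0 t); auto; lra). specialize (Hkap t). rewrite Rabs_left in Hkap; lra.
 - exists 1. split; auto. intros t. have X : - kap t < 0.
  { apply (@stay_below (fun t => - kap t) 0 0 0 t); try lra; [an|]. intros r. destruct (nz r); an. }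
  specialize (Hkap t). rewrite Rabs_right in Hkap; lra. }
destruct Hsig as [sig [Hsig Ek]]. have s2 : sig * sig = 1 by (destruct Hsig as [-> | ->]; ring). set (n := fun t => (Ci * tau t)%C).
set (c0 := (gam 0 + RtoC (sig / c) * n 0)%C). have Ec : forall t, (gam t + RtoC (sig / c) * n t)%C = c0.
{ intros t. apply (@pder_zero_const (fun t => gam t + RtoC (sig / c) * n t)%C t 0). intros r _. eapply pder_eq.
 - apply @pder_plus; [apply (fr_gam F)|]. apply pder_scal. apply pder_scal, (fr_tau F).
 - rewrite Ek.
  replace (RtoC (sig / c) * (Ci * (Ci * RtoC (sig * c * sp r) * tau r)))%C with (Ci * Ci * RtoC (sig / c * (sig * c * sp r)) * tau r)%C by (rewrite RtoC_mult; ring).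
  replace (sig / c * (sig * c * sp r)) with (sp r) by (transitivity (sig * sig * sp r); [rewrite s2; ring|field; lra]). rewrite CiCi. ring. }
have Etube : forall s t, tb s t = (c0 + RtoC (s - sig / c) * n t)%C.
{ intros s t. rewrite <- (Ec t). unfold tube. fold (n t). rewrite RtoC_minus. ring. }
have [th [Dth Eth]] := frame_angle F. set (u0 := (RtoC (- sig) * n 0)%C). set (phi := fun t => th t - th 0). have u01 : Cmod u0 = 1.
{ unfold u0, n. rewrite Cmod_mult, Cmod_Ci_mult, (fr_tau1 F), Cmod_R, Rabs_Ropp. destruct Hsig as [-> | ->]; [rewrite Rabs_pos_eq|rewrite Rabs_left]; lra. }
have Eu : forall t, (RtoC (- sig) * n t)%C = (u0 * cis (phi t))%C.
{ intros t. unfold u0, n, phi. replace (tau t) with (tau 0 * cis (th t - th 0))%C; [ring|]. rewrite !Eth, <- cis_plus. f_equal. ring. }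
have Etube2 : forall s t, tb s t = (c0 + u0 * circ 0 (/ c - sig * s) (phi t))%C.
{ intros s t. rewrite Etube. unfold circ. replace (u0 * (0 + RtoC (/ c - sig * s) * cis (phi t)))%C with (RtoC (/ c - sig * s) * (u0 * cis (phi t)))%C by ring.
 rewrite <- Eu. replace (s - sig / c) with ((/ c - sig * s) * - sig) by (transitivity (sig * sig * s - sig / c); [an|rewrite s2; ring]). rewrite RtoC_mult. ring. }
have phiD : forall t, is_derive phi t (sig * c * sp t).
{ intros t. eapply is_derive_eq; [apply @is_derive_Rminus; an|]. rewrite Ek. ring. }
have phi0 : phi 0 = 0 by (unfold phi; ring). have phiT : phi T = sig * (2 * PI).
{ transitivity (RInt (fun t => sig * c * sp t) 0 T).
 - rewrite (@RInt_FTC phi (fun t => sig * c * sp t)); [an|auto|]. intros t _. an.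
 - rewrite RInt_Rscal by (apply ex_RInt_cont; auto). rewrite Rmult_assoc. f_equal. lra. }
(* The radii of the parallel circles are [/ c - sig * s]. Thus [(r1, r2)] is [(/ c - d, / c)] when
   the collar is inside the circle ([sig = 1]) and [(/ c, / c + d)] when it is outside. *)
set (d := Rmin (dl / 2) (/ c / 2)). have ic : 0 < / c by lra. have dp : 0 < d by lra. set (r1 := / c - d * ((1 + sig) / 2)). set (r2 := / c + d * ((1 - sig) / 2)).
have rng : forall p, r1 < p < r2 <-> 0 < sig * (/ c - p) < d.
{ intros p. unfold r1, r2. destruct Hsig as [-> | ->]; split; intros; lra. }
have r10 : 0 <= r1 by (unfold r1; destruct Hsig as [-> | ->]; lra).
have pse : forall p, / c - sig * (sig * (/ c - p)) = p by (intros p; replace (sig * (sig * (/ c - p))) with (sig * sig * (/ c - p)) by ring; rewrite s2; ring).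
have onto : forall w, ann 0 r1 r2 w -> exists t, (c0 + u0 * w)%C = tb (sig * (/ c - Cmod w)) t.
{ intros w Hw. unfold ann in Hw. replace (w - 0)%C with w in Hw by ring. have w0 : w <> 0%C by (intros ->; rewrite Cmod_0 in Hw; lra).
 have [a [Ha Ew]] := circ_surj w0. replace (w - 0)%C with w in Ew by ring. set (y := if Rle_dec 0 sig then a else a - 2 * PI).
 destruct (IVT_gen phi 0 T y) as [t [_ Et]].
 - intros t. eapply is_derive_cont_pt, phiD.
 - unfold y. destruct Hsig as [-> | ->]; destruct Rle_dec; try lra; [rewrite Rmax_right|rewrite Rmax_left]; lra.
 - exists t. rewrite Etube2, pse, Et. replace (circ 0 (Cmod w) y) with w; auto. rewrite Ew at 1. unfold circ. do 2 f_equal. unfold y. destruct (Rle_dec 0 sig); auto.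
  rewrite <- (cis_2PI (a - 2 * PI)). f_equal. ring. }
set (h := fun w => (u0 * w * ell f (c0 + u0 * w) - sig)%C). have inO : forall w, ann 0 r1 r2 w -> O (c0 + u0 * w)%C.
{ intros w Hw. have [t ->] := onto w Hw. apply Hin. unfold ann in Hw. replace (w - 0)%C with w in Hw by ring. apply rng in Hw. lra. }
have cm : forall w : C, cder (fun w => u0 * w)%C w u0 by an. have Hol : hol (ann 0 r1 r2) h.
{ apply (@hol_intro _ _ (fun w => u0 * ell f (c0 + u0 * w) + u0 * w * (C_derive (ell f) (c0 + u0 * w) * u0))%C). intros w Hw. eapply cder_eq.
 - apply @cder_minus; [|an]. apply (@cder_mult (fun w => u0 * w)%C (fun w => ell f (c0 + u0 * w)%C)); auto. an.
 - ring. }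
have ht : forall s t, 0 < s < d -> h (circ 0 (/ c - sig * s) (phi t)) = (RtoC (s - sig / c) * (nl s t + c) - RtoC (s * c))%C.
{ intros s t Hs. unfold h. rewrite <- Etube2. replace (u0 * circ 0 (/ c - sig * s) (phi t))%C with (tb s t - c0)%C by (rewrite Etube2; ring). rewrite Etube at 1.
 unfold nl. fold (n t). replace (RtoC sig) with (RtoC (s * c) - RtoC (s - sig / c) * c)%C; [ring|]. rewrite <- RtoC_mult, <- RtoC_minus. f_equal. field. lra. }
have L2 : forall s, 0 < s < d -> L2circ h 0 (/ c - sig * s) = c * RInt (fun t => Cmod (h (circ 0 (/ c - sig * s) (phi t))) * Cmod (h (circ 0 (/ c - sig * s) (phi t))) * sp t) 0 T.
{ intros s Hs. set (p := / c - sig * s). set (Fs := fun a => Cmod (h (circ 0 p a)) * Cmod (h (circ 0 p a))).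
 have Hp : r1 < p < r2 by (apply rng; unfold p; replace (sig * (/ c - (/ c - sig * s))) with (sig * sig * s) by ring; rewrite s2; lra).
 have Fc : forall a, continuous Fs a.
 { intros a. apply (continuous_mult (K := R_AbsRing)); apply continuous_circ_mod; intros r; apply (@hol_ccont (ann 0 r1 r2)); auto; apply ann_circ; auto. }
 (* For [sig = -1] the angle runs from 0 down to [- 2 * PI]; the shift by a period makes the
    substitution land on the interval from 0 to [2 * PI] in either case. *)
 set (gg := fun t => if Rle_dec 0 sig then phi t else phi t + 2 * PI). have gD : forall t, is_derive gg t (sig * c * sp t).
 { intros t. destruct (Rle_dec 0 sig); auto. eapply is_derive_eq; [apply @is_derive_Rplus; an|ring]. }
 have gF : forall t, Fs (gg t) = Fs (phi t).
 { intros t. unfold gg. destruct (Rle_dec 0 sig); auto. unfold Fs, circ. now rewrite cis_2PI. }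
 have dgc : forall t, continuous (fun t => sig * c * sp t) t by an.
 have R1 : RInt (fun t => sig * c * sp t * Fs (gg t)) 0 T = RInt Fs (gg 0) (gg T) by (apply (RInt_comp Fs gg (fun t => sig * c * sp t) 0 T); an).
 have R2 : RInt Fs (gg 0) (gg T) = sig * RInt Fs 0 (2 * PI).
 { unfold gg. rewrite phi0, phiT. destruct Hsig as [-> | ->]; destruct Rle_dec; try lra.
  - rewrite !Rmult_1_l. lra.
  - replace (0 + 2 * PI) with (2 * PI) by ring. replace (-1 * (2 * PI) + 2 * PI) with 0 by ring.
   have Z : - RInt Fs 0 (2 * PI) = RInt Fs (2 * PI) 0 by exact (opp_RInt_swap Fs 0 (2 * PI) (ex_RInt_cont 0 (2 * PI) Fc)). lra. }
 have R3 : RInt (fun t => sig * c * sp t * Fs (gg t)) 0 T = sig * c * RInt (fun t => Fs (phi t) * sp t) 0 T.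
 { rewrite <- RInt_Rscal.
  - apply RInt_ext. intros t _. rewrite gF. lra.
  - apply ex_RInt_cont. intros t. apply (continuous_mult (fun t => Fs (phi t)) sp); auto. apply continuous_comp; auto. an. }
 change (RInt Fs 0 (2 * PI) = c * RInt (fun t => Fs (phi t) * sp t) 0 T). apply Rmult_eq_reg_l with sig; [|an]. lra. }
set (L := RInt sp 0 T) in *. have Lp : 0 < L by (apply Rmult_lt_reg_l with c; lra). set (m := / c + 1).
have L2s : forall s E, 0 < s < d -> s <= 1 -> RInt (fun t => Cmod (nl s t + c) * Cmod (nl s t + c) * sp t) 0 T <= E -> L2circ h 0 (/ c - sig * s) <= c * (2 * (m * m) * E + 2 * (c * c) * L * s).
{ intros s E Hs Hs1 HE2. rewrite L2 by auto. apply Rmult_le_compat_l; [lra|]. have cn : forall t, continuous (fun t => Cmod (nl s t + c)) t.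
 { intros t. apply (@pcont_comp (fun w => RtoC (Cmod w)) (fun t => nl s t + RtoC c)%C); [apply @pcont_plus; [apply (Cont s ltac:(lra))|apply pcont_const]|]. an. }
 set (N := fun t => Cmod (nl s t + c)) in *. have j1 : ex_RInt (fun t => N t * N t * sp t) 0 T by an. have jsp : ex_RInt sp 0 T by an.
 apply Rle_trans with (RInt (fun t => 2 * (m * m) * (N t * N t * sp t) + 2 * (c * c) * s * sp t) 0 T).
 - have Hp : r1 < / c - sig * s < r2 by (apply rng; replace (sig * (/ c - (/ c - sig * s))) with (sig * sig * s) by ring; rewrite s2; lra).
  apply RInt_le; [lra| | |].
  + apply ex_RInt_cont. intros t. have Z : continuous (fun t => Cmod (h (circ 0 (/ c - sig * s) (phi t)))) t.
   { apply (continuous_comp phi (fun a => Cmod (h (circ 0 (/ c - sig * s) a)))); [an|].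
    apply continuous_circ_mod; intros r; apply (@hol_ccont (ann 0 r1 r2)); auto; apply ann_circ; auto. }
   an.
  + an.
  + intros t _. have spp : 0 < sp t by (have X := fr_sp F t; have Y := fr_B F; assert (0 < / B) by (apply Rinv_0_lt_compat; lra); lra). rewrite ht by auto.
   replace (2 * (m * m) * (N t * N t * sp t) + 2 * (c * c) * s * sp t) with ((2 * (m * N t * (m * N t)) + 2 * (c * c) * s) * sp t) by ring.
   set (z := (RtoC (s - sig / c) * (nl s t + c) - RtoC (s * c))%C). have N0 : 0 <= N t by apply Cmod_ge_0. have bz : Cmod z <= m * N t + s * c.
   { eapply Rle_trans; [apply Cmod_triangle|]. rewrite Cmod_opp, Cmod_mult, !Cmod_R, (Rabs_pos_eq (s * c)) by (apply Rmult_le_pos; lra). apply Rplus_le_compat_r.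
    apply Rmult_le_compat_r; auto. unfold m. destruct Hsig as [-> | ->]; lra. }
   assert (Cmod z * Cmod z <= (m * N t + s * c) * (m * N t + s * c)) by lra. have Z := Rle_0_sqr (m * N t - s * c). unfold Rsqr in Z.
   assert (s * c * (s * c) <= c * c * s) by (replace (s * c * (s * c)) with (c * c * s * s) by ring; rewrite <- (Rmult_1_r (c * c * s)) at 2; apply Rmult_le_compat_l; an).
   lra.
 - rewrite RInt_Rplus by (apply ex_RInt_Rscal; auto). rewrite RInt_Rscal, RInt_Rscal by auto. fold L.
  assert (2 * (m * m) * RInt (fun t => N t * N t * sp t) 0 T <= 2 * (m * m) * E) by (apply Rmult_le_compat_l; [assert (0 <= m * m) by apply Rle_0_sqr; lra|an]). lra. }
(* With [x = sig * (/ c - p)], reflection in the circle of radius [p] sends the edge [/ c] to the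
   depth [2 * x - sig * c * x^2]. The bounds [x < 3 / 8 * d] and [c * x <= 3 / 16] keep it below
   [d]. *)
have Van : forall p t, 1 / 8 * d < sig * (/ c - p) < 3 / 8 * d -> 0 <= t <= 2 * PI -> h (circ 0 p t) = 0.
{ intros p t Hp Ht. apply (@hardy_vanish h 0 r1 r2 (/ c) p t); auto.
 - apply rng. lra.
 - replace (p * p / / c) with (p * p * c) by (field; lra). apply rng. set (x := sig * (/ c - p)) in *. replace p with (/ c - sig * x) by (apply pse).
  replace (sig * (/ c - (/ c - sig * x) * (/ c - sig * x) * c)) with (sig * sig * (2 * x - sig * (c * x * x))).
  2:{ field. lra. }
  have cx : c * x <= 3 / 16 by (apply Rle_trans with (c * (3 / 16 * / c)); [an|right; field; lra]). have cxx : 0 < c * x * x <= 3 / 16 * x by lra.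
  destruct Hsig as [-> | ->]; lra.
 - intros e He. set (Q := c * (2 * (m * m) + 2 * (c * c) * L) + 1). have mm : 0 <= m * m by apply Rle_0_sqr. have ccL : 0 < c * c * L by lra.
  have Qp : 1 <= Q by (unfold Q; assert (0 <= c * (2 * (m * m) + 2 * (c * c) * L)) by (apply Rmult_le_pos; lra); lra).
  set (e' := Rmin (Rmin d 1) (Rmin e (e / (2 * Q)))). have g3 := Rmin_l d 1. have g4 := Rmin_r d 1. have g5 := Rmin_l e (e / (2 * Q)).
  have g6 := Rmin_r e (e / (2 * Q)). have e'p : 0 < e' by lra. have [s [Hs Is]] := Small e' e'p. exists (/ c - sig * s). split; [|split].
  + apply rng. replace (sig * (/ c - (/ c - sig * s))) with (sig * sig * s) by ring. rewrite s2. lra.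
  + replace (/ c - sig * s - / c) with (- (sig * s)) by ring. rewrite Rabs_Ropp, Rabs_mult, (Rabs_pos_eq s) by lra.
   replace (Rabs sig) with 1 by (destruct Hsig as [-> | ->]; [rewrite Rabs_pos_eq|rewrite Rabs_left]; lra). lra.
  + eapply Rle_lt_trans; [apply (L2s s e'); lra|]. apply Rle_lt_trans with (Q * e').
   * unfold Q. assert (c * (2 * (c * c) * L * s) <= c * (2 * (c * c) * L * e')) by lra. lra.
   * apply Rle_lt_trans with (Q * (e / (2 * Q))); [an|]. replace (Q * (e / (2 * Q))) with (e / 2) by (field; lra). lra. }
set (ps := / c - sig * (d / 4)). have psp : 0 < ps by (unfold ps; destruct Hsig as [-> | ->]; lra). exists c0, (c0 + u0 * ps)%C, sig, (d / 8).
split; [auto|split; [lra|]]. intros z Hz. unfold disc in Hz. set (w := (Cconj u0 * (z - c0))%C). have uu : (u0 * Cconj u0)%C = 1.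
{ transitivity (RtoC (Cmod u0 * Cmod u0)); [|rewrite u01; f_equal; ring]. rewrite Cmod_sqr. apply Ceq; simpl; ring. }
have Ew : (u0 * w)%C = (z - c0)%C by (unfold w; transitivity ((u0 * Cconj u0) * (z - c0))%C; [ring|rewrite uu; ring]).
have Mw : Cmod w = Cmod (z - c0) by (rewrite <- Ew, Cmod_mult, u01; ring). have Wr : ps - d / 8 < Cmod w < ps + d / 8.
{ have X : Cmod (u0 * ps) = ps by (rewrite Cmod_mult, u01, Cmod_R, Rabs_pos_eq; lra). have A1 := Cmod_rev_tri (z - c0) (u0 * ps).
 have A2 := Cmod_rev_tri (u0 * ps) (z - c0). rewrite (Cmod_minus_sym (u0 * ps)) in A2. replace (z - c0 - u0 * ps)%C with (z - (c0 + u0 * ps))%C in A1, A2 by ring.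
 lra. }
have Ws : 1 / 8 * d < sig * (/ c - Cmod w) < 3 / 8 * d by (unfold ps in Wr; destruct Hsig as [-> | ->]; lra).
have Wa : ann 0 r1 r2 w by (unfold ann; replace (w - 0)%C with w by ring; apply rng; lra). have Ez : (c0 + u0 * w)%C = z by (rewrite Ew; ring).
split; [rewrite <- Ez; apply inO; auto|]. have w0 : w <> 0%C by (intros E; rewrite E, Cmod_0 in Ws; destruct Hsig as [-> | ->]; lra).
have [a [Ha Ea]] := circ_surj w0. replace (w - 0)%C with w in Ea by ring. have V := Van (Cmod w) a Ws Ha. rewrite <- Ea in V. unfold h in V. rewrite Ez, Ew in V.
replace ((z - c0) * ell f z)%C with (((z - c0) * ell f z - sig) + sig)%C by ring. rewrite V. ring.
Qed.
End Collar.

(** * Recognition of the round annulus and assembly *)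

Lemma cder_zero_disc {h z1 z r} : (forall w, disc z1 r w -> cder h w 0) -> disc z1 r z -> h z = h z1.
Proof.
intros H Hz. transitivity (h (z1 + RtoC 1 * (z - z1))%C); [f_equal; ring|]. transitivity (h (z1 + RtoC 0 * (z - z1))%C); [|f_equal; ring].
apply (@pder_zero_const (fun t => h (z1 + t * (z - z1))%C) 1 0). intros t Ht. rewrite Rmin_right, Rmax_left in Ht by lra.
eapply pder_eq; [apply (@pder_comp h (fun t => z1 + t * (z - z1))%C t 0 (z - z1)%C); [apply pder_line|]|ring]. apply H. unfold disc in *.
replace (z1 + t * (z - z1) - z1)%C with (t * (z - z1))%C by ring. rewrite Cmod_mult, Cmod_R, Rabs_pos_eq by lra. have P := Cmod_ge_0 (z - z1). nra.
Qed.

(** The identity theorem spreads [(z - c0) * f' = sig * f] over the connected set [O], so [f]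
    divided by the power [sig] of [z - c0] is a constant [q]. A similarity then carries the round
    annulus onto [O]; the rotation contained in [q] is absorbed because the annulus is invariant
    under rotations. *)
Lemma round_annulus {O beta sig r1 f g c0 z1} : 0 < beta < 1 -> opn O -> connectedC O -> biholo O beta f g ->
 sig = 1 \/ sig = -1 -> 0 < r1 -> (forall z, disc z1 r1 z -> O z /\ ((z - c0) * ell f z)%C = RtoC sig) -> exists (a : C) (r : R), 0 < r /\ forall z, O z <->
 exists w, annulus beta w /\ z = (a + RtoC r * w)%C.
Proof.
intros Hb HO Con Bi Hsig Hr1 Loc. have B' := Bi. destruct B' as [Hf [Hg [Hfa [Hga [Hgf Hfg]]]]]. have HE := proj1 (@hol_ell O beta f g ltac:(lra) HO Bi).
have Z1 : disc z1 r1 z1 by (apply disc_center; auto). have [O1 _] := Loc z1 Z1. have All : forall z, O z -> ((z - c0) * ell f z)%C = sig.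
{ intros z Oz. have X : ((z - c0) * ell f z - sig)%C = 0.
 { apply (@identity_theorem O (fun z => (z - c0) * ell f z - sig)%C z1 r1); auto.
  - apply (@hol_intro _ _ (fun z => ell f z + (z - c0) * C_derive (ell f) z)%C). intros w Ow. eapply cder_eq.
   + apply @cder_minus; [|an]. apply (@cder_mult (fun z => z - c0)%C (ell f)); an.
   + ring.
  - intros w Hw. have [_ ->] := Loc w Hw. ring. }
 replace ((z - c0) * ell f z)%C with (((z - c0) * ell f z - sig) + sig)%C by ring. rewrite X. ring. }
have fn : forall z, O z -> f z <> 0 by (intros z Oz; apply (@annulus_neq_0 beta); an). have nc : forall z, O z -> (z - c0)%C <> 0.
{ intros z Oz E. have X := All z Oz. rewrite E in X. apply (f_equal Re) in X. simpl in X. lra. }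
have f1 : forall z, O z -> (C_derive f z * (z - c0))%C = (sig * f z)%C.
{ intros z Oz. rewrite <- (All z Oz). unfold ell. field. auto. }
have Cst : forall h : C -> C, (forall z, O z -> cder h z 0) -> forall z, O z -> h z = h z1.
{ intros h Hh z Oz. have X : (h z - h z1)%C = 0.
 { apply (@identity_theorem O (fun z => h z - h z1)%C z1 r1); auto.
  - apply (@hol_intro _ _ (fun _ => 0%C)). intros w Ow. an.
  - intros w Hw. rewrite (@cder_zero_disc h z1 w r1); auto; [ring|]. intros x Hx. apply Hh, Loc, Hx. }
 apply Cmod_sub_0. rewrite X, Cmod_0. lra. }
destruct Hsig as [-> | ->].
- set (q := (f z1 / (z1 - c0))%C). have qn : q <> 0.
 { intros X. apply (fn z1 O1). transitivity (q * (z1 - c0))%C; [unfold q; field; auto|rewrite X; ring]. }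
 have E : forall z, O z -> f z = (q * (z - c0))%C.
 { intros z Oz. have X : (f z / (z - c0))%C = q.
  { apply (Cst (fun z => f z / (z - c0))%C); auto. intros w Ow. eapply cder_eq.
   - apply (@cder_div f (fun z => z - c0)%C); an.
   - replace (C_derive f w * (w - c0) - f w * (1 - 0))%C with (RtoC 0); [field; auto|]. rewrite f1 by auto. ring. }
  rewrite <- X. field. auto. }
 have qp := Cmod_pos qn. have mn : RtoC (Cmod q) <> 0 by lra. exists c0, (/ Cmod q). split; [an|]. intros z. rewrite RtoC_inv by lra. split.
 + intros Oz. exists (RtoC (Cmod q) * (z - c0))%C. split; [|field; auto]. have X := Hfa z Oz. rewrite (E z Oz) in X. unfold annulus in *. rewrite Cmod_mult in *.
  rewrite Cmod_R, Rabs_pos_eq; lra.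
 + intros [w [Aw ->]]. set (w' := (q * (/ RtoC (Cmod q) * w))%C). have Aw' : annulus beta w'.
  { unfold w', annulus. rewrite !Cmod_mult, Cmod_inv, Cmod_R, Rabs_pos_eq by lra. replace (Cmod q * (/ Cmod q * Cmod w)) with (Cmod w) by (field; lra). an. }
  replace (c0 + / RtoC (Cmod q) * w)%C with (g w'); auto. have X := E (g w') (Hga w' Aw'). rewrite Hfg in X by auto.
  transitivity (c0 + / q * (q * (g w' - c0)))%C; [field; auto|]. rewrite <- X. unfold w'. field. auto.
(* Here [f z = q / (z - c0)] exchanges the two boundary circles: [|z - c0|] runs from [|q|] to
   [|q| / beta]. *)
- set (q := (f z1 * (z1 - c0))%C). have qn : q <> 0 by (apply Cmult_neq_0; auto). have E : forall z, O z -> f z = (q / (z - c0))%C.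
 { intros z Oz. have X : (f z * (z - c0))%C = q.
  { apply (Cst (fun z => f z * (z - c0))%C); auto. intros w Ow. eapply cder_eq.
   - apply @cder_mult; an.
   - rewrite f1 by auto. ring. }
  rewrite <- X. field. auto. }
 have qp := Cmod_pos qn. have bn : RtoC beta <> 0 by lra. have mn : RtoC (Cmod q) <> 0 by lra. exists c0, (Cmod q / beta). split; [an|]. intros z.
 rewrite RtoC_div by lra. split.
 + intros Oz. exists (beta / RtoC (Cmod q) * (z - c0))%C. split; [|field; auto]. have X := Hfa z Oz. rewrite (E z Oz) in X. have N := nc z Oz. have Np := Cmod_pos N.
  unfold annulus in *. rewrite Cmod_div in X by auto. rewrite Cmod_mult, Cmod_div, !Cmod_R, !Rabs_pos_eq by lra. have Y1 : beta * Cmod (z - c0) < Cmod q.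
  { replace (Cmod q) with (Cmod q / Cmod (z - c0) * Cmod (z - c0)) by (field; lra). an. }
  have Y2 : Cmod q < Cmod (z - c0).
  { replace (Cmod q) with (Cmod q / Cmod (z - c0) * Cmod (z - c0)) by (field; lra). rewrite <- (Rmult_1_l (Cmod (z - c0))) at 3. an. }
  replace (beta / Cmod q * Cmod (z - c0)) with (beta * Cmod (z - c0) / Cmod q) by (field; lra). split; [apply lt_div; nra|apply div_lt; lra].
 + intros [w [Aw ->]]. have wn : w <> 0%C by (apply (@annulus_neq_0 beta); an). set (w' := (q * beta / (RtoC (Cmod q) * w))%C). have Aw' : annulus beta w'.
  { destruct Aw as [A1 A2]. unfold w', annulus. rewrite Cmod_div, !Cmod_mult, !Cmod_R, !Rabs_pos_eq by (try (apply Cmult_neq_0; auto); lra).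
   replace (Cmod q * beta / (Cmod q * Cmod w)) with (beta / Cmod w) by (field; lra). split; [apply lt_div; nra|apply div_lt; lra]. }
  replace (c0 + RtoC (Cmod q) / beta * w)%C with (g w'); auto. have Og := Hga w' Aw'. have X := E (g w') Og. rewrite Hfg in X by auto. have N := nc _ Og.
  generalize dependent (g w'). intros G Og X N. transitivity (c0 + q / w')%C; [rewrite X; field; auto|]. unfold w'. field. auto.
Qed.

(** A Riemann integrable function is bounded, and the weight is bounded below; periodicity extends
    the bound to all parameters. This is the source of the uniform bound on [c3] used in the
    collar. *)
Lemma ex_RInt_weight_bounded {c sp T B} : 0 < T -> 0 < B -> (forall t, c (t + T) = c t) -> (forall t, / B <= sp t) ->
 ex_RInt (fun t => c t * sp t) 0 T -> exists M, forall t, Rabs (c t) <= M.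
Proof.
intros HT HB Hp Hsp I. have [M U] := ex_RInt_ub _ _ _ I. rewrite Rmax_right in U by lra. have iB : 0 < / B by lra. exists (M * B). intros t.
have [m Hm] := period_reduce 0 t HT. rewrite <- (periodic_Z c T m t Hp). generalize dependent (t + IZR m * T). intros r Hr.
have X : Rabs (c r * sp r) <= M by (apply U; lra). specialize (Hsp r). rewrite Rabs_mult, (Rabs_pos_eq (sp r)) in X by lra.
apply Rle_trans with (Rabs (c r) * sp r * B); [|an]. replace (Rabs (c r)) with (Rabs (c r) * / B * B) at 1 by (field; lra). an.
Qed.

Theorem theorem4p3 (beta alpha T : R) (Omega : C -> Prop) (gam : R -> C)
    (u : C -> R) (c3 : C -> R) :
  0 < beta < 1 ->
  0 < alpha < 1 ->
  boundedC Omega ->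
  doubly_connected Omega ->
  C3alpha_closed_curve alpha T gam ->
  outermost_boundary Omega T gam ->
  inward_left_normal Omega gam ->
  hyperbolic_factor Omega u ->
  third_coefficient Omega alpha gam u c3 ->
  ex_RInt (fun t => c3 (gam t) * speed gam t) 0 T ->
  biholomorphic Omega (annulus beta) ->
  lambda_inv T gam c3 = 2 * PI ^ 2 / 3 * ((PI / ln beta) ^ 2 + 1) ->
  exists (a : C) (r : R), 0 < r /\
    forall z, Omega z <-> exists w, annulus beta w /\ z = (a + RtoC r * w)%C.
Proof.
intros Hb Hal HBd HD HC [K [HK [_ HKb]]] Hin Hu H3 Ic [f0 [g0 Bi0]] Hlam. have HO : opn Omega by (apply open_opn, HD). have Con : connectedC Omega by apply HD.
have [tau [kap1 [B [F Etau]]]] := frame_exists HC. have HT := fr_T F. have HB := fr_B F.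
destruct (@ex_RInt_weight_bounded (fun t => c3 (gam t)) (speed gam) T B) as [M3 HM3]; auto; [lra|intros t; now rewrite (fr_gamT F)|apply (fr_sp F)|].
have [Kin TS] := doubly_connected_two_sided Hb HBd HD Bi0 HK. destruct (@collar_exists Omega K Kin alpha T B M3 gam tau kap1 u c3) as [dl [C0 Col]]; auto; [lra|].
(* From here on the original map [f0] is replaced, if necessary, by [beta / f0], so that the collar
   is mapped near the unit circle. *)
have [f [g [Bi End]]] := collar_outer_end Hb HO HBd Bi0 F Col.
have Gr : forall gm, 0 < gm < 1 -> growth Omega u gm by (intros gm; apply (@growth_all Omega K Kin alpha beta T B M3 f g gam tau kap1 u c3 gm); auto; lra).
have lb : ln beta < 0 by (rewrite <- ln_1; apply ln_increasing; lra). set (k := bw beta 0). have kp : 0 < k by (apply bw_pos; lra).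
have Hyp : hyp_collar Omega beta k f g (fun z => exp (- u z)) T gam tau (speed gam) (curvature gam) kap1 B dl C0.
{ split; auto.
 - intros z Oz. have S := @sg_range Omega beta f g z ltac:(lra) Bi Oz. have X := @bw_range beta 0 (sg f z) ltac:(lra) ltac:(lra). rewrite Rplus_0_r in X. exact X.
 - intros z Oz. apply (@factor_formula Omega beta f g u z); auto. }
destruct H3 as [eps [Cst [Heps H3]]].
have En := collar_energy Hyp (alpha := alpha) (Cst := Cst) (d3 := Rmin eps dl) (c3 := fun t => c3 (gam t)) ltac:(lra) ltac:(apply Rmin_pos; [lra|apply Col]) HM3 Ic.
have m1 := Rmin_l eps dl. have m2 := Rmin_r eps dl. destruct (equality_case Hyp (C3 := RInt (fun t => c3 (gam t) * speed gam t) 0 T)) as [Lp [Hk Sm]].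
- apply En. intros s t Hs. have D := @Cmod_tube _ _ _ _ _ _ _ s t F ltac:(lra). have X := H3 (tube gam tau s t) t (hc_in Hyp s t ltac:(lra)). cbv zeta in X.
 rewrite D in X. replace (s - curvature gam t / 2 * (s * s) + c3 (gam t) * (s * s * s)) with (s - / 2 * curvature gam t * s ^ 2 + c3 (gam t) * s ^ 3) by field.
 apply X; [|lra]. apply (proj2 (proj2 Col) s t ltac:(lra)).
(* [k] is [PI / - ln beta]; the sign disappears in the square. *)
- unfold lambda_inv in Hlam. rewrite Hlam. unfold k, bw. field. lra.
- destruct (circle_case Hyp (c := 2 * PI / RInt (speed gam) 0 T)) as [c0 [z1 [sig [r1 [Hsig [Hr1 Loc]]]]]]; auto.
 + lra.
 + field. lra.
 + apply (@round_annulus Omega beta sig r1 f g c0 z1); auto.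
Qed.
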